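(* Let $X_N$ be the random $N\times N$ matrix described in the context. There exist constants $M_0,N_0,C,c>0$ such that for all $N>N_0$, all $K>0$, all $E\ge\frac{M_0}{N^2}$ and all $q\in\mathbb N$, $$\mathbb P\left(|\rho_N(E)-P(E)|\ge K\min\left\{\sqrt E,\frac{\log N}{N}\right\}\right)\le\frac{(Cq)^{cq^2}}{K^q}.$$
   Context: For each $N$, $X=(x_{ij})_{i,j=1}^N$ is a random matrix with complex entries such that all the real parts $\mathrm{Re}(x_{ij})$ and imaginary parts $\mathrm{Im}(x_{ij})$ are independent and identically distributed real random variables with mean $0$ and variance $\frac12$; $X_N:=X/\sqrt N$. It is assumed that $\mathbb E|x_{11}|^4=:\mu_4<\infty$ and that there is a constant $D>0$ such that for all $N\in\mathbb N$ and $q\ge1$, $\mathbb E|x_{11}|^{4q}\le D^{4(q-1)}N^{q-1}\mu_4$. Constants may depend on $\mu_4$ and $D$. Let $0\le\lambda_1\le\dots\le\lambda_N$ be the eigenvalues of $X_N^*X_N$ and $\rho_N(E):=\frac1N\#\{i\le N:\lambda_i\le E\}$. Let $\rho(x)=\frac1{2\pi}\sqrt{\frac4x-1}$ for $0<x\le4$ and $\rho(x)=0$ otherwise (Marchenko-Pastur density), and $P(E):=\int_0^E\rho(x)\,dx$. *)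

(* Defs.v *)
From mathcomp Require Import all_boot all_order all_algebra.
From mathcomp Require Import spectral complex.
From mathcomp Require Import all_classical all_reals all_analysis.

Set Implicit Arguments.
Unset Strict Implicit.
Unset Printing Implicit Defensive.

Import Order.TTheory GRing.Theory Num.Theory.
Import numFieldNormedType.Exports.

Local Open Scope classical_set_scope.
Local Open Scope sesquilinear_scope.
Local Open Scope complex_scope.
Local Open Scope ring_scope.

Definition mutually_independent (d : measure_display) (T : measurableType d)
    (R : realType) (P : probability T R) (I : finType) (Y : I -> T -> R) : Prop :=
  forall (J : {set I}) (B : I -> set R), (forall i, measurable (B i)) ->
    P (\bigcap_(i in [set` J]) (Y i @^-1` B i)) =
    (\prod_(i in J) P (Y i @^-1` B i))%E.

Definition identically_distributed (d : measure_display) (T : measurableType d)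
    (R : realType) (P : probability T R) (I : Type) (Y : I -> T -> R) : Prop :=
  forall (i j : I) (B : set R), measurable B ->
    P (Y i @^-1` B) = P (Y j @^-1` B).

(* One family of 2 N^2 real variables, so that independence and equality in law
   hold across real and imaginary parts too, not only across entries. *)
Definition entry_part (T : Type) (R : rcfType) (N : nat) (X : T -> 'M[R[i]]_N)
    (k : 'I_N * 'I_N * bool) (w : T) : R :=
  let z := X w k.1.1 k.1.2 in if k.2 then complex.Im z else complex.Re z.

(* [o] is the first row/column index, so that [X w o o] is the entry x_11; it is
   a bound variable because 'I_N is empty for N = 0. *)
Record random_matrix_hyp (d : measure_display) (T : measurableType d)
    (R : realType) (P : probability T R) (mu4 D : R) (N : nat)
    (X : T -> 'M[R[i]]_N) : Prop := {
  entry_part_measurable : forall k, measurable_fun [set: T] (entry_part X k) ;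
  entry_part_independent : mutually_independent P (entry_part X) ;
  entry_part_identical : identically_distributed P (entry_part X) ;
  entry_part_mean : forall k, ('E_P[entry_part X k] = 0)%E ;
  entry_part_variance : forall k, ('V_P[entry_part X k] = (2^-1)%:E)%E ;
  entry_fourth_moment : forall o : 'I_N, o = 0%N :> nat ->
    ('E_P[fun w => (ComplexField.Normc.normc (X w o o) ^+ 4)%R] = mu4%:E)%E ;
  entry_moments : forall o : 'I_N, o = 0%N :> nat -> forall q : nat, (1 <= q)%N ->
    ('E_P[fun w => (ComplexField.Normc.normc (X w o o) ^+ (4 * q))%R]
       <= (D ^+ (4 * (q - 1)) * N%:R ^+ (q - 1) * mu4)%:E)%E }.

Definition rescaled (R : rcfType) (N : nat) (A : 'M[R[i]]_N) : 'M[R[i]]_N :=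
  ((Num.sqrt (N%:R : R))^-1)%:C *: A.

(* For normal [H], [spectral_diag H] lists the eigenvalues with multiplicity
   (see [char_poly_spectral_diag]; [normalmx_gram] applies to A^t* *m A), and the
   count does not depend on their order. In R[i], [x <= E%:C] means that x is
   real and at most E. *)
Definition eigenvalue_cdf (R : rcfType) (N : nat) (H : 'M[R[i]]_N) (E : R) : R :=
  #|[pred i : 'I_N | spectral_diag H 0 i <= E%:C]|%:R / N%:R.

Lemma char_poly_spectral_diag (R : rcfType) (N : nat) (A : 'M[R[i]]_N) :
  A \is normalmx ->
  char_poly A = \prod_(i < N) ('X - (spectral_diag A 0 i)%:P).
Proof.
move=> /orthomx_spectralP; set Q := spectralmx A; set sp := spectral_diag A.
have Qu : Q \in unitmx by exact: spectral_unit.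
move=> AE.
have -> : char_poly A = char_poly (diag_mx sp).
  rewrite /char_poly /char_poly_mx {1}AE !map_mxM /=.
  have e : map_mx polyC (invmx Q) *m map_mx polyC Q = 1%:M.
    by rewrite -map_mxM /= mulVmx// map_mx1.
  have -> : 'X%:M - map_mx polyC (invmx Q) *m map_mx polyC (diag_mx sp) *m
      map_mx polyC Q =
      map_mx polyC (invmx Q) *m ('X%:M - map_mx polyC (diag_mx sp)) *m map_mx polyC Q.
    by rewrite mulmxBr mulmxBl scalar_mxC -!mulmxA e mulmx1.
  by rewrite !det_mulmx mulrAC -det_mulmx e det1 mul1r.
rewrite char_poly_trig ?diag_mx_is_trig//.
by apply: eq_bigr => i _; rewrite mxE eqxx mulr1n.
Qed.

Lemma normalmx_gram (R : rcfType) (N : nat) (A : 'M[R[i]]_N) : A^t* *m A \is normalmx.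
Proof.
apply/normalmxP; suff -> : (A^t* *m A)^t* = A^t* *m A by [].
by rewrite trmx_mul map_mxM /= trmxCK.
Qed.

Definition mp_density (R : realType) (x : R) : R :=
  if 0 < x <= 4 then (2 * pi)^-1 * Num.sqrt (4 / x - 1) else 0.

Definition mp_cdf (R : realType) (E : R) : R :=
  \int[lebesgue_measure]_(x in `[0, E]) mp_density x.

(* Main.v *)
(* Write A = X / sqrt N, z = x + i y and let m(z) be the normalised trace of
   z (A^* A - z^2)^(-1), the Stieltjes transform of the symmetrised singular values
   of A; the semicircle transform msc solves msc^2 + z msc + 1 = 0. By the moment
   bounds |x_ij| <= 2 D N^(1/4) almost surely, so the entries may be truncated.

   Removing one row is a rank-one perturbation, and the diagonal entries of the
   resolvent are G_i = -1/(z + Q_i) with Q_i a quadratic form in the removed row.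
   Moments of linear and quadratic forms are bounded by a leave-one-out inequality,
   and a dyadic induction on the scale y (halving y at most doubles a diagonal
   entry) bounds all moments of the resolvent entries for N y >= 1. The defect
   1 + z m + m^2 is an average of G_i (m - Q_i), to which the leave-one-out
   inequality applies once more; a self-consistent inequality for its moments
   gives ||m - msc||_q <= C_q / (N y), with C_q polynomial in q.

   The imaginary part of the primitive of m is an average of arctangents that
   counts the singular values below x up to an error y |m|, and the one of msc is
   the Marchenko-Pastur distribution function up to an error y. Both are compared
   by integrating m - msc from i to x + i and then down to height 1/N, through
   log N dyadic scales, each of which costs C_q / N in the q-th norm. *)

Require Import Defs.
From HB Require Import structures.
From mathcomp Require Import all_boot all_order all_algebra.
From mathcomp Require Import spectral complex ring lra zify.
From mathcomp Require Import all_classical all_reals all_analysis.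
From mathcomp Require Import measurable_realfun.

Set Implicit Arguments.
Unset Strict Implicit.
Unset Printing Implicit Defensive.

Import Order.TTheory GRing.Theory Num.Theory.
Import numFieldNormedType.Exports.

Local Open Scope classical_set_scope.
Local Open Scope sesquilinear_scope.
Local Open Scope ring_scope.

(** * Complex numbers *)

(** Writing [E] as [s ^+ 2] moves the hard edge of the Marchenko-Pastur law at 0 to the centre of
    the semicircle, where nothing degenerates; the threshold N^(-2) for [E] is the spacing 1/N for
    [s]. The edge s = 2 remains singular: the stability factor [bsc z] can be as small as the order
    of the square root of Im z, and then the defect controls m - msc only through its own square
    root. The recursion is therefore run for t, the square root of the modulus of the defect, and
    bounds t^2 by (bsc + 1/(N y))/(N y). Dividing by bsc when bsc is larger than 1/(N y), and taking
    a square root otherwise, gives 1/(N y) in both cases. A recursive inequality X <= A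
    E[u (u + t)^n] yields a bound proportional to A, not to its n-th root. Hence no factor 2^n may
    stand in front of a main term, and the elementary inequalities are chosen so that only powers of
    the order appear. The final exponent is [960%:R] because the estimate contains the 48th power of
    a constant of degree 20 in q. *)

Notation rp := complex.Re.
Notation ip := complex.Im.
Notation cabs := ComplexField.Normc.normc.
Notation rc := (real_complex _).

Section ComplexBasics.
Variable R : realType.
Implicit Types (x y z : complex R) (a b : R).

Lemma rpD x y : rp (x + y) = rp x + rp y. Proof. by case: x y => [a b] [c d]. Qed.
Lemma ipD x y : ip (x + y) = ip x + ip y. Proof. by case: x y => [a b] [c d]. Qed.
Lemma rpN x : rp (- x) = - rp x. Proof. by case: x. Qed.
Lemma ipN x : ip (- x) = - ip x. Proof. by case: x. Qed.
Lemma rpB x y : rp (x - y) = rp x - rp y. Proof. by rewrite rpD rpN. Qed.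
Lemma ipB x y : ip (x - y) = ip x - ip y. Proof. by rewrite ipD ipN. Qed.
Lemma rpM x y : rp (x * y) = rp x * rp y - ip x * ip y. Proof. by case: x y => [a b] [c d]. Qed.
Lemma ipM x y : ip (x * y) = rp x * ip y + ip x * rp y. Proof. by case: x y => [a b] [c d]. Qed.
Lemma rpJ x : rp (x^*)%C = rp x. Proof. by case: x. Qed.
Lemma ipJ x : ip (x^*)%C = - ip x. Proof. by case: x. Qed.
Lemma rp_sum I (r : seq I) (P : pred I) (F : I -> complex R) :
  rp (\sum_(i <- r | P i) F i) = \sum_(i <- r | P i) rp (F i).
Proof. by elim/big_rec2 : _ => // i y z _ <-; rewrite rpD. Qed.
Lemma ip_sum I (r : seq I) (P : pred I) (F : I -> complex R) :
  ip (\sum_(i <- r | P i) F i) = \sum_(i <- r | P i) ip (F i).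
Proof. by elim/big_rec2 : _ => // i y z _ <-; rewrite ipD. Qed.
Lemma rpC a : rp (rc a) = a. Proof. by []. Qed.
Lemma ipC a : ip (rc a) = 0. Proof. by []. Qed.
Lemma rpcM a x : rp (rc a * x) = a * rp x. Proof. by rewrite rpM rpC ipC mul0r subr0. Qed.
Lemma ipcM a x : ip (rc a * x) = a * ip x. Proof. by rewrite ipM rpC ipC mul0r addr0. Qed.
Lemma c_eqP x y : rp x = rp y -> ip x = ip y -> x = y.
Proof. by case: x y => [a b] [c d] /= -> ->. Qed.
Lemma natrC n : (n%:R : complex R) = rc n%:R.
Proof. by rewrite rmorph_nat. Qed.

Lemma cabs_sqr x : cabs x ^+ 2 = rp x ^+ 2 + ip x ^+ 2.
Proof. by case: x => a b; rewrite /cabs/= sqr_sqrtr// addr_ge0// sqr_ge0. Qed.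
Lemma cabs_ge0 x : 0 <= cabs x. Proof. by case: x => a b; rewrite /cabs/= sqrtr_ge0. Qed.
Lemma cabs0 : cabs (0 : complex R) = 0. Proof. exact: ComplexField.Normc.normc0. Qed.
Lemma cabs1 : cabs (1 : complex R) = 1. Proof. exact: ComplexField.Normc.normc1. Qed.
Lemma cabsM x y : cabs (x * y) = cabs x * cabs y. Proof. exact: ComplexField.Normc.normcM. Qed.
Lemma cabsV x : cabs x^-1 = (cabs x)^-1. Proof. exact: ComplexField.Normc.normcV. Qed.
Lemma cabsD x y : cabs (x + y) <= cabs x + cabs y. Proof. exact: le_normcD. Qed.
Lemma cabsN x : cabs (- x) = cabs x. Proof. exact: normcN. Qed.
Lemma cabsB x y : cabs (x - y) <= cabs x + cabs y. Proof. by rewrite -(cabsN y) cabsD. Qed.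
Lemma cabsBC x y : cabs (x - y) = cabs (y - x). Proof. by rewrite -cabsN opprB. Qed.
Lemma cabs_eq0 x : (cabs x == 0) = (x == 0).
Proof.
by apply/eqP/eqP => [|->]; [exact: ComplexField.Normc.eq0_normc|exact: cabs0].
Qed.
Lemma cabs_gt0 x : (0 < cabs x) = (x != 0).
Proof. by rewrite lt_neqAle cabs_ge0 andbT eq_sym cabs_eq0. Qed.
Lemma cabsX x n : cabs (x ^+ n) = cabs x ^+ n.
Proof. by elim: n => [|n ih]; rewrite ?cabs1// !exprS cabsM ih. Qed.
Lemma cabsJ x : cabs (x^*)%C = cabs x.
Proof. by case: x => a b; rewrite /cabs/= sqrrN. Qed.
Lemma cabsC a : cabs (rc a) = `|a|.
Proof. by rewrite /cabs/= expr0n/= addr0 sqrtr_sqr. Qed.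
Lemma cabs_nat n : cabs (n%:R : complex R) = n%:R.
Proof. by rewrite natrC cabsC ger0_norm. Qed.
Lemma cabs_sum I (r : seq I) (P : pred I) (F : I -> complex R) :
  cabs (\sum_(i <- r | P i) F i) <= \sum_(i <- r | P i) cabs (F i).
Proof.
elim/big_rec2 : _ => [|i y z _ h]; first by rewrite cabs0.
by rewrite (le_trans (cabsD _ _))// lerD2l.
Qed.
Lemma rp_cabs x : `|rp x| <= cabs x.
Proof.
by rewrite -sqrtr_sqr -[leRHS]ger0_norm ?cabs_ge0// -sqrtr_sqr ler_wsqrtr// cabs_sqr lerDl sqr_ge0.
Qed.
Lemma ip_cabs x : `|ip x| <= cabs x.
Proof.
by rewrite -sqrtr_sqr -[leRHS]ger0_norm ?cabs_ge0// -sqrtr_sqr ler_wsqrtr// cabs_sqr lerDr sqr_ge0.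
Qed.
Lemma rp_le_cabs x : rp x <= cabs x. Proof. exact: le_trans (ler_norm _) (rp_cabs _). Qed.
Lemma ip_le_cabs x : ip x <= cabs x. Proof. exact: le_trans (ler_norm _) (ip_cabs _). Qed.
Lemma mulJc x : (x * (x^*)%C) = rc (cabs x ^+ 2).
Proof. by apply: c_eqP; rewrite ?rpM ?ipM ?rpJ ?ipJ ?rpC ?ipC ?cabs_sqr; ring. Qed.
Lemma cabs_lerB x y : cabs x - cabs y <= cabs (x - y).
Proof. by rewrite lerBlDr (le_trans _ (cabsD _ _))// subrK. Qed.
Lemma conjCE x : Num.conj x = (x^*)%C. Proof. by []. Qed.
Lemma ipV x : ip x^-1 = - ip x / cabs x ^+ 2.
Proof. by rewrite cabs_sqr; case: x => a b /=; rewrite mulNr. Qed.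
Lemma rpV x : rp x^-1 = rp x / cabs x ^+ 2.
Proof. by rewrite cabs_sqr; case: x => a b /=. Qed.

End ComplexBasics.

(** * Independence *)

Section Independence.
Context d (T : measurableType d) (R : realType) (P : probability T R).
Variables (I : finType) (Y : I -> T -> R).
Hypothesis mY : forall i, measurable_fun [set: T] (Y i).
Hypothesis indY : mutually_independent P Y.

Definition cylinders (J : {set I}) : set (set T) :=
  [set A | exists2 B : I -> set R, (forall i, measurable (B i)) &
    A = \bigcap_(i in [set` J]) (Y i @^-1` B i)].

Definition sigma_of (J : {set I}) := g_sigma_algebraType (cylinders J).

Lemma measurable_preim i (B : set R) : measurable B -> measurable (Y i @^-1` B).
Proof. by move=> mB; rewrite -[X in measurable X]setTI; exact: mY. Qed.

Lemma cylinders_measurable J : cylinders J `<=` measurable.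
Proof.
move=> _ [B mB ->]; apply: fin_bigcap_measurable => // i _.
exact: measurable_preim.
Qed.

Lemma cylinders_setI J : setI_closed (cylinders J).
Proof.
move=> _ _ [B mB ->] [B' mB' ->]; exists (fun i => B i `&` B' i).
  by move=> i; exact: measurableI.
rewrite -bigcapI; apply: eq_bigcapr => i _.
by rewrite preimage_setI.
Qed.

Lemma cylinders_setT J : cylinders J setT.
Proof.
exists (fun=> setT) => //.
by apply/seteqP; split => // w _ i _.
Qed.

Lemma sub_sigma_of J (A : set T) : <<s cylinders J >> A -> measurable A.
Proof.
have h := smallest_sub (@sigma_algebra_measurable _ T) (@cylinders_measurable J).
exact: h.
Qed.

Lemma cylinders_indep (J K : {set I}) (A B : set T) : [disjoint J & K]%B ->
  cylinders J A -> cylinders K B -> P (A `&` B) = (P A * P B)%E.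
Proof.
move=> dJK [BJ mBJ ->] [BK mBK ->].
(* As [J] and [K] are disjoint, one family of Borel sets serves both cylinders, and independence can
   be applied to [J], to [K] and to their union. *)
pose B' i := if i \in J then BJ i else BK i.
have mB' i : measurable (B' i) by rewrite /B'; case: ifP.
have e1 i : i \in J -> B' i = BJ i by rewrite /B' => ->.
have e2 i : i \in K -> B' i = BK i.
  by move=> iK; rewrite /B' (disjointFl dJK).
have -> : (\bigcap_(i in [set` J]) Y i @^-1` BJ i) `&`
          (\bigcap_(i in [set` K]) Y i @^-1` BK i) =
          \bigcap_(i in [set` (J :|: K)%SET]) Y i @^-1` B' i.
  apply/seteqP; split => [w [wJ wK] i /=|w wJK].
    rewrite inE => /orP[iJ|iK]; rewrite ?(e1 _ iJ) ?(e2 _ iK).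
      by apply: (wJ i).
    by apply: (wK i).
  split => i /= iS.
    by have := wJK i; rewrite /= inE iS /= e1 //; apply.
  by have := wJK i; rewrite /= inE iS orbT /= e2 //; apply.
rewrite !indY//.
transitivity (\prod_(i in [predU J & K]) P (Y i @^-1` B' i))%E.
  by apply: eq_bigl => i; rewrite !inE.
rewrite bigU//=; congr (_ * _)%E; apply: eq_bigr => i iS; [by rewrite e1|]. by rewrite e2.
Qed.

(** Uniqueness of finite measures on a pi-system is used twice. For a cylinder B of [K] the measures
    P(. and B) and P(B) P(.) agree on the cylinders of [J], hence on the sigma-algebra they
    generate; then the roles are exchanged. *)
Lemma sigma_of_indep (J K : {set I}) (A B : set T) : [disjoint J & K]%B ->
  <<s cylinders J >> A -> <<s cylinders K >> B -> P (A `&` B) = (P A * P B)%E.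
Proof.
move=> dJK sA sB.
have mA := sub_sigma_of sA; have mB := sub_sigma_of sB.
have covT : \bigcup_(k in [set: nat]) (fun=> setT : set T) k = setT.
  by apply/seteqP; split => // w _; exists 0%N.
have step1 : forall B', cylinders K B' -> P (A `&` B') = (P A * P B')%E.
  move=> B' cB'.
  have mB' := cylinders_measurable cB'.
  have fin : P B' \is a fin_num by rewrite fin_num_measure.
  have r0 : 0 <= fine (P B') by rewrite fine_ge0.
  pose m1 := mrestr P mB'; pose m2 := mscale (NngNum r0) P.
  have /= := @g_sigma_algebra_measure_unique _ R T (cylinders J)
    (@cylinders_measurable J) (fun=> setT) (fun=> @cylinders_setT J) covT m1 m2
    (@cylinders_setI J) _ _ A sA.
  rewrite /m1 /m2 /mrestr /mscale /=. rewrite (fineK fin) (muleC (P A)); apply.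
    by move=> A' cA'; rewrite (cylinders_indep dJK)// muleC.
  by move=> _; rewrite setTI ltey_eq fin.
have fin : P A \is a fin_num by rewrite fin_num_measure.
have r0 : 0 <= fine (P A) by rewrite fine_ge0.
pose m1 := mrestr P mA; pose m2 := mscale (NngNum r0) P.
have /= := @g_sigma_algebra_measure_unique _ R T (cylinders K)
  (@cylinders_measurable K) (fun=> setT) (fun=> @cylinders_setT K) covT m1 m2
  (@cylinders_setI K) _ _ B sB.
rewrite /m1 /m2 /mrestr /mscale /= (fineK fin) => h; rewrite setIC; apply: h.
  by move=> A' cA'; rewrite setIC step1.
by move=> _; rewrite setTI ltey_eq fin.
Qed.

Lemma sigma_of_id_measurable J :
  measurable_fun [set: T] (id : T -> sigma_of J).
Proof. by move=> _ A mA; rewrite setTI preimage_id; exact: (@sub_sigma_of J A mA). Qed.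

Lemma sigma_of_measurable J (f : T -> R) :
  measurable_fun [set: sigma_of J] (f : sigma_of J -> R) -> measurable_fun [set: T] f.
Proof.
move=> mf; exact: (@measurableT_comp _ _ _ _ _ _ (f : sigma_of J -> R) _ (id : T -> sigma_of J) mf (@sigma_of_id_measurable J)).
Qed.

Lemma sigma_of_coord (J : {set I}) i : i \in J ->
  measurable_fun [set: sigma_of J] (Y i : sigma_of J -> R).
Proof.
move=> iJ _ B mB; rewrite setTI; apply: sub_sigma_algebra.
exists (fun j => if j == i then B else setT).
  by move=> j; case: ifP.
apply/seteqP; split => [w wB j jJ /=|w]; first by case: eqP => // ->.
by move=> /(_ i iJ); rewrite /= eqxx.
Qed.

Lemma sigma_of_sub (J K : {set I}) (f : T -> R) : J \subset K ->
  measurable_fun [set: sigma_of J] (f : sigma_of J -> R) ->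
  measurable_fun [set: sigma_of K] (f : sigma_of K -> R).
Proof.
move=> JK mf _ B mB.
have incl : cylinders J `<=` <<s cylinders K >>.
  move=> _ [B' mB' ->]; apply: sub_sigma_algebra.
  exists (fun j => if j \in J then B' j else setT).
    by move=> j; case: ifP.
  apply/seteqP; split => [w wB j jK /=|w wB j jJ /=]; first by case: ifPn => // /wB.
  by have := wB j (fintype.subsetP JK _ jJ); rewrite /= (_ : j \in J).
have h := smallest_sub (@smallest_sigma_algebra _ setT (cylinders K)) incl.
have := mf measurableT B mB; rewrite !setTI; exact: h.
Qed.

(** [T] is viewed with two coarser sigma-algebras. Independence says that the diagonal map pushes
    [P] forward to the product of its two restrictions, and Tonelli splits the integral. *)
Lemma ge0_indep_integral (J K : {set I}) (f g : T -> R) : [disjoint J & K]%B ->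
  measurable_fun [set: sigma_of J] (f : sigma_of J -> R) ->
  measurable_fun [set: sigma_of K] (g : sigma_of K -> R) ->
  (forall w, 0 <= f w) -> (forall w, 0 <= g w) ->
  (\int[P]_w (f w * g w)%:E = \int[P]_w (f w)%:E * \int[P]_w (g w)%:E)%E.
Proof.
move=> dJK mf mg f0 g0.
pose phi (w : T) : sigma_of J * sigma_of K := (w, w).
have mphi : measurable_fun [set: T] phi.
  by apply: measurable_fun_pair; exact: sigma_of_id_measurable.
have mJ := @sigma_of_id_measurable J; have mK := @sigma_of_id_measurable K.
pose mu := pushforward P phi.
pose iJ : {mfun T >-> sigma_of J} := HB.pack (id : T -> sigma_of J) (isMeasurableFun.Build _ _ _ _ _ mJ).
pose iK : {mfun T >-> sigma_of K} := HB.pack (id : T -> sigma_of K) (isMeasurableFun.Build _ _ _ _ _ mK).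
pose iphi : {mfun T >-> (sigma_of J * sigma_of K)%type} := HB.pack phi (isMeasurableFun.Build _ _ _ _ _ mphi).
pose PJ : probability (sigma_of J) R := distribution P iJ.
pose PK : probability (sigma_of K) R := distribution P iK.
pose PP : probability (sigma_of J * sigma_of K)%type R := distribution P iphi.
pose F (x : (sigma_of J * sigma_of K)%type) : R := f x.1 * g x.2.
have mF0 : measurable_fun [set: (sigma_of J * sigma_of K)%type] F.
  apply: measurable_funM.
    by apply: (@measurableT_comp _ _ _ _ _ _ (f : sigma_of J -> R)) => //; exact: measurable_fst.
  by apply: (@measurableT_comp _ _ _ _ _ _ (g : sigma_of K -> R)) => //; exact: measurable_snd.
have mF := (measurable_EFinP _ _).2 mF0.
have F0 : forall x, (0 <= (F x)%:E)%E by move=> x; rewrite lee_fin mulr_ge0.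
have -> : (\int[P]_w (f w * g w)%:E = \int[PP]_x (F x)%:E)%E.
  by rewrite (ge0_integral_pushforward mphi)//.
have -> : (\int[PP]_x (F x)%:E = \int[(PJ \x PK)%E]_x (F x)%:E)%E.
  apply: eq_measure_integral => A mA _.
  apply/esym; apply: (@product_measure_unique _ _ _ _ _ PJ PK PP) => // B C mB mC.
  rewrite /PP /PJ /PK /distribution /pushforward /=.
  by rewrite -(sigma_of_indep dJK).
rewrite fubini_tonelli1//= /fubini_F /F /=.
under eq_integral => x _.
  under eq_integral => y _ do rewrite EFinM.
  rewrite ge0_integralZl//; last 3 first.
  - exact/measurable_EFinP.
  - by move=> y _; rewrite lee_fin.
  - by rewrite lee_fin.
  over.
rewrite ge0_integralZr//; last 3 first.
- exact/measurable_EFinP.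
- by move=> y _; rewrite lee_fin.
- by apply: integral_ge0 => y _; rewrite lee_fin.
congr (_ * _)%E.
  by rewrite (ge0_integral_pushforward mJ)//=; [exact/measurable_EFinP|move=> x _; rewrite /= lee_fin].
by rewrite (ge0_integral_pushforward mK)//=; [exact/measurable_EFinP|move=> x _; rewrite /= lee_fin].
Qed.
End Independence.

(** * Resolvent of the Hermitization *)

Section Resolvent.
Variables (R : realType) (N : nat).
Implicit Types (A U : 'M[complex R]_N) (z : complex R) (v : 'rV[complex R]_N).

Definition gram A : 'M[complex R]_N := A^t* *m A.
(** A diagonal block of the inverse of H - z, where H is the Hermitian matrix with off-diagonal
    blocks [A] and its adjoint. The factor [z] is what gives the quadratic forms of the block a
    nonnegative imaginary part on the upper half plane. *)
Definition res A z : 'M[complex R]_N := z *: invmx (gram A - (z ^+ 2)%:M).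

(** Functional calculus in the eigenbasis described by [U]: identities and bounds for the resolvent
    become scalar ones in [f]. *)
Definition fcalc U (f : 'I_N -> complex R) : 'M[complex R]_N :=
  U^t* *m diag_mx (\row_l f l) *m U.

Lemma adjE m n (M : 'M[complex R]_(m, n)) i j : (M^t*) i j = ((M j i)^*)%C.
Proof. by rewrite !mxE. Qed.

Lemma fcalcE U f j k : fcalc U f j k = \sum_l ((U l j)^*)%C * f l * U l k.
Proof.
rewrite /fcalc mxE; apply: eq_bigr => l _; congr (_ * _).
rewrite mxE (bigD1 l)//= big1 ?addr0 => [|i /negbTE il].
  by rewrite adjE !mxE eqxx mulr1n.
by rewrite !mxE il mulr0n mulr0.
Qed.

Lemma fcalcM U f g : U \is unitarymx ->
  fcalc U f *m fcalc U g = fcalc U (fun l => f l * g l).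
Proof.
move=> /unitarymxP UU; rewrite /fcalc.
rewrite -!mulmxA (mulmxA U) UU mul1mx; congr (_ *m _); rewrite mulmxA; congr (_ *m _).
by rewrite mulmx_diag; congr diag_mx; apply/rowP => l; rewrite !mxE.
Qed.

Lemma unitarymxJ U : U \is unitarymx -> U^t* *m U = 1%:M.
Proof. by move=> UU; rewrite -invmx_unitary// mulVmx// unitarymx_unit. Qed.

Lemma fcalc_cst U c : U \is unitarymx -> fcalc U (fun=> c) = c%:M.
Proof.
move=> UU; rewrite /fcalc.
have -> : diag_mx (\row_(l < N) c) = c%:M.
  by apply/matrixP => i j; rewrite !mxE.
by rewrite mul_mx_scalar -scalemxAl unitarymxJ// scalemx1.
Qed.

Lemma fcalcB U f g : fcalc U f - fcalc U g = fcalc U (fun l => f l - g l).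
Proof.
rewrite /fcalc -mulmxBl -mulmxBr.
have -> : diag_mx (\row_l f l) - diag_mx (\row_l g l) = diag_mx (\row_l (f l - g l)); last by [].
by apply/matrixP => i j; rewrite !mxE mulrnBl.
Qed.

Lemma fcalcZ U c f : c *: fcalc U f = fcalc U (fun l => c * f l).
Proof.
rewrite /fcalc scalemxAl scalemxAr.
have -> : c *: diag_mx (\row_l f l) = diag_mx (\row_l (c * f l)); last by [].
by apply/matrixP => i j; rewrite !mxE mulrnAr.
Qed.

(** The eigenvalue of index l is the squared norm of column l of [A] times the adjoint of [U], hence
    a nonnegative real with root [s l]. The last clause keeps the indexing of [spectral_diag], to
    which the counting function refers. *)
Lemma gram_spectral A : exists U, exists s : 'I_N -> R,
  [/\ U \is unitarymx, forall l, 0 <= s l,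
      gram A = fcalc U (fun l => rc (s l ^+ 2)) &
      forall l, spectral_diag (gram A) 0 l = rc (s l ^+ 2)].
Proof.
set S := gram A; set U := spectralmx S; set sp := spectral_diag S.
have nS : S \is normalmx by exact: normalmx_gram.
have UU : U \is unitarymx by exact: spectral_unitarymx.
have SE : S = U^t* *m diag_mx sp *m U.
  rewrite -(invmx_unitary UU); apply/orthomx_spectralP; exact: nS.
have spE l : sp 0 l = \sum_k ((A *m U^t*) k l)^*%C * (A *m U^t*) k l.
  have : U *m S *m U^t* = diag_mx sp.
    rewrite SE !mulmxA; move/unitarymxP : (UU) => e; rewrite e mul1mx.
    by rewrite -mulmxA e mulmx1.
  have e2 : diag_mx sp l l = sp 0 l by rewrite mxE eqxx mulr1n.
  move=> h; rewrite -e2 -h.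
  rewrite /S /gram.
  have -> : U *m (A^t* *m A) *m U^t* = (A *m U^t*)^t* *m (A *m U^t*).
    by rewrite trmx_mul map_mxM /= trmxCK !mulmxA.
  by rewrite mxE; apply: eq_bigr => k _; rewrite adjE.
have spr l : sp 0 l = rc (\sum_k cabs ((A *m U^t*) k l) ^+ 2).
  rewrite spE rmorph_sum/=; apply: eq_bigr => k _.
  by rewrite mulrC mulJc.
exists U, (fun l => Num.sqrt (\sum_k cabs ((A *m U^t*) k l) ^+ 2)); split; [exact: UU|by move=> l; exact: sqrtr_ge0| |].
- rewrite {1}SE /fcalc.
  have -> : \row_l rc (Num.sqrt (\sum_k cabs ((A *m U^t*) k l) ^+ 2) ^+ 2) = sp; last by [].
  apply/rowP => l; rewrite mxE spr sqr_sqrtr//.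
  by apply: sumr_ge0 => k _; exact: sqr_ge0.
- by move=> l; rewrite spr sqr_sqrtr// sumr_ge0// => k _; rewrite sqr_ge0.
Qed.

(* [fz s z] is the symmetrised Cauchy kernel (1/(s - z) + 1/(-s - z))/2 of the Hermitization. *)
Definition fz (s : R) z : complex R := z / (rc (s ^+ 2) - z ^+ 2).

Lemma den_neq0 s z : 0 < ip z -> rc s - z != 0.
Proof.
move=> z0; apply/eqP => /(congr1 (fun x : complex R => ip x)); rewrite ipB ipC sub0r => /eqP.
by rewrite /= oppr_eq0 => /eqP e; rewrite e ltxx in z0.
Qed.

Lemma fzE s z : 0 < ip z ->
  fz s z = ((rc s - z)^-1 + (rc (- s) - z)^-1) / 2.
Proof.
move=> z0; have h1 := den_neq0 s z0; have h2 := den_neq0 (- s) z0.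
have h3 : rc (s ^+ 2) - z ^+ 2 = - ((rc s - z) * (rc (- s) - z)).
  by rewrite rmorphXn/= rmorphN/=; ring.
rewrite /fz h3; have : rc (- s) = - rc s by rewrite rmorphN.
move: h1 h2; set a := rc s; set b := rc (- s) => h1 h2 ba; rewrite ba in h2 *.
by field; rewrite h1 h2.
Qed.

Lemma fz_den s z : 0 < ip z -> rc (s ^+ 2) - z ^+ 2 != 0.
Proof.
move=> z0; have h1 := den_neq0 s z0; have h2 := den_neq0 (- s) z0.
have -> : rc (s ^+ 2) - z ^+ 2 = - ((rc s - z) * (rc (- s) - z)).
  by rewrite rmorphXn/= rmorphN/=; ring.
by rewrite oppr_eq0 mulf_neq0.
Qed.

Lemma fcalc_inv U f : U \is unitarymx -> (forall l, f l != 0) ->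
  invmx (fcalc U f) = fcalc U (fun l => (f l)^-1).
Proof.
move=> UU f0.
have e : fcalc U f *m fcalc U (fun l => (f l)^-1) = 1%:M.
  rewrite fcalcM// -(fcalc_cst 1 UU); congr fcalc; apply/funext => l.
  by rewrite mulfV.
have [u _] := mulmx1_unit e.
by rewrite -[RHS]mul1mx -(mulVmx u) -mulmxA e mulmx1.
Qed.

Lemma res_fcalc A U s : U \is unitarymx -> gram A = fcalc U (fun l => rc (s l ^+ 2)) ->
  forall z, 0 < ip z -> res A z = fcalc U (fun l => fz (s l) z).
Proof.
move=> UU gE z z0; rewrite /res gE -(fcalc_cst _ UU) fcalcB fcalc_inv ?fcalcZ//.
by move=> l; exact: fz_den.
Qed.

Lemma gram_unit A z : 0 < ip z -> gram A - (z ^+ 2)%:M \in unitmx.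
Proof.
move=> z0; have [U [s [UU s0 gE _]]] := gram_spectral A.
rewrite gE -(fcalc_cst _ UU) fcalcB.
have e : fcalc U (fun l => rc (s l ^+ 2) - z ^+ 2) *m
    fcalc U (fun l => (rc (s l ^+ 2) - z ^+ 2)^-1) = 1%:M.
  rewrite fcalcM// -(fcalc_cst 1 UU); congr fcalc; apply/funext => l.
  by rewrite mulfV// fz_den.
have [h _] := mulmx1_unit e; exact: h.
Qed.

Definition qf v (M : 'M[complex R]_N) : complex R := (v *m M *m v^t*) 0 0.
(** The row is set to zero instead of being deleted: the dimension stays [N] and [gram] changes by a
    rank-one matrix. *)
Definition rowz A (i : 'I_N) : 'M[complex R]_N :=
  \matrix_(k, j) (if k == i then 0 else A k j).

Lemma gram_rowz A i : gram A = gram (rowz A i) + (row i A)^t* *m row i A.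
Proof.
apply/matrixP => j k; rewrite !mxE (bigD1 i)//= addrC [in RHS](bigD1 i)//= big_ord1 !mxE eqxx.
rewrite mulr0 add0r; congr (_ + _); apply: eq_bigr => l /negbTE li.
by rewrite !mxE li.
Qed.

Lemma qf_rank1 v M c :
  qf v (M - c *: (M *m v^t* *m (v *m M))) = qf v M - c * qf v M ^+ 2.
Proof.
rewrite /qf mulmxBr mulmxBl -scalemxAr -scalemxAl.
have -> : v *m (M *m v^t* *m (v *m M)) *m v^t* = (v *m M *m v^t*) *m (v *m M *m v^t*).
  by rewrite !mulmxA.
by rewrite mxE [X in _ + X]mxE [X in _ - X]mxE [X in _ * X]mxE big_ord1 expr2.
Qed.

Section RankOne.
Variables (A : 'M[complex R]_N) (z : complex R) (i : 'I_N).
Hypothesis z0 : 0 < ip z.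
Let h := row i A.
Let B := res (rowz A i) z.
Let Q := qf h B.

Let zn0 : z != 0.
Proof. by apply/eqP => e; move: z0; rewrite e ltxx. Qed.

Lemma mulmx11 (x : 'M[complex R]_1) n (y : 'M[complex R]_(1, n)) : x *m y = x 0 0 *: y.
Proof. by rewrite {1}[x]mx11_scalar mul_scalar_mx. Qed.

Lemma resE A' : (gram A' - (z ^+ 2)%:M) *m res A' z = z%:M.
Proof. by rewrite /res -scalemxAr mulmxV ?gram_unit// scalemx1. Qed.

(* With G = - 1/(z + Q); [z + Q != 0] is a consequence of invertibility. *)
Lemma den_rank1 : z + Q != 0.
Proof.
apply/eqP => e.
have e1 : (gram A - (z ^+ 2)%:M) *m (B *m h^t*) = 0.
  rewrite (gram_rowz A i) addrAC mulmxDl mulmxA resE mul_scalar_mx -/h.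
  have -> : h^t* *m h *m (B *m h^t*) = Q *: h^t*.
    by rewrite -mulmxA (mulmxA h) [h *m B *m _]mx11_scalar mul_mx_scalar.
  by rewrite -scalerDl e scale0r.
have e2 : B *m h^t* = 0 by rewrite -[LHS]mul1mx -(mulVmx (gram_unit A z0)) -mulmxA e1 mulmx0.
have Q0 : Q = 0 by rewrite /Q /qf -mulmxA e2 mulmx0 mxE.
by move: e; rewrite Q0 addr0 => /eqP; rewrite (negbTE zn0).
Qed.

(** Sherman-Morrison formula, verified by multiplication with the invertible matrix
    [gram A - (z ^+ 2)%:M]. *)
Lemma res_rank1 : res A z = B - (z + Q)^-1 *: (B *m h^t* *m (h *m B)).
Proof.
have u := gram_unit A z0; have r1 : (gram (rowz A i) - (z ^+ 2)%:M) *m B = z%:M := resE _.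
have d := den_rank1; have QE : Q = qf h B by [].
rewrite /res -[invmx _]mulmx1 scalemxAr scalemx1.
rewrite -[RHS](mulKmx u); congr (_ *m _).
move: r1 d QE; rewrite (gram_rowz A i) -/h addrAC.
move: (gram _ - _) B Q => S1 B1 Q1 r1 d QE; clear -r1 d QE.
rewrite mulmxBr -scalemxAr !(mulmxDl S1) r1.
have e1 : S1 *m (B1 *m h^t* *m (h *m B1)) = z *: (h^t* *m (h *m B1)).
  by rewrite !mulmxA r1 mul_scalar_mx -!scalemxAl.
have e2 : h^t* *m h *m (B1 *m h^t* *m (h *m B1)) = Q1 *: (h^t* *m (h *m B1)).
  rewrite -mulmxA (mulmxA h) (mulmxA h) mulmx11 -/(qf h B1) -QE.
  by rewrite -scalemxAr.
rewrite e1 e2 -scalerDl scalerA mulVf// scale1r.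
by rewrite -mulmxA addrK.
Qed.

Lemma qf_full : qf h (res A z) = Q * z / (z + Q).
Proof.
rewrite res_rank1 qf_rank1 -/Q; have := den_rank1.
by move: Q => q d; field.
Qed.
End RankOne.

Lemma gram_adj A : gram (A^t*) = A *m A^t*.
Proof. by rewrite /gram trmxCK. Qed.

Lemma neq0_ip z : 0 < ip z -> z != 0.
Proof. by move=> z0; apply/eqP => e; move: z0; rewrite e ltxx. Qed.

(** The second diagonal block of the Hermitized resolvent in terms of the first. Its diagonal
    entries are governed by quadratic forms in the rows of [A], which is the origin of [gdiag]. *)
Lemma res_adj A z : 0 < ip z ->
  res (A^t*) z = z^-1 *: (z^-1 *: (A *m res A z *m A^t*) - 1%:M).
Proof.
move=> z0; have zn0 := neq0_ip z0.
have u := gram_unit (A^t*) z0.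
rewrite /res -[invmx (gram (A^t*) - _)]mulmx1 scalemxAr scalemx1.
rewrite -[RHS](mulKmx u); congr (_ *m _); rewrite gram_adj.
have r : A^t* *m A *m res A z = z%:M + z ^+ 2 *: res A z.
  have := resE z0 A; rewrite mulmxBl mul_scalar_mx => /eqP; rewrite subr_eq => /eqP e.
  by rewrite -e.
move: r; rewrite -/(res A z); move: (res A z) => M r.
rewrite -!scalemxAr mulmxBr mulmx1 -scalemxAr mulmxBl.
have -> : A *m A^t* *m (A *m M *m A^t*) = z *: (A *m A^t*) + z ^+ 2 *: (A *m M *m A^t*).
  rewrite -!mulmxA (mulmxA (A^t*)) (mulmxA (A^t* *m A)) r mulmxDl mulmxDr mul_scalar_mx.
  by rewrite -scalemxAr -scalemxAl -scalemxAr.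
rewrite !mul_scalar_mx addrK scalerA mulVf// scale1r opprB addrCA subrr addr0.
by rewrite scale_scalar_mx expr2 mulKf.
Qed.

Definition qrow A z i := qf (row i A) (res (rowz A i) z).
Definition gdiag A z i : complex R := - (z + qrow A z i)^-1.

Lemma qfE v M : qf v M = \sum_k \sum_j v 0 j * M j k * (v 0 k)^*%C.
Proof.
rewrite /qf mxE; apply: eq_bigr => k _; rewrite adjE mxE mulr_suml.
by apply: eq_bigr => j _.
Qed.

Lemma qf_row A M i : qf (row i A) M = (A *m M *m A^t*) i i.
Proof.
rewrite qfE [RHS]mxE; apply: eq_bigr => k _; rewrite adjE [in RHS]mxE mulr_suml.
by apply: eq_bigr => j _; rewrite !mxE.
Qed.

Lemma res_adj_diag A z i : 0 < ip z -> res (A^t*) z i i = gdiag A z i.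
Proof.
move=> z0; have zn0 := neq0_ip z0; rewrite res_adj//.
have e (K : 'M[complex R]_N) : (z^-1 *: (z^-1 *: K - 1%:M)) i i = z^-1 * (z^-1 * K i i - 1).
  by rewrite !mxE eqxx.
rewrite e -qf_row qf_full//.
rewrite /gdiag -/(qrow A z i); have := den_rank1 A i z0; rewrite -/(qrow A z i).
by move: (qrow _ _ _) => q d; field; rewrite d zn0.
Qed.

Definition mtr A z : complex R := N%:R^-1 * \tr (res A z).

Lemma mtr_adj A z : 0 < ip z -> mtr (A^t*) z = mtr A z.
Proof.
move=> z0; have zn0 := neq0_ip z0; rewrite /mtr res_adj// mxtraceZ raddfB /= mxtraceZ mxtrace1.
rewrite mxtrace_mulC mulmxA.
have -> : A^t* *m A *m res A z = z%:M + z ^+ 2 *: res A z.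
  have := resE z0 A; rewrite mulmxBl mul_scalar_mx => /eqP; rewrite subr_eq => /eqP e.
  by rewrite -e.
rewrite raddfD /= mxtraceZ mxtrace_scalar; congr (_ * _).
by rewrite -mulr_natr; field.
Qed.

Lemma mtr_gdiag A z : 0 < ip z -> mtr A z = N%:R^-1 * \sum_i gdiag A z i.
Proof.
move=> z0; rewrite -mtr_adj// /mtr; congr (_ * _); apply: eq_bigr => i _.
by rewrite res_adj_diag.
Qed.

Definition epsm z (m : complex R) : complex R := 1 + z * m + m ^+ 2.

(** Since G_i (z + Q_i) = -1, each term G_i (m - Q_i) equals 1 + (z + m) G_i, and the average of the
    G_i is m again. *)
Lemma eps_avg A z : (0 < N)%N -> 0 < ip z ->
  epsm z (mtr A z) = N%:R^-1 * \sum_i gdiag A z i * (mtr A z - qrow A z i).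
Proof.
move=> N0 z0; set m := mtr A z.
have Nn0 : (N%:R : complex R) != 0 by rewrite pnatr_eq0 -lt0n.
have -> : \sum_i gdiag A z i * (m - qrow A z i) = N%:R + (z + m) * \sum_i gdiag A z i.
  rewrite -[N%:R]mulr1 mulr_natl -[N in _ *+ N]card_ord -sumr_const mulr_sumr -big_split /=.
  apply: eq_bigr => i _; rewrite /gdiag; have := den_rank1 A i z0; rewrite -/(qrow A z i).
  by move: (qrow _ _ _) => q d; field.
rewrite mulrDr mulVf// mulrCA -mtr_gdiag// -/m /epsm; ring.
Qed.

Lemma mtr_rank1 A z i : 0 < ip z ->
  mtr A z - mtr (rowz A i) z =
  N%:R^-1 * gdiag A z i * qf (row i A) (res (rowz A i) z *m res (rowz A i) z).
Proof.
move=> z0; rewrite /mtr (res_rank1 A i z0) /gdiag /qrow.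
move: (res (rowz A i) z) => M.
rewrite raddfB /= mxtraceZ mulrBr addrAC subrr add0r.
rewrite mxtrace_mulC -mulrN -mulNr -mulrA; congr (_ * (_ * _)).
rewrite /qf /mxtrace big_ord1; congr (fun_of_matrix _ 0 0).
by rewrite !mulmxA.
Qed.
End Resolvent.

(** * Spectral bounds for the symmetrised Cauchy kernel *)

Section Bounds.
Variables (R : realType) (N : nat).
Implicit Types (A U : 'M[complex R]_N) (z : complex R) (v : 'rV[complex R]_N).

Lemma qf_delta (M : 'M[complex R]_N) j : qf (delta_mx 0 j) M = M j j.
Proof.
rewrite qfE (bigD1 j)//= [X in _ + X]big1 ?addr0 => [|k kj]; last first.
  by rewrite big1 // => l _; rewrite !mxE /= (negbTE kj) conjc0 mulr0.
rewrite (bigD1 j)//= big1 ?addr0 => [|k kj]; last first.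
  by rewrite !mxE /= (negbTE kj) mul0r mul0r.
by rewrite !mxE !eqxx mul1r conjc1 mulr1.
Qed.

Lemma qf_fcalc U f v :
  qf v (fcalc U f) = \sum_l rc (cabs ((v *m U^t*) 0 l) ^+ 2) * f l.
Proof.
rewrite /qf /fcalc !mulmxA.
have -> : v *m U^t* *m diag_mx (\row_l f l) *m U *m v^t* =
  (v *m U^t*) *m diag_mx (\row_l f l) *m (v *m U^t*)^t*.
  by rewrite trmx_mul map_mxM /= trmxCK !mulmxA.
set c := v *m U^t*; rewrite mxE; apply: eq_bigr => l _.
have -> : (c *m diag_mx (\row_l f l)) 0 l = c 0 l * f l.
  rewrite mxE (bigD1 l)//= big1 ?addr0 => [|i /negbTE il]; first by rewrite !mxE eqxx mulr1n.
  by rewrite !mxE il mulr0n mulr0.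
by rewrite adjE -mulJc mulrAC.
Qed.
Lemma unitary_sqr U v : U \is unitarymx ->
  \sum_l cabs ((v *m U^t*) 0 l) ^+ 2 = \sum_j cabs (v 0 j) ^+ 2.
Proof.
move=> UU.
have sqE (w : 'rV[complex R]_N) : rc (\sum_j cabs (w 0 j) ^+ 2) = (w *m w^t*) 0 0.
  by rewrite mxE rmorph_sum; apply: eq_bigr => j _; rewrite /= adjE -mulJc.
apply: (@complexI R); rewrite !sqE trmx_mul map_mxM /= trmxCK.
by rewrite mulmxA -(mulmxA v) unitarymxJ// mulmx1.
Qed.

Lemma sqr_mul_fcalc U f v : U \is unitarymx ->
  \sum_j cabs ((v *m fcalc U f) 0 j) ^+ 2 =
  \sum_l cabs (f l) ^+ 2 * cabs ((v *m U^t*) 0 l) ^+ 2.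
Proof.
move=> UU; rewrite -(unitary_sqr _ UU); apply: eq_bigr => l _.
rewrite /fcalc !mulmxA -(mulmxA _ U); move/unitarymxP : (UU) => ->; rewrite mulmx1.
set c := v *m U^t*.
have -> : (c *m diag_mx (\row_l f l)) 0 l = c 0 l * f l.
  rewrite mxE (bigD1 l)//= big1 ?addr0 => [|i /negbTE il]; first by rewrite !mxE eqxx mulr1n.
  by rewrite !mxE il mulr0n mulr0.
by rewrite cabsM exprMn mulrC.
Qed.

Lemma fcalc_adj U f : (fcalc U f)^t* = fcalc U (fun l => (f l)^*%C).
Proof.
apply/matrixP => i j; rewrite adjE !fcalcE rmorph_sum; apply: eq_bigr => l _.
by rewrite !rmorphM /= conjcK mulrC mulrA [RHS]mulrAC mulrC mulrA.
Qed.

Lemma sqr_fcalc_mul U f v : U \is unitarymx ->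
  \sum_j cabs ((fcalc U f *m v^t*) j 0) ^+ 2 =
  \sum_l cabs (f l) ^+ 2 * cabs ((v *m U^t*) 0 l) ^+ 2.
Proof.
move=> UU.
transitivity (\sum_j cabs ((v *m fcalc U (fun l => (f l)^*%C)) 0 j) ^+ 2).
  apply: eq_bigr => j _.
  have -> : v *m fcalc U (fun l => (f l)^*%C) = (fcalc U f *m v^t*)^t*.
    by rewrite trmx_mul map_mxM /= trmxCK fcalc_adj.
  by rewrite adjE cabsJ.
by rewrite sqr_mul_fcalc//; apply: eq_bigr => l _; rewrite cabsJ.
Qed.

Lemma mxtrace_fcalc U f : U \is unitarymx -> \tr (fcalc U f) = \sum_l f l.
Proof.
move=> /unitarymxP UU; rewrite /fcalc -mulmxA mxtrace_mulC -mulmxA UU mulmx1 mxtrace_diag.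
by apply: eq_bigr => l _; rewrite mxE.
Qed.

Lemma ip_cauchy (s : R) z : 0 < ip z -> ip (rc s - z)^-1 = ip z * cabs (rc s - z)^-1 ^+ 2.
Proof. by move=> z0; rewrite ipV ipB ipC sub0r opprK cabsV exprVn. Qed.

Lemma ip_le_den (s : R) z : 0 < ip z -> ip z <= cabs (rc s - z).
Proof.
move=> z0; apply: le_trans (ip_cabs _); rewrite ipB ipC sub0r normrN.
exact: ler_norm.
Qed.

Lemma cabs_cauchy (s : R) z : 0 < ip z -> cabs (rc s - z)^-1 <= (ip z)^-1.
Proof.
move=> z0; rewrite cabsV lef_pV2 ?posrE//; last by rewrite cabs_gt0 den_neq0.
exact: ip_le_den.
Qed.

Lemma cabs2 : cabs (2 : complex R) = 2. Proof. by rewrite cabs_nat. Qed.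

Lemma half_cabs (x y : complex R) : cabs ((x + y) / 2) <= (cabs x + cabs y) / 2.
Proof. by rewrite cabsM cabsV cabs2 ler_pM2r ?invr_gt0// cabsD. Qed.

Lemma ip_half (x y : complex R) : ip ((x + y) / 2) = (ip x + ip y) / 2.
Proof.
have -> : (x + y) / 2 = rc (2^-1) * (x + y) by rewrite mulrC fmorphV rmorph_nat.
by rewrite ipcM ipD mulrC.
Qed.

(** Scalar Ward inequality. For a single pole it is the equality [ip_cauchy]; averaging the poles s
    and -s costs only the convexity of the square. *)
Lemma fz_ip_ge (s : R) z : 0 < ip z -> ip z * cabs (fz s z) ^+ 2 <= ip (fz s z).
Proof.
move=> z0; rewrite fzE// ip_half !ip_cauchy// -mulrDr -mulrA ler_pM2l//.
set x := (_ - z)^-1; set y := (_ - z)^-1.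
apply: (@le_trans _ _ (((cabs x + cabs y) / 2) ^+ 2)).
  by rewrite ler_sqr ?nnegrE ?cabs_ge0 ?half_cabs// divr_ge0// addr_ge0// cabs_ge0.
have := sqr_ge0 (cabs x - cabs y); nra.
Qed.

Lemma fz_ip_ge0 (s : R) z : 0 < ip z -> 0 <= ip (fz s z).
Proof.
by move=> z0; apply: le_trans (fz_ip_ge s z0); rewrite mulr_ge0 ?sqr_ge0// ltW.
Qed.

Lemma cabs_fz (s : R) z : 0 < ip z -> cabs (fz s z) <= (ip z)^-1.
Proof.
move=> z0; rewrite fzE//; apply: le_trans (half_cabs _ _) _.
have := cabs_cauchy s z0; have := cabs_cauchy (- s) z0; lra.
Qed.

Lemma fz_lip (s : R) z z' : 0 < ip z -> 0 < ip z' ->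
  cabs (fz s z - fz s z') <= cabs (z - z') / (ip z * ip z').
Proof.
move=> z0 z0'; have c0 := cabs_ge0 (z - z').
have key (t : R) : cabs ((rc t - z)^-1 - (rc t - z')^-1) <= cabs (z - z') / (ip z * ip z').
  have h := den_neq0 t z0; have h' := den_neq0 t z0'.
  have -> : (rc t - z)^-1 - (rc t - z')^-1 = (z - z') * ((rc t - z)^-1 * (rc t - z')^-1).
    by field; rewrite h h'.
  rewrite !cabsM ler_wpM2l// invfM ler_pM ?cabs_ge0 ?cabs_cauchy//.
rewrite !fzE//.
have -> (a b c d : complex R) : (a + b) / 2 - (c + d) / 2 = ((a - c) + (b - d)) / 2 by field.
apply: le_trans (half_cabs _ _) _.
have := key s; have := key (- s); lra.
Qed.

(* Up to a factor 2 in the imaginary part, |1/(s - z')| <= 2 |1/(s - z)|. *)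
Lemma fz_half (s e y y' : R) : 0 < y -> y / 2 <= y' <= y ->
  cabs (fz s (e +i* y')%C - fz s (e +i* y)%C) <= ip (fz s (e +i* y)%C).
Proof.
move=> y0 /andP[y1 y2]; set z := (e +i* y)%C; set z' := (e +i* y')%C.
have yp : 0 < y' by apply: lt_le_trans y1; rewrite divr_gt0.
have z0 : 0 < ip z by []. have z0' : 0 < ip z' by [].
have key (t : R) : cabs ((rc t - z')^-1 - (rc t - z)^-1) <= ip (rc t - z)^-1.
  have h := den_neq0 t z0; have h' := den_neq0 t z0'.
  have -> : (rc t - z')^-1 - (rc t - z)^-1 = (z' - z) * ((rc t - z)^-1 * (rc t - z')^-1).
    by field; rewrite h h'.
  have dz : cabs (z' - z) <= y / 2.
    have -> : z' - z = (0 +i* (- (y - y')))%C by apply: c_eqP; rewrite ?rpB ?ipB /=; lra.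
    by rewrite /cabs /= expr0n /= add0r sqrrN sqrtr_sqr ger0_norm; lra.
  rewrite !cabsM ip_cauchy// [ip z]/= expr2.
  have h3 : cabs (rc t - z')^-1 <= 2 * cabs (rc t - z)^-1.
    rewrite !cabsV -[2]invrK -invfM lef_pV2 ?posrE ?mulr_gt0 ?cabs_gt0 ?invr_gt0//.
    rewrite -(@ler_pXn2r _ 2) ?nnegrE ?mulr_ge0 ?cabs_ge0 ?invr_ge0//.
    rewrite exprMn !cabs_sqr !rpB !ipB !rpC !ipC /=; have := sqr_ge0 (t - e); nra.
  have c0 := cabs_ge0 (rc t - z)^-1; have c0' := cabs_ge0 (rc t - z')^-1.
  apply: (@le_trans _ _ (y / 2 * (cabs (rc t - z)^-1 * (2 * cabs (rc t - z)^-1)))); last first.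
    by move: c0; set x := cabs _ => c0; nra.
  apply: ler_pM => //; [exact: cabs_ge0|exact: mulr_ge0|exact: ler_wpM2l].
rewrite !fzE//.
have -> (a b c d : complex R) : (a + b) / 2 - (c + d) / 2 = ((a - c) + (b - d)) / 2 by field.
apply: le_trans (half_cabs _ _) _; rewrite ip_half.
have := key s; have := key (- s); lra.
Qed.
End Bounds.

(** * Ward-type domination and the effect of removing a row *)

Section ResolventBounds.
Variables (R : realType) (N : nat).
Implicit Types (A U B C : 'M[complex R]_N) (z : complex R) (v : 'rV[complex R]_N).

(** The Ward inequality in the form needed later. With [v] a basis vector it bounds rows and columns
    of [C]; with [v] the removed row it bounds the linear forms from which the quadratic form is
    built. *)
Definition dominated (e : R) C B := forall v,
  e * (\sum_j cabs ((v *m C) 0 j) ^+ 2) <= ip (qf v B) /\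
  e * (\sum_j cabs ((C *m v^t*) j 0) ^+ 2) <= ip (qf v B).

(* [ip z *: B^2] is dominated by B in the same sense as B itself, so that one
   concentration lemma serves both quadratic forms. *)
Definition sqres A z : 'M[complex R]_N := rc (ip z) *: (res A z *m res A z).

Lemma sum_fcalc_ip U f v : ip (qf v (fcalc U f)) =
  \sum_l ip (f l) * cabs ((v *m U^t*) 0 l) ^+ 2.
Proof.
by rewrite qf_fcalc ip_sum; apply: eq_bigr => l _; rewrite ipcM mulrC.
Qed.

Lemma dominated_fcalc U f g e : U \is unitarymx ->
  (forall l, e * cabs (f l) ^+ 2 <= ip (g l)) -> dominated e (fcalc U f) (fcalc U g).
Proof.
move=> UU fg v; rewrite sqr_mul_fcalc// sqr_fcalc_mul// sum_fcalc_ip mulr_sumr.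
have h : \sum_l e * (cabs (f l) ^+ 2 * cabs ((v *m U^t*) 0 l) ^+ 2) <=
  \sum_l ip (g l) * cabs ((v *m U^t*) 0 l) ^+ 2.
  by apply: ler_sum => l _; rewrite mulrA ler_wpM2r ?sqr_ge0.
by split.
Qed.

Lemma dominated_res A z : 0 < ip z -> dominated (ip z) (res A z) (res A z).
Proof.
move=> z0; have [U [s [UU s0 gE _]]] := gram_spectral A.
rewrite (res_fcalc UU gE z0); apply: dominated_fcalc => // l; exact: fz_ip_ge.
Qed.

Lemma cabs_sq_fz (s : R) z : 0 < ip z -> cabs (rc (ip z) * (fz s z * fz s z)) <= ip (fz s z).
Proof.
move=> z0; rewrite 2!cabsM cabsC gtr0_norm// -expr2; exact: fz_ip_ge.
Qed.

Lemma sqres_fcalc A U s : U \is unitarymx -> gram A = fcalc U (fun l => rc (s l ^+ 2)) ->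
  forall z, 0 < ip z ->
  sqres A z = fcalc U (fun l => rc (ip z) * (fz (s l) z * fz (s l) z)).
Proof. by move=> UU gE z z0; rewrite /sqres (res_fcalc UU gE z0) (fcalcM _ _ UU) fcalcZ. Qed.

Lemma dominated_sqres A z : 0 < ip z -> dominated (ip z) (sqres A z) (res A z).
Proof.
move=> z0; have [U [s [UU s0 gE _]]] := gram_spectral A.
rewrite (sqres_fcalc UU gE z0) (res_fcalc UU gE z0); apply: dominated_fcalc => // l.
apply: le_trans (fz_ip_ge _ z0); rewrite ler_pM2l// ler_sqr ?nnegrE ?cabs_ge0//.
rewrite mulrA cabsM ler_piMl ?cabs_ge0// cabsM cabsC gtr0_norm//.
by rewrite mulrC -ler_pdivlMr// div1r cabs_fz.
Qed.

Lemma ip_qf_ge0 A z v : 0 < ip z -> 0 <= ip (qf v (res A z)).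
Proof.
move=> z0; have [h _] := dominated_res A z0 v; apply: le_trans h.
by apply: mulr_ge0; [exact: ltW|apply: sumr_ge0 => j _; exact: sqr_ge0].
Qed.

Lemma ip_res_ge0 A z j : 0 < ip z -> 0 <= ip (res A z j j).
Proof. by move=> z0; rewrite -qf_delta ip_qf_ge0. Qed.

(** Cauchy-Schwarz over the eigenvectors, in the form 2 x y <= x^2 + y^2. Off-diagonal entries are
    compared with diagonal ones through it. *)
Lemma entry_fcalc_bound U f g j k : U \is unitarymx ->
  (forall l, cabs (f l) <= ip (g l)) ->
  cabs (fcalc U f j k) <= (ip (fcalc U g j j) + ip (fcalc U g k k)) / 2.
Proof.
move=> UU fg; rewrite fcalcE; apply: le_trans (cabs_sum _ _ _) _.
have e i : ip (fcalc U g i i) = \sum_l ip (g l) * cabs (U l i) ^+ 2.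
  rewrite fcalcE ip_sum; apply: eq_bigr => l _.
  by rewrite mulrAC [(_^*)%C * _]mulrC mulJc ipcM mulrC.
rewrite !e -big_split/= mulr_suml; apply: ler_sum => l _.
rewrite !cabsM cabsJ; have := fg l; have := cabs_ge0 (f l).
have := sqr_ge0 (cabs (U l j) - cabs (U l k)).
set x := cabs (U l j); set y := cabs (U l k) => h1 h2 h3.
have x0 : 0 <= x by exact: cabs_ge0. have y0 : 0 <= y by exact: cabs_ge0.
have h4 : cabs (f l) * (x * y) <= ip (g l) * (x * y) by rewrite ler_wpM2r// mulr_ge0.
have h5 : 0 <= ip (g l) * (x - y) ^+ 2 by rewrite mulr_ge0// (le_trans h2).
lra.
Qed.

Lemma qf_fcalc_bound U f g v : U \is unitarymx ->
  (forall l, cabs (f l) <= ip (g l)) -> cabs (qf v (fcalc U f)) <= ip (qf v (fcalc U g)).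
Proof.
move=> UU fg; rewrite sum_fcalc_ip qf_fcalc (le_trans (cabs_sum _ _ _))//.
apply: ler_sum => l _; rewrite cabsM cabsC ger0_norm ?sqr_ge0// mulrC.
by apply: ler_wpM2r; [exact: sqr_ge0|].
Qed.

Lemma cabs_sqres A z j k : 0 < ip z ->
  cabs (sqres A z j k) <= (ip (res A z j j) + ip (res A z k k)) / 2.
Proof.
move=> z0; have [U [s [UU s0 gE _]]] := gram_spectral A.
rewrite (sqres_fcalc UU gE z0) (res_fcalc UU gE z0).
by apply: entry_fcalc_bound => // l; exact: cabs_sq_fz.
Qed.

Lemma qf_sqres A z v : 0 < ip z -> cabs (qf v (sqres A z)) <= ip (qf v (res A z)).
Proof.
move=> z0; have [U [s [UU s0 gE _]]] := gram_spectral A.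
rewrite (sqres_fcalc UU gE z0) (res_fcalc UU gE z0).
by apply: qf_fcalc_bound => // l; exact: cabs_sq_fz.
Qed.

Lemma qfZ c v C : qf v (c *: C) = c * qf v C.
Proof. by rewrite /qf -scalemxAr -scalemxAl mxE. Qed.

Lemma res_half A j k (e y y' : R) : 0 < y -> y / 2 <= y' <= y ->
  cabs (res A (e +i* y')%C j k) <= cabs (res A (e +i* y)%C j k) +
    (ip (res A (e +i* y)%C j j) + ip (res A (e +i* y)%C k k)) / 2.
Proof.
move=> y0 yy; have [U [s [UU s0 gE _]]] := gram_spectral A.
have z0 : 0 < ip (e +i* y)%C by [].
have z0' : 0 < ip (e +i* y')%C by case/andP: yy => h _; apply: lt_le_trans h; rewrite divr_gt0.
rewrite !(res_fcalc UU gE) // -lerBlDl (le_trans (cabs_lerB _ _))//.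
have -> (f g : 'I_N -> complex R) : fcalc U f j k - fcalc U g j k = (fcalc U f - fcalc U g) j k.
  by rewrite !mxE.
by rewrite fcalcB; apply: entry_fcalc_bound => // l; exact: fz_half.
Qed.

Lemma res_half_diag A j (e y y' : R) : 0 < y -> y / 2 <= y' <= y ->
  cabs (res A (e +i* y')%C j j) <= 2 * cabs (res A (e +i* y)%C j j).
Proof.
move=> y0 yy; apply: le_trans (res_half _ _ _ _ y0 yy) _.
by have := ip_le_cabs (res A (e +i* y)%C j j); lra.
Qed.

Lemma cabs_res A z j k : 0 < ip z -> cabs (res A z j k) <= (ip z)^-1.
Proof.
move=> z0; have [h _] := dominated_res A z0 (delta_mx 0 j).
rewrite qf_delta in h.
have h2 l : ip z * cabs (res A z j l) ^+ 2 <= ip (res A z j j).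
  apply: le_trans h; rewrite ler_pM2l//.
  have e i : ((delta_mx 0 j : 'rV_N) *m res A z) 0 i = res A z j i by rewrite -rowE mxE.
  rewrite (bigD1 l)//= e lerDl sumr_ge0// => i _; exact: sqr_ge0.
(* The Ward bound at l = j reads Im z |R_jj|^2 <= |R_jj|; division by |R_jj| settles the diagonal,
   and the other entries follow from the same bound. *)
have dj : cabs (res A z j j) <= (ip z)^-1.
  have [->|n0] := eqVneq (cabs (res A z j j)) 0; first by rewrite invr_ge0 ltW.
  have p0 : 0 < cabs (res A z j j) by rewrite lt_neqAle eq_sym n0 cabs_ge0.
  rewrite -div1r ler_pdivlMr// -(ler_pM2r p0) mul1r.
  apply: le_trans (ip_le_cabs _); apply: le_trans (h2 j); rewrite le_eqVlt; apply/orP; left; apply/eqP; ring.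
have zi0 : 0 <= (ip z)^-1 by rewrite invr_ge0 ltW.
rewrite -(@ler_pXn2r _ 2) ?nnegrE ?cabs_ge0//.
rewrite -(ler_pM2l z0); apply: le_trans (h2 k) _.
rewrite expr2 mulVKf ?gt_eqF//; apply: le_trans dj; exact: ip_le_cabs.
Qed.

Lemma ip_mtr A z : ip (mtr A z) = N%:R^-1 * \sum_j ip (res A z j j).
Proof.
rewrite /mtr.
have -> : (N%:R^-1 : complex R) = rc (N%:R^-1) by rewrite fmorphV rmorph_nat.
by rewrite ipcM /mxtrace ip_sum.
Qed.

Lemma ip_mtr_ge0 A z : 0 < ip z -> 0 <= ip (mtr A z).
Proof.
by move=> z0; rewrite ip_mtr mulr_ge0 ?invr_ge0// sumr_ge0// => j _; exact: ip_res_ge0.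
Qed.

Lemma ip_gden A z i : 0 < ip z -> ip (qrow A z i) <= cabs (z + qrow A z i).
Proof.
move=> z0; apply: le_trans (ip_le_cabs _); rewrite ipD lerDr ltW//.
Qed.

Lemma cabs_gdiag A z i : 0 < ip z -> cabs (gdiag A z i) <= (ip z)^-1.
Proof. by move=> z0; rewrite -res_adj_diag// cabs_res. Qed.

Lemma qf_res2 A z v : 0 < ip z ->
  qf v (res A z *m res A z) = (rc (ip z))^-1 * qf v (sqres A z).
Proof.
move=> z0; rewrite /sqres qfZ mulKf//.
by rewrite -(rmorph0 (real_complex R)) (inj_eq (@complexI R)) gt_eqF.
Qed.

Lemma cabs_qf_res2 A z v : 0 < ip z ->
  cabs (qf v (res A z *m res A z)) <= ip (qf v (res A z)) / ip z.
Proof.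
move=> z0; rewrite qf_res2// cabsM cabsV cabsC gtr0_norm// mulrC; apply: ler_wpM2r; [by rewrite invr_ge0 ltW|exact: qf_sqres].
Qed.

Lemma cabs_Ninv (a : R) : 0 <= a -> cabs (N%:R^-1 : complex R) = N%:R^-1.
Proof. by rewrite cabsV cabs_nat. Qed.

Lemma mtr_diff_le A z i : 0 < ip z ->
  cabs (mtr A z - mtr (rowz A i) z) <=
  cabs (gdiag A z i) * ip (qrow A z i) / (N%:R * ip z).
Proof.
move=> z0; rewrite mtr_rank1// !cabsM (@cabs_Ninv 0)// invfM.
have := cabs_qf_res2 (rowz A i) (row i A) z0; rewrite -/(qrow A z i) => h.
have g0 := cabs_ge0 (gdiag A z i).
have -> : cabs (gdiag A z i) * ip (qrow A z i) * (N%:R^-1 / ip z) =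
  (N%:R^-1 * cabs (gdiag A z i)) * (ip (qrow A z i) / ip z) by ring.
by apply: ler_wpM2l; [rewrite mulr_ge0 ?invr_ge0|].
Qed.

Lemma gdiag_ip A z i : 0 < ip z -> cabs (gdiag A z i) * ip (qrow A z i) <= 1.
Proof.
move=> z0; rewrite /gdiag cabsN cabsV mulrC.
have p : 0 < cabs (z + qrow A z i) by rewrite cabs_gt0; exact: den_rank1.
by rewrite ler_pdivrMr// mul1r ip_gden.
Qed.

(** The bound is deterministic: the imaginary part of Q_i is at most |z + Q_i|, the reciprocal of
    |G_i|. *)
Lemma mtr_diff A z i : 0 < ip z ->
  cabs (mtr A z - mtr (rowz A i) z) <= (N%:R * ip z)^-1.
Proof.
move=> z0; apply: le_trans (mtr_diff_le _ _ z0) _.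
by apply: ler_piMl; [rewrite invr_ge0 mulr_ge0// ltW|exact: gdiag_ip].
Qed.

End ResolventBounds.

(** * Bounded random variables *)

Section BoundedMeasurable.
Context d (T : measurableType d) (R : realType) (P : probability T R).
Implicit Types f g : T -> R.

Definition bounded_fct (T0 : Type) (f : T0 -> R) := exists C, forall w, `|f w| <= C.

Definition Ex f : R := \int[P]_w f w.

Definition bm f := measurable_fun [set: T] f /\ bounded_fct f.

Lemma bm_integrable f : bm f -> P.-integrable [set: T] (EFin \o f).
Proof.
move=> [mf [C fC]]; apply: measurable_bounded_integrable => //.
  by have := fin_num_measure P _ (@measurableT _ T); rewrite ge0_fin_numE.
exists C; split; first exact: num_real.
by move=> M CM w _; apply: le_trans (fC w) _; exact: ltW.
Qed.

Lemma Ex_cst c : Ex (fun=> c) = c.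
Proof.
have e : fine (P [set: T]) = 1 :> R by rewrite (@probability_setT _ _ _ P).
by rewrite /Ex Rintegral_cst// -[RHS]mulr1 -e.
Qed.

Lemma ExD f g : bm f -> bm g -> Ex (fun w => f w + g w) = Ex f + Ex g.
Proof. by move=> bf bg; rewrite /Ex RintegralD//; exact: bm_integrable. Qed.

Lemma ExZ c f : bm f -> Ex (fun w => c * f w) = c * Ex f.
Proof. by move=> bf; rewrite /Ex RintegralZl//; exact: bm_integrable. Qed.

Lemma Ex_le f g : bm f -> bm g -> (forall w, f w <= g w) -> Ex f <= Ex g.
Proof. by move=> bf bg fg; apply: le_Rintegral => //; exact: bm_integrable. Qed.

Lemma Ex_ge0 f : (forall w, 0 <= f w) -> 0 <= Ex f.
Proof. by move=> f0; exact: Rintegral_ge0. Qed.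

Lemma Ex_ext f g : f =1 g -> Ex f = Ex g.
Proof. by move=> fg; congr Ex; apply/funext. Qed.

Lemma bfct_cst c : bounded_fct (fun _ : T => c).
Proof. by exists `|c|. Qed.
Lemma bounded_fctD (T0 : Type) (f g : T0 -> R) : bounded_fct f -> bounded_fct g -> bounded_fct (fun w => f w + g w).
Proof.
move=> [C fC] [D gD]; exists (C + D) => w.
by rewrite (le_trans (ler_normD _ _))// lerD.
Qed.
Lemma bounded_fctM (T0 : Type) (f g : T0 -> R) : bounded_fct f -> bounded_fct g -> bounded_fct (fun w => f w * g w).
Proof. by move=> [C fC] [D gD]; exists (C * D) => w; rewrite normrM ler_pM. Qed.
Lemma bounded_abs (T0 : Type) (f : T0 -> R) : bounded_fct f -> bounded_fct (fun w => `|f w|).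
Proof. by move=> [C fC]; exists C => w; rewrite normr_id. Qed.
Lemma bounded_sqrt (T0 : Type) (f : T0 -> R) : bounded_fct f -> bounded_fct (fun w => Num.sqrt (f w)).
Proof.
move=> [C fC]; exists (Num.sqrt C) => w; rewrite ger0_norm ?sqrtr_ge0// ler_wsqrtr//.
by rewrite (le_trans (ler_norm _)).
Qed.
End BoundedMeasurable.

(** * Random variables depending on a set of entries *)

Section MeasureSystem.
Context d (T : measurableType d) (R : realType) (P : probability T R).
Variable E : finType.

(* [ms S f]: the random variable f is measurable with respect to the entries
   indexed by S. *)
Record msystem (ms : {set E} -> (T -> R) -> Prop) : Prop := {
  ms_meas : forall S f, ms S f -> measurable_fun [set: T] f ;
  ms_cst : forall S c, ms S (fun=> c) ;
  ms_add : forall S f g, ms S f -> ms S g -> ms S (fun w => f w + g w) ;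
  ms_mul : forall S f g, ms S f -> ms S g -> ms S (fun w => f w * g w) ;
  ms_comp : forall S f (phi : R -> R), measurable_fun setT phi -> ms S f ->
    ms S (fun w => phi (f w)) ;
  ms_sub : forall (S S' : {set E}) f, S \subset S' -> ms S f -> ms S' f ;
  ms_indep : forall (S S' : {set E}) f g, [disjoint S & S']%B -> ms S f -> ms S' g ->
    bounded_fct f -> bounded_fct g ->
    Ex P (fun w => f w * g w) = Ex P f * Ex P g }.

Variable ms : {set E} -> (T -> R) -> Prop.
Hypothesis msy : msystem ms.

(** Boundedness is built in: entries are truncated and the resolvent is at most 1/Im z, so every
    expectation is a real number and linearity needs no integrability argument. *)
Definition rv S f := ms S f /\ bounded_fct f.

Lemma rv_bm S f : rv S f -> bm f.
Proof. by move=> [/(ms_meas msy)]. Qed.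
Lemma rv_cst S c : rv S (fun=> c).
Proof. by split; [exact: (ms_cst msy)|exact: bfct_cst]. Qed.
Lemma rvD S f g : rv S f -> rv S g -> rv S (fun w => f w + g w).
Proof. by move=> [? ?] [? ?]; split; [exact: (ms_add msy)|exact: bounded_fctD]. Qed.
Lemma rvM S f g : rv S f -> rv S g -> rv S (fun w => f w * g w).
Proof. by move=> [? ?] [? ?]; split; [exact: (ms_mul msy)|exact: bounded_fctM]. Qed.
Lemma rvN S f : rv S f -> rv S (fun w => - f w).
Proof.
move=> rf; have -> : (fun w => - f w) = (fun w => -1 * f w) by apply/funext => w; rewrite mulN1r.
by apply: rvM => //; exact: rv_cst.
Qed.
Lemma rvB S f g : rv S f -> rv S g -> rv S (fun w => f w - g w).
Proof. by move=> rf rg; apply: rvD => //; exact: rvN. Qed.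
Lemma rvX S f n : rv S f -> rv S (fun w => f w ^+ n).
Proof.
move=> rf; elim: n => [|n ih].
  have -> : (fun w => f w ^+ 0) = (fun=> 1) by apply/funext => w; rewrite expr0.
  exact: rv_cst.
have -> : (fun w => f w ^+ n.+1) = (fun w => f w * f w ^+ n) by apply/funext => w; rewrite exprS.
exact: rvM.
Qed.
Lemma rv_sum S (I : Type) (r : seq I) (p : pred I) (F : I -> T -> R) :
  (forall i, p i -> rv S (F i)) -> rv S (fun w => \sum_(i <- r | p i) F i w).
Proof.
move=> h; elim: r => [|i r ih].
  have -> : (fun w => \sum_(i <- [::] | p i) F i w) = (fun=> 0) by apply/funext => w; rewrite big_nil.
  exact: rv_cst.
have -> : (fun w => \sum_(j <- i :: r | p j) F j w) =
  (fun w => (if p i then F i w else 0) + \sum_(j <- r | p j) F j w).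
  by apply/funext => w; rewrite big_cons; case: ifP; rewrite ?add0r.
by apply: rvD => //; case pi: (p i); [exact: h|exact: rv_cst].
Qed.
Lemma measurable_sqrt : measurable_fun [set: R] (@Num.sqrt R).
Proof. by apply: continuous_measurable_fun; exact: sqrt_continuous. Qed.
Lemma rv_abs S f : rv S f -> rv S (fun w => `|f w|).
Proof.
by move=> [? ?]; split; [apply: (ms_comp msy) => //; exact: measurable_normr|exact: bounded_abs].
Qed.
Lemma rv_sqrt S f : rv S f -> rv S (fun w => Num.sqrt (f w)).
Proof.
by move=> [? ?]; split; [apply: (ms_comp msy) => //; exact: measurable_sqrt|exact: bounded_sqrt].
Qed.
Lemma rv_ext S f g : f =1 g -> rv S f -> rv S g.
Proof. by move=> /funext ->. Qed.
Lemma rv_sub (S S' : {set E}) f : S \subset S' -> rv S f -> rv S' f.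
Proof. by move=> SS' [? ?]; split => //; exact: (ms_sub msy) SS' _. Qed.
Lemma rvT S f : rv S f -> rv [set: E]%SET f.
Proof. by apply: rv_sub; exact: finset.subsetT. Qed.
Lemma rv_indep (S S' : {set E}) f g : [disjoint S & S']%B -> rv S f -> rv S' g ->
  Ex P (fun w => f w * g w) = Ex P f * Ex P g.
Proof. by move=> dSS [? ?] [? ?]; apply: (ms_indep msy dSS). Qed.

Lemma Ex_sum (I : Type) (r : seq I) (p : pred I) (F : I -> T -> R) S :
  (forall i, p i -> rv S (F i)) ->
  Ex P (fun w => \sum_(i <- r | p i) F i w) = \sum_(i <- r | p i) Ex P (F i).
Proof.
move=> h; elim: r => [|i r ih].
  rewrite big_nil -[RHS](Ex_cst P); apply: Ex_ext => w; by rewrite big_nil.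
rewrite big_cons -ih; case: ifP => pi.
  rewrite -ExD; [|exact: rv_bm (h _ pi)|].
    by apply: Ex_ext => w; rewrite big_cons pi.
  by apply: (@rv_bm S); exact: rv_sum.
by apply: Ex_ext => w; rewrite big_cons pi.
Qed.

Definition crv S (F : T -> complex R) := rv S (fun w => rp (F w)) /\ rv S (fun w => ip (F w)).

Lemma rv_rp S F : crv S F -> rv S (fun w => rp (F w)).
Proof. by case. Qed.
Lemma rv_ip S F : crv S F -> rv S (fun w => ip (F w)).
Proof. by case. Qed.
Lemma crv_cst S c : crv S (fun=> c).
Proof. by split; exact: rv_cst. Qed.
Lemma crvD S F G : crv S F -> crv S G -> crv S (fun w => F w + G w).
Proof.
move=> [? ?] [? ?]; split; apply: rv_ext; first by move=> w; rewrite rpD.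
- exact: rvD.
- by move=> w; rewrite ipD.
- exact: rvD.
Qed.
Lemma crvM S F G : crv S F -> crv S G -> crv S (fun w => F w * G w).
Proof.
move=> [? ?] [? ?]; split; apply: rv_ext; first by move=> w; rewrite rpM.
- by apply: rvB; exact: rvM.
- by move=> w; rewrite ipM.
- by apply: rvD; exact: rvM.
Qed.
Lemma crvN S F : crv S F -> crv S (fun w => - F w).
Proof.
move=> [? ?]; split; apply: rv_ext; first by move=> w; rewrite rpN.
- exact: rvN.
- by move=> w; rewrite ipN.
- exact: rvN.
Qed.
Lemma crvB S F G : crv S F -> crv S G -> crv S (fun w => F w - G w).
Proof. by move=> cF cG; apply: crvD => //; exact: crvN. Qed.
Lemma crvJ S F : crv S F -> crv S (fun w => ((F w)^*)%C).
Proof.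
move=> [? ?]; split; apply: rv_ext; first by move=> w; rewrite rpJ.
- by [].
- by move=> w; rewrite ipJ.
- exact: rvN.
Qed.
Lemma crv_rc S f : rv S f -> crv S (fun w => rc (f w)).
Proof. by move=> rf; split => //; exact: rv_cst. Qed.
Lemma crv_sum S (I : Type) (r : seq I) (p : pred I) (F : I -> T -> complex R) :
  (forall i, p i -> crv S (F i)) -> crv S (fun w => \sum_(i <- r | p i) F i w).
Proof.
move=> h; split; apply: rv_ext; first by move=> w; rewrite rp_sum.
- by apply: rv_sum => i pi; case: (h i pi).
- by move=> w; rewrite ip_sum.
- by apply: rv_sum => i pi; case: (h i pi).
Qed.
Lemma crvX S F n : crv S F -> crv S (fun w => F w ^+ n).
Proof.
move=> cF; elim: n => [|n ih].
  have -> : (fun w => F w ^+ 0) = (fun=> 1) by apply/funext => w; rewrite expr0.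
  exact: crv_cst.
have -> : (fun w => F w ^+ n.+1) = (fun w => F w * F w ^+ n) by apply/funext => w; rewrite exprS.
exact: crvM.
Qed.
Lemma rv_cabs S F : crv S F -> rv S (fun w => cabs (F w)).
Proof.
move=> [? ?]; apply: (@rv_ext _ (fun w => Num.sqrt (rp (F w) ^+ 2 + ip (F w) ^+ 2))).
  by move=> w; rewrite -cabs_sqr sqrtr_sqr ger0_norm// cabs_ge0.
by apply: rv_sqrt; apply: rvD; exact: rvX.
Qed.
Lemma crv_sub (S S' : {set E}) F : S \subset S' -> crv S F -> crv S' F.
Proof. by move=> SS' [? ?]; split; exact: rv_sub SS' _. Qed.
Lemma crvT S F : crv S F -> crv [set: E]%SET F.
Proof. by apply: crv_sub; exact: finset.subsetT. Qed.

Lemma crv_indep0 (S S' : {set E}) F G : [disjoint S & S']%B -> crv S F -> crv S' G ->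
  Ex P (fun w => rp (F w)) = 0 -> Ex P (fun w => ip (F w)) = 0 ->
  Ex P (fun w => rp (F w * G w)) = 0.
Proof.
move=> dSS [rF iF] [rG iG] r0 i0.
rewrite (@Ex_ext _ _ _ _ _ (fun w => rp (F w) * rp (G w) + (-1) * (ip (F w) * ip (G w)))); last first.
  by move=> w; rewrite rpM mulN1r.
have dS := rvM (rvT rF) (rvT rG); have dS' := rvM (rvT iF) (rvT iG).
rewrite ExD ?ExZ; [|exact: rv_bm dS'|exact: rv_bm dS|exact: rv_bm (rvM (rv_cst [set: E]%SET (-1)) dS')].
by rewrite !(rv_indep dSS)// r0 i0 !mul0r mulr0 addr0.
Qed.

(** Complex variables without a bound, for Cramer's rule, where the reciprocal of the determinant
    has no a priori bound. *)
Definition cms S (F : T -> complex R) := ms S (fun w => rp (F w)) /\ ms S (fun w => ip (F w)).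

Lemma ms_ext S f g : f =1 g -> ms S f -> ms S g.
Proof. by move=> /funext ->. Qed.
Lemma ms_opp S f : ms S f -> ms S (fun w => - f w).
Proof.
move=> mf; apply: (@ms_ext _ (fun w => -1 * f w)); first by move=> w; rewrite mulN1r.
by apply: (ms_mul msy) => //; exact: (ms_cst msy).
Qed.
Lemma cms_cst S c : cms S (fun=> c).
Proof. by split; exact: (ms_cst msy). Qed.
Lemma cmsD S F G : cms S F -> cms S G -> cms S (fun w => F w + G w).
Proof.
move=> [? ?] [? ?]; split; apply: ms_ext; first by move=> w; rewrite rpD.
- exact: (ms_add msy).
- by move=> w; rewrite ipD.
- exact: (ms_add msy).
Qed.
Lemma cmsM S F G : cms S F -> cms S G -> cms S (fun w => F w * G w).
Proof.
move=> [? ?] [? ?]; split; apply: ms_ext; first by move=> w; rewrite rpM.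
- by apply: (ms_add msy); [|apply: ms_opp]; exact: (ms_mul msy).
- by move=> w; rewrite ipM.
- by apply: (ms_add msy); exact: (ms_mul msy).
Qed.
Lemma cmsJ S F : cms S F -> cms S (fun w => ((F w)^*)%C).
Proof.
move=> [? ?]; split; apply: ms_ext; first by move=> w; rewrite rpJ.
- by [].
- by move=> w; rewrite ipJ.
- exact: ms_opp.
Qed.
Lemma ms_sqsum S F : cms S F -> ms S (fun w => cabs (F w) ^+ 2).
Proof.
move=> [? ?]; apply: (@ms_ext _ (fun w => rp (F w) * rp (F w) + ip (F w) * ip (F w))).
  by move=> w; rewrite cabs_sqr !expr2.
by apply: (ms_add msy); exact: (ms_mul msy).
Qed.
Lemma cmsV S F : cms S F -> cms S (fun w => (F w)^-1).
Proof.
move=> cF; have [? ?] := cF.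
(* On nonnegative reals the reciprocal is the real power -1, also at 0, where both vanish;
   measurability is taken from the power. *)
have mi : ms S (fun w => (cabs (F w) ^+ 2)^-1).
  apply: (@ms_ext _ (fun w => (cabs (F w) ^+ 2) `^ (-1))).
    by move=> w; rewrite -powR_inv1// sqr_ge0.
  by apply: (@ms_comp _ msy _ _ (@powR R ^~ (-1))); [exact: measurable_powR|exact: ms_sqsum].
split; apply: ms_ext; first by move=> w; rewrite rpV.
- exact: (ms_mul msy).
- by move=> w; rewrite ipV.
- by apply: (ms_mul msy) => //; exact: ms_opp.
Qed.
Lemma cms_sum S (I : Type) (r : seq I) (p : pred I) (F : I -> T -> complex R) :
  (forall i, p i -> cms S (F i)) -> cms S (fun w => \sum_(i <- r | p i) F i w).
Proof.
move=> h; elim: r => [|i r ih].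
  have -> : (fun w => \sum_(i <- [::] | p i) F i w) = (fun=> 0) by apply/funext => w; rewrite big_nil.
  exact: cms_cst.
have -> : (fun w => \sum_(j <- i :: r | p j) F j w) =
  (fun w => (if p i then F i w else 0) + \sum_(j <- r | p j) F j w).
  by apply/funext => w; rewrite big_cons; case: ifP; rewrite ?add0r.
by apply: cmsD => //; case pi: (p i); [exact: h|exact: cms_cst].
Qed.
Lemma cms_prod S (I : Type) (r : seq I) (p : pred I) (F : I -> T -> complex R) :
  (forall i, p i -> cms S (F i)) -> cms S (fun w => \prod_(i <- r | p i) F i w).
Proof.
move=> h; elim: r => [|i r ih].
  have -> : (fun w => \prod_(i <- [::] | p i) F i w) = (fun=> 1) by apply/funext => w; rewrite big_nil.
  exact: cms_cst.
have -> : (fun w => \prod_(j <- i :: r | p j) F j w) =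
  (fun w => (if p i then F i w else 1) * \prod_(j <- r | p j) F j w).
  by apply/funext => w; rewrite big_cons; case: ifP; rewrite ?mul1r.
by apply: cmsM => //; case pi: (p i); [exact: h|exact: cms_cst].
Qed.

Section MatrixValued.
Variable n : nat.
Definition mms m (S : {set E}) (M : T -> 'M[complex R]_(m, n)) :=
  forall i j, cms S (fun w => M w i j).
End MatrixValued.

Lemma cms_det n S (M : T -> 'M[complex R]_n) : mms S M -> cms S (fun w => \det (M w)).
Proof.
move=> mM; apply: cms_sum => s _; apply: cmsM; first exact: cms_cst.
by apply: cms_prod => i _; exact: mM.
Qed.

Lemma mms_mul m n p S (M : T -> 'M[complex R]_(m, n)) (M' : T -> 'M[complex R]_(n, p)) :
  mms S M -> mms S M' -> mms S (fun w => M w *m M' w).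
Proof.
move=> mM mM' i j.
have -> : (fun w => (M w *m M' w) i j) = (fun w => \sum_k M w i k * M' w k j).
  by apply/funext => w; rewrite mxE.
by apply: cms_sum => k _; exact: cmsM.
Qed.

Lemma mms_adj m n S (M : T -> 'M[complex R]_(m, n)) : mms S M -> mms S (fun w => (M w)^t*).
Proof.
move=> mM i j.
have -> : (fun w => (M w)^t* i j) = (fun w => ((M w j i)^*)%C).
  by apply/funext => w; rewrite !mxE.
exact: cmsJ.
Qed.

(** Cramer's rule: the entries of the inverse are cofactors over the determinant. *)
Lemma mms_inv n S (M : T -> 'M[complex R]_n) : mms S M -> (forall w, M w \in unitmx) ->
  mms S (fun w => invmx (M w)).
Proof.
move=> mM uM i j.
have -> : (fun w => invmx (M w) i j) =
  (fun w => (\det (M w))^-1 * ((-1) ^+ (j + i) * \det (row' j (col' i (M w))))).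
  by apply/funext => w; rewrite /invmx uM !mxE.
apply: cmsM; first by apply: cmsV; exact: cms_det.
apply: cmsM; first exact: cms_cst.
apply: cms_det => k l.
have -> : (fun w => (row' j (col' i (M w))) k l) = (fun w => M w (lift j k) (lift i l)).
  by apply/funext => w; rewrite !mxE.
exact: mM.
Qed.
End MeasureSystem.

(** * Power inequalities with controlled constants *)

Section PowerInequalities.
Variable R : realType.
Implicit Types x y l : R.

(** Convexity of the power in tangent-line form. Summed at the mean it is Jensen's inequality; at a
    pair of points it bounds differences of powers. *)
Lemma pow_tangent n x y : 0 <= x -> 0 <= y ->
  y ^+ n.+1 + n.+1%:R * y ^+ n * (x - y) <= x ^+ n.+1.
Proof.
move=> x0 y0; elim: n => [|n ih]; first by rewrite !expr1 expr0 mulr1 mul1r addrC subrK.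
have h : x * (y ^+ n.+1 + n.+1%:R * y ^+ n * (x - y)) <= x ^+ n.+2.
  by rewrite [leRHS]exprS ler_wpM2l.
apply: le_trans h; rewrite -subr_ge0.
have -> : x * (y ^+ n.+1 + n.+1%:R * y ^+ n * (x - y)) -
  (y ^+ n.+2 + n.+2%:R * y ^+ n.+1 * (x - y)) = n.+1%:R * y ^+ n * (x - y) ^+ 2.
  by rewrite !exprS -[n.+2]addn1 natrD; ring.
by apply: mulr_ge0; [apply: mulr_ge0 => //; exact: exprn_ge0|exact: sqr_ge0].
Qed.

Lemma pow_sub n x y : 0 <= x -> 0 <= y -> x ^+ n - y ^+ n <= n%:R * x ^+ n.-1 * (x - y).
Proof.
case: n => [|n] x0 y0; first by rewrite !expr0 subrr !mul0r.
have := pow_tangent n y0 x0; rewrite /=; set X := x ^+ n.+1; set Y := y ^+ n.+1.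
by rewrite -subr_ge0 => h; rewrite -subr_ge0; apply: le_trans h _; rewrite le_eqVlt; apply/orP; left; apply/eqP; ring.
Qed.

Lemma pow_jensen n (I : finType) (w x : I -> R) : (forall i, 0 <= w i) -> (forall i, 0 <= x i) ->
  \sum_i w i = 1 -> (\sum_i w i * x i) ^+ n.+1 <= \sum_i w i * x i ^+ n.+1.
Proof.
move=> w0 x0 w1; set y := \sum_i w i * x i.
have y0 : 0 <= y by apply: sumr_ge0 => i _; exact: mulr_ge0.
have -> : y ^+ n.+1 = \sum_i w i * (y ^+ n.+1 + n.+1%:R * y ^+ n * (x i - y)).
  have -> : \sum_i w i * (y ^+ n.+1 + n.+1%:R * y ^+ n * (x i - y)) =
    y ^+ n.+1 * \sum_i w i + n.+1%:R * y ^+ n * (\sum_i w i * x i - y * \sum_i w i).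
    rewrite mulr_sumr [y * \sum_i w i]mulr_sumr -sumrB mulr_sumr -big_split/=.
    by apply: eq_bigr => i _; ring.
  by rewrite w1 -/y mulr1 mulr1 subrr mulr0 addr0.
by apply: ler_sum => i _; rewrite ler_wpM2l// pow_tangent.
Qed.

Definition e0 : R := expR 1.

Lemma e0_ge1 : 1 <= e0.
Proof. by rewrite -expR0 /e0 ler_expR. Qed.

Lemma e0_gt0 : 0 < e0. Proof. exact: lt_le_trans e0_ge1. Qed.

Lemma one_inv_pow n l : n%:R <= l -> 0 < l -> (1 + l^-1) ^+ n <= e0.
Proof.
move=> nl l0.
apply: (@le_trans _ _ (expR l^-1 ^+ n)).
  have li : 0 <= l^-1 by rewrite invr_ge0 ltW.
  by rewrite lerXn2r ?nnegrE ?expR_ge0 ?addr_ge0 ?expR_ge1Dx.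
by rewrite -expRM_natl /e0 ler_expR ler_pdivrMr// mul1r.
Qed.

(** The leading coefficient is [e0 R], not 2^n. Either n y <= x, and (1 + 1/n)^n <= e applies, or x
    + y is at most (n + 1) y. *)
Lemma pow_add n x y : 0 <= x -> 0 <= y ->
  (x + y) ^+ n <= e0 * x ^+ n + n.+1%:R ^+ n * y ^+ n.
Proof.
move=> x0 y0; have e1 := e0_ge1.
have xn := exprn_ge0 n x0; have yn := exprn_ge0 n y0.
have [h|h] := leP (n%:R * y) x.
  case: n h xn yn => [|n] h xn yn; first by rewrite !expr0 !mulr1; have := e0_ge1; lra.
  have hl : (x + y) ^+ n.+1 <= (x * (1 + n.+1%:R^-1)) ^+ n.+1.
    rewrite lerXn2r ?nnegrE ?addr_ge0// ?mulr_ge0// ?addr_ge0//.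
    by rewrite mulrDr mulr1 lerD2l ler_pdivlMr ?ltr0n// mulrC.
  apply: le_trans hl _; rewrite exprMn mulrC.
  apply: (@le_trans _ _ (e0 * x ^+ n.+1)); first by rewrite ler_wpM2r// one_inv_pow.
  by rewrite lerDl mulr_ge0// exprn_ge0.
rewrite -exprMn.
apply: (@le_trans _ _ ((n.+1%:R * y) ^+ n)).
  rewrite lerXn2r ?nnegrE ?addr_ge0 ?mulr_ge0//.
  by rewrite -[n.+1]addn1 natrD mulrDl mul1r lerD2r ltW.
by rewrite lerDr mulr_ge0// (le_trans _ e1).
Qed.

(** The coefficient of the power of t is as small as l permits. The price (1 + l)^n on the power of
    u becomes a factor of at most 1 + l after a root of order n + 1. *)
Lemma young_pt n l u t : 0 <= u -> 0 <= t -> n.+1%:R <= l ->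
  u * (u + t) ^+ n <= (1 + l) ^+ n * u ^+ n.+1 + (e0 / l) * t ^+ n.+1.
Proof.
move=> u0 t0 nl.
have l0 : 0 < l by apply: lt_le_trans nl; rewrite ltr0n.
have un := exprn_ge0 n.+1 u0; have tn := exprn_ge0 n.+1 t0.
have e1 := e0_gt0.
have l0' := ltW l0; have l1 : 0 <= 1 + l by rewrite addr_ge0.
have li0 : 0 <= l^-1 by rewrite invr_ge0.
have [h|h] := leP t (l * u).
  have h2 : u + t <= (1 + l) * u by rewrite mulrDl mul1r lerD2l.
  apply: (@le_trans _ _ (u * ((1 + l) * u) ^+ n)).
    by rewrite ler_wpM2l// lerXn2r ?nnegrE ?addr_ge0 ?mulr_ge0.
  rewrite exprMn mulrCA -exprS lerDl mulr_ge0// divr_ge0//; exact: ltW.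
have ut : u <= t / l by rewrite ler_pdivlMr// mulrC ltW.
apply: (@le_trans _ _ ((t / l) * (t * (1 + l^-1)) ^+ n)).
  have h2 : u + t <= t * (1 + l^-1) by rewrite mulrDr mulr1 addrC lerD2l.
  by rewrite ler_pM ?exprn_ge0 ?addr_ge0// lerXn2r ?nnegrE ?addr_ge0// (le_trans _ h2)// addr_ge0.
have -> : t / l * (t * (1 + l^-1)) ^+ n = ((1 + l^-1) ^+ n / l) * t ^+ n.+1.
  by rewrite exprMn exprS; ring.
apply: (@le_trans _ _ (e0 / l * t ^+ n.+1)).
  rewrite ler_wpM2r// ler_wpM2r ?invr_ge0 ?(ltW l0)//.
  by apply: one_inv_pow => //; apply: le_trans nl; rewrite ler_nat.
by rewrite lerDr mulr_ge0// exprn_ge0// addr_ge0// ltW.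
Qed.

Lemma young_xy n x y : 0 <= x -> 0 <= y -> x * y ^+ n <= x ^+ n.+1 + y ^+ n.+1.
Proof.
move=> x0 y0; have xn := exprn_ge0 n.+1 x0; have yn := exprn_ge0 n.+1 y0.
have [h|h] := leP x y.
  by rewrite (le_trans _ (_ : y ^+ n.+1 <= _)) ?lerDr// exprS ler_wpM2r// exprn_ge0.
rewrite (le_trans _ (_ : x ^+ n.+1 <= _)) ?lerDl// exprS ler_wpM2l//.
by rewrite lerXn2r ?nnegrE// ltW.
Qed.
End PowerInequalities.

Section PhiPower.
Variable R : realType.
Implicit Types a b z : complex R.
(** Up to the factor k + 1, the derivative of |z|^(2k+2) in z. One factor z of that power is thereby
    separated, so that it can be expanded into a sum of centred terms. *)
Definition phi k z : complex R := rc (cabs z ^+ (2 * k)) * (z^*)%C.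

Lemma cabs_phi k z : cabs (phi k z) = cabs z ^+ (2 * k).+1.
Proof. by rewrite /phi cabsM cabsC cabsJ ger0_norm ?exprn_ge0 ?cabs_ge0// exprSr. Qed.

Lemma rp_mul_phi k z : rp (z * phi k z) = cabs z ^+ (2 * k.+1).
Proof. by rewrite /phi mulrCA mulJc -rmorphM rpC -exprD mulnS addnC. Qed.

Lemma phi_diff k a b : cabs (phi k a - phi k b) <=
  (2 * k).+1%:R * cabs (a - b) * (cabs b + cabs (a - b)) ^+ (2 * k).
Proof.
set dd := cabs (a - b); set M := cabs b + dd; set n := (2 * k)%N.
have d0 : 0 <= dd by exact: cabs_ge0.
have b0 := cabs_ge0 b; have a0 := cabs_ge0 a.
have aM : cabs a <= M by rewrite /M -{1}(subrK b a) addrC cabsD.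
have bM : cabs b <= M by rewrite /M lerDl.
have M0 : 0 <= M by rewrite addr_ge0.
have -> : phi k a - phi k b = rc (cabs a ^+ n) * ((a - b)^*)%C + rc (cabs a ^+ n - cabs b ^+ n) * (b^*)%C.
  by rewrite /phi -/n rmorphB /= rmorphB /=; ring.
apply: le_trans (cabsD _ _) _; rewrite !cabsM !cabsC !cabsJ -/dd.
rewrite ger0_norm ?exprn_ge0//.
have h1 : cabs a ^+ n * dd <= M ^+ n * dd by rewrite ler_wpM2r// lerXn2r// nnegrE.
have ab : `|cabs a - cabs b| <= dd.
  rewrite ler_norml; apply/andP; split; last exact: cabs_lerB.
  by rewrite lerNl opprB /dd cabsBC; exact: cabs_lerB.
have h2 : `|cabs a ^+ n - cabs b ^+ n| * cabs b <= n%:R * dd * M ^+ n.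
  have key x y : 0 <= x -> 0 <= y -> x <= M -> y <= M -> x - y <= dd -> 0 <= x - y -> (x ^+ n - y ^+ n) * cabs b <= n%:R * dd * M ^+ n.
    move=> x0 y0 xM yM xyd xy.
    apply: (@le_trans _ _ (n%:R * x ^+ n.-1 * (x - y) * cabs b)).
      by rewrite ler_wpM2r// pow_sub.
    case: (n) => [|m /=]; first by rewrite !mul0r.
    have -> : m.+1%:R * x ^+ m * (x - y) * cabs b = m.+1%:R * ((x - y) * (x ^+ m * cabs b)) by ring.
    rewrite -mulrA ler_wpM2l// ler_pM ?mulr_ge0 ?exprn_ge0// exprSr ler_pM ?exprn_ge0//.
    by rewrite lerXn2r ?nnegrE.
  have [h|h] := leP (cabs b) (cabs a).
    rewrite ger0_norm; last by rewrite subr_ge0 lerXn2r// nnegrE.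
    by apply: key => //; rewrite ?subr_ge0// (le_trans (ler_norm _)).
  rewrite distrC ger0_norm; last by rewrite subr_ge0 lerXn2r// ?nnegrE// ltW.
  apply: key => //; last by rewrite subr_ge0 ltW.
  by rewrite (le_trans (ler_norm _))// distrC.
rewrite -[in leRHS]addn1 natrD; lra.
Qed.
End PhiPower.

(** * Moments *)

Section Moments.
Context d (T : measurableType d) (R : realType) (P : probability T R).
Variable E : finType.
Variable ms : {set E} -> (T -> R) -> Prop.
Hypothesis msy : msystem P ms.
Local Notation rv := (rv ms).
Local Notation crv := (crv ms).
Local Notation fullE := ([set: E]%SET).
Implicit Types (f g : T -> R) (a b : R).
Let rv_cst := (@rv_cst _ _ _ _ _ _ msy).
Let rvD := (@rvD _ _ _ _ _ _ msy).
Let rvM := (@rvM _ _ _ _ _ _ msy).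
Let rvN := (@rvN _ _ _ _ _ _ msy).
Let rvB := (@rvB _ _ _ _ _ _ msy).
Let rvX := (@rvX _ _ _ _ _ _ msy).
Let rv_sum := (@rv_sum _ _ _ _ _ _ msy).
Let rv_abs := (@rv_abs _ _ _ _ _ _ msy).
Let rv_sqrt := (@rv_sqrt _ _ _ _ _ _ msy).
Let rv_sub := (@rv_sub _ _ _ _ _ _ msy).
Let rvT := (@rvT _ _ _ _ _ _ msy).
Let crv_cst := (@crv_cst _ _ _ _ _ _ msy).
Let crvD := (@crvD _ _ _ _ _ _ msy).
Let crvM := (@crvM _ _ _ _ _ _ msy).
Let crvN := (@crvN _ _ _ _ _ _ msy).
Let crvB := (@crvB _ _ _ _ _ _ msy).
Let crvJ := (@crvJ _ _ _ _ _ _ msy).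
Let crv_rc := (@crv_rc _ _ _ _ _ _ msy).
Let crv_sum := (@crv_sum _ _ _ _ _ _ msy).
Let crvX := (@crvX _ _ _ _ _ _ msy).
Let rv_cabs := (@rv_cabs _ _ _ _ _ _ msy).
Let crv_sub := (@crv_sub _ _ _ _ _ _ msy).
Let crvT := (@crvT _ _ _ _ _ _ msy).

(** A bound [a] for the n-th norm of a nonnegative [f], stated without extracting a root. *)
Definition mom n f a := Ex P (fun w => f w ^+ n) <= a ^+ n.

Lemma Ex_mono S f g : rv S f -> rv S g -> (forall w, f w <= g w) -> Ex P f <= Ex P g.
Proof. by move=> rf rg fg; apply: Ex_le => //; apply: (rv_bm msy); [exact: rf|exact: rg]. Qed.

Lemma ExDr S f g : rv S f -> rv S g -> Ex P (fun w => f w + g w) = Ex P f + Ex P g.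
Proof. by move=> rf rg; apply: ExD; apply: (rv_bm msy); [exact: rf|exact: rg]. Qed.

Lemma ExZr S c f : rv S f -> Ex P (fun w => c * f w) = c * Ex P f.
Proof. by move=> rf; apply: ExZ; apply: (rv_bm msy); exact: rf. Qed.

Lemma mom_le n S f g a : rv S f -> rv S g -> (forall w, 0 <= f w) -> (forall w, f w <= g w) ->
  mom n g a -> mom n f a.
Proof.
move=> rf rg f0 fg; apply: le_trans; apply: (@Ex_mono S); [exact: rvX|exact: rvX|].
by move=> w; rewrite lerXn2r ?nnegrE// (le_trans (f0 w)).
Qed.

Lemma mom_ler n f a b : 0 <= a -> a <= b -> mom n f a -> mom n f b.
Proof. by move=> a0 ab /le_trans; apply; rewrite lerXn2r ?nnegrE// (le_trans a0). Qed.

Lemma mom_cst n c : mom n (fun=> c) c.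
Proof. by rewrite /mom Ex_cst. Qed.

Lemma mom_bound n S f c : rv S f -> (forall w, 0 <= f w) -> (forall w, f w <= c) -> mom n f c.
Proof.
by move=> rf f0 fc; exact: (mom_le rf (rv_cst S c) f0 fc (mom_cst n c)).
Qed.

Lemma mom_scale n S f a c : rv S f -> mom n f a -> mom n (fun w => c * f w) (c * a) \/ ~~ (0 <= c).
Proof.
move=> rf fa; have [c0|] := boolP (0 <= c); [left|by right].
rewrite /mom; under Ex_ext do rewrite exprMn.
by rewrite (@ExZr S) ?exprMn; [rewrite ler_wpM2l// exprn_ge0|exact: rvX].
Qed.

Lemma momZ n S f a c : 0 <= c -> rv S f -> mom n f a -> mom n (fun w => c * f w) (c * a).
Proof. by move=> c0 rf fa; have [//|] := mom_scale c rf fa; rewrite c0. Qed.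

(** Minkowski's inequality, obtained from Jensen with weights proportional to the bounds [a i]. *)
Lemma mom_sum n S (I : finType) (F : I -> T -> R) (a : I -> R) :
  (forall i, rv S (F i)) -> (forall i w, 0 <= F i w) -> (forall i, 0 < a i) ->
  (forall i, mom n.+1 (F i) (a i)) ->
  mom n.+1 (fun w => \sum_i F i w) (\sum_i a i).
Proof.
move=> rF F0 a0 mF; set s := \sum_i a i.
have [j0|no] := pickP (fun _ : I => true); last first.
  have e0' (G : I -> R) : \sum_i G i = 0 by rewrite big1 // => i; have := no i.
  rewrite /mom /s e0'; under Ex_ext do rewrite e0'.
  by rewrite Ex_cst.
move=> _; have s0 : 0 < s.
  rewrite /s (bigD1 j0)//= ltr_pwDl// sumr_ge0// => i _; exact: ltW.
have pt w : (\sum_i F i w) ^+ n.+1 <= \sum_i (s ^+ n * (a i / a i ^+ n.+1)) * F i w ^+ n.+1.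
  have -> : \sum_i F i w = s * \sum_i (a i / s) * (F i w / a i).
    rewrite mulr_sumr; apply: eq_bigr => i _; field.
    by rewrite (gt_eqF s0) (gt_eqF (a0 i)).
  rewrite exprMn; apply: (@le_trans _ _ (s ^+ n.+1 * \sum_i (a i / s) * (F i w / a i) ^+ n.+1)).
    rewrite ler_wpM2l ?exprn_ge0 ?(ltW s0)//; apply: pow_jensen.
    - by move=> i; rewrite divr_ge0 ?(ltW s0) ?(ltW (a0 i)).
    - by move=> i; rewrite divr_ge0 ?(ltW (a0 i)).
    - by rewrite -mulr_suml mulfV// gt_eqF.
  rewrite mulr_sumr; apply: ler_sum => i _; rewrite le_eqVlt; apply/orP; left; apply/eqP.
  rewrite expr_div_n !exprS; field.
  by rewrite (gt_eqF s0) (gt_eqF (a0 i)) expf_neq0 ?(gt_eqF (a0 i)).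
have rX i : rv S (fun w => F i w ^+ n.+1) by exact: rvX.
have rc i : rv S (fun w => s ^+ n * (a i / a i ^+ n.+1) * F i w ^+ n.+1).
  by apply: rvM; [exact: rv_cst|exact: rX].
apply: (@le_trans _ _ (Ex P (fun w => \sum_i (s ^+ n * (a i / a i ^+ n.+1)) * F i w ^+ n.+1))).
  by apply: (@Ex_mono S) => //; [apply: rvX => //; exact: rv_sum|exact: rv_sum].
rewrite (@Ex_sum _ _ _ _ _ _ msy _ _ _ _ S)//.
apply: (@le_trans _ _ (\sum_i s ^+ n * a i)); last by rewrite -mulr_sumr -/s exprSr.
apply: ler_sum => i _; rewrite (ExZr _ (rX i)) -mulrA ler_wpM2l ?exprn_ge0 ?(ltW s0)//.
rewrite -mulrA ler_piMr ?(ltW (a0 i))// ler_pdivrMl ?exprn_gt0// mulr1; exact: mF.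
Qed.

Lemma mom_add n S f g a b : rv S f -> rv S g -> (forall w, 0 <= f w) -> (forall w, 0 <= g w) ->
  0 < a -> 0 < b -> mom n.+1 f a -> mom n.+1 g b -> mom n.+1 (fun w => f w + g w) (a + b).
Proof.
move=> rf rg f0 g0 a0 b0 mf mg.
have := @mom_sum n S bool (fun i => if i then f else g) (fun i => if i then a else b).
rewrite /mom big_bool; under Ex_ext do rewrite big_bool.
by apply => [[]|[]|[]|[]].
Qed.

Lemma mom_avg n S N (F : 'I_N -> T -> R) a : (0 < N)%N ->
  (forall i, rv S (F i)) -> (forall i w, 0 <= F i w) -> 0 < a ->
  (forall i, mom n.+1 (F i) a) ->
  mom n.+1 (fun w => N%:R^-1 * \sum_i F i w) a.
Proof.
move=> N0 rF F0 a0 mF.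
have h := @mom_sum n S 'I_N F (fun=> a) rF F0 (fun=> a0) mF.
have -> : a = N%:R^-1 * \sum_(i < N) a.
  by rewrite sumr_const card_ord -[a *+ N]mulr_natl mulKf// pnatr_eq0 -lt0n.
by apply: (@momZ _ S) => //; exact: rv_sum.
Qed.

Lemma Ex_mul_le S f g a b : rv S f -> rv S g -> 0 < a -> 0 < b ->
  Ex P (fun w => f w ^+ 2) <= a ^+ 2 -> Ex P (fun w => g w ^+ 2) <= b ^+ 2 ->
  Ex P (fun w => f w * g w) <= a * b.
Proof.
move=> rf rg a0 b0 ha hb.
have r1 : rv S (fun w => b / a / 2 * f w ^+ 2) by apply: rvM; [exact: rv_cst|exact: rvX].
have r2 : rv S (fun w => a / b / 2 * g w ^+ 2) by apply: rvM; [exact: rv_cst|exact: rvX].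
apply: (@le_trans _ _ (Ex P (fun w => b / a / 2 * f w ^+ 2 + a / b / 2 * g w ^+ 2))).
  apply: (@Ex_mono S); [exact: rvM|exact: rvD|] => w.
  have h := sqr_ge0 (b * f w - a * g w).
  rewrite -subr_ge0.
  have -> : b / a / 2 * f w ^+ 2 + a / b / 2 * g w ^+ 2 - f w * g w =
    (b * f w - a * g w) ^+ 2 * (2 * (a * b))^-1.
    by field; rewrite (gt_eqF a0) (gt_eqF b0).
  by rewrite mulr_ge0// invr_ge0 !mulr_ge0// ltW.
rewrite (ExDr r1 r2) (ExZr _ (rvX 2 rf)) (ExZr _ (rvX 2 rg)).
have -> : a * b = b / a / 2 * a ^+ 2 + a / b / 2 * b ^+ 2.
  by field; rewrite (gt_eqF a0) (gt_eqF b0).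
by apply: lerD; rewrite ler_wpM2l// divr_ge0// divr_ge0// ltW.
Qed.

Lemma mom_mul n S f g a b : rv S f -> rv S g -> 0 < a -> 0 < b ->
  mom (n * 2) f a -> mom (n * 2) g b -> mom n (fun w => f w * g w) (a * b).
Proof.
move=> rf rg a0 b0 hf hg; rewrite /mom exprMn.
have -> : Ex P (fun w => (f w * g w) ^+ n) = Ex P (fun w => f w ^+ n * g w ^+ n).
  by apply: Ex_ext => w; rewrite exprMn.
have h k (F : T -> R) : Ex P (fun w => (F w ^+ n) ^+ k) = Ex P (fun w => F w ^+ (n * k)).
  by apply: Ex_ext => w; rewrite exprM.
apply: (Ex_mul_le (rvX n rf) (rvX n rg) (exprn_gt0 n a0) (exprn_gt0 n b0)).
- by rewrite h -exprM.
- by rewrite h -exprM.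
Qed.

Lemma mom_pow n k f a : mom (k * n) f a -> mom n (fun w => f w ^+ k) (a ^+ k).
Proof. by rewrite /mom -exprM; under [in X in _ -> X]Ex_ext do rewrite -exprM. Qed.

(** Where [f] exceeds [a], its lower power is dominated by its suitably normalised m-th power, and
    elsewhere by a constant. The two cases account for the factor 2. *)
Lemma mom_order n m S f a : (n.+1 <= m)%N -> rv S f -> (forall w, 0 <= f w) -> 0 < a ->
  mom m f a -> mom n.+1 f (2 * a).
Proof.
move=> nm rf f0 a0 mf.
have am := exprn_gt0 m a0; have an := exprn_gt0 n.+1 a0.
have pt w : f w ^+ n.+1 <= a ^+ n.+1 + (a ^+ n.+1 / a ^+ m) * f w ^+ m.
  have fm := exprn_ge0 m (f0 w).
  have [h|h] := leP (f w) a.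
    apply: (@le_trans _ _ (a ^+ n.+1)); first by rewrite lerXn2r ?nnegrE// ltW.
    by rewrite lerDl mulr_ge0// divr_ge0 ?(ltW an) ?(ltW am).
  apply: (@le_trans _ _ ((a ^+ n.+1 / a ^+ m) * f w ^+ m)); last by rewrite lerDr ltW.
  rewrite mulrAC ler_pdivlMr//.
  have e : m = (n.+1 + (m - n.+1))%N by rewrite subnKC.
  rewrite e; move: (m - n.+1)%N => k; rewrite !(exprD _ n.+1) mulrCA ler_wpM2l ?(ltW an)//.
  by rewrite ler_wpM2l ?exprn_ge0// lerXn2r ?nnegrE// ltW.
have r1 : rv S (fun w => (a ^+ n.+1 / a ^+ m) * f w ^+ m).
  by apply: rvM; [exact: rv_cst|exact: rvX].
apply: (@le_trans _ _ (Ex P (fun w => a ^+ n.+1 + (a ^+ n.+1 / a ^+ m) * f w ^+ m))).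
  by apply: (@Ex_mono S) => //; [exact: rvX|apply: rvD => //; exact: rv_cst].
rewrite (ExDr (rv_cst S _) r1).
rewrite Ex_cst (ExZr _ (rvX m rf)).
apply: (@le_trans _ _ (2 * a ^+ n.+1)).
  rewrite mulr_natl mulr2n lerD2l mulrAC ler_pdivrMr// ler_wpM2l ?(ltW an)//.
rewrite exprMn ler_wpM2r ?(ltW an)// exprS ler_peMr// exprn_ege1//.
by rewrite ler1n.
Qed.

(** Absorption. In [young_pt] the parameter l is chosen with A e0 / l <= 1/2, so that the moment of
    t returns to the left-hand side; [A] then multiplies [b] linearly, together with the order. *)
Lemma moment_close n S t u A b J : rv S t -> rv S u -> (forall w, 0 <= t w) -> (forall w, 0 <= u w) ->
  1 <= A -> 0 <= b -> 0 <= J ->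
  Ex P (fun w => t w ^+ n.+1) <= A * Ex P (fun w => u w * (u w + t w) ^+ n) + J ^+ n.+1 ->
  mom n.+1 u b ->
  mom n.+1 t ((1 + 2 * e0 R * A * n.+1%:R) * b + 2 * J).
Proof.
move=> rt ru t0 u0 A1 b0 J0 h hu.
set l := 2 * e0 R * A * n.+1%:R.
have e1 := e0_ge1 R; have A0 : 0 <= A by lra.
have eA : 1 <= e0 R * A by rewrite -[1]mulr1; apply: ler_pM.
have n1 : 1 <= n.+1%:R :> R by rewrite ler1n.
have nl : n.+1%:R <= l by rewrite /l -mulrA -[leLHS]mul1r -!mulrA; nra.
have l0 : 0 < l by apply: lt_le_trans nl.
have rut : rv S (fun w => u w * (u w + t w) ^+ n) by apply: rvM => //; apply: rvX => //; exact: rvD.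
have r1 : rv S (fun w => (1 + l) ^+ n * u w ^+ n.+1) by apply: rvM; [exact: rv_cst|exact: rvX].
have r2 : rv S (fun w => (e0 R / l) * t w ^+ n.+1) by apply: rvM; [exact: rv_cst|exact: rvX].
have h1 : Ex P (fun w => u w * (u w + t w) ^+ n) <=
   (1 + l) ^+ n * b ^+ n.+1 + (e0 R / l) * Ex P (fun w => t w ^+ n.+1).
  apply: (@le_trans _ _ (Ex P (fun w => (1 + l) ^+ n * u w ^+ n.+1 + (e0 R / l) * t w ^+ n.+1))).
    by apply: (@Ex_mono S) => //; [exact: rvD|move=> w; exact: young_pt].
  rewrite (ExDr r1 r2) (ExZr _ (rvX n.+1 ru)) (ExZr _ (rvX n.+1 rt)) lerD2r.
  by rewrite ler_wpM2l// exprn_ge0// addr_ge0// ltW.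
set x := Ex P (fun w => t w ^+ n.+1) in h h1 *.
have x0 : 0 <= x by apply: Ex_ge0 => w; exact: exprn_ge0.
have hh : A * (e0 R / l) <= 2^-1.
  rewrite /l mulrA ler_pdivrMr//; nra.
have hx : x <= 2 * (A * ((1 + l) ^+ n * b ^+ n.+1)) + 2 * J ^+ n.+1.
  have : A * Ex P (fun w => u w * (u w + t w) ^+ n) <=
    A * ((1 + l) ^+ n * b ^+ n.+1) + A * (e0 R / l) * x.
    by rewrite -[A * _ * x]mulrA -mulrDr ler_wpM2l.
  have : A * (e0 R / l) * x <= 2^-1 * x by rewrite ler_wpM2r.
  lra.
rewrite /mom; apply: le_trans hx _.
have lb : 0 <= (1 + l) * b by rewrite mulr_ge0// addr_ge0// ltW.
apply: (@le_trans _ _ (((1 + l) * b) ^+ n.+1 + (2 * J) ^+ n.+1)).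
  apply: lerD.
    rewrite exprMn mulrA mulrA ler_wpM2r ?exprn_ge0// exprS ler_wpM2r ?exprn_ge0 ?addr_ge0 ?(ltW l0)//.
    rewrite /l; nra.
  rewrite exprMn ler_wpM2r ?exprn_ge0// exprS ler_peMr// exprn_ege1//; by rewrite ler1n.
have p1 := lb; have p2 : 0 <= 2 * J by rewrite mulr_ge0.
set x1 := (1 + l) * b in p1 *; set x2 := 2 * J in p2 *.
rewrite [leRHS]exprS mulrDl; apply: lerD; rewrite exprS; apply: ler_wpM2l => //.
  by rewrite lerXn2r ?nnegrE ?addr_ge0// lerDl.
by rewrite lerXn2r ?nnegrE ?addr_ge0// lerDr.
Qed.

Lemma crv_phi S k F : crv S F -> crv S (fun w => phi k (F w)).
Proof.
move=> cF; apply: crvM => //; last exact: crvJ.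
by apply: crv_rc => //; apply: rvX => //; exact: rv_cabs.
Qed.

(* Leave-one-out inequality: only the increments Z - Zj and the conditional
   variances (through W) enter. *)
Lemma leave_one_out (J : finType) k (Z : T -> complex R) (D Zj : J -> T -> complex R)
    (U W : J -> T -> R) :
  crv fullE Z -> (forall j, crv fullE (D j)) -> (forall j, crv fullE (Zj j)) ->
  (forall j, rv fullE (U j)) -> (forall j, rv fullE (W j)) ->
  (forall j w, 0 <= W j w) ->
  (forall w, Z w = \sum_j D j w) ->
  (forall j w, cabs (D j w) <= U j w) ->
  (forall j w, cabs (Z w - Zj j w) <= U j w) ->
  (forall j, Ex P (fun w => rp (D j w * phi k (Zj j w))) = 0) ->
  (forall j, Ex P (fun w => U j w ^+ 2 * cabs (Zj j w) ^+ (2 * k)) <=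
             Ex P (fun w => W j w * cabs (Zj j w) ^+ (2 * k))) ->
  Ex P (fun w => cabs (Z w) ^+ (2 * k.+1)) <=
  4 * e0 R ^+ 2 * k.+1%:R * (Ex P (fun w => (\sum_j W j w) * cabs (Z w) ^+ (2 * k)) +
    (2 * k.+1)%:R ^+ (2 * k.+1) * \sum_j (Ex P (fun w => U j w ^+ (2 * k.+1)) + Ex P (fun w => W j w ^+ k.+1))).
Proof.
move=> cZ cD cZj rU rW W0 ZE DU ZU DZ0 UW.
set e := e0 R; have e1 : 1 <= e := e0_ge1 R; have e00 : 0 <= e by lra.
set K := (2 * k.+1)%:R : R; have K1 : 1 <= K by rewrite ler1n.
have K0 : 0 <= K by lra.
set M := K ^+ (2 * k.+1); have M1 : 1 <= M by rewrite exprn_ege1.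
have U0 j w : 0 <= U j w by apply: le_trans (DU j w); exact: cabs_ge0.
have rZ := rv_cabs cZ; have rZj j := rv_cabs (cZj j).
have Z0 w := cabs_ge0 (Z w). have Zj0 j w := cabs_ge0 (Zj j w).
pose B j w := K * (e * (U j w ^+ 2 * cabs (Zj j w) ^+ (2 * k)) + M * U j w ^+ (2 * k.+1)).
have kk : (2 * k.+1 = (2 * k).+2)%N by rewrite mulnS.
have kk1 : ((2 * k).+1%:R ^+ (2 * k) : R) <= M.
  apply: (@le_trans _ _ (K ^+ (2 * k))); last first.
    by rewrite /M ler_weXn2l// leq_mul.
  by rewrite lerXn2r ?nnegrE// /K ler_nat kk.
have rUZ j : rv fullE (fun w => U j w ^+ 2 * cabs (Zj j w) ^+ (2 * k)).
  by apply: rvM; apply: rvX.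
have rUp j : rv fullE (fun w => U j w ^+ (2 * k.+1)) by apply: rvX.
have rWp j : rv fullE (fun w => W j w ^+ k.+1) by apply: rvX.
have rWZj j : rv fullE (fun w => W j w * cabs (Zj j w) ^+ (2 * k)).
  by apply: rvM => //; apply: rvX.
have rWZ j : rv fullE (fun w => W j w * cabs (Z w) ^+ (2 * k)).
  by apply: rvM => //; apply: rvX.
have rB j : rv fullE (B j).
  apply: rvM; first exact: rv_cst.
  by apply: rvD; (apply: rvM; [exact: rv_cst|]).
have crD j : crv fullE (fun w => D j w * (phi k (Z w) - phi k (Zj j w))).
  by apply: crvM => //; apply: crvB; exact: crv_phi.
have crDZ j : crv fullE (fun w => D j w * phi k (Zj j w)).
  by apply: crvM => //; exact: crv_phi.
(* |Z|^(2k+2) is the real part of the sum of the D_j phi(Z). As D_j integrates to zero against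
   phi(Z_j), only the difference of the two values of phi remains, and it brings a second factor
   U_j. *)
have step1 : Ex P (fun w => cabs (Z w) ^+ (2 * k.+1)) <= \sum_j Ex P (B j).
  have -> : Ex P (fun w => cabs (Z w) ^+ (2 * k.+1)) =
    Ex P (fun w => \sum_j (rp (D j w * (phi k (Z w) - phi k (Zj j w))) + rp (D j w * phi k (Zj j w)))).
    apply: Ex_ext => w; rewrite -rp_mul_phi {1}ZE mulr_suml rp_sum; apply: eq_bigr => j _.
    by rewrite -rpD -mulrDr subrK.
  rewrite (@Ex_sum _ _ _ _ _ _ msy _ _ _ _ fullE); last first.
    by move=> j _; apply: rvD; [case: (crD j)|case: (crDZ j)].
  apply: ler_sum => j _; rewrite (@ExDr fullE); [|by case: (crD j)|by case: (crDZ j)].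
  rewrite DZ0 addr0; apply: (@Ex_mono fullE) => //; first by case: (crD j).
  move=> w; apply: le_trans (rp_le_cabs _) _; rewrite cabsM.
  apply: (@le_trans _ _ (U j w * (K * U j w * (cabs (Zj j w) + U j w) ^+ (2 * k)))).
    apply: ler_pM; rewrite ?cabs_ge0//; apply: le_trans (phi_diff _ _ _) _.
    have c0 := cabs_ge0 (Z w - Zj j w).
    apply: ler_pM; rewrite ?mulr_ge0 ?exprn_ge0 ?addr_ge0//.
      by apply: ler_pM => //; rewrite /K ler_nat kk.
    by rewrite lerXn2r ?nnegrE ?addr_ge0// lerD2l.
  have := pow_add (2 * k) (Zj0 j w) (U0 j w); rewrite -/e => h.
  have h2 : (2 * k).+1%:R ^+ (2 * k) * U j w ^+ (2 * k) <= M * U j w ^+ (2 * k).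
    by rewrite ler_wpM2r ?exprn_ge0.
  rewrite /B kk !exprS.
  have -> : U j w * (K * U j w * (cabs (Zj j w) + U j w) ^+ (2 * k)) =
    (K * (U j w * U j w)) * (cabs (Zj j w) + U j w) ^+ (2 * k) by ring.
  apply: (@le_trans _ _ ((K * (U j w * U j w)) * (e * cabs (Zj j w) ^+ (2 * k) + M * U j w ^+ (2 * k)))).
    by apply: ler_wpM2l; [rewrite !mulr_ge0|lra].
  by rewrite expr0 mulr1 le_eqVlt; apply/orP; left; apply/eqP; ring.
apply: le_trans step1 _.
(* The power of |Z_j| is turned back into one of |Z|, at the cost of further jump terms in U_j and
   W_j. *)
have step2 j : Ex P (B j) <= 4 * e ^+ 2 * k.+1%:R *
   (Ex P (fun w => W j w * cabs (Z w) ^+ (2 * k)) + M * (Ex P (fun w => U j w ^+ (2 * k.+1)) + Ex P (fun w => W j w ^+ k.+1))).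
  rewrite /B (@ExZr fullE); last by apply: rvD; (apply: rvM; [exact: rv_cst|]).
  rewrite (@ExDr fullE); [|by apply: rvM; [exact: rv_cst|]|by apply: rvM; [exact: rv_cst|]].
  rewrite !(@ExZr fullE)//.
  have h1 := UW j.
  have h2 : Ex P (fun w => W j w * cabs (Zj j w) ^+ (2 * k)) <=
     e * Ex P (fun w => W j w * cabs (Z w) ^+ (2 * k)) + (Ex P (fun w => W j w ^+ k.+1) + M * Ex P (fun w => U j w ^+ (2 * k.+1))).
    rewrite -!(@ExZr fullE)//.
    have r1 : rv fullE (fun w => M * U j w ^+ (2 * k.+1)) by apply: rvM; [exact: rv_cst|].
    have r2 : rv fullE (fun w => e * (W j w * cabs (Z w) ^+ (2 * k))) by apply: rvM; [exact: rv_cst|].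
    have r3 := rvD (rWp j) r1.
    rewrite -(ExDr (rWp j) r1) -(ExDr r2 r3).
    apply: (@Ex_mono fullE) => //; first exact: rvD.
    move=> w.
    have hz : cabs (Zj j w) <= cabs (Z w) + U j w.
      apply: le_trans (_ : cabs (Z w) + cabs (Z w - Zj j w) <= _); last by rewrite lerD2l.
      by rewrite -{1}(subKr (Z w) (Zj j w)) cabsB.
    have hp : cabs (Zj j w) ^+ (2 * k) <= e * cabs (Z w) ^+ (2 * k) + K ^+ (2 * k) * U j w ^+ (2 * k).
      apply: (@le_trans _ _ ((cabs (Z w) + U j w) ^+ (2 * k))).
        by rewrite lerXn2r ?nnegrE ?addr_ge0.
      apply: le_trans (pow_add _ (Z0 w) (U0 j w)) _.
      rewrite lerD2l ler_wpM2r ?exprn_ge0// lerXn2r ?nnegrE// /K ler_nat kk//.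
    have hy := young_xy k (W0 j w) (exprn_ge0 2 (mulr_ge0 K0 (U0 j w))).
    rewrite -!exprM in hy.
    have hw := ler_wpM2l (W0 j w) hp.
    have e5 : (K * U j w) ^+ (2 * k.+1) = M * U j w ^+ (2 * k.+1) by rewrite exprMn.
    have e6 : (K * U j w) ^+ (2 * k) = K ^+ (2 * k) * U j w ^+ (2 * k) by rewrite exprMn.
    rewrite e5 e6 in hy; nra.
  set x := Ex P (fun w => W j w * cabs (Z w) ^+ (2 * k)) in h2 *.
  set y := Ex P (fun w => U j w ^+ (2 * k.+1)) in h2 *.
  set v := Ex P (fun w => W j w ^+ k.+1) in h2 *.
  have x0 : 0 <= x by apply: Ex_ge0 => w; rewrite mulr_ge0 ?exprn_ge0.
  have y0 : 0 <= y by apply: Ex_ge0 => w; rewrite exprn_ge0.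
  have v0 : 0 <= v by apply: Ex_ge0 => w; rewrite exprn_ge0.
  have KE : K = 2 * k.+1%:R by rewrite /K natrM.
  set q := Ex P _ in h1 *; set q' := Ex P _ in h1 h2.
  have hq : e * q <= e * (e * x + (v + M * y)) by rewrite ler_wpM2l// (le_trans h1).
  have -> : 4 * e ^+ 2 * k.+1%:R * (x + M * (y + v)) = K * (2 * e ^+ 2 * (x + M * (y + v))).
    by rewrite KE; ring.
  rewrite ler_wpM2l//.
  have M0 : 0 <= M by lra.
  have My : 0 <= M * y by rewrite mulr_ge0.
  have Mv : v <= M * v by rewrite ler_peMl.
  have ee : e <= e ^+ 2 by rewrite expr2 ler_peMl.
  have ex : 0 <= e ^+ 2 * x by rewrite mulr_ge0// exprn_ge0.
  have h7 : e * v <= e ^+ 2 * (M * v) by rewrite ler_pM.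
  have h8 : e * (M * y) <= e ^+ 2 * (M * y) by rewrite ler_wpM2r.
  have h9 : M * y <= e ^+ 2 * (M * y) by rewrite ler_peMl// (le_trans e1).
  have h10 : 0 <= e ^+ 2 * (M * v) by rewrite mulr_ge0 ?exprn_ge0// mulr_ge0.
  rewrite !mulrDr in hq *.
  rewrite expr2 in h7 h8 h9 h10 ex *.
  lra.
apply: (le_trans (ler_sum _ (fun j _ => step2 j))).
rewrite -mulr_sumr ler_wpM2l ?mulr_ge0 ?exprn_ge0//.
rewrite big_split/= -mulr_sumr lerD2r.
rewrite -(@Ex_sum _ _ _ _ _ _ msy _ _ _ _ fullE)// le_eqVlt; apply/orP; left; apply/eqP.
by apply: Ex_ext => w; rewrite mulr_suml.
Qed.
End Moments.

(** * Concentration of linear and quadratic forms *)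

Ltac rvtac m := lazymatch goal with
  | |- rv _ _ (fun w => GRing.add _ _) => apply: (rvD m); rvtac m
  | |- rv _ _ (fun w => GRing.opp _) => apply: (rvN m); rvtac m
  | |- rv _ _ (fun w => GRing.mul _ _) => apply: (rvM m); rvtac m
  | |- rv _ _ (fun w => GRing.exp _ _) => apply: (rvX m); rvtac m
  | |- rv _ _ (fun w => Num.sqrt _) => apply: (rv_sqrt m); rvtac m
  | |- rv _ _ (fun w => Num.norm _) => apply: (rv_abs m); rvtac m
  | |- rv _ _ (fun w => cabs _) => apply: (rv_cabs m); rvtac m
  | |- rv _ _ (fun w => ComplexField.Normc.normc _) => apply: (rv_cabs m); rvtac m
  | |- rv _ _ (fun w => rp _) => apply: rv_rp; rvtac m
  | |- rv _ _ (fun w => ip _) => apply: rv_ip; rvtac m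
  | |- rv _ _ (fun w => bigop _ _ _) => apply: (rv_sum m) => ? ?; rvtac m
  | |- crv _ _ (fun w => GRing.add _ _) => apply: (crvD m); rvtac m
  | |- crv _ _ (fun w => GRing.opp _) => apply: (crvN m); rvtac m
  | |- crv _ _ (fun w => GRing.mul _ _) => apply: (crvM m); rvtac m
  | |- crv _ _ (fun w => GRing.exp _ _) => apply: (crvX m); rvtac m
  | |- crv _ _ (fun w => conjc _) => apply: (crvJ m); rvtac m
  | |- crv _ _ (fun w => phi _ _) => apply: (crv_phi m); rvtac m
  | |- crv _ _ (fun w => bigop _ _ _) => apply: (crv_sum m) => ? ?; rvtac m
  | |- rv _ _ (fun _ => ?c) => first [exact: (rv_cst m) | solve [eauto 4] | idtac]
  | |- crv _ _ (fun _ => ?c) => first [exact: (crv_cst m) | solve [eauto 4] | (apply: (crv_rc m); rvtac m) | idtac]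
  | _ => first [solve [eauto 4] | idtac]
  end.

Lemma mul4_double q : (4 * q.+1 = 2 * (2 * q).+2)%N.
Proof. lia. Qed.

Section RandomMatrix.
Context d (T : measurableType d) (R : realType) (P : probability T R).
Variable N : nat.
Local Notation E := ('I_N * 'I_N)%type.
Local Notation fullE := ([set: E]%SET).

(* The entries are already rescaled by N^(-1/2); the bound on the moments of order
   4 q encodes E|x|^(4 q) <= C^(4 q) N^(q - 1). *)
Record rmodel (ms : {set E} -> (T -> R) -> Prop) (A : T -> 'M[complex R]_N) (Cm : R) : Prop := {
  rm_sys : msystem P ms ;
  rm_entry : forall (S : {set E}) i j, (i, j) \in S -> crv ms S (fun w => A w i j) ;
  rm_re0 : forall i j, Ex P (fun w => rp (A w i j)) = 0 ;
  rm_im0 : forall i j, Ex P (fun w => ip (A w i j)) = 0 ;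
  rm_var : forall i j, Ex P (fun w => cabs (A w i j) ^+ 2) = N%:R^-1 ;
  rm_cst : 1 <= Cm ;
  rm_mom : forall i j q, Ex P (fun w => cabs (A w i j) ^+ (4 * q.+1)) <=
    Cm ^+ (4 * q.+1) * N%:R^-1 ^+ q.+2 }.

Variables (ms : {set E} -> (T -> R) -> Prop) (A : T -> 'M[complex R]_N) (Cm : R).
Hypothesis M : rmodel ms A Cm.
Let msy := rm_sys M.
Local Ltac rvt := rvtac msy.
Let rv_cst := (@rv_cst _ _ _ _ _ _ msy).
Let rvD := (@rvD _ _ _ _ _ _ msy).
Let rvM := (@rvM _ _ _ _ _ _ msy).
Let rvN := (@rvN _ _ _ _ _ _ msy).
Let rvB := (@rvB _ _ _ _ _ _ msy).
Let rvX := (@rvX _ _ _ _ _ _ msy).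
Let rv_sum := (@rv_sum _ _ _ _ _ _ msy).
Let rv_abs := (@rv_abs _ _ _ _ _ _ msy).
Let rv_sqrt := (@rv_sqrt _ _ _ _ _ _ msy).
Let rv_sub := (@rv_sub _ _ _ _ _ _ msy).
Let rvT := (@rvT _ _ _ _ _ _ msy).
Let crv_cst := (@crv_cst _ _ _ _ _ _ msy).
Let crvD := (@crvD _ _ _ _ _ _ msy).
Let crvM := (@crvM _ _ _ _ _ _ msy).
Let crvN := (@crvN _ _ _ _ _ _ msy).
Let crvB := (@crvB _ _ _ _ _ _ msy).
Let crvJ := (@crvJ _ _ _ _ _ _ msy).
Let crv_rc := (@crv_rc _ _ _ _ _ _ msy).
Let crv_sum := (@crv_sum _ _ _ _ _ _ msy).
Let crvX := (@crvX _ _ _ _ _ _ msy).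
Let rv_cabs := (@rv_cabs _ _ _ _ _ _ msy).
Let crv_sub := (@crv_sub _ _ _ _ _ _ msy).
Let crvT := (@crvT _ _ _ _ _ _ msy).
Local Notation rv := (rv ms).
Local Notation crv := (crv ms).
Local Notation mom := (mom P).

Definition off_row (i : 'I_N) : {set E} := [set p | p.1 != i]%SET.
Definition off_entry (i j : 'I_N) : {set E} := [set p | p != (i, j)]%SET.

Lemma off_row_sub i j : off_row i \subset off_entry i j.
Proof.
by apply/fintype.subsetP => -[a b]; rewrite !inE /=; apply: contra => /eqP[-> _].
Qed.

Lemma off_entry_disj i j : [disjoint [set (i, j)]%SET & off_entry i j]%B.
Proof.
rewrite -setI_eq0; apply/eqP/setP => p; rewrite !inE.
by case: eqP.
Qed.

(** N^(-1/4), the order of the largest rescaled entries. The moment bound of [rmodel] is nu^(4q+4)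
    times 1/N up to the constant, and this 1/N pays for the sum over the N entries of a row. *)
Definition nu : R := Num.sqrt (Num.sqrt N%:R^-1).

Lemma nu4 : nu ^+ 4 = N%:R^-1.
Proof. by rewrite -[4%N]/(2 * 2)%N exprM !sqr_sqrtr ?sqrtr_ge0// invr_ge0. Qed.

Lemma nu_ge0 : 0 <= nu. Proof. exact: sqrtr_ge0. Qed.

Lemma Ninv_ge0 : 0 <= N%:R^-1 :> R. Proof. by rewrite invr_ge0. Qed.

Lemma Ninv_le1 (i : 'I_N) : N%:R^-1 <= 1 :> R.
Proof. by rewrite invf_le1 ?ler1n ?ltr0n; exact: leq_ltn_trans (ltn_ord i). Qed.

Lemma mom_sqrt p f a : (forall w, 0 <= f w) -> 0 <= a -> mom p f a ->
  mom (2 * p) (fun w => Num.sqrt (f w)) (Num.sqrt a).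
Proof.
move=> f0 a0; rewrite /mom !exprM sqr_sqrtr//.
by under [X in _ -> X <= _]Ex_ext do rewrite exprM sqr_sqrtr//.
Qed.

Lemma entry_indep i j (f : T -> R) (Y : T -> R) :
  rv [set (i, j)]%SET f -> rv (off_entry i j) Y ->
  Ex P (fun w => f w * Y w) = Ex P f * Ex P Y.
Proof. by move=> rf rY; apply: (rv_indep msy) rf rY; exact: off_entry_disj. Qed.

Lemma entry_indep0 i j (Y : T -> complex R) : crv (off_entry i j) Y ->
  Ex P (fun w => rp (A w i j * Y w)) = 0.
Proof.
move=> cY; apply: (crv_indep0 msy (off_entry_disj i j)) => //.
- by apply: (rm_entry M); rewrite inE.
- exact: rm_re0 M _ _.
- exact: rm_im0 M _ _.
Qed.

Lemma entry_indepJ0 i j (Y : T -> complex R) : crv (off_entry i j) Y ->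
  Ex P (fun w => rp ((A w i j)^*%C * Y w)) = 0.
Proof.
move=> cY; rewrite -[RHS](@entry_indep0 i j (fun w => (Y w)^*%C)); last exact: crvJ.
by apply: Ex_ext => w; rewrite !rpM !rpJ !ipJ; ring.
Qed.

Section Linear.
Variables (i : 'I_N) (v : 'I_N -> T -> complex R) (q : nat).
Hypothesis cv : forall j, crv (off_row i) (v j).
Let n := (4 * q.+1)%N.
Let k := (2 * q).+1.
Let xi w := \sum_j A w i j * v j w.

Let c1 : R := 16 * e0 R ^+ 3.

(** Given the other rows the summands are independent and centred: [b] bounds the conditional
    standard deviation of their sum and [kap * nu] the largest single summand. *)
Lemma linear_concentration b kap : 0 < b -> 0 < kap ->
  (forall j, mom n (fun w => cabs (v j w)) kap) ->
  mom n (fun w => Num.sqrt (N%:R^-1 * \sum_j cabs (v j w) ^+ 2)) b ->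
  mom n (fun w => cabs (xi w)) (c1 * n%:R ^+ 2 * (b + Cm * kap * nu)).
Proof.
move=> b0 k0 mv mb.
have C1 := rm_cst M. have N1 := Ninv_le1 i. have N0 := Ninv_ge0.
have cA j : crv fullE (fun w => A w i j) by apply: (rm_entry M); rewrite inE.
have cAe j : crv [set (i, j)]%SET (fun w => A w i j) by apply: (rm_entry M); rewrite inE.
have cAo j l : l != j -> crv (off_entry i j) (fun w => A w i l).
  by move=> lj; apply: (rm_entry M); rewrite inE; apply: contra lj => /eqP[->].
have cvf j : crv fullE (v j) by apply: crvT (cv j).
have cvo j l : crv (off_entry i l) (v j) by apply: crv_sub (off_row_sub i l) (cv j).
pose D j w := A w i j * v j w.
pose Zj j w := \sum_(l | l != j) A w i l * v l w.
pose U j w := cabs (A w i j) * cabs (v j w).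
pose W j w := N%:R^-1 * cabs (v j w) ^+ 2.
have cZjo j : crv (off_entry i j) (Zj j).
  by apply: crv_sum => l lj; apply: crvM; [exact: cAo|exact: cvo].
have cZj j : crv fullE (Zj j) by apply: crvT (cZjo j).
have nE : n = (2 * k.+1)%N by exact: mul4_double.
have cxi : crv fullE xi by rewrite /xi; rvt.
have rU j : rv fullE (U j) by rewrite /U; rvt.
have rW j : rv fullE (W j) by rewrite /W; rvt.
have cD j : crv fullE (D j) by rewrite /D; rvt.
have W0 j w : 0 <= W j w by rewrite mulr_ge0 ?exprn_ge0 ?cabs_ge0.
have DU j w : cabs (D j w) <= U j w by rewrite /U cabsM.
have ZU j w : cabs (xi w - Zj j w) <= U j w by rewrite /xi (bigD1 j)//= addrK /U cabsM.
have D0 j : Ex P (fun w => rp (D j w * phi k (Zj j w))) = 0.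
  rewrite -[RHS](@entry_indep0 i j (fun w => v j w * phi k (Zj j w))); last by rvt.
  by apply: Ex_ext => w; rewrite mulrA.
have UW j : Ex P (fun w => U j w ^+ 2 * cabs (Zj j w) ^+ (2 * k)) <=
             Ex P (fun w => W j w * cabs (Zj j w) ^+ (2 * k)).
  rewrite (@Ex_ext _ _ _ P _ (fun w => cabs (A w i j) ^+ 2 * (cabs (v j w) ^+ 2 * cabs (Zj j w) ^+ (2 * k)))); last first.
    by move=> w; rewrite /U exprMn mulrA.
  rewrite (@entry_indep i j (fun w => cabs (A w i j) ^+ 2)); [|by rvt|by rvt].
  rewrite (rm_var M) -(@ExZr _ _ _ _ _ _ msy fullE); last by rvt.
  by apply: (@Ex_mono _ _ _ _ _ _ msy fullE); [rvt|rvt|move=> w; rewrite /W mulrA].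
have := leave_one_out msy cxi cD cZj rU rW W0 (fun w => erefl) DU ZU D0 UW.
rewrite -nE.
set A' := 4 * e0 R ^+ 2 * k.+1%:R.
have e1 := e0_ge1 R.
have k1 : 1 <= k.+1%:R :> R by rewrite ler1n.
have n1 : 1 <= n%:R :> R by rewrite ler1n.
have kn : 2 * k.+1%:R = n%:R :> R by rewrite nE natrM.
have A1 : 1 <= A'.
  rewrite /A'; have e2 : 1 <= e0 R ^+ 2 by rewrite exprn_ege1.
  by move: e2 k1; set x := e0 R ^+ 2; set y := k.+1%:R; nra.
have NE : (N%:R : R) * N%:R^-1 = 1 by rewrite mulfV// pnatr_eq0 -lt0n (leq_ltn_trans _ (ltn_ord i)).
have A'n : A' = 2 * e0 R ^+ 2 * n%:R by rewrite /A' -kn; ring.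
clearbody A'.
have jump : A' * (n%:R ^+ n * \sum_j (Ex P (fun w => U j w ^+ n) + Ex P (fun w => W j w ^+ k.+1))) <=
   (2 * A' * n%:R * Cm * kap * nu) ^+ n.
  have hj j : Ex P (fun w => U j w ^+ n) + Ex P (fun w => W j w ^+ k.+1) <=
     2 * Cm ^+ n * kap ^+ n * N%:R^-1 ^+ q.+2.
    have -> : 2 * Cm ^+ n * kap ^+ n * N%:R^-1 ^+ q.+2 =
      (Cm ^+ n * N%:R^-1 ^+ q.+2) * kap ^+ n + (Cm ^+ n * N%:R^-1 ^+ q.+2) * kap ^+ n by ring.
    have Cn : 0 <= Cm ^+ n * N%:R^-1 ^+ q.+2 by rewrite mulr_ge0 ?exprn_ge0//; lra.
    have vn0 : 0 <= Ex P (fun w => cabs (v j w) ^+ n).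
      by apply: Ex_ge0 => w; rewrite exprn_ge0 ?cabs_ge0.
    apply: lerD.
      rewrite (@Ex_ext _ _ _ P _ (fun w => cabs (A w i j) ^+ n * cabs (v j w) ^+ n)); last first.
        by move=> w; rewrite /U exprMn.
      rewrite (@entry_indep i j); [|by rvt|by rvt].
      apply: ler_pM => //; [|exact: rm_mom M _ _ _|exact: mv].
      by apply: Ex_ge0 => w; rewrite exprn_ge0 ?cabs_ge0.
    rewrite (@Ex_ext _ _ _ P _ (fun w => N%:R^-1 ^+ k.+1 * cabs (v j w) ^+ n)); last first.
      by move=> w; rewrite /W exprMn -exprM nE.
    rewrite (@ExZr _ _ _ _ _ _ msy fullE); last by rvt.
    apply: ler_pM; rewrite ?exprn_ge0//; last exact: mv.
    apply: (@le_trans _ _ (N%:R^-1 ^+ q.+2)).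
      by apply: ler_wiXn2l; [exact: Ninv_ge0|exact: Ninv_le1 i|rewrite /k !ltnS leq_pmull].
    by rewrite ler_peMl ?exprn_ge0// exprn_ege1.
  apply: (@le_trans _ _ (A' * (n%:R ^+ n * \sum_(j < N) 2 * Cm ^+ n * kap ^+ n * N%:R^-1 ^+ q.+2))).
    by rewrite !ler_wpM2l ?exprn_ge0//; [lra|apply: ler_sum => j _; exact: hj].
  rewrite sumr_const card_ord -[_ *+ N]mulr_natl.
  have -> : N%:R * (2 * Cm ^+ n * kap ^+ n * N%:R^-1 ^+ q.+2) = 2 * Cm ^+ n * kap ^+ n * nu ^+ n.
    rewrite [nu ^+ n]exprM nu4 [_ ^+ q.+2]exprS.
    transitivity ((N%:R * N%:R^-1) * (2 * Cm ^+ n * kap ^+ n * N%:R^-1 ^+ q.+1)); last by rewrite NE mul1r.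
    by set a1 := Cm ^+ n; set a2 := kap ^+ n; ring.
  rewrite !exprMn.
  have -> : A' * (n%:R ^+ n * (2 * Cm ^+ n * kap ^+ n * nu ^+ n)) =
    (2 * A') * (n%:R ^+ n * Cm ^+ n * kap ^+ n * nu ^+ n) by ring.
  have -> : 2 ^+ n * A' ^+ n * n%:R ^+ n * Cm ^+ n * kap ^+ n * nu ^+ n =
    (2 * A') ^+ n * (n%:R ^+ n * Cm ^+ n * kap ^+ n * nu ^+ n) by rewrite exprMn !mulrA.
  rewrite ler_wpM2r//.
    by rewrite !mulr_ge0 ?exprn_ge0 ?nu_ge0//; lra.
  rewrite /n -[(4 * q.+1)%N]prednK// exprS ler_peMr//; first by lra.
  by rewrite exprn_ege1//; lra.
move=> h.
pose u w := Num.sqrt (N%:R^-1 * \sum_j cabs (v j w) ^+ 2).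
have ru : rv fullE u by rewrite /u; rvt.
have rxi : rv fullE (fun w => cabs (xi w)) by rvt.
have u0 w : 0 <= u w by exact: sqrtr_ge0.
have x0 w : 0 <= cabs (xi w) by exact: cabs_ge0.
have nn : n = n.-1.+1 by rewrite prednK.
have J0 : 0 <= 2 * A' * n%:R * Cm * kap * nu by rewrite !mulr_ge0 ?nu_ge0//; lra.
have := @moment_close _ T R P _ ms msy n.-1 fullE (fun w => cabs (xi w)) u A' b _ rxi ru x0 u0 A1 (ltW b0) J0.
rewrite -nn => /(_ _ mb) hc.
have rest : Ex P (fun w => cabs (xi w) ^+ n) <= A' * Ex P (fun w => u w * (u w + cabs (xi w)) ^+ n.-1) +
   (2 * A' * n%:R * Cm * kap * nu) ^+ n.
  apply: le_trans h _; rewrite mulrDr; apply: lerD => //.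
  rewrite ler_wpM2l//; first by lra.
  apply: (@Ex_mono _ _ _ _ _ _ msy fullE); [by rvt|by rvt|] => w.
  have -> : \sum_j W j w = u w ^+ 2.
    rewrite sqr_sqrtr ?mulr_ge0 ?sumr_ge0// => [|j _]; last by rewrite exprn_ge0 ?cabs_ge0.
    by rewrite mulr_sumr.
  have -> : n.-1 = (2 * k).+1 by rewrite nE mulnS.
  rewrite expr2 -mulrA ler_wpM2l// exprS; apply: ler_pM; rewrite ?exprn_ge0//.
    by rewrite lerDl.
  by rewrite lerXn2r ?nnegrE ?addr_ge0// lerDr.
apply: mom_ler (hc rest).
  have hp : 0 <= 2 * e0 R * A' * n%:R by rewrite !mulr_ge0//; lra.
  by apply: addr_ge0; [apply: mulr_ge0; lra|apply: mulr_ge0].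
rewrite A'n /c1.
have bn : 0 <= Cm * kap * nu by rewrite !mulr_ge0 ?nu_ge0//; lra.
set y := Cm * kap * nu in bn *.
have -> : 2 * (2 * (2 * e0 R ^+ 2 * n%:R) * n%:R * Cm * kap * nu) = 8 * (e0 R ^+ 2 * n%:R ^+ 2) * y.
  by rewrite /y; ring.
have -> : 16 * e0 R ^+ 3 * n%:R ^+ 2 * (b + y) = 16 * (e0 R ^+ 3 * n%:R ^+ 2) * b + 16 * (e0 R ^+ 3 * n%:R ^+ 2) * y by ring.
have -> : 1 + 2 * e0 R * (2 * e0 R ^+ 2 * n%:R) * n%:R = 1 + 4 * (e0 R ^+ 3 * n%:R ^+ 2) by ring.
have n2 : 1 <= n%:R ^+ 2 :> R by rewrite exprn_ege1.
have e2 : 1 <= e0 R ^+ 2 by rewrite exprn_ege1.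
have e3 : e0 R ^+ 2 <= e0 R ^+ 3 by rewrite ler_weXn2l.
have e4 : e0 R ^+ 2 * n%:R ^+ 2 <= e0 R ^+ 3 * n%:R ^+ 2 by rewrite ler_wpM2r// exprn_ge0.
have e5 : 1 <= e0 R ^+ 3 * n%:R ^+ 2 by rewrite -[1]mulr1; apply: ler_pM => //; lra.
set x := e0 R ^+ 3 * n%:R ^+ 2 in e4 e5 *; set x' := e0 R ^+ 2 * n%:R ^+ 2 in e4 *.
nra.
Qed.
End Linear.
End RandomMatrix.

(** * Quadratic forms in one row *)

Section Quadratic.
Context d (T : measurableType d) (R : realType) (P : probability T R).
Variable N : nat.
Local Notation E := ('I_N * 'I_N)%type.
Local Notation fullE := ([set: E]%SET).
Variables (ms : {set E} -> (T -> R) -> Prop) (A : T -> 'M[complex R]_N) (Cm : R).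
Hypothesis M : rmodel P ms A Cm.
Let msy := rm_sys M.
Local Ltac rvt := rvtac msy.
Let rv_cst := (@rv_cst _ _ _ _ _ _ msy).
Let rvD := (@rvD _ _ _ _ _ _ msy).
Let rvM := (@rvM _ _ _ _ _ _ msy).
Let rvN := (@rvN _ _ _ _ _ _ msy).
Let rvB := (@rvB _ _ _ _ _ _ msy).
Let rvX := (@rvX _ _ _ _ _ _ msy).
Let rv_sum := (@rv_sum _ _ _ _ _ _ msy).
Let rv_abs := (@rv_abs _ _ _ _ _ _ msy).
Let rv_sqrt := (@rv_sqrt _ _ _ _ _ _ msy).
Let rv_sub := (@rv_sub _ _ _ _ _ _ msy).
Let rvT := (@rvT _ _ _ _ _ _ msy).
Let crv_cst := (@crv_cst _ _ _ _ _ _ msy).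
Let crvD := (@crvD _ _ _ _ _ _ msy).
Let crvM := (@crvM _ _ _ _ _ _ msy).
Let crvN := (@crvN _ _ _ _ _ _ msy).
Let crvB := (@crvB _ _ _ _ _ _ msy).
Let crvJ := (@crvJ _ _ _ _ _ _ msy).
Let crv_rc := (@crv_rc _ _ _ _ _ _ msy).
Let crv_sum := (@crv_sum _ _ _ _ _ _ msy).
Let crvX := (@crvX _ _ _ _ _ _ msy).
Let rv_cabs := (@rv_cabs _ _ _ _ _ _ msy).
Let crv_sub := (@crv_sub _ _ _ _ _ _ msy).
Let crvT := (@crvT _ _ _ _ _ _ msy).
Local Notation rv := (rv ms).
Local Notation crv := (crv ms).
Local Notation mom := (mom P).
Local Notation nu := (nu R N).
Variables (i : 'I_N) (C B : T -> 'M[complex R]_N) (eta : R) (q : nat).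
Hypothesis cC : forall a b, crv (off_row i) (fun w => C w a b).
Hypothesis cB : forall a, crv (off_row i) (fun w => B w a a).
Hypothesis eta0 : 0 < eta.
Hypothesis dom : forall w, dominated eta (C w) (B w).
Let n := (4 * q.+1)%N.
Let p := (2 * q.+1)%N.
Let k := (2 * q).+1.
Let h w := row i (A w).
Let Zq w := qf (h w) (C w) - rc N%:R^-1 * \sum_j C w j j.

Let nE : n = (2 * k.+1)%N. Proof. by rewrite /n /k; lia. Qed.
Let nE2 : n = (2 * p)%N. Proof. by rewrite /n /p; lia. Qed.
Let pE : p = k.+1. Proof. by rewrite /k /p; lia. Qed.

Let ar1 : (4 * (2 * q).+2 = 2 * n)%N. Proof. by rewrite /n; lia. Qed.
Let ar2 : ((2 * q).+3 = 2 * q + 3)%N. Proof. by lia. Qed.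
Let ar3 : (2 * q + 3 <= n)%N. Proof. by rewrite /n; lia. Qed.
Let ar4 : (q.+2 <= p)%N. Proof. by rewrite /p; lia. Qed.
Let ar5 : (4 * p = 2 * n)%N. Proof. by rewrite /n /p; lia. Qed.
Let ar6 : (2 * q + 3 = (2 * q + 2).+1)%N. Proof. by lia. Qed.
Let ar7 : (2 * n = 4 * (2 * q + 2))%N. Proof. by rewrite /n; lia. Qed.
Let ar8 : n.-1 = (2 * k).+1. Proof. by rewrite /n /k; lia. Qed.

Let C1 : 1 <= Cm := rm_cst M.
Let N1 : N%:R^-1 <= 1 :> R := Ninv_le1 R i.
Let N0 : 0 <= N%:R^-1 :> R := Ninv_ge0 R N.
Let Npos : 0 < N%:R :> R. Proof. by rewrite ltr0n (leq_ltn_trans _ (ltn_ord i)). Qed.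

Let cA j : crv fullE (fun w => A w i j).
Proof. by apply: (rm_entry M); rewrite inE. Qed.
Let cAe j : crv [set (i, j)]%SET (fun w => A w i j).
Proof. by apply: (rm_entry M); rewrite inE. Qed.
Let cAo j l : l != j -> crv (off_entry i j) (fun w => A w i l).
Proof. by move=> lj; apply: (rm_entry M); rewrite inE; apply: contra lj => /eqP[->]. Qed.
Let cCf a b : crv fullE (fun w => C w a b).
Proof. exact: crvT (cC a b). Qed.
Let cCo a b l : crv (off_entry i l) (fun w => C w a b).
Proof. exact: crv_sub (off_row_sub i l) (cC a b). Qed.
Let cBf a : crv fullE (fun w => B w a a).
Proof. exact: crvT (cB a). Qed.

(** [xi] and [xi'] omit the index j, hence are independent of the entry (i, j). Only the complete
    sums [xf] and [xf'] are controlled by domination; [full_ge] passes from the former to the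
    latter. *)
Let xi j w := \sum_(l | l != j) C w j l * (A w i l)^*%C.
Let xi' j w := \sum_(l | l != j) A w i l * C w l j.
Let xf j w := \sum_l C w j l * (A w i l)^*%C.
Let xf' j w := \sum_l A w i l * C w l j.
Let Zj j w := (\sum_(b | b != j) \sum_(a | a != j) A w i a * C w a b * (A w i b)^*%C)
   - rc N%:R^-1 * \sum_(a | a != j) C w a a.
Let dv j w := cabs (A w i j) ^+ 2 - N%:R^-1.
Let U j w := cabs (A w i j) * (cabs (xi j w) + cabs (xi' j w)) + cabs (C w j j) * `|dv j w|.
(** The half splits each off-diagonal term between its two indices, so that the [D j] sum to [Zq].
    Removing the entry (i, j) changes [Zq] by the full cross terms, and [U j] bounds both
    quantities. *)
Let D j w := 2^-1 * (A w i j * xi j w + xi' j w * (A w i j)^*%C) + C w j j * rc (dv j w).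
Let W j w := 4 * N%:R^-1 * (cabs (xf j w) ^+ 2 + cabs (xf' j w) ^+ 2) +
  2 * Cm ^+ 4 * N%:R^-1 ^+ 2 * cabs (C w j j) ^+ 2.

Let rdv j : rv [set (i, j)]%SET (dv j). Proof. by rewrite /dv; rvt. Qed.
Let rdvf j : rv fullE (dv j). Proof. by rewrite /dv; rvt. Qed.
Let cxio j : crv (off_entry i j) (xi j).
Proof. by apply: crv_sum => l lj; apply: crvM; [exact: cCo|apply: crvJ; exact: cAo]. Qed.
Let cxio' j : crv (off_entry i j) (xi' j).
Proof. by apply: crv_sum => l lj; apply: crvM; [exact: cAo|exact: cCo]. Qed.
Let cxi j : crv fullE (xi j). Proof. exact: crvT (cxio j). Qed.
Let cxi' j : crv fullE (xi' j). Proof. exact: crvT (cxio' j). Qed.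
Let cxf j : crv fullE (xf j). Proof. by rewrite /xf; rvt. Qed.
Let cxf' j : crv fullE (xf' j). Proof. by rewrite /xf'; rvt. Qed.
Let cZjo j : crv (off_entry i j) (Zj j).
Proof.
apply: crvB.
  apply: crv_sum => b bj; apply: crv_sum => a aj; apply: crvM; last by apply: crvJ; exact: cAo.
  by apply: crvM; [exact: cAo|exact: cCo].
by apply: crvM; [exact: crv_cst|apply: crv_sum => a _; exact: cCo].
Qed.
Let cZj j : crv fullE (Zj j). Proof. exact: crvT (cZjo j). Qed.
Let cZ : crv fullE Zq.
Proof.
apply: crvB; last by rvt.
have -> : (fun w => qf (h w) (C w)) = (fun w => \sum_b \sum_a A w i a * C w a b * (A w i b)^*%C).
  by apply/funext => w; rewrite qfE; apply: eq_bigr => b _; apply: eq_bigr => a _; rewrite !mxE.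
by rvt.
Qed.

Let Z_diff j w : Zq w - Zj j w = A w i j * xi j w + xi' j w * (A w i j)^*%C + C w j j * rc (dv j w).
Proof.
rewrite /Zq /Zj qfE.
have -> : \sum_b \sum_a h w 0 a * C w a b * (h w 0 b)^*%C =
   \sum_b \sum_a A w i a * C w a b * (A w i b)^*%C.
  by apply: eq_bigr => b _; apply: eq_bigr => a _; rewrite !mxE.
rewrite (bigD1 j)//= (bigD1 j)//= [X in _ - _ * X - _](bigD1 j)//=.
have -> : \sum_(b | b != j) \sum_a A w i a * C w a b * (A w i b)^*%C =
  A w i j * xi j w + \sum_(b | b != j) \sum_(a | a != j) A w i a * C w a b * (A w i b)^*%C.
  rewrite /xi mulr_sumr -big_split/=; apply: eq_bigr => b bj.
  by rewrite (bigD1 j)//= mulrA.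
have -> : \sum_(a | a != j) A w i a * C w a j * (A w i j)^*%C = xi' j w * (A w i j)^*%C.
  by rewrite /xi' mulr_suml.
have -> : A w i j * C w j j * (A w i j)^*%C = C w j j * rc (cabs (A w i j) ^+ 2).
  by rewrite mulrAC mulJc mulrC.
have -> : rc (dv j w) = rc (cabs (A w i j) ^+ 2) - rc N%:R^-1 by rewrite rmorphB.
ring.
Qed.

Let Z_sum w : Zq w = \sum_j D j w.
Proof.
rewrite /D big_split/= -mulr_sumr big_split/=.
have e : \sum_j xi' j w * (A w i j)^*%C = \sum_j A w i j * xi j w.
  rewrite /xi /xi'.
  under eq_bigr do rewrite mulr_suml.
  under [RHS]eq_bigr do rewrite mulr_sumr.
  rewrite [LHS](exchange_big_dep predT)//=; apply: eq_bigr => a _.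
  by apply: eq_big => [b|b _]; [rewrite eq_sym|rewrite mulrA].
have half (S : complex R) : 2^-1 * (S + S) = S by field.
rewrite e half /Zq qfE.
have -> : \sum_j C w j j * rc (dv j w) = \sum_j C w j j * rc (cabs (A w i j) ^+ 2) - rc N%:R^-1 * \sum_j C w j j.
  rewrite mulr_sumr -sumrB; apply: eq_bigr => j _.
  by rewrite /dv rmorphB/= mulrBr [_ * C w j j]mulrC.
rewrite addrA; congr (_ - _); rewrite -big_split/=.
rewrite exchange_big /=; apply: eq_bigr => j _.
rewrite (bigD1 j)//= addrC; congr (_ + _); last first.
  by rewrite !mxE mulrAC mulJc mulrC.
by rewrite /xi mulr_sumr; apply: eq_bigr => l _; rewrite !mxE mulrA.
Qed.

Let DU j w : cabs (D j w) <= U j w.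
Proof.
rewrite /D /U; apply: le_trans (cabsD _ _) _; apply: lerD; last by rewrite cabsM cabsC.
rewrite cabsM cabsV cabs2.
have := cabsD (A w i j * xi j w) (xi' j w * (A w i j)^*%C); rewrite !cabsM cabsJ.
have := mulr_ge0 (cabs_ge0 (A w i j)) (cabs_ge0 (xi j w)).
have := mulr_ge0 (cabs_ge0 (A w i j)) (cabs_ge0 (xi' j w)).
by rewrite mulrDr [_ * cabs (A w i j)]mulrC; lra.
Qed.

Let ZU j w : cabs (Zq w - Zj j w) <= U j w.
Proof.
rewrite Z_diff /U; apply: le_trans (cabsD _ _) _; apply: lerD; last by rewrite cabsM cabsC.
have := cabsD (A w i j * xi j w) (xi' j w * (A w i j)^*%C); rewrite !cabsM cabsJ.
by rewrite mulrDr [_ * cabs (A w i j)]mulrC.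
Qed.

Let var0 j : Ex P (dv j) = 0.
Proof.
rewrite /dv (@ExDr _ _ _ _ _ _ msy fullE) ?(rm_var M) ?Ex_cst ?subrr//; by rvt.
Qed.

Let D0 j : Ex P (fun w => rp (D j w * phi k (Zj j w))) = 0.
Proof.
pose F1 w := A w i j * (2^-1 * xi j w * phi k (Zj j w)).
pose F2 w := (A w i j)^*%C * (2^-1 * xi' j w * phi k (Zj j w)).
pose F3 w := rp (C w j j * phi k (Zj j w)).
have r3 : rv (off_entry i j) F3 by rewrite /F3; rvt.
have c1 : crv fullE F1 by rewrite /F1; rvt.
have c2 : crv fullE F2 by rewrite /F2; rvt.
have -> : Ex P (fun w => rp (D j w * phi k (Zj j w))) =
  Ex P (fun w => (rp (F1 w) + rp (F2 w)) + dv j w * F3 w).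
  apply: Ex_ext => w; rewrite -rpD /F3 -rpcM -rpD; congr complex.Re.
  by rewrite /D /F1 /F2; ring.
have r12 : rv fullE (fun w => rp (F1 w) + rp (F2 w)) by rvt.
have r3f := rvT r3.
rewrite (@ExDr _ _ _ _ _ _ msy fullE)//; last by rvt.
rewrite (@ExDr _ _ _ _ _ _ msy fullE); [|by rvt|by rvt].
rewrite (entry_indep0 M); last by rvt.
rewrite (entry_indepJ0 M); last by rvt.
by rewrite (entry_indep M (rdv j) r3) var0 mul0r !addr0.
Qed.

Let xf_split j w : xf j w = xi j w + C w j j * (A w i j)^*%C.
Proof. by rewrite /xf (bigD1 j)//= addrC. Qed.
Let xf_split' j w : xf' j w = xi' j w + A w i j * C w j j.
Proof. by rewrite /xf' (bigD1 j)//= addrC. Qed.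

(** The added term is a multiple of the entry (i, j). Its cross term with [f] has mean zero against
    anything independent of that entry, so completing the sum can only enlarge the weighted second
    moment. *)
Let full_ge (j : 'I_N) (f ff g : T -> complex R) (Y : T -> R) : rv (off_entry i j) Y -> (forall w, 0 <= Y w) ->
  crv (off_entry i j) f -> crv (off_entry i j) g ->
  crv fullE ff ->
  (forall w, cabs (f w) ^+ 2 + 2 * rp (A w i j * g w) <= cabs (ff w) ^+ 2) ->
  Ex P (fun w => cabs (f w) ^+ 2 * Y w) <= Ex P (fun w => cabs (ff w) ^+ 2 * Y w).
Proof.
move=> rY Y0 cf cg cff h0.
have rYf := rvT rY; have cff' := crvT cf; have cgf := crvT cg.
have c1 : crv (off_entry i j) (fun w => g w * rc (Y w)) by rvt.
have r1 : rv fullE (fun w => rp (A w i j * (g w * rc (Y w)))).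
  by have c1f := crvT c1; rvt.
have e : Ex P (fun w => 2 * rp (A w i j * (g w * rc (Y w)))) = 0.
  by rewrite (ExZr msy 2 r1) (entry_indep0 M)// mulr0.
have r2 : rv fullE (fun w => cabs (f w) ^+ 2 * Y w) by rvt.
have r3 : rv fullE (fun w => 2 * rp (A w i j * (g w * rc (Y w)))) by apply: rvM => //; exact: rv_cst.
rewrite -[leLHS]addr0 -e -(ExDr msy r2 r3).
apply: (@Ex_mono _ _ _ _ _ _ msy fullE); [exact: rvD|by rvt|] => w.
have := ler_wpM2r (Y0 w) (h0 w).
rewrite mulrDl mulrA [_ * rc (Y w)]mulrC rpcM; lra.
Qed.

Let UW j : Ex P (fun w => U j w ^+ 2 * cabs (Zj j w) ^+ (2 * k)) <=
  Ex P (fun w => W j w * cabs (Zj j w) ^+ (2 * k)).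
Proof.
pose Y w := cabs (Zj j w) ^+ (2 * k).
have rY : rv (off_entry i j) Y by rewrite /Y; rvt.
have rYf := rvT rY.
have Y0 w : 0 <= Y w by rewrite exprn_ge0 ?cabs_ge0.
have e1 : Ex P (fun w => cabs (xi j w) ^+ 2 * Y w) <= Ex P (fun w => cabs (xf j w) ^+ 2 * Y w).
  apply: (@full_ge j (xi j) (xf j) (fun w => xi j w * (C w j j)^*%C)) => //; first by rvt.
  move=> w; rewrite xf_split !cabs_sqr !rpD !ipD.
  set a := xi j w; set b := C w j j; set c := A w i j.
  rewrite !rpM !ipM !rpJ !ipJ.
  set x := (rp b * rp c - ip b * - ip c); set y := (rp b * - ip c + ip b * rp c).
  have := sqr_ge0 x; have := sqr_ge0 y.
  have -> : (rp a + x) ^+ 2 + (ip a + y) ^+ 2 = rp a ^+ 2 + ip a ^+ 2 + 2 * (rp a * x + ip a * y) + x ^+ 2 + y ^+ 2 by ring.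
  have -> : 2 * (rp c * (rp a * rp b - ip a * - ip b) - ip c * (rp a * - ip b + ip a * rp b)) =
     2 * (rp a * x + ip a * y) by rewrite /x /y; ring.
  by lra.
have e2 : Ex P (fun w => cabs (xi' j w) ^+ 2 * Y w) <= Ex P (fun w => cabs (xf' j w) ^+ 2 * Y w).
  apply: (@full_ge j (xi' j) (xf' j) (fun w => (xi' j w)^*%C * C w j j)) => //; first by rvt.
  move=> w; rewrite xf_split' !cabs_sqr !rpD !ipD.
  set a := xi' j w; set b := C w j j; set c := A w i j.
  rewrite !rpM !ipM !rpJ !ipJ.
  set x := (rp c * rp b - ip c * ip b); set y := (rp c * ip b + ip c * rp b).
  have := sqr_ge0 x; have := sqr_ge0 y.
  have -> : (rp a + x) ^+ 2 + (ip a + y) ^+ 2 = rp a ^+ 2 + ip a ^+ 2 + 2 * (rp a * x + ip a * y) + x ^+ 2 + y ^+ 2 by ring.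
  have -> : 2 * (rp c * (rp a * rp b - - ip a * ip b) - ip c * (rp a * ip b + - ip a * rp b)) =
     2 * (rp a * x + ip a * y) by rewrite /x /y; ring.
  by lra.
pose Y1 w := (cabs (xi j w) ^+ 2 + cabs (xi' j w) ^+ 2) * Y w.
pose Y2 w := cabs (C w j j) ^+ 2 * Y w.
have rY1 : rv (off_entry i j) Y1 by rewrite /Y1; rvt.
have rY2 : rv (off_entry i j) Y2 by rewrite /Y2; rvt.
have rY1f := rvT rY1; have rY2f := rvT rY2.
have Y20 : 0 <= Ex P Y2 by apply: Ex_ge0 => w; rewrite mulr_ge0 ?exprn_ge0 ?cabs_ge0.
apply: (@le_trans _ _ (Ex P (fun w => 4 * (cabs (A w i j) ^+ 2 * Y1 w) + 2 * (dv j w ^+ 2 * Y2 w)))).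
  apply: (@Ex_mono _ _ _ _ _ _ msy fullE); [by rewrite /U; rvt|by rvt|] => w.
  have ev : dv j w ^+ 2 = `|dv j w| ^+ 2 by rewrite real_normK ?num_real.
  have core : U j w ^+ 2 <= 4 * (cabs (A w i j) ^+ 2 * (cabs (xi j w) ^+ 2 + cabs (xi' j w) ^+ 2)) + 2 * (dv j w ^+ 2 * cabs (C w j j) ^+ 2).
    rewrite ev /U.
    set x := cabs (A w i j); set y := cabs (xi j w); set z := cabs (xi' j w); set c := cabs (C w j j); set v := `|dv j w|.
    have := sqr_ge0 (x * (y + z) - c * v); have := sqr_ge0 (x * (y - z)); nra.
  apply: le_trans (ler_wpM2r (Y0 w) core) _; rewrite /Y1 /Y2 le_eqVlt; apply/orP; left; apply/eqP; ring.
have vd : Ex P (fun w => dv j w ^+ 2) <= Cm ^+ 4 * N%:R^-1 ^+ 2.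
  apply: le_trans (rm_mom M i j 0).
  have -> : Ex P (fun w => dv j w ^+ 2) = Ex P (fun w => cabs (A w i j) ^+ 4 + (- (2 * N%:R^-1)) * (cabs (A w i j) ^+ 2) + N%:R^-1 ^+ 2).
    by apply: Ex_ext => w; rewrite /dv; ring.
  rewrite (@ExDr _ _ _ _ _ _ msy fullE) ?Ex_cst; [|by rvt|by rvt].
  rewrite (@ExDr _ _ _ _ _ _ msy fullE); [|by rvt|by rvt].
  rewrite (@ExZr _ _ _ _ _ _ msy fullE); last by rvt.
  rewrite (rm_var M) mulNr.
  have := exprn_ge0 2 N0; rewrite !expr2; lra.
rewrite (@ExDr _ _ _ _ _ _ msy fullE); [|by rvt|by rvt].
rewrite (@ExZr _ _ _ _ _ _ msy fullE); last by rvt.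
rewrite (@ExZr _ _ _ _ _ _ msy fullE); last by rvt.
rewrite (entry_indep M (f := fun w => cabs (A w i j) ^+ 2) (j := j) _ rY1); last by rvt.
rewrite (entry_indep M (f := fun w => dv j w ^+ 2) (j := j) _ rY2); last by rvt.
rewrite (rm_var M).
have -> : Ex P (fun w => W j w * cabs (Zj j w) ^+ (2 * k)) =
   4 * N%:R^-1 * (Ex P (fun w => cabs (xf j w) ^+ 2 * Y w) + Ex P (fun w => cabs (xf' j w) ^+ 2 * Y w)) +
   2 * Cm ^+ 4 * N%:R^-1 ^+ 2 * Ex P Y2.
  rewrite -(@ExDr _ _ _ _ _ _ msy fullE); [|by rvt|by rvt].
  rewrite -(@ExZr _ _ _ _ _ _ msy fullE); last by rvt.
  rewrite -(@ExZr _ _ _ _ _ _ msy fullE); last by rvt.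
  rewrite -(@ExDr _ _ _ _ _ _ msy fullE); [|by rvt|by rvt].
  by apply: Ex_ext => w; rewrite /W -/(Y w) /Y2; ring.
have -> : Ex P Y1 = Ex P (fun w => cabs (xi j w) ^+ 2 * Y w) + Ex P (fun w => cabs (xi' j w) ^+ 2 * Y w).
  rewrite -(@ExDr _ _ _ _ _ _ msy fullE); [|by rvt|by rvt].
  by apply: Ex_ext => w; rewrite /Y1; ring.
apply: lerD.
  by rewrite -mulrA ler_wpM2l// ler_wpM2l// lerD.
have -> : 2 * Cm ^+ 4 * N%:R^-1 ^+ 2 * Ex P Y2 = 2 * (Cm ^+ 4 * N%:R^-1 ^+ 2 * Ex P Y2) by ring.
apply: ler_wpM2l => //; exact: ler_wpM2r.
Qed.

Let dom_ge0 w v0 : 0 <= ip (qf v0 (B w)).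
Proof.
have [h1 _] := dom w v0; apply: le_trans h1; apply: mulr_ge0; first exact: ltW.
by apply: sumr_ge0 => j _; exact: sqr_ge0.
Qed.

Let ipB_ge0 w j : 0 <= ip (B w j j). Proof. by rewrite -qf_delta. Qed.

Let row_bound w j : \sum_l cabs (C w j l) ^+ 2 <= ip (B w j j) / eta.
Proof.
have [h1 _] := dom w (delta_mx 0 j); rewrite qf_delta in h1.
rewrite ler_pdivlMr// mulrC; apply: le_trans h1; rewrite ler_pM2l// le_eqVlt; apply/orP; left; apply/eqP.
by apply: eq_bigr => l _; rewrite -rowE mxE.
Qed.

Let col_bound w j : \sum_l cabs (C w l j) ^+ 2 <= ip (B w j j) / eta.
Proof.
have [_ h1] := dom w (delta_mx 0 j); rewrite qf_delta in h1.
rewrite ler_pdivlMr// mulrC; apply: le_trans h1; rewrite ler_pM2l// le_eqVlt; apply/orP; left; apply/eqP.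
apply: eq_bigr => l _; congr (cabs _ ^+ 2).
rewrite mxE (bigD1 j)//= big1 ?addr0 => [|a aj]; first by rewrite !mxE !eqxx conjC1 mulr1.
by rewrite !mxE (negbTE aj) conjC0 mulr0.
Qed.

Let sum_xf w : \sum_j cabs (xf j w) ^+ 2 <= ip (qf (h w) (B w)) / eta.
Proof.
have [_ h1] := dom w (h w); rewrite ler_pdivlMr// mulrC; apply: le_trans h1.
rewrite ler_pM2l// le_eqVlt; apply/orP; left; apply/eqP; apply: eq_bigr => j _.
by rewrite mxE; congr (cabs _ ^+ 2); apply: eq_bigr => l _; rewrite !mxE.
Qed.

Let sum_xf' w : \sum_j cabs (xf' j w) ^+ 2 <= ip (qf (h w) (B w)) / eta.
Proof.
have [h1 _] := dom w (h w); rewrite ler_pdivlMr// mulrC; apply: le_trans h1.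
rewrite ler_pM2l// le_eqVlt; apply/orP; left; apply/eqP; apply: eq_bigr => j _.
by rewrite mxE; congr (cabs _ ^+ 2); apply: eq_bigr => l _; rewrite !mxE.
Qed.

Variables (G0 : T -> R) (mu a kap theta : R).
Hypothesis rG0 : rv fullE G0.
Hypothesis QG0 : forall w, ip (qf (h w) (B w)) <= G0 w + cabs (Zq w).
Hypothesis mG0 : forall w, N%:R^-1 * \sum_j ip (B w j j) <= G0 w.
Hypothesis (mu0 : 0 < mu) (a0 : 0 < a) (kap0 : 0 < kap) (theta0 : 0 < theta).
Hypothesis momG : mom p G0 mu.
Hypothesis momB : forall j, mom p (fun w => ip (B w j j)) a.
Hypothesis momC : forall j l, mom n (fun w => cabs (C w j l)) kap.
Let Ne := N%:R * eta.
Hypothesis mu_th : mu <= Ne * theta ^+ 2.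
Hypothesis one_th : 1 <= Ne * theta.
Hypothesis a_th : nu ^+ 2 * a <= Ne * theta ^+ 2.
Hypothesis kap_th : nu ^+ 2 * kap <= theta.

Let Ne0 : 0 < Ne. Proof. by rewrite mulr_gt0. Qed.
Let G00 w : 0 <= G0 w.
Proof. by apply: le_trans (mG0 w); rewrite mulr_ge0// sumr_ge0// => j _. Qed.
Let X1 : R := 16 * e0 R ^+ 3 * n%:R ^+ 2 * (Num.sqrt (a / Ne) + Cm * kap * nu).

Let sa0 : 0 < Num.sqrt (a / Ne). Proof. by rewrite sqrtr_gt0 divr_gt0. Qed.
Let X10 : 0 <= X1.
Proof.
rewrite /X1; apply: mulr_ge0; first by rewrite !mulr_ge0 ?exprn_ge0// ltW// e0_gt0.
apply: addr_ge0; first exact: ltW.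
by rewrite !mulr_ge0 ?nu_ge0 ?(ltW kap0)//; apply: le_trans C1.
Qed.

Let lin (j : 'I_N) (v : 'I_N -> T -> complex R) : (forall l, crv (off_row i) (v l)) ->
  (forall l w, cabs (v l w) <= cabs (C w l j)) \/ (forall l w, cabs (v l w) <= cabs (C w j l)) ->
  mom n (fun w => cabs (\sum_l A w i l * v l w)) X1.
Proof.
move=> cv hv.
have cvf l : crv fullE (v l) by apply: crvT (cv l).
apply: (@linear_concentration _ _ _ _ _ _ _ _ M i v q cv _ _ sa0 kap0).
  move=> l; have [h1|h1] := hv.
    apply: (@mom_le _ _ _ _ _ _ msy n fullE _ (fun w => cabs (C w l j))) => //; [by rvt|by rvt|by move=> w; exact: cabs_ge0].
  apply: (@mom_le _ _ _ _ _ _ msy n fullE _ (fun w => cabs (C w j l))) => //; [by rvt|by rvt|by move=> w; exact: cabs_ge0].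
rewrite -/n nE2; apply: mom_sqrt.
- by move=> w; rewrite mulr_ge0// sumr_ge0// => l _; exact: sqr_ge0.
- by rewrite divr_ge0// ltW.
rewrite [a / Ne]mulrC.
have rB : rv fullE (fun w => ip (B w j j)) by rvt.
apply: (@mom_le _ _ _ _ _ _ msy p fullE _ (fun w => Ne^-1 * ip (B w j j))); [by rvt|by rvt| | |].
- by move=> w; rewrite mulr_ge0// sumr_ge0// => l _; exact: sqr_ge0.
- move=> w; rewrite /Ne invfM -mulrA ler_wpM2l// mulrC.
  have [h1|h1] := hv.
    apply: le_trans (col_bound w j); apply: ler_sum => l _.
    by rewrite ler_sqr ?nnegrE ?cabs_ge0.
  apply: le_trans (row_bound w j); apply: ler_sum => l _.
  by rewrite ler_sqr ?nnegrE ?cabs_ge0.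
- by apply: (momZ msy _ rB) => //; rewrite invr_ge0 ltW.
Qed.

Let cif (S : {set E}) (b : bool) (F : T -> complex R) : crv S F -> crv S (fun w => if b then 0 else F w).
Proof. by case: b => // _; exact: crv_cst. Qed.

Let mxi' j : mom n (fun w => cabs (xi' j w)) X1.
Proof.
have -> : (fun w => cabs (xi' j w)) = (fun w => cabs (\sum_l A w i l * (if l == j then 0 else C w l j))).
  apply/funext => w; rewrite /xi' big_mkcond/=; congr cabs; apply: eq_bigr => l _.
  by case: eqP; rewrite ?mulr0.
apply: (lin (j := j)) => [l|]; first exact: cif.
by left=> l w; case: eqP => // _; rewrite cabs0 cabs_ge0.
Qed.

Let mxi j : mom n (fun w => cabs (xi j w)) X1.
Proof.
have -> : (fun w => cabs (xi j w)) = (fun w => cabs (\sum_l A w i l * (if l == j then 0 else (C w j l)^*%C))).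
  apply/funext => w; rewrite /xi -cabsJ rmorph_sum big_mkcond/=; congr cabs; apply: eq_bigr => l _.
  by case: eqP => //= _; rewrite ?mulr0// rmorphM/= conjcK mulrC.
apply: (lin (j := j)) => [l|]; first by apply: cif; exact: crvJ.
by right=> l w; case: eqP => // _; rewrite ?cabs0 ?cabs_ge0// cabsJ.
Qed.

Let mxf' j : mom n (fun w => cabs (xf' j w)) X1.
Proof. by apply: (lin (j := j) (v := fun l w => C w l j)) => [l|]; [exact: cC|left]. Qed.

Let mxf j : mom n (fun w => cabs (xf j w)) X1.
Proof.
have -> : (fun w => cabs (xf j w)) = (fun w => cabs (\sum_l A w i l * (C w j l)^*%C)).
  apply/funext => w; rewrite /xf -cabsJ rmorph_sum; congr cabs; apply: eq_bigr => l _.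
  by rewrite rmorphM/= conjcK mulrC.
apply: (lin (j := j)) => [l|]; first by apply: crvJ; exact: cC.
by right=> l w; rewrite cabsJ.
Qed.

Let pow3 m (x y z : R) : 0 <= x -> 0 <= y -> 0 <= z ->
  (x + y + z) ^+ m <= 3 ^+ m * (x ^+ m + y ^+ m + z ^+ m).
Proof.
move=> x0 y0 z0; have xm := exprn_ge0 m x0; have ym := exprn_ge0 m y0; have zm := exprn_ge0 m z0.
have key t : 0 <= t -> x <= t -> y <= t -> z <= t -> (x + y + z) ^+ m <= 3 ^+ m * t ^+ m.
  move=> t0 xt yt zt; rewrite -exprMn lerXn2r ?nnegrE ?mulr_ge0 ?addr_ge0//; lra.
have h3 : 0 <= 3 ^+ m :> R by rewrite exprn_ge0.
have [xy|xy] := leP x y; [have [yz|yz] := leP y z|have [xz|xz] := leP x z].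
- apply: le_trans (key z z0 (le_trans xy yz) yz (lexx _)) _; rewrite ler_wpM2l//; lra.
- apply: le_trans (key y y0 xy (lexx _) (ltW yz)) _; rewrite ler_wpM2l//; lra.
- apply: le_trans (key z z0 xz _ (lexx _)) _; [by lra|rewrite ler_wpM2l//; lra].
- apply: le_trans (key x x0 (lexx _) (ltW xy) (ltW xz)) _; rewrite ler_wpM2l//; lra.
Qed.

Let pow2 m (x y : R) : 0 <= x -> 0 <= y -> (x + y) ^+ m.+1 <= 2 ^+ m.+1 * (x ^+ m.+1 + y ^+ m.+1).
Proof.
move=> x0 y0; have xm := exprn_ge0 m.+1 x0; have ym := exprn_ge0 m.+1 y0.
have key t : 0 <= t -> x <= t -> y <= t -> (x + y) ^+ m.+1 <= 2 ^+ m.+1 * t ^+ m.+1.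
  move=> t0 xt yt; rewrite -exprMn lerXn2r ?nnegrE ?mulr_ge0 ?addr_ge0//; lra.
have h3 : 0 <= 2 ^+ m.+1 :> R by rewrite exprn_ge0.
have [xy|xy] := leP x y.
- apply: le_trans (key y y0 xy (lexx _)) _; rewrite ler_wpM2l//; lra.
- apply: le_trans (key x x0 (lexx _) (ltW xy)) _; rewrite ler_wpM2l//; lra.
Qed.

(** Moments of the two kinds of increment before summation over j. Multiplied by N, they become
    exactly (nu X1)^n and (nu^2 kap)^n. *)
Let y1 := N%:R^-1 ^+ q.+2 * X1 ^+ n.
Let y2 := N%:R^-1 ^+ (2 * q + 3) * kap ^+ n.
Let y10 : 0 <= y1. Proof. by rewrite mulr_ge0 ?exprn_ge0. Qed.
Let y20 : 0 <= y2. Proof. by rewrite mulr_ge0 ?exprn_ge0// ltW. Qed.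
Let nS : n = n.-1.+1. Proof. by rewrite /n prednK. Qed.
Let pS : p = p.-1.+1. Proof. by rewrite /p prednK. Qed.
Let Cn1 : 1 <= Cm ^+ n. Proof. by rewrite exprn_ege1. Qed.
Let Ex_pow_ge0 m (f : T -> R) : (forall w, 0 <= f w) -> 0 <= Ex P (fun w => f w ^+ m).
Proof. by move=> f0; apply: Ex_ge0 => w; rewrite exprn_ge0. Qed.

Let dv_mom j : Ex P (fun w => `|dv j w| ^+ n) <= 2 ^+ n * (2 * (Cm ^+ (2 * n) * N%:R^-1 ^+ (2 * q + 3))).
Proof.
apply: (@le_trans _ _ (Ex P (fun w => 2 ^+ n * (cabs (A w i j) ^+ (2 * n) + N%:R^-1 ^+ n)))).
  apply: (@Ex_mono _ _ _ _ _ _ msy fullE); [by rvt|by rvt|] => w.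
  apply: (@le_trans _ _ ((cabs (A w i j) ^+ 2 + N%:R^-1) ^+ n)).
    rewrite lerXn2r ?nnegrE ?normr_ge0 ?addr_ge0 ?sqr_ge0//.
    by rewrite /dv (le_trans (ler_normB _ _))// !ger0_norm ?sqr_ge0.
  by rewrite nS; apply: le_trans (pow2 _ _ _) _; rewrite ?sqr_ge0// -exprM mulnC.
rewrite (@ExZr _ _ _ _ _ _ msy fullE); last by rvt.
rewrite ler_wpM2l ?exprn_ge0//.
rewrite (@ExDr _ _ _ _ _ _ msy fullE) ?Ex_cst; [|by rvt|by rvt].
rewrite mulr_natl mulr2n; apply: lerD.
  have := rm_mom M i j (2 * q).+1.
  by rewrite ar1 ar2.
apply: (@le_trans _ _ (N%:R^-1 ^+ (2 * q + 3))).
  by rewrite ler_wiXn2l.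
by rewrite ler_peMl ?exprn_ge0// exprn_ege1.
Qed.

Let U_mom j : Ex P (fun w => U j w ^+ n) <= 3 ^+ n * (2 * Cm ^+ n * y1 + 2 ^+ n * (2 * Cm ^+ (2 * n)) * y2).
Proof.
have cAj := cabs_ge0.
apply: (@le_trans _ _ (Ex P (fun w => 3 ^+ n * (cabs (A w i j) ^+ n * cabs (xi j w) ^+ n + cabs (A w i j) ^+ n * cabs (xi' j w) ^+ n + `|dv j w| ^+ n * cabs (C w j j) ^+ n)))).
  apply: (@Ex_mono _ _ _ _ _ _ msy fullE); [by rewrite /U; rvt|by rvt|] => w.
  rewrite /U mulrDr; apply: le_trans (pow3 _ _ _ _) _; rewrite ?mulr_ge0 ?cabs_ge0//.
  by rewrite !exprMn [cabs (C w j j) ^+ _ * _]mulrC.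
rewrite (@ExZr _ _ _ _ _ _ msy fullE); last by rvt.
rewrite ler_wpM2l ?exprn_ge0//.
rewrite (@ExDr _ _ _ _ _ _ msy fullE); [|by rvt|by rvt].
rewrite (@ExDr _ _ _ _ _ _ msy fullE); [|by rvt|by rvt].
have rx : rv (off_entry i j) (fun w => cabs (xi j w) ^+ n) by rvt.
have rx' : rv (off_entry i j) (fun w => cabs (xi' j w) ^+ n) by rvt.
have rc : rv (off_entry i j) (fun w => cabs (C w j j) ^+ n) by rvt.
rewrite (entry_indep M (f := fun w => cabs (A w i j) ^+ n) _ rx); last by rvt.
rewrite (entry_indep M (f := fun w => cabs (A w i j) ^+ n) _ rx'); last by rvt.
rewrite (entry_indep M (f := fun w => `|dv j w| ^+ n) _ rc); last by rvt.
have hA : Ex P (fun w => cabs (A w i j) ^+ n) <= Cm ^+ n * N%:R^-1 ^+ q.+2 := rm_mom M i j q.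
have A0 : 0 <= Ex P (fun w => cabs (A w i j) ^+ n) by apply: Ex_pow_ge0 => w; exact: cabs_ge0.
have D00 : 0 <= Ex P (fun w => `|dv j w| ^+ n) by apply: Ex_pow_ge0 => w; exact: normr_ge0.
apply: lerD.
  have -> : 2 * Cm ^+ n * y1 = (Cm ^+ n * N%:R^-1 ^+ q.+2) * X1 ^+ n + (Cm ^+ n * N%:R^-1 ^+ q.+2) * X1 ^+ n.
    by rewrite /y1; set c := Cm ^+ n; set x := X1 ^+ n; ring.
  apply: lerD; apply: ler_pM => //.
  - by apply: Ex_pow_ge0 => w; exact: cabs_ge0.
  - exact: mxi.
  - by apply: Ex_pow_ge0 => w; exact: cabs_ge0.
  - exact: mxi'.
have -> : 2 ^+ n * (2 * Cm ^+ (2 * n)) * y2 = (2 ^+ n * (2 * (Cm ^+ (2 * n) * N%:R^-1 ^+ (2 * q + 3)))) * kap ^+ n.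
  by rewrite /y2 !mulrA.
apply: ler_pM => //; last exact: momC.
by apply: Ex_pow_ge0 => w; exact: cabs_ge0.
Qed.

Let W_mom j : Ex P (fun w => W j w ^+ k.+1) <= 12 ^+ n * (2 * y1 + Cm ^+ (2 * n) * y2).
Proof.
rewrite -pE.
apply: (@le_trans _ _ (Ex P (fun w => 3 ^+ p * ((4 * N%:R^-1) ^+ p * cabs (xf j w) ^+ n + (4 * N%:R^-1) ^+ p * cabs (xf' j w) ^+ n + (2 * Cm ^+ 4 * N%:R^-1 ^+ 2) ^+ p * cabs (C w j j) ^+ n)))).
  apply: (@Ex_mono _ _ _ _ _ _ msy fullE); [by rewrite /W; rvt|by rvt|] => w.
  have g4 : 0 <= 4 * N%:R^-1 :> R by rewrite mulr_ge0.
  have gC : 0 <= 2 * Cm ^+ 4 * N%:R^-1 ^+ 2.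
    by rewrite mulr_ge0 ?exprn_ge0// mulr_ge0// exprn_ge0//; apply: le_trans C1.
  have g1 := mulr_ge0 g4 (sqr_ge0 (cabs (xf j w))).
  have g2 := mulr_ge0 g4 (sqr_ge0 (cabs (xf' j w))).
  have g3 := mulr_ge0 gC (sqr_ge0 (cabs (C w j j))).
  rewrite /W mulrDr; apply: le_trans (pow3 p g1 g2 g3) _.
  by rewrite ![(_ * cabs _ ^+ 2) ^+ _]exprMn -!(exprM (cabs _)) -nE2.
rewrite (@ExZr _ _ _ _ _ _ msy fullE); last by rvt.
rewrite (@ExDr _ _ _ _ _ _ msy fullE); [|by rvt|by rvt].
rewrite (@ExDr _ _ _ _ _ _ msy fullE); [|by rvt|by rvt].
rewrite (@ExZr _ _ _ _ _ _ msy fullE); last by rvt.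
rewrite (@ExZr _ _ _ _ _ _ msy fullE); last by rvt.
rewrite (@ExZr _ _ _ _ _ _ msy fullE); last by rvt.
have p34 : 3 ^+ p * 4 ^+ p <= 12 ^+ n :> R.
  by rewrite -exprMn -natrM; apply: ler_weXn2l; rewrite ?ler1n// nE2 leq_pmull.
have p32 : 3 ^+ p * 2 ^+ p <= 12 ^+ n :> R.
  apply: le_trans p34; rewrite ler_wpM2l ?exprn_ge0// lerXn2r ?nnegrE//.
  by rewrite ler_nat.
have Np : N%:R^-1 ^+ p <= N%:R^-1 ^+ q.+2 :> R by rewrite ler_wiXn2l.
have Nn : N%:R^-1 ^+ n <= N%:R^-1 ^+ (2 * q + 3) :> R by rewrite ler_wiXn2l.
have h1 (x : T -> R) : mom n x X1 -> (forall w, 0 <= x w) ->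
  3 ^+ p * ((4 * N%:R^-1) ^+ p * Ex P (fun w => x w ^+ n)) <= 12 ^+ n * y1.
  move=> mx x0; rewrite exprMn /y1.
  have -> : 3 ^+ p * (4 ^+ p * N%:R^-1 ^+ p * Ex P (fun w => x w ^+ n)) =
    (3 ^+ p * 4 ^+ p) * (N%:R^-1 ^+ p * Ex P (fun w => x w ^+ n)) by rewrite !mulrA.
  have x0' := Ex_pow_ge0 n x0.
  by apply: ler_pM; rewrite ?mulr_ge0 ?exprn_ge0//; apply: ler_pM; rewrite ?exprn_ge0.
have h2 : 3 ^+ p * ((2 * Cm ^+ 4 * N%:R^-1 ^+ 2) ^+ p * Ex P (fun w => cabs (C w j j) ^+ n)) <= 12 ^+ n * (Cm ^+ (2 * n) * y2).
  rewrite 2!exprMn -(exprM Cm) -(exprM _ 2 p) -nE2.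
  rewrite ar5.
  have -> : 3 ^+ p * (2 ^+ p * Cm ^+ (2 * n) * N%:R^-1 ^+ n * Ex P (fun w => cabs (C w j j) ^+ n)) =
    (3 ^+ p * 2 ^+ p) * (Cm ^+ (2 * n) * (N%:R^-1 ^+ n * Ex P (fun w => cabs (C w j j) ^+ n))) by rewrite !mulrA.
  have x0' : 0 <= Ex P (fun w => cabs (C w j j) ^+ n) by apply: Ex_pow_ge0 => w; exact: cabs_ge0.
  have C0 : 0 <= Cm ^+ (2 * n) by rewrite exprn_ge0//; apply: le_trans C1.
  have q1 : N%:R^-1 ^+ n * Ex P (fun w => cabs (C w j j) ^+ n) <= y2.
    by rewrite /y2; apply: ler_pM; [exact: exprn_ge0| |exact: Nn|exact: momC].
  apply: ler_pM; [by apply: mulr_ge0; exact: exprn_ge0| |exact: p32|exact: ler_wpM2l].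
  by apply: mulr_ge0 => //; apply: mulr_ge0 => //; exact: exprn_ge0.
have := h1 _ (mxf j) (fun w => cabs_ge0 _); have := h1 _ (mxf' j) (fun w => cabs_ge0 _).
move: h2; set z1 := _ * (_ * Ex P _); set z2 := _ * (_ * Ex P _); set z3 := _ * (_ * Ex P _).
set a3 := 12 ^+ n; rewrite !(mulrDr (3 ^+ p)) -/z1 -/z2 -/z3; set c := Cm ^+ (2 * n); lra.
Qed.

(** [theta] majorises four sizes: sqrt(mu/Ne) from the conditional variance, 1/Ne from the part of
    that variance proportional to |Zq|, and nu sqrt(a/Ne) and nu^2 kap from the off-diagonal and
    diagonal increments. The part with |Zq| is absorbed through [moment_close]. *)
Lemma quadratic_concentration :
  mom n (fun w => cabs (Zq w)) (10000 * e0 R ^+ 5 * n%:R ^+ 4 * Cm ^+ 4 * theta).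
Proof.
have e1 := e0_ge1 R; have e00 := e0_gt0 R.
have n1 : 1 <= n%:R :> R by rewrite ler1n.
have Cp : 0 < Cm by apply: lt_le_trans C1.
have cD j : crv fullE (D j) by rewrite /D; rvt.
have rU j : rv fullE (U j) by rewrite /U; rvt.
have rW j : rv fullE (W j) by rewrite /W; rvt.
have W0 j w : 0 <= W j w.
  have C4 : 0 <= Cm ^+ 4 by rewrite exprn_ge0// ltW.
  have g4 : 0 <= 4 * N%:R^-1 :> R by rewrite mulr_ge0.
  have gC : 0 <= 2 * Cm ^+ 4 * N%:R^-1 ^+ 2.
    by apply: mulr_ge0; [exact: mulr_ge0|exact: exprn_ge0].
  exact: addr_ge0 (mulr_ge0 g4 (addr_ge0 (sqr_ge0 _) (sqr_ge0 _))) (mulr_ge0 gC (sqr_ge0 _)).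
have := leave_one_out msy cZ cD cZj rU rW W0 Z_sum DU ZU D0 UW.
rewrite -nE.
set AA := 4 * e0 R ^+ 2 * k.+1%:R.
have AE : AA = 2 * e0 R ^+ 2 * n%:R by rewrite /AA nE natrM; ring.
rewrite {}AE; clear AA; set AA := 2 * e0 R ^+ 2 * n%:R.
have e2 : 1 <= e0 R ^+ 2 by rewrite exprn_ege1.
have A1 : 1 <= AA by rewrite /AA; move: e2 n1; set x := e0 R ^+ 2; set y := n%:R; nra.
set Jm := n%:R ^+ n * _ => hLOO.
pose J := 48 * AA * n%:R * Cm ^+ 2 * (nu * X1 + nu ^+ 2 * kap).
have nu0 := nu_ge0 R N.
have nX0 : 0 <= nu * X1 by rewrite mulr_ge0.
have nk0 : 0 <= nu ^+ 2 * kap by rewrite mulr_ge0 ?exprn_ge0// ltW.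
have jump : AA * Jm <= J ^+ n.
  have hj j : Ex P (fun w => U j w ^+ n) + Ex P (fun w => W j w ^+ k.+1) <= 12 ^+ n * (4 * Cm ^+ (2 * n)) * (y1 + y2).
    apply: le_trans (lerD (U_mom j) (W_mom j)) _.
    have c12 : Cm ^+ n <= Cm ^+ (2 * n) by rewrite ler_weXn2l// leq_pmull.
    have c1' : 1 <= Cm ^+ (2 * n) by rewrite exprn_ege1.
    have t3 : 3 ^+ n <= 12 ^+ n :> R by rewrite lerXn2r ?nnegrE// ler_nat.
    have t32 : 3 ^+ n * 2 ^+ n <= 12 ^+ n :> R.
      by rewrite -exprMn -natrM lerXn2r ?nnegrE// ler_nat.
    have t0 : 0 <= 3 ^+ n :> R by rewrite exprn_ge0.
    have t20 : 0 <= 2 ^+ n :> R by rewrite exprn_ge0.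
    have c0' : 0 <= Cm ^+ (2 * n) := le_trans ler01 c1'.
    have cn0 : 0 <= Cm ^+ n := le_trans ler01 Cn1.
    have t12 : 0 <= 12 ^+ n :> R by rewrite exprn_ge0.
    have u1 : 3 ^+ n * (Cm ^+ n * y1) <= 12 ^+ n * (Cm ^+ (2 * n) * y1).
      by apply: ler_pM => //; [rewrite mulr_ge0|rewrite ler_wpM2r].
    have u2 : (3 ^+ n * 2 ^+ n) * (Cm ^+ (2 * n) * y2) <= 12 ^+ n * (Cm ^+ (2 * n) * y2).
      by rewrite ler_wpM2r// mulr_ge0.
    have u3 : 12 ^+ n * y1 <= 12 ^+ n * (Cm ^+ (2 * n) * y1).
      by rewrite ler_wpM2l// ler_peMl.
    have u4 : 0 <= 12 ^+ n * (Cm ^+ (2 * n) * y2) by apply: mulr_ge0 => //; exact: mulr_ge0.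
    move: u1 u2 u3 u4; set b1 := 3 ^+ n; set b2 := 2 ^+ n; set b3 := 12 ^+ n; set b4 := Cm ^+ n; set b5 := Cm ^+ (2 * n).
    by lra.
  have NE : (N%:R : R) * N%:R^-1 = 1 by rewrite mulfV// gt_eqF.
  have s1 : \sum_j (Ex P (fun w => U j w ^+ n) + Ex P (fun w => W j w ^+ k.+1)) <=
     12 ^+ n * (4 * Cm ^+ (2 * n)) * ((nu * X1) ^+ n + (nu ^+ 2 * kap) ^+ n).
    apply: (@le_trans _ _ (\sum_(j < N) 12 ^+ n * (4 * Cm ^+ (2 * n)) * (y1 + y2))).
      by apply: ler_sum => j _; exact: hj.
    have f1 : N%:R * y1 = (nu * X1) ^+ n.
      rewrite /y1; move: X1 => x1; rewrite [(nu * x1) ^+ n]exprMn [nu ^+ n]exprM nu4 mulrA.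
      by rewrite [N%:R^-1 ^+ q.+2]exprS mulrA NE mul1r.
    have f2 : N%:R * y2 = (nu ^+ 2 * kap) ^+ n.
      rewrite /y2 [(nu ^+ 2 * kap) ^+ n]exprMn mulrA -(exprM nu).
      by rewrite ar6 [N%:R^-1 ^+ _.+1]exprS mulrA NE mul1r ar7 [nu ^+ (4 * _)]exprM nu4.
    rewrite sumr_const card_ord -[_ *+ N]mulr_natl mulrCA [N%:R * (y1 + y2)]mulrDr.
    by rewrite f1 f2.
  have s2 : (nu * X1) ^+ n + (nu ^+ 2 * kap) ^+ n <= (nu * X1 + nu ^+ 2 * kap) ^+ n.
    move: nX0 nk0; set x := nu * X1; set y := nu ^+ 2 * kap => x0' y0'.
    rewrite nS [leRHS]exprS mulrDl; apply: lerD; rewrite exprS; apply: ler_wpM2l => //.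
      by rewrite lerXn2r ?nnegrE ?addr_ge0// lerDl.
    by rewrite lerXn2r ?nnegrE ?addr_ge0// lerDr.
  apply: (@le_trans _ _ (AA * (n%:R ^+ n * (12 ^+ n * (4 * Cm ^+ (2 * n)) * (nu * X1 + nu ^+ 2 * kap) ^+ n)))).
    apply: ler_wpM2l; first by lra.
    apply: ler_wpM2l; first by rewrite exprn_ge0.
    apply: le_trans s1 _; apply: ler_wpM2l => //.
    by rewrite !mulr_ge0 ?exprn_ge0//; lra.
  rewrite /J.
  have -> : 48 * AA * n%:R * Cm ^+ 2 * (nu * X1 + nu ^+ 2 * kap) =
    (4 * AA) * (n%:R * (12 * (Cm ^+ 2 * (nu * X1 + nu ^+ 2 * kap)))) by ring.
  set yy := nu * X1 + nu ^+ 2 * kap.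
  have yy0 : 0 <= yy by rewrite addr_ge0.
  rewrite [(4 * AA * _) ^+ n]exprMn [(n%:R * _) ^+ n]exprMn [(12 * _) ^+ n]exprMn [(Cm ^+ 2 * _) ^+ n]exprMn -(exprM Cm).
  have -> : AA * (n%:R ^+ n * (12 ^+ n * (4 * Cm ^+ (2 * n)) * yy ^+ n)) =
    (4 * AA) * (n%:R ^+ n * (12 ^+ n * (Cm ^+ (2 * n) * yy ^+ n))).
    by set b1 := n%:R ^+ n; set b2 := 12 ^+ n; set b3 := Cm ^+ _; set b4 := yy ^+ n; ring.
  apply: ler_wpM2r.
    by rewrite !mulr_ge0 ?exprn_ge0//; lra.
  rewrite nS exprS ler_peMr//; first by lra.
  by rewrite exprn_ege1//; lra.
(* The constant added to the square root makes u (u + |Zq|) dominate the sum of the [W j], including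
   its part linear in |Zq|. *)
pose u w := Num.sqrt (16 * Cm ^+ 4 / Ne * G0 w) + 8 * Cm ^+ 4 / Ne.
have ru : rv fullE u by rewrite /u; rvt.
have rt : rv fullE (fun w => cabs (Zq w)) by rvt.
have C4 : 0 < Cm ^+ 4 by rewrite exprn_gt0.
have u10 w : 0 <= 16 * Cm ^+ 4 / Ne * G0 w.
  by apply: mulr_ge0 => //; rewrite divr_ge0 ?(ltW Ne0)// mulr_ge0// ltW.
have c80 : 0 < 8 * Cm ^+ 4 / Ne by rewrite divr_gt0// mulr_gt0.
have u0 w : 0 <= u w by rewrite addr_ge0 ?sqrtr_ge0// ltW.
have t0 w : 0 <= cabs (Zq w) by exact: cabs_ge0.
have sumW w : \sum_j W j w <= 16 * Cm ^+ 4 / Ne * G0 w + 8 * Cm ^+ 4 / Ne * cabs (Zq w).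
  rewrite /W big_split/= -!mulr_sumr big_split/=.
  have s1 := sum_xf w; have s2 := sum_xf' w; have s3 := QG0 w; have s4 := mG0 w.
  have s5 : \sum_j cabs (C w j j) ^+ 2 <= N%:R / eta * G0 w.
    apply: (@le_trans _ _ (\sum_j ip (B w j j) / eta)).
      apply: ler_sum => j _; apply: le_trans (row_bound w j).
      by rewrite (bigD1 j)//= lerDl sumr_ge0// => l _; exact: sqr_ge0.
    rewrite -mulr_suml mulrAC ler_wpM2r ?invr_ge0 ?(ltW eta0)//.
    by move: s4; rewrite mulrC ler_pdivrMr// mulrC.
  have cc1 : 1 <= Cm ^+ 4 by rewrite exprn_ege1.
  set Q := ip (qf (h w) (B w)) in s1 s2 s3; set sx := \sum_i0 _; set sy := \sum_i0 _.
  have h5 : 4 * N%:R^-1 * (sx + sy) <= 8 / Ne * (G0 w + cabs (Zq w)).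
    have -> : 8 / Ne * (G0 w + cabs (Zq w)) = 4 * N%:R^-1 * (2 * ((G0 w + cabs (Zq w)) / eta)).
      by rewrite /Ne; field; rewrite !gt_eqF.
    rewrite ler_wpM2l ?mulr_ge0//.
    have : Q / eta <= (G0 w + cabs (Zq w)) / eta by rewrite ler_wpM2r// invr_ge0 ltW.
    by move: s1 s2; rewrite -/sx -/sy; lra.
  have h6 : 2 * Cm ^+ 4 * N%:R^-1 ^+ 2 * \sum_i0 cabs (C w i0 i0) ^+ 2 <= 2 * Cm ^+ 4 / Ne * G0 w.
    apply: (@le_trans _ _ (2 * Cm ^+ 4 * N%:R^-1 ^+ 2 * (N%:R / eta * G0 w))).
      by rewrite ler_wpM2l// !mulr_ge0 ?exprn_ge0// ltW.
    rewrite /Ne le_eqVlt; apply/orP; left; apply/eqP; field; by rewrite !gt_eqF.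
  apply: le_trans (lerD h5 h6) _.
  have iNe : 0 <= Ne^-1 by rewrite invr_ge0 ltW.
  have g0 := G00 w; have z0 := t0 w.
  have k1 : 0 <= (Cm ^+ 4 - 1) * (Ne^-1 * G0 w) by rewrite !mulr_ge0// subr_ge0.
  have k2 : 0 <= (Cm ^+ 4 - 1) * (Ne^-1 * cabs (Zq w)) by rewrite !mulr_ge0// subr_ge0.
  have k3 : 0 <= Cm ^+ 4 * (Ne^-1 * G0 w) by rewrite !mulr_ge0// ltW.
  lra.
have hcl : Ex P (fun w => cabs (Zq w) ^+ n) <= AA * Ex P (fun w => u w * (u w + cabs (Zq w)) ^+ n.-1) + J ^+ n.
  apply: le_trans hLOO _; rewrite mulrDr; apply: lerD => //.
  rewrite ler_wpM2l//; first by lra.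
  apply: (@Ex_mono _ _ _ _ _ _ msy fullE); [by rvt|by rvt|] => w.
  rewrite ar8.
  apply: (@le_trans _ _ ((u w * (u w + cabs (Zq w))) * cabs (Zq w) ^+ (2 * k))).
    rewrite ler_wpM2r ?exprn_ge0//; apply: le_trans (sumW w) _.
    rewrite mulrDr; apply: lerD.
      rewrite -[X in X <= _]sqr_sqrtr// expr2; apply: ler_pM; rewrite ?sqrtr_ge0//; by rewrite lerDl ltW.
    by rewrite ler_wpM2r// /u lerDr sqrtr_ge0.
  rewrite -mulrA [_ ^+ (2 * k).+1]exprS; apply: ler_wpM2l => //; apply: ler_wpM2l; first exact: addr_ge0.
  move: (t0 w) (u0 w); set x := cabs _; set y := u w => x0 y0.
  by apply: lerXn2r; rewrite ?nnegrE//; [exact: addr_ge0|rewrite lerDr].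
have c48 : 0 <= 48 * AA * n%:R * Cm ^+ 2.
  by apply: mulr_ge0 (sqr_ge0 _); apply: mulr_ge0 (ler0n _ _); apply: mulr_ge0; [exact: ler0n|exact: le_trans ler01 A1].
have J0 : 0 <= J by rewrite /J !mulr_ge0 ?exprn_ge0 ?addr_ge0//; lra.
have mu_u : mom n u (12 * Cm ^+ 4 * theta).
  have m1 : mom n (fun w => Num.sqrt (16 * Cm ^+ 4 / Ne * G0 w)) (Num.sqrt (16 * Cm ^+ 4 / Ne * mu)).
    rewrite nE2; apply: mom_sqrt => //.
      by rewrite mulr_ge0 ?(ltW mu0)// divr_ge0 ?(ltW Ne0)// mulr_ge0// ltW.
    by apply: (momZ msy _ rG0) => //; rewrite divr_ge0 ?(ltW Ne0)// mulr_ge0// ltW.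
  have sq0 : 0 < Num.sqrt (16 * Cm ^+ 4 / Ne * mu).
    by rewrite sqrtr_gt0 mulr_gt0// divr_gt0// mulr_gt0.
  have r1 : rv fullE (fun w => Num.sqrt (16 * Cm ^+ 4 / Ne * G0 w)) by rvt.
  have m2 := mom_cst P n (8 * Cm ^+ 4 / Ne).
  rewrite nS in m1 m2.
  have := mom_add msy r1 (rv_cst fullE (8 * Cm ^+ 4 / Ne)) (fun w => sqrtr_ge0 _) (fun w => ltW c80) sq0 c80 m1 m2.
  rewrite -nS; apply: mom_ler; first by rewrite addr_ge0 ?sqrtr_ge0// ltW.
  have b1 : Num.sqrt (16 * Cm ^+ 4 / Ne * mu) <= 4 * Cm ^+ 2 * theta.
    rewrite -[leRHS]ger0_norm; last by rewrite !mulr_ge0 ?exprn_ge0// ltW.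
    rewrite -sqrtr_sqr ler_wsqrtr//.
    have -> : (4 * Cm ^+ 2 * theta) ^+ 2 = 16 * Cm ^+ 4 / Ne * (Ne * theta ^+ 2).
      by field; rewrite gt_eqF.
    by rewrite ler_wpM2l// divr_ge0 ?(ltW Ne0)// mulr_ge0// ltW.
  have b2 : 8 * Cm ^+ 4 / Ne <= 8 * Cm ^+ 4 * theta.
    have c8 : 0 <= 8 * Cm ^+ 4 by rewrite mulr_ge0// ltW.
    by rewrite ler_pdivrMr// -[_ * theta * Ne]mulrA ler_peMr// mulrC.
  have b3 : Cm ^+ 2 * theta <= Cm ^+ 4 * theta by rewrite ler_wpM2r ?(ltW theta0)// ler_weXn2l.
  lra.
have := @moment_close _ _ _ _ _ _ msy n.-1 fullE _ u AA (12 * Cm ^+ 4 * theta) J rt ru t0 u0 A1.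
rewrite -nS => /(_ _ J0 hcl mu_u) hfin.
have th0 : 0 <= 12 * Cm ^+ 4 * theta by rewrite !mulr_ge0// ltW.
apply: mom_ler (hfin th0).
  have AA0 : 0 <= AA by lra.
  apply: addr_ge0; last exact: mulr_ge0.
  apply: mulr_ge0 => //; apply: addr_ge0 => //; apply: mulr_ge0; last by lra.
  by apply: mulr_ge0 => //; rewrite mulr_ge0// ltW.
have nb : nu * Num.sqrt (a / Ne) <= theta.
  rewrite -[leRHS]ger0_norm ?(ltW theta0)// -[leLHS]ger0_norm ?mulr_ge0 ?sqrtr_ge0//.
  rewrite -!sqrtr_sqr ler_wsqrtr// [(nu * _) ^+ 2]exprMn [Num.sqrt (a / Ne) ^+ 2]sqr_sqrtr ?divr_ge0 ?(ltW a0) ?(ltW Ne0)//.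
  have -> : nu ^+ 2 * (a / Ne) = nu ^+ 2 * a / Ne by rewrite mulrA.
  by rewrite ler_pdivrMr// [_ * Ne]mulrC.
have nX : nu * X1 <= 32 * e0 R ^+ 3 * n%:R ^+ 2 * Cm * theta.
  rewrite /X1.
  have -> : nu * (16 * e0 R ^+ 3 * n%:R ^+ 2 * (Num.sqrt (a / Ne) + Cm * kap * nu)) =
    (16 * e0 R ^+ 3 * n%:R ^+ 2) * (nu * Num.sqrt (a / Ne) + Cm * (nu ^+ 2 * kap)) by ring.
  have -> : 32 * e0 R ^+ 3 * n%:R ^+ 2 * Cm * theta = (16 * e0 R ^+ 3 * n%:R ^+ 2) * (2 * (Cm * theta)) by ring.
  rewrite ler_wpM2l ?mulr_ge0 ?exprn_ge0 ?(ltW e00)//.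
  have : Cm * (nu ^+ 2 * kap) <= Cm * theta by rewrite ler_wpM2l// ltW.
  have : theta <= Cm * theta by rewrite ler_peMl// ltW.
  lra.
have JE : J <= 48 * AA * n%:R * Cm ^+ 2 * (33 * e0 R ^+ 3 * n%:R ^+ 2 * Cm * theta).
  rewrite /J; apply: (ler_wpM2l c48).
  have : theta <= e0 R ^+ 3 * n%:R ^+ 2 * Cm * theta.
    rewrite ler_peMl ?(ltW theta0)//.
    have h1 : 1 <= e0 R ^+ 3 * n%:R ^+ 2.
      by apply: mulr_ege1; exact: exprn_ege1.
    exact: mulr_ege1.
  move: nX kap_th; set x3 := e0 R ^+ 3; set x2 := n%:R ^+ 2; set x4 := nu * X1; set x5 := nu ^+ 2 * kap.
  lra.
have h4 : 1 <= n%:R ^+ 4 :> R by rewrite exprn_ege1.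
have h5 : 1 <= e0 R ^+ 5 by rewrite exprn_ege1.
have hx : 0 <= Cm ^+ 4 * theta by rewrite mulr_ge0 ?exprn_ge0// ltW.
have t1 : (1 + 2 * e0 R * AA * n%:R) * (12 * Cm ^+ 4 * theta) <= 60 * (e0 R ^+ 5 * n%:R ^+ 4 * (Cm ^+ 4 * theta)).
  have -> : 60 * (e0 R ^+ 5 * n%:R ^+ 4 * (Cm ^+ 4 * theta)) = (5 * (e0 R ^+ 5 * n%:R ^+ 4)) * (12 * Cm ^+ 4 * theta) by ring.
  rewrite ler_wpM2r// /AA.
  have -> : 1 + 2 * e0 R * (2 * e0 R ^+ 2 * n%:R) * n%:R = 1 + 4 * (e0 R ^+ 3 * n%:R ^+ 2) by ring.
  have g1 : e0 R ^+ 3 * n%:R ^+ 2 <= e0 R ^+ 5 * n%:R ^+ 4.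
    by apply: ler_pM; rewrite ?exprn_ge0 ?(ltW e00)// ler_weXn2l.
  have g2 : 1 <= e0 R ^+ 5 * n%:R ^+ 4 by exact: mulr_ege1.
  lra.
have t2 : 2 * J <= 6336 * (e0 R ^+ 5 * n%:R ^+ 4 * (Cm ^+ 4 * theta)).
  have -> : 6336 * (e0 R ^+ 5 * n%:R ^+ 4 * (Cm ^+ 4 * theta)) =
     2 * (48 * AA * n%:R * Cm ^+ 2 * (33 * e0 R ^+ 3 * n%:R ^+ 2 * Cm * theta)) * Cm by rewrite /AA; ring.
  apply: (@le_trans _ _ (2 * (48 * AA * n%:R * Cm ^+ 2 * (33 * e0 R ^+ 3 * n%:R ^+ 2 * Cm * theta)))).
    by rewrite ler_wpM2l.
  by rewrite ler_peMr// (le_trans _ (ler_wpM2l _ JE))// mulr_ge0.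
have hy : 0 <= e0 R ^+ 5 * n%:R ^+ 4 * (Cm ^+ 4 * theta) by rewrite !mulr_ge0 ?exprn_ge0// ltW.
apply: le_trans (lerD t1 t2) _.
have -> : 10000 * e0 R ^+ 5 * n%:R ^+ 4 * Cm ^+ 4 * theta = 10000 * (e0 R ^+ 5 * n%:R ^+ 4 * (Cm ^+ 4 * theta)) by ring.
lra.
Qed.
End Quadratic.

(** * The semicircle transform *)

Section Semicircle.
Variable R : realType.
Implicit Types (z m : complex R) (s y : R).

Definition mscp z : complex R := (- z + sqrtc (z ^+ 2 - 4)) / 2.
Definition mscm z : complex R := (- z - sqrtc (z ^+ 2 - 4)) / 2.
(* Of the two roots of [m^2 + z m + 1], whose product is 1, exactly one lies in
   the upper half plane when z does. *)
Definition msc z : complex R := if 0 < ip (mscp z) then mscp z else mscm z.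

Let two0 : (2 : complex R) != 0. Proof. by rewrite pnatr_eq0. Qed.

Lemma mscp_mscm z : mscp z * mscm z = 1.
Proof.
rewrite /mscp /mscm; have := sqr_sqrtc (z ^+ 2 - 4); move: (sqrtc _) => w hw.
have -> : (- z + w) / 2 * ((- z - w) / 2) = (z ^+ 2 - w ^+ 2) / 4 by field.
by rewrite hw; field.
Qed.

Lemma mscD z : mscp z + mscm z = - z. Proof. by rewrite /mscp /mscm; field. Qed.

Lemma msc_ip z : 0 < ip z -> 0 < ip (msc z).
Proof.
move=> z0; rewrite /msc; case: ifP => // /negbT; rewrite -leNgt => h.
have := mscD z => /(congr1 (fun x : complex R => ip x)); rewrite ipD ipN => hs.
have h0 : mscp z != 0.
  by apply/eqP => e; have := mscp_mscm z; rewrite e mul0r => /eqP; rewrite eq_sym oner_eq0.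
have hm : mscm z = (mscp z)^-1.
  by apply: (mulfI h0); rewrite mscp_mscm mulfV.
have hp : 0 < (cabs (mscp z) ^+ 2)^-1 by rewrite invr_gt0 exprn_gt0// cabs_gt0.
have := ipV (mscp z); rewrite -hm => hv.
have : 0 <= ip (mscm z) by rewrite hv mulr_ge0 ?oppr_ge0// ltW.
rewrite le_eqVlt => /orP[/eqP e|//].
suff : ip (mscp z) = 0 by lra.
move: hv; rewrite -e => /eqP; rewrite eq_sym mulf_eq0 (gt_eqF hp) orbF oppr_eq0.
by move=> /eqP.
Qed.

Lemma msc_eq z : epsm z (msc z) = 0.
Proof.
have e := mscD z; have p := mscp_mscm z.
rewrite /msc /epsm; case: ifP => _; move: e p; set u := mscp _; set v := mscm _ => e p.
  transitivity (u * v + - (u + v) * u + u ^+ 2); last by ring.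
  by rewrite p e opprK.
transitivity (u * v + - (u + v) * v + v ^+ 2); last by ring.
by rewrite p e opprK.
Qed.

Lemma epsm_factor z m : epsm z m = (m - msc z) * (m + msc z + z).
Proof.
rewrite -[LHS]subr0 -(msc_eq z) /epsm; ring.
Qed.

Lemma msc_inv z : 0 < ip z -> msc z * (z + msc z) = - 1.
Proof.
move=> z0; have := msc_eq z; rewrite /epsm => /eqP; rewrite -addrA addrC addr_eq0 => /eqP <-.
ring.
Qed.

Lemma msc_neq0 z : 0 < ip z -> msc z != 0.
Proof.
by move=> z0; apply/eqP => e; have := msc_ip z0; rewrite e ltxx.
Qed.

Lemma cabs_zmsc z : 0 < ip z -> cabs (msc z) * cabs (z + msc z) = 1.
Proof. by move=> z0; rewrite -cabsM msc_inv// cabsN cabs1. Qed.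

(** Imaginary parts in 1/m = -(z + m) give (Im z + Im m) |m|^2 = Im m. *)
Lemma cabs_msc z : 0 < ip z -> cabs (msc z) <= 1.
Proof.
move=> z0; have m0 := msc_neq0 z0; have i0 := msc_ip z0.
have e : (msc z)^-1 = - (z + msc z).
  by apply: (mulfI m0); rewrite mulfV// mulrN msc_inv// opprK.
have := ipV (msc z); rewrite e ipN ipD => h.
have c0 : 0 < cabs (msc z) ^+ 2 by rewrite exprn_gt0// cabs_gt0.
have h1 : (ip z + ip (msc z)) * cabs (msc z) ^+ 2 = ip (msc z).
  have -> : ip z + ip (msc z) = ip (msc z) / cabs (msc z) ^+ 2 by lra.
  by rewrite divfK// gt_eqF.
have hc := cabs_ge0 (msc z); rewrite -(ler_sqr (x:=cabs _)) ?nnegrE// expr1n.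
move: c0 h1; set c := cabs _ ^+ 2 => c0 h1; nra.
Qed.

Lemma cabs_zmsc_ge1 z : 0 < ip z -> 1 <= cabs (z + msc z).
Proof.
move=> z0; have h := cabs_zmsc z0; have := cabs_msc z0.
have := cabs_ge0 (msc z); have := cabs_ge0 (z + msc z).
move: h; set x := cabs _; set y := cabs _ => *; nra.
Qed.

(** Subtracting the equations at z and z' leaves the factor m + m' + z, whose imaginary part is at
    least Im z. *)
Lemma msc_lip z z' : 0 < ip z -> 0 < ip z' ->
  cabs (msc z - msc z') <= cabs (z - z') / ip z.
Proof.
move=> z0 z0'.
have e : (msc z - msc z') * (msc z + msc z' + z) = (z' - z) * msc z'.
  apply/eqP; rewrite -subr_eq0; apply/eqP.
  have e1 := msc_eq z; have e2 := msc_eq z'; move: e1 e2; rewrite /epsm => e1 e2.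
  transitivity ((1 + z * msc z + msc z ^+ 2) - (1 + z' * msc z' + msc z' ^+ 2)); first by ring.
  by rewrite e1 e2 subrr.
have h : ip z <= cabs (msc z + msc z' + z).
  apply: le_trans (ip_le_cabs _); rewrite !ipD.
  by have := msc_ip z0; have := msc_ip z0'; lra.
rewrite ler_pdivlMr//.
apply: (@le_trans _ _ (cabs (msc z - msc z') * cabs (msc z + msc z' + z))).
  by rewrite ler_wpM2l// cabs_ge0.
rewrite -cabsM e cabsM cabsBC ler_piMr ?cabs_ge0//; exact: cabs_msc.
Qed.

(* The factor [m + msc z + z] of [epsm] is bounded below by half of this. *)
Definition bsc z : R := 2 * ip (msc z) + ip z.

Lemma bsc_gt0 z : 0 < ip z -> 0 < bsc z.
Proof. by move=> z0; have := msc_ip z0; rewrite /bsc; lra. Qed.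

(** Identifies [bsc z] as the imaginary part of a root of the discriminant, a quantity that tends to
    0 at the edges 2 and -2. *)
Lemma disc_msc z : (2 * msc z + z) ^+ 2 = z ^+ 2 - 4.
Proof.
have e := msc_eq z; move: e; rewrite /epsm => e.
transitivity (z ^+ 2 - 4 + 4 * (1 + z * msc z + msc z ^+ 2)); first by ring.
by rewrite e mulr0 addr0.
Qed.

Lemma ip_disc z : ip (2 * msc z + z) = bsc z.
Proof. by rewrite ipD /bsc natrC ipcM. Qed.

Section InBulk.
Variable z : complex R.
Hypotheses (z0 : 0 < ip z) (re0 : 0 <= rp z) (re2 : rp z <= 2).

Let b0 := bsc_gt0 z0.

(** For 0 <= Re z <= 2 the real part of z^2 - 4 is nonpositive, so the real part of its root is in
    modulus at most the imaginary part [bsc z]. *)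
Lemma cabs_disc2 : cabs (2 * msc z + z) ^+ 2 <= 2 * bsc z ^+ 2.
Proof.
have := disc_msc z => /(congr1 (fun x : complex R => rp x)).
rewrite cabs_sqr -ip_disc; set a := 2 * msc z + z.
rewrite rpB !expr2 !rpM [4]natrC rpC => h.
have h1 : rp z * rp z <= 4 by move: (rp z) re0 re2 => x *; nra.
have h2 := sqr_ge0 (ip z); rewrite expr2 in h2.
lra.
Qed.

Lemma cabs_disc : cabs (2 * msc z + z) <= 3 / 2 * bsc z.
Proof.
have h := cabs_disc2; have := cabs_ge0 (2 * msc z + z); move: h b0.
set x := cabs _; set y := bsc _ => *; nra.
Qed.

Lemma bsc_sq : ip z <= bsc z ^+ 2.
Proof.
have h := cabs_disc2; have := disc_msc z => /(congr1 (fun x : complex R => cabs x)).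
rewrite cabsX => e; rewrite e in h.
have : cabs (z ^+ 2 - 4) = cabs (z - 2) * cabs (z + 2) by rewrite -cabsM; congr cabs; ring.
have h1 : ip z <= cabs (z - 2).
  by apply: le_trans (ip_le_cabs _); rewrite ipB natrC ipC subr0.
have h2 : 2 <= cabs (z + 2).
  by apply: le_trans (rp_le_cabs _); rewrite rpD (natrC R 2) rpC; move: (rp z) re0 => x *; lra.
move=> e'; rewrite e' in h; move: h h1 h2; set x := cabs _; set y := cabs _; set c := bsc z ^+ 2 => h h1 h2.
have : ip z * 2 <= x * y by apply: ler_pM => //; exact: ltW.
lra.
Qed.

Variable m : complex R.
Hypothesis m0 : 0 <= ip m.

Lemma factor_ge : bsc z / 2 <= cabs (m + msc z + z).
Proof. by apply: le_trans (ip_le_cabs _); rewrite /bsc !ipD; move: z0 m0; set x := ip z; set y := ip m; set t := ip (msc z) => *; lra. Qed.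

(** The second factor of the defect is at least a quarter of |m - msc|: the two differ by the root
    of the discriminant, which is at most three times that factor. Unlike [lam_eps], the bound does
    not degenerate at the edge. *)
Lemma lam_sq_eps : cabs (m - msc z) ^+ 2 <= 4 * cabs (epsm z m).
Proof.
rewrite epsm_factor cabsM.
have h1 : cabs (m - msc z) <= cabs (m + msc z + z) + cabs (2 * msc z + z).
  by have -> : m - msc z = (m + msc z + z) - (2 * msc z + z); [ring|exact: cabsB].
have := cabs_disc; have := factor_ge; have := cabs_ge0 (m - msc z); move: h1.
by set x := cabs (m - _); set y := cabs _; set w := cabs _; set c := bsc _ => *; nra.
Qed.

Lemma lam_eps : cabs (m - msc z) <= 2 * cabs (epsm z m) / bsc z.
Proof.
rewrite epsm_factor cabsM ler_pdivlMr//.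
have := factor_ge; have := cabs_ge0 (m - msc z).
by set x := cabs (m - _); set y := cabs _; set c := bsc _ => *; nra.
Qed.

Lemma factor_le : cabs (m + msc z + z) <= 3 / 2 * bsc z + cabs (m - msc z).
Proof.
have -> : m + msc z + z = (m - msc z) + (2 * msc z + z) by ring.
by have := cabsD (m - msc z) (2 * msc z + z); have := cabs_disc; lra.
Qed.

Lemma ip_le_bsc : ip m <= bsc z + cabs (m - msc z).
Proof.
have := ip_le_cabs (m - msc z); rewrite ipB /bsc; move: (msc_ip z0) z0; set x := ip z; set y := ip m; set t := ip (msc z) => *; lra.
Qed.

End InBulk.

(* Both sides of [g = -1/(z + Q)], [msc z = -1/(z + msc z)] compared. *)
Lemma resolvent_expand z Q : 0 < ip z -> z + Q != 0 ->
  - (z + Q)^-1 = msc z + - (z + Q)^-1 * msc z * (Q - msc z).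
Proof.
move=> z0 zQ; have e := msc_inv z0.
apply: (mulIf zQ); rewrite mulrDl mulNr mulVf//.
have -> : - (z + Q)^-1 * msc z * (Q - msc z) * (z + Q) = - (((z + Q)^-1 * (z + Q)) * (msc z * (Q - msc z))) by ring.
rewrite mulVf// mul1r.
have -> : msc z * (z + Q) - msc z * (Q - msc z) = msc z * (z + msc z) by ring.
by rewrite e.
Qed.

Lemma gden_good z Q : 0 < ip z -> cabs (Q - msc z) <= 1 / 2 -> cabs (- (z + Q)^-1) <= 2.
Proof.
move=> z0 h; rewrite cabsN cabsV.
have h1 := cabs_zmsc_ge1 z0.
have h2 : 1 / 2 <= cabs (z + Q).
  have := cabs_lerB (z + msc z) (z + Q).
  have -> : cabs (z + msc z - (z + Q)) = cabs (Q - msc z).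
    by rewrite -cabsN; congr cabs; ring.
  lra.
by rewrite -[2]invrK lef_pV2 ?posrE; lra.
Qed.

End Semicircle.

(** * Measurability of resolvent quantities *)

Section ResolventVariables.
Context d (T : measurableType d) (R : realType) (P : probability T R).
Variables (E : finType) (ms : {set E} -> (T -> R) -> Prop).
Hypothesis msy : msystem P ms.
Variable N : nat.
Implicit Types (S : {set E}) (X Y : T -> 'M[complex R]_N) (z : complex R).

Lemma crv_bound S F (c : R) : cms ms S F -> (forall w, cabs (F w) <= c) -> crv ms S F.
Proof.
move=> [m1 m2] b; split; split => //; exists c => w; apply: le_trans (b w).
  exact: rp_cabs.
exact: ip_cabs.
Qed.

Lemma crv_res S X z j k : 0 < ip z -> (forall a b, crv ms S (fun w => X w a b)) ->
  crv ms S (fun w => res (X w) z j k).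
Proof.
move=> z0 cX; apply: (@crv_bound _ _ (ip z)^-1); last by move=> w; exact: cabs_res.
have mX : mms ms S X by move=> a b; have [[h1 _] [h2 _]] := cX a b; split.
have mG : mms ms S (fun w => gram (X w) - (z ^+ 2)%:M).
  move=> a b; have h := mms_mul msy (mms_adj msy mX) mX a b.
  have -> : (fun w => (gram (X w) - (z ^+ 2)%:M) a b) =
    (fun w => ((X w)^t* *m X w) a b + - (z ^+ 2)%:M a b) by apply/funext => w; rewrite !mxE.
  by apply: (cmsD msy) => //; exact: (cms_cst msy).
have mI := mms_inv msy mG (fun w => gram_unit (X w) z0) j k.
have -> : (fun w => res (X w) z j k) = (fun w => z * invmx (gram (X w) - (z ^+ 2)%:M) j k).
  by apply/funext => w; rewrite mxE.
by apply: (cmsM msy) => //; exact: (cms_cst msy).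
Qed.

Lemma crv_mtr S X z : 0 < ip z -> (forall a b, crv ms S (fun w => X w a b)) ->
  crv ms S (fun w => mtr (X w) z).
Proof.
by move=> z0 cX; rewrite /mtr /mxtrace; apply: (crvM msy); [exact: (crv_cst msy)|
  apply: (crv_sum msy) => j _; exact: crv_res].
Qed.

Lemma crv_qf S (h : T -> 'rV[complex R]_N) X : (forall a, crv ms S (fun w => h w 0 a)) ->
  (forall a b, crv ms S (fun w => X w a b)) -> crv ms S (fun w => qf (h w) (X w)).
Proof.
move=> ch cX.
have -> : (fun w => qf (h w) (X w)) = (fun w => \sum_k \sum_j h w 0 j * X w j k * (h w 0 k)^*%C).
  by apply/funext => w; rewrite qfE.
apply: (crv_sum msy) => k _; apply: (crv_sum msy) => j _.
by apply: (crvM msy); [apply: (crvM msy)|apply: (crvJ msy)].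
Qed.

Lemma crv_mulmx S X Y j k : (forall a b, crv ms S (fun w => X w a b)) ->
  (forall a b, crv ms S (fun w => Y w a b)) -> crv ms S (fun w => (X w *m Y w) j k).
Proof.
move=> cX cY; have -> : (fun w => (X w *m Y w) j k) = (fun w => \sum_l X w j l * Y w l k).
  by apply/funext => w; rewrite mxE.
by apply: (crv_sum msy) => l _; apply: (crvM msy).
Qed.

Lemma crv_sqres S X z j k : 0 < ip z -> (forall a b, crv ms S (fun w => X w a b)) ->
  crv ms S (fun w => sqres (X w) z j k).
Proof.
move=> z0 cX; have -> : (fun w => sqres (X w) z j k) = (fun w => rc (ip z) * (res (X w) z *m res (X w) z) j k).
  by apply/funext => w; rewrite mxE.
apply: (crvM msy); first exact: (crv_cst msy).
by apply: crv_mulmx => a b; exact: crv_res.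
Qed.

End ResolventVariables.

(** * Rows, minors and fluctuations in the matrix model *)

Section Model.
Context d (T : measurableType d) (R : realType) (P : probability T R).
Variable N : nat.
Local Notation E := ('I_N * 'I_N)%type.
Local Notation fullE := ([set: E]%SET).

Definition swapE (S : {set E}) : {set E} := [set p | (p.2, p.1) \in S]%SET.
Definition ms_swap (ms : {set E} -> (T -> R) -> Prop) S f := ms (swapE S) f.

(** Exchanging rows and columns turns bounds for [gdiag] into bounds for the diagonal entries of
    [res A z], which the estimate of the minors requires. *)
Lemma rmodel_adj ms A Cm : rmodel P ms A Cm -> rmodel P (ms_swap ms) (fun w => (A w)^t*) Cm.
Proof.
move=> M; have msy := rm_sys M; split; last 2 first.
- exact: rm_cst M.
- move=> i j q; have := rm_mom M j i q; congr (_ <= _).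
  by apply: Ex_ext => w; rewrite adjE cabsJ.
- split.
  + by move=> S f; exact: ms_meas msy _ _.
  + by move=> S c; exact: ms_cst msy _ _.
  + by move=> S f g; exact: ms_add msy _ _ _.
  + by move=> S f g; exact: ms_mul msy _ _ _.
  + by move=> S f p; exact: ms_comp msy _ _ _.
  + move=> S S' f SS; apply: (ms_sub msy); apply/fintype.subsetP => p; rewrite !inE.
    exact: (fintype.subsetP SS).
  + move=> S S' f g dS; apply: (ms_indep msy).
    rewrite -setI_eq0; apply/eqP/setP => p; rewrite !inE.
    by move: dS; rewrite -setI_eq0 => /eqP/setP/(_ (p.2, p.1)); rewrite !inE.
- move=> S i j ijS.
  have -> : (fun w => (A w)^t* i j) = (fun w => ((A w j i)^*)%C) by apply/funext => w; rewrite adjE.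
  have [] := crvJ msy (rm_entry M (S := swapE S) (i := j) (j := i) _); first by rewrite inE.
  by [].
- by move=> i j; rewrite -[RHS](rm_re0 M j i); apply: Ex_ext => w; rewrite adjE rpJ.
- move=> i j; have := rm_im0 M j i => h.
  have e : Ex P (fun w => ip ((A w)^t* i j)) = - Ex P (fun w => ip (A w j i)).
    rewrite -mulN1r -(@ExZr _ _ _ _ _ _ msy fullE); last by apply: rv_ip; apply: (rm_entry M); rewrite inE.
    by apply: Ex_ext => w; rewrite adjE ipJ mulN1r.
  by rewrite e h oppr0.
- by move=> i j; rewrite -(rm_var M j i); apply: Ex_ext => w; rewrite adjE cabsJ.
Qed.

Variables (ms : {set E} -> (T -> R) -> Prop) (A : T -> 'M[complex R]_N) (Cm : R).
Hypothesis M : rmodel P ms A Cm.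
Let msy := rm_sys M.
Local Notation mom := (mom P).
Local Notation rv := (rv ms).
Local Notation crv := (crv ms).

Lemma rowz_entry i a b : crv (off_row i) (fun w => rowz (A w) i a b).
Proof.
have -> : (fun w => rowz (A w) i a b) = (fun w => if a == i then 0 else A w a b).
  by apply/funext => w; rewrite mxE.
by case: eqP => [_|/eqP ai]; [exact: (crv_cst msy)|apply: (rm_entry M); rewrite inE].
Qed.

Variable z : complex R.
Hypothesis z0 : 0 < ip z.

Lemma crv_minor i j k : crv (off_row i) (fun w => res (rowz (A w) i) z j k).
Proof. by apply: (crv_res msy) => // a b; exact: rowz_entry. Qed.

Lemma crv_minor2 i j k : crv (off_row i) (fun w => sqres (rowz (A w) i) z j k).
Proof. by apply: (crv_sqres msy) => // a b; exact: rowz_entry. Qed.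

Lemma crv_mtr_minor i : crv (off_row i) (fun w => mtr (rowz (A w) i) z).
Proof. by apply: (crv_mtr msy) => // a b; exact: rowz_entry. Qed.

Lemma crv_full a b : crv fullE (fun w => A w a b).
Proof. by apply: (rm_entry M); rewrite inE. Qed.

Lemma crv_row i a : crv fullE (fun w => (row i (A w)) 0 a).
Proof. by have -> : (fun w => (row i (A w)) 0 a) = (fun w => A w i a); [apply/funext => w; rewrite mxE|exact: crv_full]. Qed.

Lemma crv_resA j k : crv fullE (fun w => res (A w) z j k).
Proof. by apply: (crv_res msy) => // a b; exact: crv_full. Qed.

Lemma crv_mtrA : crv fullE (fun w => mtr (A w) z).
Proof. by apply: (crv_mtr msy) => // a b; exact: crv_full. Qed.

Lemma crv_qrow i : crv fullE (fun w => qrow (A w) z i).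
Proof.
apply: (crv_qf msy) => a; first exact: crv_row.
by move=> b; apply: (crvT msy); exact: crv_minor.
Qed.

Lemma crv_gdiag i : crv fullE (fun w => gdiag (A w) z i).
Proof.
have -> : (fun w => gdiag (A w) z i) = (fun w => res ((A w)^t*) z i i).
  by apply/funext => w; rewrite res_adj_diag.
apply: (crv_res msy) => // a b; have -> : (fun w => (A w)^t* a b) = (fun w => ((A w b a)^*)%C).
  by apply/funext => w; rewrite adjE.
by apply: (crvJ msy); exact: crv_full.
Qed.

Lemma crv_eps : crv fullE (fun w => epsm z (mtr (A w) z)).
Proof.
have h := crv_mtrA; rewrite /epsm; apply: (crvD msy); last exact: (crvX msy).
apply: (crvD msy); first exact: (crv_cst msy).
by apply: (crvM msy) => //; exact: (crv_cst msy).
Qed.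

(** The fluctuation of [qrow] about its conditional mean given the other rows, which is the trace of
    the minor. *)
Definition zrow (X : 'M[complex R]_N) (i : 'I_N) : complex R := qrow X z i - mtr (rowz X i) z.

Lemma crv_zrow i : crv fullE (fun w => zrow (A w) i).
Proof. by apply: (crvB msy); [exact: crv_qrow|apply: (crvT msy); exact: crv_mtr_minor]. Qed.

Lemma zrowE X i : zrow X i = qf (row i X) (res (rowz X i) z) - rc N%:R^-1 * \sum_j res (rowz X i) z j j.
Proof. by rewrite /zrow /mtr /mxtrace natrC fmorphV. Qed.

Lemma dominated_entry (C B : 'M[complex R]_N) eta j l : 0 < eta -> dominated eta C B ->
  cabs (C j l) <= Num.sqrt (eta^-1 * ip (B j j)).
Proof.
move=> e0 dom; have [h1 _] := dom (delta_mx 0 j); rewrite qf_delta in h1.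
have h2 : cabs (C j l) ^+ 2 <= eta^-1 * ip (B j j).
  rewrite -ler_pdivrMl ?invr_gt0// invrK; apply: le_trans h1; rewrite ler_pM2l//.
  rewrite (bigD1 l)//= -rowE mxE lerDl sumr_ge0// => k _; exact: sqr_ge0.
rewrite -[leLHS]ger0_norm ?cabs_ge0// -sqrtr_sqr; exact: ler_wsqrtr.
Qed.

Lemma mom_entry i (C : T -> 'M[complex R]_N) p K : (forall j l, crv (off_row i) (fun w => C w j l)) ->
  (forall w, dominated (ip z) (C w) (res (rowz (A w) i) z)) -> 0 <= K ->
  (forall j, mom p (fun w => ip (res (rowz (A w) i) z j j)) K) ->
  forall j l, mom (2 * p) (fun w => cabs (C w j l)) (Num.sqrt ((ip z)^-1 * K)).
Proof.
move=> cC dom K0 h j l.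
have rB : rv (off_row i) (fun w => (ip z)^-1 * ip (res (rowz (A w) i) z j j)).
  by apply: (rvM msy); [exact: (rv_cst msy)|apply: rv_ip; exact: crv_minor].
have B0 w : 0 <= (ip z)^-1 * ip (res (rowz (A w) i) z j j).
  by rewrite mulr_ge0 ?invr_ge0 ?(ltW z0)//; exact: ip_res_ge0.
apply: (mom_le msy (S := off_row i) _ _ _ (fun w => dominated_entry j l z0 (dom w))).
- by apply: (rv_cabs msy).
- exact: (rv_sqrt msy).
- by move=> w; exact: cabs_ge0.
apply: mom_sqrt => //; first by rewrite mulr_ge0// invr_ge0 ltW.
apply: (momZ msy (S := off_row i)) => //; first by rewrite invr_ge0 ltW.
by apply: rv_ip; exact: crv_minor.
Qed.

Lemma N_gt0 (i : 'I_N) : (0 < N)%N. Proof. exact: leq_ltn_trans (ltn_ord i). Qed.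

Lemma mom_ip i p K : (forall j, mom p.+1 (fun w => cabs (res (rowz (A w) i) z j j)) K) ->
  forall j, mom p.+1 (fun w => ip (res (rowz (A w) i) z j j)) K.
Proof.
move=> h j; apply: (mom_le msy (S := off_row i)) (h j).
- by apply: rv_ip; exact: crv_minor.
- by apply: (rv_cabs msy); exact: crv_minor.
- by move=> w; exact: ip_res_ge0.
- by move=> w; exact: ip_le_cabs.
Qed.

Lemma mom_ip_mtr i p K : 0 < K -> (forall j, mom p.+1 (fun w => ip (res (rowz (A w) i) z j j)) K) ->
  mom p.+1 (fun w => ip (mtr (rowz (A w) i) z)) K.
Proof.
move=> K0 h.
have -> : (fun w => ip (mtr (rowz (A w) i) z)) = (fun w => N%:R^-1 * \sum_j ip (res (rowz (A w) i) z j j)).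
  by apply/funext => w; rewrite ip_mtr.
apply: (mom_avg msy (S := off_row i)) => //; first exact: N_gt0 i.
- by move=> j; apply: rv_ip; exact: crv_minor.
- by move=> j w; exact: ip_res_ge0.
Qed.

Lemma nu2 : nu R N ^+ 2 = Num.sqrt N%:R^-1.
Proof. by rewrite sqr_sqrtr// sqrtr_ge0. Qed.

Definition cz (n : nat) : R := 10000 * e0 R ^+ 5 * n%:R ^+ 4 * Cm ^+ 4.

Lemma cz_ge1 n : (0 < n)%N -> 1 <= cz n.
Proof.
move=> n0; have e1 := e0_ge1 R; have C1 := rm_cst M.
rewrite /cz; apply: mulr_ege1; last exact: exprn_ege1.
apply: mulr_ege1; last by apply: exprn_ege1; rewrite ler1n.
by apply: mulr_ege1; [lra|exact: exprn_ege1].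
Qed.

(** The theta of [quadratic_concentration] is sqrt(K/Ne). Entries of the minor have size sqrt(K/Im
    z) by domination, and as nu^2 = N^(-1/2) the condition on nu^2 kap becomes an equality. *)
Lemma zrow_mom i q K : ip z <= 1 -> 1 <= K -> 1 <= N%:R * ip z ->
  (forall j, mom (2 * q.+1) (fun w => cabs (res (rowz (A w) i) z j j)) K) ->
  mom (4 * q.+1) (fun w => cabs (zrow (A w) i)) (cz (4 * q.+1) * Num.sqrt (K / (N%:R * ip z))).
Proof.
move=> z1 K1 Nz h.
have K0 : 0 < K by lra.
have Nz0 : 0 < N%:R * ip z by lra.
have Np : 0 < N%:R :> R by rewrite ltr0n; exact: N_gt0 i.
have h' : forall j, mom (2 * q.+1) (fun w => ip (res (rowz (A w) i) z j j)) K.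
  by move: h; rewrite (_ : 2 * q.+1 = (2 * q).+2)%N; [exact: mom_ip|rewrite mulnS].
have th2 : Num.sqrt (K / (N%:R * ip z)) ^+ 2 = K / (N%:R * ip z) by rewrite sqr_sqrtr// divr_ge0 ?ltW.
have t0 : 0 < Num.sqrt (K / (N%:R * ip z)) by rewrite sqrtr_gt0 divr_gt0.
have thE : N%:R * ip z * Num.sqrt (K / (N%:R * ip z)) ^+ 2 = K.
  by rewrite th2 mulrC divfK// gt_eqF.
have nu2le : nu R N ^+ 2 <= 1.
  rewrite nu2 -[leRHS]sqrtr1 ler_wsqrtr//; exact: Ninv_le1 i.
have -> : (fun w => cabs (zrow (A w) i)) = (fun w => cabs (qf (row i (A w)) (res (rowz (A w) i) z) -
    rc N%:R^-1 * \sum_j res (rowz (A w) i) z j j)) by apply/funext => w; rewrite zrowE.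
apply: (@quadratic_concentration _ _ _ _ _ _ _ _ M i (fun w => res (rowz (A w) i) z)
  (fun w => res (rowz (A w) i) z) (ip z) q _ _ _ _ (fun w => ip (mtr (rowz (A w) i) z)) K K
  (Num.sqrt ((ip z)^-1 * K)) (Num.sqrt (K / (N%:R * ip z)))) => //.
- by move=> a b; exact: crv_minor.
- by move=> a; exact: crv_minor.
- by move=> w; exact: dominated_res.
- by apply: (rvT msy (S := off_row i)); apply: rv_ip; exact: crv_mtr_minor.
- move=> w; rewrite -zrowE -/(qrow _ _ _).
  have -> : qrow (A w) z i = mtr (rowz (A w) i) z + zrow (A w) i by rewrite /zrow addrC subrK.
  by rewrite ipD lerD2l; exact: ip_le_cabs.
- by move=> w; rewrite ip_mtr.
- by rewrite sqrtr_gt0 mulr_gt0// invr_gt0.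
- by move: h'; rewrite (_ : 2 * q.+1 = (2 * q).+2)%N ?mulnS//; exact: mom_ip_mtr.
- have e4 : (4 * q.+1 = 2 * (2 * q.+1))%N by rewrite mulnA.
  move=> j l; rewrite e4.
  apply: (@mom_entry i (fun w => res (rowz (A w) i) z) (2 * q.+1) K _ _ (ltW K0) h' j l).
    by move=> a b; exact: crv_minor.
  by move=> w; exact: dominated_res.
- by rewrite thE.
- move: thE t0 Nz; set t := Num.sqrt _; set x := N%:R * _ => e tp x1.
  have h1 : 1 <= (x * t) ^+ 2 by rewrite exprMn expr2 -mulrA e; exact: mulr_ege1.
  have h2 : 0 <= x * t by apply: mulr_ge0; lra.
  by move: h1 h2; set u := x * t => *; nra.
- by rewrite thE ler_piMl// ltW.
- have -> : K / (N%:R * ip z) = N%:R^-1 * ((ip z)^-1 * K) by rewrite invfM mulrC mulrA.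
  by rewrite nu2 [in leRHS]sqrtrM// invr_ge0 ltW.
Qed.

End Model.

Lemma ord84S q : (8 * q.+1 = 4 * (2 * q).+2)%N. Proof. by lia. Qed.
Lemma ord24S q : (2 * (2 * q).+2 = 4 * q.+1)%N. Proof. by lia. Qed.
Lemma ord8P q : (8 * q.+1 = (8 * q.+1).-1.+1)%N. Proof. by lia. Qed.
Lemma ord4P q : (4 * q.+1 = (4 * q.+1).-1.+1)%N. Proof. by lia. Qed.
Lemma ord82 q : (8 * q.+1 = 4 * q.+1 * 2)%N. Proof. by lia. Qed.
Lemma ord28 q : (8 * q.+1 = 2 * (4 * q.+1))%N. Proof. by lia. Qed.
Lemma ord2P q : (2 * q.+1 = (2 * q).+2)%N. Proof. by lia. Qed.
Lemma ord24 q : (4 * q.+1 = 2 * (2 * q.+1))%N. Proof. by lia. Qed.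

(** * Deviation and minors at one spectral parameter *)

Section OneScale.
Context d (T : measurableType d) (R : realType) (P : probability T R).
Variable N : nat.
Local Notation E := ('I_N * 'I_N)%type.
Local Notation fullE := ([set: E]%SET).
Variables (ms : {set E} -> (T -> R) -> Prop) (A : T -> 'M[complex R]_N) (Cm : R).
Hypothesis M : rmodel P ms A Cm.
Let msy := rm_sys M.
Local Notation mom := (mom P).
Local Notation rv := (rv ms).
Local Notation crv := (crv ms).
Local Notation cz := (@cz R Cm).
Variable z : complex R.
Hypothesis z0 : 0 < ip z.
Let Ne := N%:R * ip z.
Let B i w := res (rowz (A w) i) z.
Let rz i : rv fullE (fun w => cabs (zrow z (A w) i)).
Proof. by apply: (rv_cabs msy); exact: (crv_zrow M). Qed.
Let rG i : rv fullE (fun w => cabs (gdiag (A w) z i)).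
Proof. by apply: (rv_cabs msy); exact: (crv_gdiag M). Qed.

Lemma mtr_qrow (X : 'M[complex R]_N) i : cabs (mtr X z - qrow X z i) <= cabs (zrow z X i) + Ne^-1.
Proof.
have -> : mtr X z - qrow X z i = (mtr X z - mtr (rowz X i) z) - zrow z X i.
  by rewrite /zrow; move: (mtr X z) (mtr (rowz X i) z) (qrow X z i) => a b c; ring.
apply: le_trans (cabsB _ _) _; rewrite addrC lerD2l; exact: mtr_diff.
Qed.

Lemma eps_le (X : 'M[complex R]_N) : (0 < N)%N ->
  cabs (epsm z (mtr X z)) <= N%:R^-1 * \sum_i cabs (gdiag X z i) * (cabs (zrow z X i) + Ne^-1).
Proof.
move=> N0; rewrite eps_avg// cabsM cabsV cabs_nat ler_wpM2l ?invr_ge0//.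
apply: le_trans (cabs_sum _ _ _) _; apply: ler_sum => i _.
by rewrite cabsM ler_wpM2l ?cabs_ge0// mtr_qrow.
Qed.

Section Deviation.
Variables (q : nat) (K : R).
Hypotheses (re0 : 0 <= rp z) (re2 : rp z <= 2) (z1 : ip z <= 1) (K1 : 1 <= K) (NK : K <= Ne).
Hypothesis hG : forall i, mom (8 * q.+1) (fun w => cabs (gdiag (A w) z i)) K.
Hypothesis hB : forall i j, mom (4 * q.+1) (fun w => cabs (B i w j j)) K.
Let theta := Num.sqrt (K / Ne).
Let D := cz (8 * q.+1).

Let K0 : 0 < K. Proof. by move: K1; apply: lt_le_trans. Qed.
Let Ne0 : 0 < Ne. Proof. by move: NK; apply: lt_le_trans. Qed.
Let Ne1 : 1 <= Ne. Proof. exact: le_trans NK. Qed.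
Let D1 : 1 <= D. Proof. exact: (cz_ge1 M). Qed.
Let th0 : 0 < theta. Proof. by rewrite sqrtr_gt0 divr_gt0. Qed.
Let th1 : theta <= 1.
Proof. by rewrite -[leRHS]sqrtr1 ler_wsqrtr// ler_pdivrMr// mul1r. Qed.
Let iNe : Ne^-1 <= theta.
Proof.
have h : 0 <= Ne^-1 by rewrite invr_ge0 ltW.
rewrite -[leLHS]ger0_norm// -sqrtr_sqr ler_wsqrtr//.
have h1 : Ne^-1 <= 1 by rewrite invf_le1.
move: h h1; set y := Ne^-1 => h h1; rewrite expr2 ler_wpM2r//.
exact: le_trans K1.
Qed.
Let N0 : (0 < N)%N.
Proof. by rewrite lt0n; apply/eqP => e; move: Ne0; rewrite /Ne e mul0r ltxx. Qed.

Let zm i : mom (8 * q.+1) (fun w => cabs (zrow z (A w) i)) (D * theta).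
Proof.
have e1 := ord84S q.
have e2 := ord24S q.
have := @zrow_mom _ _ _ _ _ _ _ _ M z z0 i (2 * q).+1 K z1 K1 Ne1.
by rewrite -e1 e2 => /(_ (hB i)).
Qed.

Let e8 := ord8P q.
Let e4 := ord4P q.
Let e82 := ord82 q.
Let e28 := ord28 q.
Let Dth : 0 < D * theta. Proof. by apply: mulr_gt0 => //; apply: lt_le_trans D1. Qed.

Let zm' i : mom (8 * q.+1) (fun w => cabs (zrow z (A w) i) + Ne^-1) (2 * D * theta).
Proof.
have c := mom_cst P (8 * q.+1) Ne^-1.
have zi := zm i; rewrite e8 in c zi *.
have i0 : 0 < Ne^-1 by rewrite invr_gt0.
have := mom_add msy (S := fullE) (rz i) (rv_cst msy _ _) (fun w => cabs_ge0 _) (fun=> ltW i0) Dth i0 zi c.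
apply: mom_ler; first by apply: addr_ge0; exact: ltW.
have : theta <= D * theta by rewrite ler_peMl// ltW.
by move: iNe; set x := Ne^-1; set y := D * theta => *; rewrite -mulrA -/y; lra.
Qed.

Let rz' i : rv fullE (fun w => cabs (zrow z (A w) i) + Ne^-1).
Proof. by apply: (rvD msy) => //; exact: (rv_cst msy). Qed.

Lemma eps_mom : mom (4 * q.+1) (fun w => cabs (epsm z (mtr (A w) z))) (2 * K * D * theta).
Proof.
have r1 i : rv fullE (fun w => cabs (gdiag (A w) z i) * (cabs (zrow z (A w) i) + Ne^-1)).
  by apply: (rvM msy).
have p1 i w : 0 <= cabs (gdiag (A w) z i) * (cabs (zrow z (A w) i) + Ne^-1).
  by rewrite mulr_ge0 ?addr_ge0 ?cabs_ge0// invr_ge0 ltW.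
have c0 : 0 < 2 * K * D * theta by rewrite -mulrA mulr_gt0// mulr_gt0.
apply: (mom_le msy (S := fullE) (g := fun w => N%:R^-1 * \sum_i cabs (gdiag (A w) z i) * (cabs (zrow z (A w) i) + Ne^-1))).
- by apply: (rv_cabs msy); exact: (crv_eps M z0).
- by apply: (rvM msy); [exact: (rv_cst msy)|exact: (rv_sum msy)].
- by move=> w; exact: cabs_ge0.
- by move=> w; exact: eps_le.
rewrite e4; apply: (mom_avg msy (S := fullE)) => // i; rewrite -e4.
have -> : 2 * K * D * theta = K * (2 * D * theta) by ring.
apply: (mom_mul msy (S := fullE)) => //.
- by rewrite -mulrA mulr_gt0.
- by rewrite -e82.
- by rewrite -e82.
Qed.

(** The root of theta, instead of theta, is the price for uniformity up to the edge: m - msc is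
    estimated here only through the square root of the defect. *)
Lemma deviation_mom i :
  mom (8 * q.+1) (fun w => cabs (qrow (A w) z i - msc z)) (6 * K * D * Num.sqrt theta).
Proof.
have rL : rv fullE (fun w => Num.sqrt (4 * cabs (epsm z (mtr (A w) z)))).
  apply: (rv_sqrt msy); apply: (rvM msy); first exact: (rv_cst msy).
  by apply: (rv_cabs msy); exact: (crv_eps M z0).
apply: (mom_le msy (S := fullE) (g := fun w => (cabs (zrow z (A w) i) + Ne^-1) + Num.sqrt (4 * cabs (epsm z (mtr (A w) z))))).
- by apply: (rv_cabs msy); apply: (crvB msy); [exact: (crv_qrow M)|exact: (crv_cst msy)].
- exact: (rvD msy).
- by move=> w; exact: cabs_ge0.
- move=> w.
  have -> : qrow (A w) z i - msc z = - (mtr (A w) z - qrow (A w) z i) + (mtr (A w) z - msc z) by ring.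
  apply: le_trans (cabsD _ _) _; rewrite cabsN; apply: lerD; first exact: mtr_qrow.
  rewrite -[leLHS]ger0_norm ?cabs_ge0// -sqrtr_sqr ler_wsqrtr//.
  by apply: lam_sq_eps => //; exact: ip_mtr_ge0.
have c0 : 0 < 2 * K * D * theta by rewrite -mulrA mulr_gt0// mulr_gt0.
have hs : mom (8 * q.+1) (fun w => Num.sqrt (4 * cabs (epsm z (mtr (A w) z)))) (Num.sqrt (4 * (2 * K * D * theta))).
  rewrite e28; apply: mom_sqrt => //.
  - by move=> w; rewrite mulr_ge0// cabs_ge0.
  - by rewrite mulr_ge0// ltW.
  apply: (momZ msy (S := fullE)) => //; first by apply: (rv_cabs msy); exact: (crv_eps M z0).
  exact: eps_mom.
have zi := zm' i; rewrite e8 in hs zi *.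
have d0 : 0 < 2 * D * theta by rewrite -mulrA mulr_gt0.
have s0 : 0 < Num.sqrt (4 * (2 * K * D * theta)) by rewrite sqrtr_gt0 mulr_gt0.
have i0 : 0 <= Ne^-1 by rewrite invr_ge0 ltW.
have := mom_add msy (S := fullE) (rz' i) rL (fun w => addr_ge0 (cabs_ge0 _) i0) (fun w => sqrtr_ge0 _) d0 s0 zi hs.
apply: mom_ler; first by apply: addr_ge0; exact: ltW.
have KD : 1 <= K * D by exact: mulr_ege1.
have KD0 : 0 <= K * D := le_trans ler01 KD.
have sth : Num.sqrt theta ^+ 2 = theta by rewrite sqr_sqrtr// ltW.
have sp : 0 < Num.sqrt theta by rewrite sqrtr_gt0.
have s1 : theta <= Num.sqrt theta.
  by rewrite -[leLHS]ger0_norm ?(ltW th0)// -sqrtr_sqr ler_wsqrtr// expr2 ler_piMl// ltW.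
have b1 : Num.sqrt (4 * (2 * K * D * theta)) <= 3 * (K * D) * Num.sqrt theta.
  rewrite -[leRHS]ger0_norm; last by apply: mulr_ge0; [lra|exact: ltW].
  rewrite -sqrtr_sqr ler_wsqrtr// exprMn sth.
  have -> : 4 * (2 * K * D * theta) = (8 * (K * D)) * theta by ring.
  rewrite ler_wpM2r ?(ltW th0)// expr2; move: KD; set x := K * D => *; nra.
have b2 : 2 * D * theta <= 2 * (K * D) * Num.sqrt theta.
  have hh : D <= K * D by rewrite ler_peMl// (le_trans _ D1).
  apply: ler_pM => //; [|exact: ltW|by rewrite ler_pM2l].
  by apply: mulr_ge0 => //; exact: le_trans D1.
have hp : 0 <= K * D * Num.sqrt theta by apply: mulr_ge0; [exact: KD0|exact: ltW].
apply: le_trans (lerD b2 b1) _; rewrite -![_ * K * D]mulrA; move: hp; set x := K * D; rewrite -!(mulrA _ x); set y := x * _; lra.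
Qed.
End Deviation.

Section Minor.
Variables (q : nat) (K a kap : R) (i : 'I_N).
Hypotheses (K0 : 0 < K) (a0 : 0 < a) (kap0 : 0 < kap).
Hypothesis hG : mom (2 * q.+1) (fun w => cabs (gdiag (A w) z i)) K.
Hypothesis hB : forall j, mom (2 * q.+1) (fun w => cabs (B i w j j)) K.
Hypothesis hC : forall j k, mom (4 * q.+1) (fun w => cabs (B i w j k)) kap.

Definition lconst (n : nat) (K kap : R) := 16 * e0 R ^+ 3 * n%:R ^+ 2 * (Num.sqrt (K / Ne) + Cm * kap * nu R N).

Let L := lconst (4 * q.+1) K kap.
Let Np : 0 < N%:R :> R. Proof. by rewrite ltr0n; exact: N_gt0 i. Qed.
Let Ne0 : 0 < Ne. Proof. by rewrite mulr_gt0. Qed.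
Let sN : 0 < Num.sqrt (K / Ne). Proof. by rewrite sqrtr_gt0 divr_gt0. Qed.
Let L0 : 0 < L.
Proof.
have e1 := e0_gt0 R; have C1 := rm_cst M; have n0 := nu_ge0 R N.
have h : 0 < 16 * e0 R ^+ 3 * (4 * q.+1)%:R ^+ 2.
  by rewrite mulr_gt0 ?exprn_gt0 ?ltr0n// mulr_gt0// exprn_gt0.
rewrite /L /lconst; apply: mulr_gt0 => //.
apply: (lt_le_trans sN); rewrite lerDl; apply: mulr_ge0 => //.
by apply: mulr_ge0; [lra|exact: ltW].
Qed.
Let e2q := ord2P q.
Let e4q := ord24 q.

Let lin (v : 'I_N -> T -> complex R) (j : 'I_N) : (forall k, crv (off_row i) (v k)) ->
  (forall k, mom (4 * q.+1) (fun w => cabs (v k w)) kap) ->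
  (forall w, ip z * \sum_k cabs (v k w) ^+ 2 <= ip (B i w j j)) ->
  mom (4 * q.+1) (fun w => cabs (\sum_k A w i k * v k w)) L.
Proof.
move=> cv mv hv; apply: (linear_concentration M) => //.
have rB : rv (off_row i) (fun w => Ne^-1 * ip (B i w j j)).
  by apply: (rvM msy); [exact: (rv_cst msy)|apply: rv_ip; exact: (crv_minor M)].
have B0 w : 0 <= ip (B i w j j) by exact: ip_res_ge0.
have iN0 : 0 <= Ne^-1 by rewrite invr_ge0 ltW.
apply: (mom_le msy (S := off_row i) (g := fun w => Num.sqrt (Ne^-1 * ip (B i w j j)))).
- apply: (rv_sqrt msy); apply: (rvM msy); first exact: (rv_cst msy).
  by apply: (rv_sum msy) => k _; apply: (rvX msy); exact: (rv_cabs msy).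
- exact: (rv_sqrt msy).
- by move=> w; exact: sqrtr_ge0.
- move=> w; apply: ler_wsqrtr; rewrite /Ne invfM -mulrA ler_wpM2l ?invr_ge0 ?(ltW Np)//.
  by rewrite -ler_pdivrMl ?invr_gt0// invrK.
rewrite e4q; apply: mom_sqrt.
- by move=> w; rewrite mulr_ge0.
- by rewrite divr_ge0 ?ltW.
rewrite mulrC; apply: (momZ msy (S := off_row i)) => //.
  by apply: rv_ip; exact: (crv_minor M).
by move: hB; rewrite e2q => hB'; exact: (mom_ip M z0 hB' j).
Qed.

(** Sherman-Morrison read backwards: an entry of the minor is the full entry plus G_i times two
    linear forms in the removed row. The crude bounds [K] and [kap] enter only through these forms,
    so [a] is kept up to K L^2. *)
Lemma minor_mom j : mom q.+1 (fun w => cabs (res (A w) z j j)) a ->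
  mom q.+1 (fun w => cabs (B i w j j)) (a + K * L ^+ 2).
Proof.
move=> ha.
have cB a' b : crv (off_row i) (fun w => B i w a' b) by exact: (crv_minor M).
pose v w := \sum_k A w i k * B i w k j.
pose u w := \sum_k A w i k * (B i w j k)^*%C.
have mv : mom (4 * q.+1) (fun w => cabs (v w)) L.
  apply: (lin (v := fun k w => B i w k j) (j := j)) => // w.
  have [_ h] := dominated_res (rowz (A w) i) z0 (delta_mx 0 j); rewrite qf_delta in h.
  apply: le_trans h; rewrite ler_pM2l// le_eqVlt; apply/orP; left; apply/eqP; apply: eq_bigr => k _; congr (cabs _ ^+ 2).
  rewrite [RHS]mxE (bigD1 j)//= big1 ?addr0 => [|b bj].
    by rewrite adjE [delta_mx _ _ _ _]mxE !eqxx /= oppr0 mulr1.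
  by rewrite adjE [delta_mx _ _ _ _]mxE (negbTE bj) /= oppr0 mulr0.
have mu : mom (4 * q.+1) (fun w => cabs (u w)) L.
  apply: (lin (v := fun k w => (B i w j k)^*%C) (j := j)) => [k|k|w].
  - exact: (crvJ msy).
  - have -> : (fun w => cabs (B i w j k)^*%C) = (fun w => cabs (B i w j k)) by apply/funext => w; rewrite cabsJ.
    by [].
  have [h _] := dominated_res (rowz (A w) i) z0 (delta_mx 0 j); rewrite qf_delta in h.
  apply: le_trans h; rewrite ler_pM2l// le_eqVlt; apply/orP; left; apply/eqP; apply: eq_bigr => k _.
  by rewrite cabsJ -rowE [in RHS]mxE.
have cv : crv fullE v.
  by apply: (crv_sum msy) => k _; apply: (crvM msy); [exact: (crv_full M)|apply: (crvT msy); exact: cB].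
have cu : crv fullE u.
  by apply: (crv_sum msy) => k _; apply: (crvM msy); [exact: (crv_full M)|apply: (crvJ msy); apply: (crvT msy); exact: cB].
have rv1 : rv fullE (fun w => cabs (v w)) by exact: (rv_cabs msy).
have ru1 : rv fullE (fun w => cabs (u w)) by exact: (rv_cabs msy).
have muv : mom (2 * q.+1) (fun w => cabs (u w) * cabs (v w)) (L * L).
  by apply: (mom_mul msy (S := fullE)) => //; rewrite mulnC mulnA.
have mguv : mom q.+1 (fun w => cabs (gdiag (A w) z i) * (cabs (u w) * cabs (v w))) (K * (L * L)).
  apply: (mom_mul msy (S := fullE)) => //; [exact: (rvM msy)|exact: mulr_gt0| |]; by rewrite mulnC.
apply: (mom_le msy (S := fullE) (g := fun w => cabs (res (A w) z j j) + cabs (gdiag (A w) z i) * (cabs (u w) * cabs (v w)))).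
- by apply: (rv_cabs msy); apply: (crvT msy); exact: cB.
- apply: (rvD msy); first by apply: (rv_cabs msy); exact: (crv_resA M).
  by apply: (rvM msy) => //; exact: (rvM msy).
- by move=> w; exact: cabs_ge0.
- move=> w; set G := (z + qrow (A w) z i)^-1.
  set x := (B i w *m (row i (A w))^t*) j 0; set y := (row i (A w) *m B i w) 0 j.
  have e : res (A w) z j j = B i w j j - G * (x * y).
    rewrite (res_rank1 (A w) i z0) [LHS]mxE; congr (_ + _); rewrite [LHS]mxE; congr (- _).
    rewrite [LHS]mxE; congr (_ * _); by rewrite [LHS]mxE big_ord1.
  have -> : B i w j j = res (A w) z j j + G * (x * y) by rewrite e subrK.
  apply: le_trans (cabsD _ _) _; rewrite lerD2l 2!cabsM.
  have -> : cabs x = cabs (u w).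
    rewrite /x mxE -(cabsJ (u w)) /u; congr cabs; rewrite -conjCE rmorph_sum; apply: eq_bigr => k _.
    by rewrite rmorphM /= !conjCE conjcK mulrC adjE [row i (A w) 0 k]mxE.
  have -> : cabs y = cabs (v w).
    by rewrite /y mxE; congr cabs; apply: eq_bigr => k _; rewrite [row i (A w) 0 k]mxE.
  by rewrite /gdiag cabsN.
rewrite expr2; apply: (mom_add msy (S := fullE)) => //.
- by apply: (rv_cabs msy); exact: (crv_resA M).
- by apply: (rvM msy) => //; exact: (rvM msy).
- by move=> w; exact: cabs_ge0.
- by move=> w; rewrite mulr_ge0 ?cabs_ge0// mulr_ge0 ?cabs_ge0.
- by rewrite mulr_gt0// mulr_gt0.
Qed.
End Minor.
End OneScale.

(** * Dyadic ladder of scales *)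

Section Scales.
Variable R : realType.

(** If [f k] is large, trace it back to a scale l where [f] was at most 2: the next scale has V >
    1/2, and each later halving at most doubles [f]. *)
Lemma last_good_scale (f V : nat -> R) : f 0%N <= 2 -> (forall l, f l.+1 <= 2 * f l) ->
  (forall l, V l <= 1 / 2 -> f l <= 2) ->
  forall k, f k <= 2 \/ exists2 l, (l < k)%N & 1 / 2 < V l.+1 /\ f k <= 4 * 2 ^+ (k - l.+1).
Proof.
move=> f0 fh fV; elim=> [|k IH]; first by left.
have [h|h] := leP (V k.+1) (1 / 2); first by left; exact: fV.
right; case: IH => [h2|[l lk [Vl h2]]].
  exists k => //; split => //; rewrite subnn expr0; have := fh k; lra.
exists l; first exact: ltnW.
split => //; rewrite subSn// exprS; have := fh k; lra.
Qed.

(** In the case of index l the number 2 V exceeds 1, so any power of it may be inserted, as in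
    Markov's inequality. The power 8 Q is the order available from [deviation_mom]. *)
Lemma last_good_scale_sum (f V : nat -> R) Q : (forall l, 0 <= f l) -> (forall l, 0 <= V l) ->
  f 0%N <= 2 -> (forall l, f l.+1 <= 2 * f l) -> (forall l, V l <= 1 / 2 -> f l <= 2) ->
  forall k, f k ^+ Q <= 2 ^+ Q + \sum_(l < k) (4 * 2 ^+ (k - l.+1)) ^+ Q * (2 * V l.+1) ^+ (8 * Q).
Proof.
move=> fp Vp f0 fh fV k.
have t0 (l : nat) : 0 <= (4 * 2 ^+ (k - l.+1)) ^+ Q * (2 * V l.+1) ^+ (8 * Q).
  by apply: mulr_ge0; apply: exprn_ge0; apply: mulr_ge0 => //; exact: exprn_ge0.
case: (last_good_scale f0 fh fV k) => [h|[l lk [Vl h]]].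
  have : f k ^+ Q <= 2 ^+ Q by rewrite lerXn2r ?nnegrE.
  by move=> h1; apply: le_trans h1 _; rewrite lerDl sumr_ge0// => l _; exact: t0.
rewrite (bigD1 (Ordinal lk))//= addrCA -[leLHS]addr0; apply: lerD.
  have h1 : f k ^+ Q <= (4 * 2 ^+ (k - l.+1)) ^+ Q.
    by rewrite lerXn2r ?nnegrE// mulr_ge0// exprn_ge0.
  apply: le_trans h1 _; apply: ler_peMr.
    by apply: exprn_ge0; apply: mulr_ge0 => //; exact: exprn_ge0.
  by apply: exprn_ege1; lra.
by apply: addr_ge0; [exact: exprn_ge0|apply: sumr_ge0 => j _; exact: t0].
Qed.

Lemma half_sum k : \sum_(l < k) (2^-1 : R) ^+ (k - l) <= 1.
Proof.
elim: k => [|k IH]; first by rewrite big_ord0.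
rewrite big_ord_recl /= subn0.
under eq_bigr => i _ do rewrite /bump /= add1n subSS.
have e : (2^-1 : R) ^+ k.+1 <= 2^-1 ^+ k by rewrite ler_wiXn2l//; lra.
move: IH; suff : \sum_(i < k) (2^-1 : R) ^+ (k - i) = 1 - 2^-1 ^+ k.
  by move=> -> _; lra.
clear; elim: k => [|k IH]; first by rewrite big_ord0 expr0 subrr.
rewrite big_ord_recl /= subn0.
under eq_bigr => i _ do rewrite /bump /= add1n subSS.
by rewrite IH exprS; set x := _ ^+ k; lra.
Qed.

(** Off-diagonal entries grow at most linearly in the number of scales. This inequality absorbs that
    growth into nu = N^(-1/4), or into the fourth root of 1/Im z. *)
Lemma pow4_le_exp2 l : (l.+1%:R : R) ^+ 4 <= 256 * 2 ^+ l.
Proof.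
have h n : ((n + 6) ^ 4 <= 256 * 2 ^ (n + 5))%N.
  elim: n => [//|n IH].
  rewrite !addSn (expnS 2).
  have h2 : ((n + 6).+1 ^ 4 <= 2 * (n + 6) ^ 4)%N.
    by rewrite -![(_ ^ 4)%N]/(_ * (_ * (_ * _)))%N; nia.
  apply: (leq_trans h2); rewrite [leqRHS]mulnCA leq_pmul2l//.
have : (l.+1 ^ 4 <= 256 * 2 ^ l)%N.
  case: l => [|[|[|[|[|l]]]]] //.
  by have := h l; rewrite !addnS !addn0.
by rewrite -(ler_nat R) natrM !natrX.
Qed.

Context d (T : measurableType d) (P : probability T R).
Variables (E : finType) (ms : {set E} -> (T -> R) -> Prop).
Hypothesis msy : msystem P ms.
Local Notation fullE := ([set: E]%SET).

(** Beyond the threshold, doubling at each halving of the height produces exactly the ratio of [thr]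
    to the present value of N y. The 8 is the bound 4 doubled once, at the first scale beyond the
    threshold. *)
Lemma halving_mom (f : nat -> T -> R) (N : nat) Q thr : (0 < N)%N -> 0 < thr ->
  (forall l, rv ms fullE (f l)) -> (forall l w, 0 <= f l w) ->
  (forall w, f 0%N w <= 1) -> (forall l w, f l.+1 w <= 2 * f l w) ->
  forall k, (forall l, (l <= k)%N -> thr <= N%:R * 2^-1 ^+ l -> mom P Q.+1 (f l) 4) ->
  mom P Q.+1 (f k) (8 * Num.max 1 (thr / (N%:R * 2^-1 ^+ k))).
Proof.
move=> N0 t0 rf f0 f1 fh; have Np : 0 < N%:R :> R by rewrite ltr0n.
have Nk l : 0 < N%:R * 2^-1 ^+ l :> R by rewrite mulr_gt0// exprn_gt0.
elim=> [|k IH] h.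
  apply: (mom_ler (a := 1)) => //.
    have : 1 <= Num.max 1 (thr / (N%:R * 2^-1 ^+ 0)) by rewrite le_max lexx.
    lra.
  exact: (mom_bound msy _ (rf 0%N) (f0 0%N) f1).
have mx : 1 <= Num.max 1 (thr / (N%:R * 2^-1 ^+ k.+1)) by rewrite le_max lexx.
have [g|g] := leP thr (N%:R * 2^-1 ^+ k.+1).
  by apply: (mom_ler (a := 4)) => //; [lra|exact: h].
have m2 a : 0 <= a -> mom P Q.+1 (f k) a -> mom P Q.+1 (f k.+1) (2 * a).
  move=> a0 ma; apply: (mom_le msy (S := fullE) (g := fun w => 2 * f k w)) => //.
    by apply: (rvM msy) => //; exact: (rv_cst msy).
  exact: (momZ msy (S := fullE)).
have [g'|g'] := leP thr (N%:R * 2^-1 ^+ k).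
  apply: (mom_ler (a := 2 * 4)) => //; first lra.
  by apply: m2 => //; apply: h.
have IH' := IH (fun l lk => h l (leqW lk)).
apply: mom_ler (m2 _ _ IH'); last 2 first.
- have h1 : 1 <= thr / (N%:R * 2^-1 ^+ k) by rewrite ler_pdivlMr// mul1r ltW.
  have -> : Num.max 1 (thr / (N%:R * 2^-1 ^+ k)) = thr / (N%:R * 2^-1 ^+ k) by apply/max_idPr.
  have -> : 2 * (8 * (thr / (N%:R * 2^-1 ^+ k))) = 8 * (thr / (N%:R * 2^-1 ^+ k.+1)).
    by rewrite exprS; field; rewrite expf_neq0 ?gt_eqF ?invr_gt0//.
  by rewrite ler_pM2l// le_max lexx orbT.
- by rewrite mulr_ge0// le_max ler01.
- by rewrite mulr_ge0// mulr_ge0// le_max ler01.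
Qed.

End Scales.

Section LadderConstants.
Variable R : realType.
Variable Cm : R.
(** The loss in passing from order q to orders up to 8 q at one scale: [thr] grows by at most 8^16,
    [halving_mom] contributes 8, and one more doubling leads to the next scale. *)
Definition lK : R := 16 * 8 ^+ 16.
(** Chosen so that 36 K^2 [cz] at order 8 q equals lH q^4. The deviation contains a fourth root of
    K/Ne, which raises this q^4 to the exponent 16 of the threshold. *)
Definition lH : R := 36 * lK ^+ 2 * (10000 * e0 R ^+ 5 * 8 ^+ 4 * Cm ^+ 4).
(* Threshold on [N * eta] beyond which moments of order [q] are of order one. *)
Definition thr (q : nat) : R := (lH * q%:R) ^+ 16.
Hypothesis C1 : 1 <= Cm.

Lemma lK_ge1 : 1 <= lK.
Proof. by rewrite /lK; apply: mulr_ege1; [lra|apply: exprn_ege1; lra]. Qed.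

Lemma lH_ge1 : 1 <= lH.
Proof.
have e1 := e0_ge1 R; rewrite /lH; apply: mulr_ege1.
  by apply: mulr_ege1; [lra|apply: exprn_ege1; exact: lK_ge1].
apply: mulr_ege1; last exact: exprn_ege1.
apply: mulr_ege1; last by apply: exprn_ege1; lra.
by apply: mulr_ege1; [lra|exact: exprn_ege1].
Qed.

Lemma thr_ge1 q : (0 < q)%N -> 1 <= thr q.
Proof.
by move=> q0; apply: exprn_ege1; apply: mulr_ege1; [exact: lH_ge1|rewrite ler1n].
Qed.

Lemma thr_mul m q : thr (m * q) = m%:R ^+ 16 * thr q.
Proof. by rewrite /thr natrM mulrCA exprMn. Qed.

Lemma thr_cz q : 36 * lK ^+ 2 * cz Cm (8 * q.+1) <= (lH * q.+1%:R) ^+ 4.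
Proof.
have h1 := lH_ge1.
have -> : 36 * lK ^+ 2 * cz Cm (8 * q.+1) = lH * q.+1%:R ^+ 4.
  by rewrite /cz /lH natrM exprMn; ring.
rewrite exprMn ler_wpM2r ?exprn_ge0//; exact: ler_eXnr.
Qed.
End LadderConstants.

Lemma mulP m q : (0 < m)%N -> (m * q.+1 = (m * q.+1).-1.+1)%N.
Proof. by move=> m0; rewrite prednK// muln_gt0 m0. Qed.

Section GoodScales.
Variable R : realType.
Variables (Cm : R) (C1 : 1 <= Cm).
Context d (T : measurableType d) (P : probability T R).
Variables (E : finType) (ms : {set E} -> (T -> R) -> Prop).
Hypothesis msy : msystem P ms.
Local Notation fullE := ([set: E]%SET).
Local Notation mom := (mom P).
Variable N : nat.
Hypothesis N0 : (0 < N)%N.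
Local Notation Ne l := (N%:R * 2^-1 ^+ l : R).

(** The induction hypothesis of the ladder: at scale l all orders whose threshold is still below N y
    have moments bounded by the one constant 4. *)
Definition good (f : nat -> T -> R) l := forall q, thr Cm q.+1 <= Ne l -> mom q.+1 (f l) 4.

Lemma Ne_gt0 l : 0 < Ne l. Proof. by rewrite mulr_gt0 ?ltr0n// exprn_gt0. Qed.

Lemma Ne_le l k : (l <= k)%N -> Ne k <= Ne l.
Proof. by move=> lk; rewrite ler_wpM2l// ler_wiXn2l//; lra. Qed.

Variable f : nat -> T -> R.
Hypothesis rf : forall l, rv ms fullE (f l).
Hypothesis f0 : forall l w, 0 <= f l w.
Hypothesis f1 : forall w, f 0%N w <= 1.
Hypothesis fh : forall l w, f l.+1 w <= 2 * f l w.

Lemma lK8 : lK R / 2 = 8 * 8 ^+ 16.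
Proof. by rewrite /lK; set x := 8 ^+ 16; lra. Qed.

Lemma good_bound k : (forall l, (l <= k)%N -> good f l) -> forall q,
  mom q.+1 (f k) (8 * Num.max 1 (thr Cm q.+1 / Ne k)).
Proof.
move=> g q; apply: (halving_mom msy) => //.
  by apply: lt_le_trans (thr_ge1 C1 _).
by move=> l lk h; exact: g.
Qed.

(** Orders up to 8 q are needed where only the threshold of order q is known to hold. Descending
    from the scale where the larger order was still good costs at most the ratio m^16 of the two
    thresholds, whatever q and the scale are; this prevents constants from growing along the
    ladder. *)
Lemma good_mom m q k : (0 < m <= 8)%N -> (forall l, (l <= k)%N -> good f l) ->
  thr Cm q.+1 <= Ne k -> mom (m * q.+1) (f k) (lK R / 2).
Proof.
move=> /andP[m0 m8] g h; rewrite mulP//; apply: mom_ler (good_bound g _).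
  by rewrite mulr_ge0// le_max ler01.
rewrite lK8 ler_pM2l// ge_max exprn_ege1 ?ler1n//=.
rewrite -mulP// thr_mul ler_pdivrMr ?Ne_gt0//; have t0 : 0 <= thr Cm q.+1 by apply: le_trans (thr_ge1 C1 _).
apply: ler_pM => //.
by rewrite lerXn2r ?nnegrE// ler_nat.
Qed.

Lemma next_mom m q k : (0 < m <= 8)%N -> (forall l, (l <= k)%N -> good f l) ->
  thr Cm q.+1 <= Ne k.+1 -> mom (m * q.+1) (f k.+1) (lK R).
Proof.
move=> m8 g h; apply: (mom_le msy (S := fullE) (g := fun w => 2 * f k w)) => //.
  by apply: (rvM msy) => //; exact: (rv_cst msy).
have -> : lK R = 2 * (lK R / 2) by rewrite mulrC divfK.
apply: (momZ msy _ (rf k)) => //; apply: good_mom => //.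
by apply: le_trans h _; exact: Ne_le.
Qed.

End GoodScales.

Section Ladder.
Context d (T : measurableType d) (R : realType) (P : probability T R).
Variable N : nat.
Hypothesis N0 : (0 < N)%N.
Local Notation E := ('I_N * 'I_N)%type.
Local Notation fullE := ([set: E]%SET).
Local Notation mom := (mom P).
Local Notation Ne l := (N%:R * 2^-1 ^+ l : R).
Variable s : R.
Hypotheses (s0 : 0 <= s) (s2 : s <= 2).

Definition sc l : complex R := (s +i* (2^-1 ^+ l))%C.
Lemma ip_sc l : ip (sc l) = 2^-1 ^+ l. Proof. by []. Qed.
Lemma sc_gt0 l : 0 < ip (sc l). Proof. exact: exprn_gt0. Qed.
Lemma sc_le1 l : ip (sc l) <= 1. Proof. by apply: exprn_ile1; lra. Qed.
Lemma scS l : sc l.+1 = (s +i* (2^-1 ^+ l / 2))%C. Proof. by rewrite /sc exprSr. Qed.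

Let half_gt0 l : 0 < 2^-1 ^+ l :> R. Proof. exact: exprn_gt0. Qed.
Let half_le (l : nat) : let x := (2^-1 : R) ^+ l in x / 2 <= x / 2 <= x.
Proof. have h := half_gt0 l; rewrite /= lexx /=; move: h; move: ((2^-1 : R) ^+ l) => x h; lra. Qed.

Lemma gdiag_half (X : 'M[complex R]_N) i l : cabs (gdiag X (sc l.+1) i) <= 2 * cabs (gdiag X (sc l) i).
Proof. by rewrite -2?res_adj_diag ?sc_gt0// scS; apply: res_half_diag (half_le l). Qed.

Lemma minor_half (X : 'M[complex R]_N) j l : cabs (res X (sc l.+1) j j) <= 2 * cabs (res X (sc l) j j).
Proof. by rewrite scS; apply: res_half_diag (half_le l). Qed.

(** The bounds of [res_half] added over all previous scales, so that off-diagonal entries are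
    controlled by diagonal ones only. *)
Lemma entry_chain (X : 'M[complex R]_N) j k l : cabs (res X (sc l) j k) <=
  1 + \sum_(a < l) 2^-1 * (cabs (res X (sc a) j j) + cabs (res X (sc a) k k)).
Proof.
elim: l => [|l IH].
  rewrite big_ord0 addr0; apply: le_trans (cabs_res _ _ _ (sc_gt0 0)) _.
  by rewrite ip_sc expr0 invr1.
rewrite big_ord_recr /= addrA scS; apply: le_trans (res_half _ _ _ _ (half_gt0 l) (half_le l)) _.
apply: lerD => //; rewrite mulrC ler_pM2l//; apply: lerD; exact: ip_le_cabs.
Qed.

Variables (ms : {set E} -> (T -> R) -> Prop) (A : T -> 'M[complex R]_N) (Cm : R).
Hypothesis M : rmodel P ms A Cm.
Let msy := rm_sys M.
Let C1 : 1 <= Cm := rm_cst M.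
Local Notation rv := (rv ms).
Local Notation K := (lK R).
Local Notation good := (good Cm P N).

Definition gf i l w := cabs (gdiag (A w) (sc l) i).
Definition bf i j l w := cabs (res (rowz (A w) i) (sc l) j j).

Lemma rv_gf i l : rv fullE (gf i l).
Proof. by apply: (rv_cabs msy); exact: (crv_gdiag M (sc_gt0 l)). Qed.
Lemma rv_bf i j l : rv fullE (bf i j l).
Proof. by apply: (rv_cabs msy); apply: (crvT msy); exact: (crv_minor M (sc_gt0 l)). Qed.
Lemma gf0 i w : gf i 0 w <= 1.
Proof. by apply: le_trans (cabs_gdiag _ _ (sc_gt0 0)) _; rewrite ip_sc expr0 invr1. Qed.
Lemma bf0 i j w : bf i j 0 w <= 1.
Proof. by apply: le_trans (cabs_res _ _ _ (sc_gt0 0)) _; rewrite ip_sc expr0 invr1. Qed.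

Section Step.
Variable k : nat.
Hypothesis gG : forall i l, (l <= k)%N -> good (gf i) l.
Hypothesis gB : forall i j l, (l <= k)%N -> good (bf i j) l.

Lemma gf_next m q i l : (l <= k)%N -> (0 < m <= 8)%N -> thr Cm q.+1 <= Ne l.+1 ->
  mom (m * q.+1) (gf i l.+1) K.
Proof.
move=> lk m8 h; apply: (next_mom C1 msy N0) => //.
- exact: rv_gf.
- by move=> a w; exact: cabs_ge0.
- exact: gf0.
- by move=> a w; exact: gdiag_half.
- by move=> a al; apply: gG; exact: leq_trans lk.
Qed.

Lemma bf_next m q i j l : (l <= k)%N -> (0 < m <= 8)%N -> thr Cm q.+1 <= Ne l.+1 ->
  mom (m * q.+1) (bf i j l.+1) K.
Proof.
move=> lk m8 h; apply: (next_mom C1 msy N0) => //.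
- exact: rv_bf.
- by move=> a w; exact: cabs_ge0.
- exact: bf0.
- by move=> a w; exact: minor_half.
- by move=> a al; apply: gB; exact: leq_trans lk.
Qed.

Lemma Ne_le_K q l : thr Cm q.+1 <= Ne l -> K <= Ne l.
Proof.
apply: le_trans; have h := thr_cz C1 q; have h1 := lK_ge1 R; have h2 := lH_ge1 C1.
have hc : 1 <= cz Cm (8 * q.+1) by apply: (cz_ge1 M).
rewrite /thr (_ : 16%N = 4 * 4)%N// exprM.
have hx : 36 * K ^+ 2 <= (lH Cm * q.+1%:R) ^+ 4.
  by apply: le_trans h; rewrite ler_peMr// mulr_ge0// sqr_ge0.
apply: (@le_trans _ _ ((lH Cm * q.+1%:R) ^+ 4)).
  by apply: le_trans hx; move: h1; set x := K => *; nra.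
apply: ler_eXnr => //; apply: exprn_ege1; apply: mulr_ege1 => //.
by rewrite ler1n.
Qed.

Lemma dev_next q i l : (l <= k)%N -> thr Cm q.+1 <= Ne l.+1 ->
  mom (8 * q.+1) (fun w => cabs (qrow (A w) (sc l.+1) i - msc (sc l.+1)))
    (6 * K * cz Cm (8 * q.+1) * Num.sqrt (Num.sqrt (K / Ne l.+1))).
Proof.
move=> lk h; apply: (deviation_mom M (sc_gt0 l.+1)) => //.
- exact: sc_le1.
- exact: lK_ge1.
- exact: Ne_le_K h.
- by move=> a; exact: gf_next.
- by move=> a b; exact: bf_next.
Qed.

Lemma thr_W q l : thr Cm q.+1 <= Ne l -> 8 * (12 * K * cz Cm (8 * q.+1)) ^+ 8 * K ^+ 2 <= Ne l ^+ 2.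
Proof.
move=> h; have hc : 1 <= cz Cm (8 * q.+1) by apply: (cz_ge1 M).
have h1 := lK_ge1 R.
have hz := thr_cz C1 q.
have hp : 0 <= 36 * K ^+ 2 * cz Cm (8 * q.+1).
  by apply: mulr_ge0; [apply: mulr_ge0 => //; exact: sqr_ge0|lra].
have : (36 * K ^+ 2 * cz Cm (8 * q.+1)) ^+ 8 <= Ne l ^+ 2.
  apply: (@le_trans _ _ (thr Cm q.+1 ^+ 2)).
    by rewrite /thr -exprM (_ : 16 * 2 = 4 * 8)%N// exprM lerXn2r ?nnegrE// (le_trans hp).
  by rewrite lerXn2r ?nnegrE// (le_trans ler01)// ?(thr_ge1 C1)// (le_trans (thr_ge1 C1 _)).
apply: le_trans.
have -> : 36 * K ^+ 2 * cz Cm (8 * q.+1) = (12 * K * cz Cm (8 * q.+1)) * (3 * K) by ring.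
rewrite [leRHS]exprMn mulrAC mulrC; apply: ler_wpM2l.
  by apply: exprn_ge0; apply: mulr_ge0; lra.
have -> : (3 * K) ^+ 8 = 3 ^+ 8 * K ^+ 6 * K ^+ 2 by ring.
rewrite ler_wpM2r ?sqr_ge0//.
have : 1 <= K ^+ 6 by apply: exprn_ege1.
by set x := K ^+ 6; lra.
Qed.

(** Term l of [last_good_scale_sum] loses 2^(j Q) by doubling over j further scales and gains
    (K/Ne)^(2 Q) at scale l + 1, where Ne is 2^j times its present value; the net factor is at most
    2^(-(j+1)). The constant 3 instead of 4 leaves the room that [bf_step] uses. *)
Lemma gf_step q i : thr Cm q.+1 <= Ne k.+1 -> mom q.+1 (gf i k.+1) 3.
Proof.
move=> h; set Q := q.+1; set V := fun l w => cabs (qrow (A w) (sc l) i - msc (sc l)).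
have rV l : rv fullE (V l).
  apply: (rv_cabs msy); apply: (crvB msy); last exact: (crv_cst msy).
  exact: (crv_qrow M (sc_gt0 l)).
have hpt w : gf i k.+1 w ^+ Q <= 2 ^+ Q + \sum_(l < k.+1) (4 * 2 ^+ (k.+1 - l.+1)) ^+ Q * (2 * V l.+1 w) ^+ (8 * Q).
  apply: (@last_good_scale_sum _ (fun l => gf i l w) (fun l => V l w)).
  - by move=> l; exact: cabs_ge0.
  - by move=> l; exact: cabs_ge0.
  - by apply: le_trans (gf0 i w) _; lra.
  - by move=> l; exact: gdiag_half.
  - by move=> l; exact: (gden_good (sc_gt0 l)).
rewrite /mom.
have rt l : rv fullE (fun w => (4 * 2 ^+ (k.+1 - l.+1)) ^+ Q * (2 * V l.+1 w) ^+ (8 * Q)).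
  apply: (rvM msy); first exact: (rv_cst msy).
  by apply: (rvX msy); apply: (rvM msy) => //; exact: (rv_cst msy).
apply: (@le_trans _ _ (2 ^+ Q + \sum_(l < k.+1) (2^-1 : R) ^+ (k.+1 - l))); last first.
  have hs := half_sum R k.+1.
  apply: (@le_trans _ _ (2 ^+ Q + 1)); first by rewrite lerD2l.
  rewrite /Q 2!exprS.
  have a1 : 1 <= 2 ^+ q :> R by apply: exprn_ege1; lra.
  have a2 : 2 ^+ q <= 3 ^+ q :> R by rewrite lerXn2r ?nnegrE//; lra.
  by move: a1 a2; set x := 2 ^+ q; set y := 3 ^+ q; lra.
apply: (@le_trans _ _ (Ex P (fun w => 2 ^+ Q + \sum_(l < k.+1) (4 * 2 ^+ (k.+1 - l.+1)) ^+ Q * (2 * V l.+1 w) ^+ (8 * Q)))).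
  apply: (@Ex_mono _ _ _ _ _ _ msy fullE) => //; first by apply: (rvX msy); exact: rv_gf.
  by apply: (rvD msy); [exact: (rv_cst msy)|apply: (rv_sum msy)].
rewrite (@ExDr _ _ _ _ _ _ msy fullE); [|exact: (rv_cst msy)|by apply: (rv_sum msy)].
rewrite Ex_cst lerD2l (@Ex_sum _ _ _ _ _ _ msy _ _ _ _ fullE)//.
apply: ler_sum => l _.
have lk : (l <= k)%N by rewrite -ltnS.
have hl : thr Cm q.+1 <= Ne l.+1 by apply: le_trans h _; exact: Ne_le.
have hv := dev_next i lk hl; rewrite -/(V l.+1) in hv.
rewrite (@ExZr _ _ _ _ _ _ msy fullE); last first.
  by apply: (rvX msy); apply: (rvM msy) => //; exact: (rv_cst msy).
have -> : (fun w => (2 * V l.+1 w) ^+ (8 * Q)) = (fun w => 2 ^+ (8 * Q) * V l.+1 w ^+ (8 * Q)).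
  by apply/funext => w; rewrite exprMn.
rewrite (@ExZr _ _ _ _ _ _ msy fullE); last exact: (rvX msy).
set D := cz Cm (8 * q.+1) in hv *.
have nel : 0 < Ne l.+1 by exact: Ne_gt0.
have K0 : 0 < K by apply: lt_le_trans (lK_ge1 R).
have kn : 0 <= K / Ne l.+1 by rewrite divr_ge0 ?ltW.
have h1 : 2 ^+ (8 * Q) * Ex P (fun w => V l.+1 w ^+ (8 * Q)) <= ((12 * K * D) ^+ 8 * (K / Ne l.+1) ^+ 2) ^+ Q.
  apply: (@le_trans _ _ (2 ^+ (8 * Q) * (6 * K * D * Num.sqrt (Num.sqrt (K / Ne l.+1))) ^+ (8 * Q))).
    by rewrite ler_wpM2l// exprn_ge0.
  rewrite -exprMn le_eqVlt; apply/orP; left; apply/eqP; rewrite exprM; congr (_ ^+ Q).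
  set x := Num.sqrt (Num.sqrt _).
  have e : x ^+ 4 = K / Ne l.+1 by rewrite (_ : 4 = 2 * 2)%N// exprM 2?sqr_sqrtr// sqrtr_ge0.
  by rewrite -e; ring.
apply: le_trans (ler_wpM2l _ h1) _; first by apply: exprn_ge0; apply: mulr_ge0 => //; exact: exprn_ge0.
rewrite -exprMn.
set j := (k.+1 - l.+1)%N.
have ej : (k.+1 - l = j.+1)%N by rewrite /j subSS subSn.
have e2 : Ne l.+1 = 2 ^+ j * Ne k.+1.
  have : (2 ^+ j * 2^-1 ^+ j = 1 :> R) by rewrite -exprMn mulfV ?expr1n// pnatr_eq0.
  have -> : (2^-1 : R) ^+ k.+1 = 2^-1 ^+ j * 2^-1 ^+ l.+1 by rewrite -exprD /j subnK.
  by move=> e; rewrite [RHS]mulrCA (mulrA (2 ^+ j)) e mul1r.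
have W := thr_W h; rewrite -/D in W.
have j0 : 0 < 2 ^+ j :> R by exact: exprn_gt0.
have nek : 0 < Ne k.+1 by exact: Ne_gt0.
have hb : 4 * 2 ^+ j * ((12 * K * D) ^+ 8 * (K / Ne l.+1) ^+ 2) <= 2^-1 ^+ j.+1.
  rewrite e2.
  have -> : 4 * 2 ^+ j * ((12 * K * D) ^+ 8 * (K / (2 ^+ j * Ne k.+1)) ^+ 2) =
    (8 * (12 * K * D) ^+ 8 * K ^+ 2 / Ne k.+1 ^+ 2) * (2 * 2 ^+ j)^-1.
    move: j0 nek; set x := 2 ^+ j; set y := Ne k.+1 => j0 nek; field.
    by rewrite !gt_eqF.
  rewrite [leRHS]exprVn [in leRHS]exprS; apply: ler_piMl.
    by rewrite invr_ge0; apply: mulr_ge0 => //; exact: ltW.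
  by rewrite ler_pdivrMr ?mul1r// exprn_gt0.
rewrite ej; apply: le_trans (_ : (2^-1 ^+ j.+1) ^+ Q <= _).
  rewrite lerXn2r ?nnegrE ?exprn_ge0//.
  apply: mulr_ge0; first by apply: mulr_ge0 => //; exact: ltW.
  by apply: mulr_ge0; [apply: exprn_even_ge0|exact: sqr_ge0].
apply: ler_iXnr => //; by apply: exprn_ile1; lra.
Qed.

Lemma bf_chain q i j b : thr Cm q.+1 <= Ne k.+1 ->
  mom (4 * q.+1) (fun w => cabs (res (rowz (A w) i) (sc k.+1) j b)) (K * k.+2%:R).
Proof.
move=> h; have K1 := lK_ge1 R; have K0 : 0 < K by lra.
have rb x a : rv fullE (bf i x a) by exact: rv_bf.
have rs a : rv fullE (fun w => 2^-1 * (bf i j a w + bf i b a w)).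
  by apply: (rvM msy); [exact: (rv_cst msy)|exact: (rvD msy)].
have b0 x a w : 0 <= bf i x a w by exact: cabs_ge0.
have s0' a w : 0 <= 2^-1 * (bf i j a w + bf i b a w) by rewrite mulr_ge0// addr_ge0.
apply: (mom_le msy (S := fullE) (g := fun w => 1 + \sum_(a < k.+1) 2^-1 * (bf i j a w + bf i b a w))).
- by apply: (rv_cabs msy); apply: (crvT msy); exact: (crv_minor M (sc_gt0 _)).
- by apply: (rvD msy); [exact: (rv_cst msy)|apply: (rv_sum msy)].
- by move=> w; exact: cabs_ge0.
- by move=> w; exact: entry_chain.
have ms1 : mom (4 * q.+1) (fun w => \sum_(a < k.+1) 2^-1 * (bf i j a w + bf i b a w)) (\sum_(a < k.+1) K).
  rewrite mulP//; apply: (mom_sum msy (S := fullE)) => // a; rewrite -mulP//.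
  have hx x : mom (4 * q.+1) (bf i x a) K.
    apply: (mom_ler (a := K / 2)); [by rewrite divr_ge0// ltW|lra|].
    have hm a' w : bf i x a'.+1 w <= 2 * bf i x a' w by exact: minor_half.
    have hg l : (l <= a)%N -> good (bf i x) l.
      by move=> la; apply: gB; rewrite (leq_trans la)// -ltnS.
    apply: (good_mom C1 msy N0 (rb x) (b0 x) (bf0 i x) hm _ hg) => //.
    by apply: le_trans h _; apply: Ne_le => //; exact: ltnW.
  have -> : K = 2^-1 * (K + K) by lra.
  apply: (momZ msy (S := fullE)) => //; first exact: (rvD msy).
  have h1 := hx j; have h2 := hx b; rewrite mulP// in h1 h2 *.
  exact: (mom_add msy (S := fullE)).
have c1 := mom_cst P (4 * q.+1) 1.
have eK : \sum_(a < k.+1) K = K * k.+1%:R by rewrite sumr_const card_ord mulr_natr.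
rewrite eK in ms1; rewrite mulP// in ms1 c1 *.
have rS : rv fullE (fun w => \sum_(a < k.+1) 2^-1 * (bf i j a w + bf i b a w)) by exact: (rv_sum msy).
have S0 w : 0 <= \sum_(a < k.+1) 2^-1 * (bf i j a w + bf i b a w) by exact: sumr_ge0.
have Kk : 0 < K * k.+1%:R by rewrite mulr_gt0// ltr0n.
apply: mom_ler (mom_add msy (S := fullE) (rv_cst msy _ _) rS (fun=> ler01) S0 ltr01 Kk c1 ms1).
  by apply: addr_ge0 => //; exact: ltW.
by rewrite -(natr1 k.+1) mulrDr mulr1; lra.
Qed.

Lemma lconst_le q : thr Cm q.+1 <= Ne k.+1 ->
  K * lconst N Cm (sc k.+1) (4 * q.+1) K (K * k.+2%:R) ^+ 2 <= 1.
Proof.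
move=> h; have K1 := lK_ge1 R; have e1 := e0_ge1 R; have Np : 0 < N%:R :> R by rewrite ltr0n.
have H1 := lH_ge1 C1; set X := lH Cm * q.+1%:R.
have X1 : 1 <= X by apply: mulr_ege1 => //; rewrite ler1n.
have X4 : 1 <= X ^+ 4 by apply: exprn_ege1.
have nek : 0 < Ne k.+1 by exact: Ne_gt0.
have hX : X ^+ 16 <= Ne k.+1 by exact: h.
have hc := thr_cz C1 q; rewrite -/X in hc.
have iN : (Ne k.+1)^-1 <= (X ^+ 16)^-1 by rewrite lef_pV2 ?posrE// exprn_gt0//; lra.
have Xi0 : 0 < (X ^+ 4)^-1 by rewrite invr_gt0; lra.
have Xi1 : (X ^+ 4)^-1 <= 1 by rewrite invf_le1//; lra.
have e16 : (X ^+ 16)^-1 = ((X ^+ 4)^-1) ^+ 4 by rewrite exprVn -exprM.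
rewrite e16 in iN; set x := (X ^+ 4)^-1 in Xi0 Xi1 iN.
have K0 : 0 <= K by lra.
have b1 : Num.sqrt (K / Ne k.+1) <= K * x.
  rewrite -[leRHS]ger0_norm; last by apply: mulr_ge0 => //; exact: ltW.
  rewrite -sqrtr_sqr; apply: ler_wsqrtr; rewrite exprMn; apply: ler_pM; [exact: K0|by rewrite invr_ge0 ltW|exact: ler_eXnr|].
  apply: le_trans iN _; rewrite (_ : 4 = 2 + 2)%N// exprD ler_piMr ?sqr_ge0//.
  by apply: exprn_ile1 => //; exact: ltW.
have n0 := nu_ge0 R N.
(* The linear growth in the number of scales is beaten by nu: the fourth power of k + 2 is at most
   256 2^(k+1), and nu^4 2^(k+1) is 1/Ne. *)
have b2 : nu R N * k.+2%:R <= 4 * x.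
  rewrite -(@ler_pXn2r _ 4) ?nnegrE//; last first.
    by apply: mulr_ge0 => //; exact: ltW.
    by apply: mulr_ge0.
  rewrite 2!exprMn nu4.
  have p4 := pow4_le_exp2 R k.+1.
  apply: (@le_trans _ _ (N%:R^-1 * (256 * 2 ^+ k.+1))).
    by rewrite ler_wpM2l ?invr_ge0 ?(ltW Np).
  have -> : N%:R^-1 * (256 * 2 ^+ k.+1) = 256 * (Ne k.+1)^-1.
    by rewrite invfM exprVn invrK mulrCA mulrA.
  have -> : (4 : R) ^+ 4 = 256 by rewrite !exprS expr0; lra.
  by apply: ler_wpM2l => //; exact: ler0n.
rewrite /lconst ip_sc; set w := Num.sqrt _ + _.
have w0 : 0 <= w.
  rewrite /w; apply: addr_ge0; first exact: sqrtr_ge0.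
  apply: mulr_ge0 => //; apply: mulr_ge0; first exact: le_trans C1.
  exact: mulr_ge0.
have hw : w <= 5 * (Cm * K * x).
  rewrite /w.
  have -> : Cm * (K * k.+2%:R) * nu R N = Cm * K * (nu R N * k.+2%:R) by ring.
  have CK : 0 <= Cm * K by apply: mulr_ge0 => //; exact: le_trans C1.
  have t2 : Cm * K * (nu R N * k.+2%:R) <= Cm * K * (4 * x) by rewrite ler_wpM2l.
  have t1 : K * x <= Cm * K * x.
    by rewrite -mulrA ler_peMl// mulr_ge0// ltW.
  by lra.
set c := 16 * e0 R ^+ 3 * _ ^+ 2.
have c0 : 0 <= c by rewrite /c; apply: mulr_ge0; [apply: mulr_ge0 => //; apply: exprn_ge0; lra|exact: sqr_ge0].
have hcw : c * w <= K^-1.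
  rewrite -div1r ler_pdivlMr; last by lra.
  apply: (@le_trans _ _ (c * (5 * (Cm * K * x)) * K)).
    by rewrite ler_wpM2r// ler_wpM2l.
  have -> : c * (5 * (Cm * K * x)) * K = (5 * c * Cm * K ^+ 2) * x by ring.
  rewrite /x ler_pdivrMr ?mul1r; last by lra.
  apply: le_trans hc; rewrite /c /cz [(8 * _)%:R]natrM [(4 * _)%:R]natrM.
  have q1 : 1 <= q.+1%:R :> R by rewrite ler1n.
  set y := q.+1%:R in q1 *; set e := e0 R in e1 *.
  have [b [b1' ->]] : exists b : R, 1 <= b /\ 10000 = 10 * b by exists 1000; split; lra.
  have -> : 36 * K ^+ 2 * (10 * b * e ^+ 5 * (8%:R * y) ^+ 4 * Cm ^+ 4) =
    (5 * (16 * e ^+ 3 * (4%:R * y) ^+ 2) * Cm * K ^+ 2) * (1152 * b * e ^+ 2 * y ^+ 2 * Cm ^+ 3) by ring.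
  rewrite ler_peMr//.
    apply: mulr_ge0; last exact: sqr_ge0.
    apply: mulr_ge0; last exact: le_trans C1.
    apply: mulr_ge0 => //; apply: mulr_ge0; last exact: sqr_ge0.
    by apply: mulr_ge0 => //; apply: exprn_ge0; exact: le_trans e1.
  apply: mulr_ege1; last exact: exprn_ege1.
  apply: mulr_ege1; last exact: exprn_ege1.
  by apply: mulr_ege1; [apply: mulr_ege1 => //; lra|exact: exprn_ege1].
have cw0 : 0 <= c * w by exact: mulr_ge0.
have iK : K^-1 <= 1 by rewrite invf_le1//; lra.
have iK0 : 0 <= K^-1 by rewrite invr_ge0.
apply: (@le_trans _ _ (K * (K^-1 * 1))).
  rewrite ler_wpM2l// expr2; apply: ler_pM => //.
  exact: le_trans hcw iK.
by rewrite mulr1 mulfV// gt_eqF//; lra.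
Qed.

Lemma bf_step q i j : thr Cm q.+1 <= Ne k.+1 ->
  mom q.+1 (fun w => cabs (res (A w) (sc k.+1) j j)) 3 -> mom q.+1 (bf i j k.+1) 4.
Proof.
move=> h h3; have K1 := lK_ge1 R; have K0 : 0 < K by apply: lt_le_trans K1.
have kap0 : 0 < K * k.+2%:R by rewrite mulr_gt0// ltr0n.
have a0 : 0 < (3 : R) by [].
have hG : mom (2 * q.+1) (fun w => cabs (gdiag (A w) (sc k.+1) i)) K by exact: gf_next.
have hB b : mom (2 * q.+1) (fun w => cabs (res (rowz (A w) i) (sc k.+1) b b)) K by exact: bf_next.
have hC b b' := bf_chain i b b' h.
have := minor_mom M (sc_gt0 k.+1) K0 a0 kap0 hG hB hC h3.
have hl := lconst_le h.
apply: mom_ler; last by rewrite (_ : 4 = 3 + 1); [rewrite lerD2l|lra].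
by apply: addr_ge0 => //; apply: mulr_ge0; [exact: ltW|exact: sqr_ge0].
Qed.
End Step.
End Ladder.

Section LadderInduction.
Context d (T : measurableType d) (R : realType) (P : probability T R).
Variables (N : nat) (s Cm : R).
Hypotheses (N0 : (0 < N)%N) (s0 : 0 <= s) (s2 : s <= 2).
Local Notation E := ('I_N * 'I_N)%type.
Local Notation fullE := ([set: E]%SET).
Local Notation mom := (mom P).
Local Notation Ne l := (N%:R * 2^-1 ^+ l : R).

Definition model_good (A : T -> 'M[complex R]_N) l :=
  (forall i, good Cm P N (gf s A i) l) /\ (forall i j, good Cm P N (bf s A i j) l).

Lemma model_good0 ms A : rmodel P ms A Cm -> model_good A 0.
Proof.
move=> M; have msy := rm_sys M; split=> [i|i j] q _; apply: (mom_ler (a := 1)) => //.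
- by lra.
- by apply: (mom_bound msy _ (rv_gf s M i 0)) => w; [exact: cabs_ge0|exact: gf0].
- by lra.
- by apply: (mom_bound msy _ (rv_bf s M i j 0)) => w; [exact: cabs_ge0|exact: bf0].
Qed.

Lemma gdiag_adj (X X' : 'M[complex R]_N) z i : 0 < ip z -> X'^t* = X -> gdiag X' z i = res X z i i.
Proof. by move=> z0 <-; rewrite -(res_adj_diag X' i z0). Qed.

(** A matrix and its adjoint are treated together: the minors of one need the diagonal entries of
    its resolvent, which are the [gdiag] of the other. *)
Lemma ladder_step ms ms' A A' : rmodel P ms A Cm -> rmodel P ms' A' Cm -> (forall w, (A' w)^t* = A w) ->
  forall k, (forall l, (l <= k)%N -> model_good A l /\ model_good A' l) -> model_good A k.+1.
Proof.
move=> M M' AA' k IH.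
have gG i l : (l <= k)%N -> good Cm P N (gf s A i) l by move=> /IH[[]].
have gB i j l : (l <= k)%N -> good Cm P N (bf s A i j) l by move=> /IH[[]].
have gG' i l : (l <= k)%N -> good Cm P N (gf s A' i) l by move=> /IH[_ []].
have gB' i j l : (l <= k)%N -> good Cm P N (bf s A' i j) l by move=> /IH[_ []].
split=> [i|i j] q h.
  by apply: (mom_ler (a := 3)) => //; [lra|exact: (gf_step N0 s0 s2 M gG gB)].
apply: (bf_step N0 M gG gB) => //.
have := gf_step N0 s0 s2 M' gG' gB' j h; congr (mom _ _ _).
by apply/funext => w; rewrite /gf (@gdiag_adj (A w) (A' w))// sc_gt0.
Qed.

Lemma ladder ms A : rmodel P ms A Cm -> forall l, model_good A l.
Proof.
move=> M; have [ms' [A' [M' [h1 h2]]]] : exists ms' A', rmodel P ms' A' Cm /\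
    (forall w, (A' w)^t* = A w) /\ (forall w, (A w)^t* = A' w).
  exists (ms_swap ms), (fun w => (A w)^t*); split; first exact: rmodel_adj.
  by split=> // w; rewrite trmxCK.
suff h k : forall l, (l <= k)%N -> model_good A l /\ model_good A' l.
  by move=> l; have [] := h l l (leqnn l).
elim: k => [|k IH] l.
  by rewrite leqn0 => /eqP ->; split; [exact: model_good0 M|exact: model_good0 M'].
rewrite leq_eqVlt ltnS => /orP[/eqP ->|]; last exact: IH.
split; first exact: ladder_step M M' h1 k IH.
have IH' a : (a <= k)%N -> model_good A' a /\ model_good A a by move=> /IH[].
exact: ladder_step M' M h2 k IH'.
Qed.
End LadderInduction.

(** * Moments of all orders as soon as N y is at least 1 *)

Section MomentsAt.
Context d (T : measurableType d) (R : realType) (P : probability T R).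
Variables (N : nat) (Cm : R).
Hypothesis (N0 : (0 < N)%N).
Local Notation E := ('I_N * 'I_N)%type.
Local Notation fullE := ([set: E]%SET).
Local Notation mom := (mom P).

Lemma near_scale n (y : R) : 2^-1 ^+ n <= y -> y <= 1 -> exists l, 2^-1 ^+ l / 2 <= y <= 2^-1 ^+ l.
Proof.
elim: n => [|n IH] h y1.
  by exists 0%N; rewrite expr0 in h *; rewrite y1 andbT; lra.
have [g|g] := leP y (2^-1 ^+ n); last by apply: IH => //; exact: ltW.
by exists n; rewrite g -exprSr h.
Qed.

Variables (ms : {set E} -> (T -> R) -> Prop) (A : T -> 'M[complex R]_N).
Hypothesis M : rmodel P ms A Cm.
Let msy := rm_sys M.
Let C1 : 1 <= Cm := rm_cst M.
Variable z : complex R.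
Hypotheses (re0 : 0 <= rp z) (re2 : rp z <= 2) (zN : 1 <= N%:R * ip z) (z1 : ip z <= 1).
Let Np : 0 < N%:R :> R. Proof. by rewrite ltr0n. Qed.
Let z0 : 0 < ip z.
Proof. by have := lt_le_trans ltr01 zN; rewrite pmulr_rgt0. Qed.
Let zE : z = (rp z +i* ip z)%C. Proof. by case: z. Qed.

Lemma near_half l (X : 'M[complex R]_N) j : 2^-1 ^+ l / 2 <= ip z <= 2^-1 ^+ l ->
  cabs (res X z j j) <= 2 * cabs (res X (sc (rp z) l) j j).
Proof. by move=> ll; rewrite {1}zE; exact: (res_half_diag _ _ _ (exprn_gt0 _ _) ll). Qed.

Lemma near_entry l (X : 'M[complex R]_N) j k : 2^-1 ^+ l / 2 <= ip z <= 2^-1 ^+ l ->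
  cabs (res X z j k) <= cabs (res X (sc (rp z) l) j k) +
    (ip (res X (sc (rp z) l) j j) + ip (res X (sc (rp z) l) k k)) / 2.
Proof. by move=> ll; rewrite {1}zE; exact: (res_half _ _ _ _ (exprn_gt0 _ _) ll). Qed.

Lemma near_ip : exists l, 2^-1 ^+ l / 2 <= ip z <= 2^-1 ^+ l.
Proof.
apply: (@near_scale N) => //; rewrite exprVn -div1r ler_pdivrMr ?exprn_gt0//.
apply: le_trans zN _; rewrite mulrC ler_pM2l//.
by rewrite -natrX ler_nat ltnW// ltn_expl.
Qed.

Lemma scale_bound l q : ip z <= 2^-1 ^+ l -> 8 * Num.max 1 (thr Cm q.+1 / (N%:R * 2^-1 ^+ l)) <= 8 * thr Cm q.+1.
Proof.
move=> h; have t1 := thr_ge1 C1 (ltn0Sn q).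
rewrite ler_pM2l// ge_max t1 /= ler_pdivrMr ?Ne_gt0// ler_peMr//; first by lra.
by apply: le_trans zN _; rewrite ler_wpM2l// ltW.
Qed.

(** An order whose threshold exceeds N y costs the ratio of the two, at most [thr] itself because N
    y >= 1. The constant is thus a power of q. *)
Lemma gdiag_mom q i : mom q.+1 (fun w => cabs (gdiag (A w) z i)) (16 * thr Cm q.+1).
Proof.
have [l ll] := near_ip; have /andP[l1 l2] := ll; have t1 := thr_ge1 C1 (ltn0Sn q).
have rg := rv_gf (rp z) M i l.
apply: (mom_le msy (S := fullE) (g := fun w => 2 * gf (rp z) A i l w)).
- by apply: (rv_cabs msy); exact: (crv_gdiag M).
- by apply: (rvM msy) => //; exact: (rv_cst msy).
- by move=> w; exact: cabs_ge0.
- move=> w; by rewrite /gf -2?res_adj_diag ?sc_gt0//; exact: near_half.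
have -> : 16 * thr Cm q.+1 = 2 * (8 * thr Cm q.+1) by lra.
apply: (momZ msy _ rg) => //.
apply: mom_ler (scale_bound q l2) _; first by rewrite mulr_ge0// le_max ler01.
have h0 a w : 0 <= gf (rp z) A i a w by exact: cabs_ge0.
have hh a w : gf (rp z) A i a.+1 w <= 2 * gf (rp z) A i a w by exact: gdiag_half.
have hg a : (a <= l)%N -> good Cm P N (gf (rp z) A i) a.
  by move=> _; have [g _] := ladder N0 re0 re2 M a; exact: g.
exact: (good_bound C1 msy N0 (rv_gf (rp z) M i) h0 (gf0 (rp z) A i) hh hg).
Qed.

Lemma bf_mom q i j l : ip z <= 2^-1 ^+ l -> mom q.+1 (bf (rp z) A i j l) (8 * thr Cm q.+1).
Proof.
move=> l2.
apply: mom_ler (scale_bound q l2) _; first by rewrite mulr_ge0// le_max ler01.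
have h0 a w : 0 <= bf (rp z) A i j a w by exact: cabs_ge0.
have hh a w : bf (rp z) A i j a.+1 w <= 2 * bf (rp z) A i j a w by exact: minor_half.
have hg a : (a <= l)%N -> good Cm P N (bf (rp z) A i j) a.
  by move=> _; have [_ g] := ladder N0 re0 re2 M a; exact: g.
exact: (good_bound C1 msy N0 (rv_bf (rp z) M i j) h0 (bf0 (rp z) A i j) hh hg).
Qed.

Lemma minor_diag_mom q i j : mom q.+1 (fun w => cabs (res (rowz (A w) i) z j j)) (16 * thr Cm q.+1).
Proof.
have [l ll] := near_ip; have /andP[l1 l2] := ll.
have rg := rv_bf (rp z) M i j l.
apply: (mom_le msy (S := fullE) (g := fun w => 2 * bf (rp z) A i j l w)).
- by apply: (rv_cabs msy); apply: (crvT msy); exact: (crv_minor M).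
- by apply: (rvM msy) => //; exact: (rv_cst msy).
- by move=> w; exact: cabs_ge0.
- move=> w; exact: near_half.
have -> : 16 * thr Cm q.+1 = 2 * (8 * thr Cm q.+1) by lra.
apply: (momZ msy _ rg) => //; exact: bf_mom.
Qed.

(** The chain over scales contributes their number, logarithmic in 1/y, and it is bounded by the
    fourth root of 1/y. This loss is harmless because [nu R N ^+ 2] multiplies the entries in the
    concentration estimate. *)
Lemma minor_entry_mom q i j k :
  mom q.+1 (fun w => cabs (res (rowz (A w) i) z j k)) (40 * thr Cm q.+1 * Num.sqrt (Num.sqrt (ip z)^-1)).
Proof.
have [l ll] := near_ip; have /andP[l1 l2] := ll; have t1 := thr_ge1 C1 (ltn0Sn q).
set K := 8 * thr Cm q.+1.
have K0 : 0 < K by rewrite /K; lra.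
have hb x a : (a <= l)%N -> mom q.+1 (bf (rp z) A i x a) K.
  by move=> al; apply: bf_mom; apply: le_trans l2 _; rewrite ler_wiXn2l//; lra.
have rb x a : rv ms fullE (bf (rp z) A i x a) by exact: (rv_bf (rp z) M i x a).
have b0 x a w : 0 <= bf (rp z) A i x a w by exact: cabs_ge0.
have rs a : rv ms fullE (fun w => 2^-1 * (bf (rp z) A i j a w + bf (rp z) A i k a w)).
  by apply: (rvM msy); [exact: (rv_cst msy)|exact: (rvD msy)].
have s0' a w : 0 <= 2^-1 * (bf (rp z) A i j a w + bf (rp z) A i k a w) by rewrite mulr_ge0// addr_ge0.
set S := fun w => \sum_(a < l.+1) 2^-1 * (bf (rp z) A i j a w + bf (rp z) A i k a w).
have rS : rv ms fullE S by exact: (rv_sum msy).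
have S0 w : 0 <= S w by exact: sumr_ge0.
apply: (mom_le msy (S := fullE) (g := fun w => 1 + S w)).
- by apply: (rv_cabs msy); apply: (crvT msy); exact: (crv_minor M).
- by apply: (rvD msy) => //; exact: (rv_cst msy).
- by move=> w; exact: cabs_ge0.
- move=> w; rewrite /S big_ord_recr /= addrA; apply: le_trans (near_entry _ _ _ ll) _.
  apply: lerD; first exact: entry_chain.
  by rewrite mulrC ler_pM2l//; apply: lerD; exact: ip_le_cabs.
have mS : mom q.+1 S (\sum_(a < l.+1) K).
  apply: (mom_sum msy (S := fullE)) => // a.
  have -> : K = 2^-1 * (K + K) by lra.
  apply: (momZ msy (S := fullE)) => //; first exact: (rvD msy).
  by apply: (mom_add msy (S := fullE)) => //; apply: hb; rewrite -ltnS.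
have eK : \sum_(a < l.+1) K = K * l.+1%:R by rewrite sumr_const card_ord mulr_natr.
rewrite eK in mS.
have Kk : 0 < K * l.+1%:R by rewrite mulr_gt0// ltr0n.
apply: mom_ler (mom_add msy (S := fullE) (rv_cst msy _ _) rS (fun=> ler01) S0 ltr01 Kk (mom_cst P q.+1 1) mS).
  by apply: addr_ge0 => //; exact: ltW.
have hl : l.+2%:R <= 5 * Num.sqrt (Num.sqrt (ip z)^-1).
  rewrite -(@ler_pXn2r _ 4) ?nnegrE ?mulr_ge0 ?sqrtr_ge0// exprMn.
  have -> : Num.sqrt (Num.sqrt (ip z)^-1) ^+ 4 = (ip z)^-1.
    by rewrite (_ : 4 = 2 * 2)%N// exprM 2?sqr_sqrtr ?sqrtr_ge0// invr_ge0 ltW.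
  apply: le_trans (pow4_le_exp2 R l.+1) _.
  have h2 : 2 ^+ l <= (ip z)^-1.
    by rewrite -[leLHS]invrK lef_pV2 ?posrE ?invr_gt0 ?exprn_gt0// -exprVn.
  have -> : (5 : R) ^+ 4 = 625 by rewrite !exprS expr0; lra.
  by rewrite exprS; move: h2 (exprn_gt0 l (ltr0n R 2)); set x := 2 ^+ l; set y := _^-1; lra.
apply: (@le_trans _ _ (K * l.+2%:R)).
  by rewrite -(natr1 l.+1) mulrDr mulr1 addrC lerD2l /K; lra.
have -> : 40 * thr Cm q.+1 * Num.sqrt (Num.sqrt (ip z)^-1) = K * (5 * Num.sqrt (Num.sqrt (ip z)^-1)) by rewrite /K; ring.
by rewrite ler_wpM2l// ltW.
Qed.

End MomentsAt.

(** * The self-consistent equation *)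

Section RealSteps.
Variable R : realType.
Implicit Types (g I v F t r Z u : R).

(** A common majorant u, built so that each error term of the pointwise estimate is at most a
    multiple of u (u + t)^(4q+3), the shape that [moment_close] accepts. *)
Definition uform g I v F := 2 * (1 + g) ^+ 2 * I * v * (1 + F).

Lemma step_u0 g I v F : 0 <= g -> 1 <= I -> 0 <= v -> v <= F ->
  let u := uform g I v F in
  [/\ 0 <= u, 2 * (1 + g) ^+ 2 * v <= u, 2 * I * v * (1 + v) <= u & v <= u].
Proof.
move=> g0 I1 v0 vF u.
have h1 : 1 <= (1 + g) ^+ 2 by apply: exprn_ege1; lra.
have a0 : 0 <= 2 * (1 + g) ^+ 2 * v by apply: mulr_ge0 => //; lra.
have a1 : 2 * (1 + g) ^+ 2 * v <= u.
  have -> : u = 2 * (1 + g) ^+ 2 * v * (I * (1 + F)) by rewrite /u /uform; ring.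
  by rewrite ler_peMr//; apply: mulr_ege1; lra.
have b0 : 0 <= 2 * I * v * (1 + v) by apply: mulr_ge0; [apply: mulr_ge0|]; lra.
split => //.
- exact: le_trans a1.
- have -> : u = (1 + g) ^+ 2 * (2 * I * v * (1 + F)) by rewrite /u /uform; ring.
  apply: (@le_trans _ _ (2 * I * v * (1 + F))).
    by apply: ler_wpM2l; [apply: mulr_ge0; lra|lra].
  by rewrite ler_peMl//; apply: mulr_ge0; [apply: mulr_ge0; lra|lra].
- apply: le_trans a1; rewrite ler_peMl//; lra.
Qed.

Lemma step_main g I v F t q : 0 <= g -> 1 <= I -> 0 <= v -> v <= F -> 0 <= t ->
  (g ^+ 2 * v ^+ 2 + g * v ^+ 2 + g * v * (2 * t + v)) * t ^+ (4 * q).+2 <=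
  uform g I v F * (uform g I v F + t) ^+ (4 * q).+3.
Proof.
move=> g0 I1 v0 vF t0; set u := uform _ _ _ _; have [u0 u1 _ _] := step_u0 g0 I1 v0 vF; rewrite -/u in u0 u1.
rewrite [_ ^+ (4 * q).+3]exprS mulrA; apply: ler_pM.
- apply: addr_ge0; last by apply: mulr_ge0; [exact: mulr_ge0|lra].
  by apply: addr_ge0; apply: mulr_ge0 => //; exact: sqr_ge0.
- exact: exprn_ge0.
- have b : 0 <= 2 * (1 + g) ^+ 2 * v.
    by apply: mulr_ge0 => //; apply: mulr_ge0 => //; exact: sqr_ge0.
  have h1 : (2 * (1 + g) ^+ 2 * v) * (2 * (1 + g) ^+ 2 * v + t) <= u * (u + t).
    by apply: ler_pM => //; lra.
  apply: le_trans h1.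
  have -> : 2 * (1 + g) ^+ 2 * v * (2 * (1 + g) ^+ 2 * v + t) =
    (4 * (1 + g) ^+ 4) * v ^+ 2 + (2 * (1 + g) ^+ 2) * (v * t) by ring.
  have -> : g ^+ 2 * v ^+ 2 + g * v ^+ 2 + g * v * (2 * t + v) =
    (g ^+ 2 + 2 * g) * v ^+ 2 + (2 * g) * (v * t) by ring.
  have p1 : 1 <= (1 + g) ^+ 2 by apply: exprn_ege1; lra.
  apply: lerD; apply: ler_wpM2r; [exact: sqr_ge0| |exact: mulr_ge0|].
    have -> : (1 + g) ^+ 4 = (1 + g) ^+ 2 * (1 + g) ^+ 2 by ring.
    have e : g ^+ 2 + 2 * g = (1 + g) ^+ 2 - 1 by ring.
    by rewrite e; move: p1; set x := (1 + g) ^+ 2; nra.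
  have e : (1 + g) ^+ 2 = 1 + 2 * g + g ^+ 2 by ring.
  by rewrite e; have := sqr_ge0 g; lra.
- by rewrite lerXn2r ?nnegrE//; lra.
Qed.

(** The error made by replacing the defect inside [phi] with a version free of row i. As the
    increment [Dl] is quadratic in r, t^2 + Dl stays below (u + t)^2 and Z Dl below u (u + t)^3. *)
Lemma step_phi g I v F t r Z Dl q : 0 <= g -> 1 <= I -> 0 <= v -> v <= F -> 0 <= t ->
  0 <= Z <= v -> 0 <= r <= v -> 0 <= Dl -> Dl <= 4 * I * r ^+ 2 * (v + t) ->
  Z * ((2 * q).+1%:R * Dl * (t ^+ 2 + Dl) ^+ (2 * q)) <=
  (2 * q).+1%:R * (uform g I v F * (uform g I v F + t) ^+ (4 * q).+3).
Proof.
move=> g0 I1 v0 vF t0 /andP[Z0 Zv] /andP[r0 rv'] D0 hD; set u := uform _ _ _ _.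
have [u0 _ u1 u2] := step_u0 g0 I1 v0 vF; rewrite -/u in u0 u1 u2.
clearbody u; have Iv0 : 0 <= I * v by apply: mulr_ge0; lra.
have rr : r ^+ 2 <= v ^+ 2 by rewrite lerXn2r ?nnegrE.
have hD2 : Dl <= 4 * I * v ^+ 2 * (v + t).
  apply: le_trans hD _; apply: ler_wpM2r; first lra.
  by apply: ler_wpM2l => //; lra.
have w0 : 0 <= 2 * I * v * (1 + v) by apply: mulr_ge0; [apply: mulr_ge0; lra|lra].
have uu : (2 * I * v * (1 + v)) ^+ 2 <= u ^+ 2 by rewrite lerXn2r ?nnegrE.
have v20 := sqr_ge0 v.
have Iv : 0 <= (I - 1) * v ^+ 2 by apply: mulr_ge0 => //; lra.
have II : 0 <= I * I by apply: mulr_ge0; lra.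
have IvI : 0 <= I * ((I - 1) * v ^+ 2) by apply: mulr_ge0; lra.
have v30 : 0 <= I * (I * (v ^+ 2 * v)).
  by apply: mulr_ge0; [lra|apply: mulr_ge0; [lra|exact: mulr_ge0]].
have v31 : 0 <= I * ((I - 1) * v ^+ 2 * v).
  by apply: mulr_ge0; [lra|exact: mulr_ge0].
have v40 : 0 <= (I * I) * (v ^+ 2 * v ^+ 2) by apply: mulr_ge0 => //; exact: mulr_ge0.
have eu : (2 * I * v * (1 + v)) ^+ 2 = 4 * (I * (I * v ^+ 2)) + 8 * (I * (I * (v ^+ 2 * v))) + 4 * ((I * I) * (v ^+ 2 * v ^+ 2)) by ring.
have k1 : 4 * I * v ^+ 2 <= u ^+ 2 by apply: le_trans uu; rewrite eu; lra.
have k2 : 4 * I * v ^+ 2 * v <= u ^+ 2 by apply: le_trans uu; rewrite eu; lra.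
have k3 : 4 * I * v ^+ 2 * t <= 2 * u * t.
  by apply: ler_wpM2r => //; apply: (@le_trans _ _ (2 * (2 * I * v * (1 + v)))); lra.
have hs : t ^+ 2 + Dl <= (u + t) ^+ 2.
  have -> : (u + t) ^+ 2 = u ^+ 2 + 2 * u * t + t ^+ 2 by ring.
  by move: hD2; rewrite mulrDr; lra.
have hz : Z * Dl <= u * (u + t) ^+ 3.
  apply: (@le_trans _ _ (v * (4 * I * v ^+ 2 * (v + t)))); first exact: ler_pM.
  rewrite [_ ^+ 3]exprSr; apply: ler_pM => //.
    by apply: mulr_ge0; [apply: mulr_ge0; lra|lra].
  apply: ler_pM; [by apply: mulr_ge0; lra|lra| |lra].
  by apply: le_trans k1 _; rewrite lerXn2r ?nnegrE//; lra.
have -> : Z * ((2 * q).+1%:R * Dl * (t ^+ 2 + Dl) ^+ (2 * q)) =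
  (2 * q).+1%:R * ((Z * Dl) * (t ^+ 2 + Dl) ^+ (2 * q)) by set a := _ ^+ (2 * q); ring.
rewrite ler_wpM2l// (_ : (4 * q).+3 = 3 + 2 * (2 * q))%N; last by rewrite mulnA addnC addn3.
rewrite exprD mulrA [_ ^+ (2 * (2 * q))]exprM; apply: ler_pM => //.
- exact: mulr_ge0.
- by apply: exprn_ge0; apply: addr_ge0 => //; exact: sqr_ge0.
- by rewrite lerXn2r ?nnegrE ?sqr_ge0// addr_ge0 ?sqr_ge0.
Qed.

Lemma im_minor_aux (b t c x x1 l e : R) : x <= b + l -> x1 - x <= e -> l <= 2 * t -> e <= c -> 0 <= t ->
  x1 <= b + 3 * t + c.
Proof. lra. Qed.

End RealSteps.

Lemma cabs_rcM (R : realType) (a : R) (x : complex R) : 0 <= a -> cabs (rc a * x) = a * cabs x.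
Proof. by move=> a0; rewrite cabsM (cabsC a) ger0_norm. Qed.

(** * Pointwise estimate for one term of the defect *)

Section Pointwise.
Variables (R : realType) (N : nat) (X : 'M[complex R]_N) (z : complex R) (i : 'I_N).
Hypotheses (z0 : 0 < ip z) (re0 : 0 <= rp z) (re2 : rp z <= 2) (z1 : ip z <= 1).
Let Ne := N%:R * ip z.
Hypothesis Ne1 : 1 <= Ne.

Definition crow (Y : 'M[complex R]_N) k : complex R :=
  qf (row k Y) (sqres (rowz Y k) z) - rc N%:R^-1 * \sum_j sqres (rowz Y k) z j j.
(* The part of [mtr X z - mtr (rowz X i) z] that does not depend on row [i]. *)
Definition delta0 (Y : 'M[complex R]_N) k : complex R :=
  rc Ne^-1 * (msc z * (rc N%:R^-1 * \sum_j sqres (rowz Y k) z j j)).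
Definition eps0 (Y : 'M[complex R]_N) k : complex R := epsm z (mtr (rowz Y k) z + delta0 Y k).

Definition tval (Y : 'M[complex R]_N) : R := Num.sqrt (cabs (epsm z (mtr Y z))).
(** A majorant of the imaginary part of the trace of every minor. It is small at the edge, and
    sqrt(S/Ne) is the size expected of the fluctuations. *)
Definition Sval (Y : 'M[complex R]_N) : R := bsc z + 3 * tval Y + Ne^-1.
Definition vval (Y : 'M[complex R]_N) k : R :=
  cabs (crow Y k) + cabs (zrow z Y k) + Num.sqrt (Ne^-1 * Sval Y).
(** A crude majorant of [vval]. In [uval] one factor v is kept small, and v is replaced by F in the
    others, where polynomial bounds on the moments suffice. *)
Definition Fval (Y : 'M[complex R]_N) k : R :=
  2 * ip (mtr (rowz Y k) z) + 2 * cabs (zrow z Y k) + 11 + 9 * cabs (mtr Y z) + 3 * cabs (mtr Y z) ^+ 2.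
Definition uval (Y : 'M[complex R]_N) k : R :=
  uform (cabs (gdiag Y z k)) (1 + ip (mtr (rowz Y k) z)) (vval Y k) (Fval Y k).

Let m := mtr X z.
Let m1 := mtr (rowz X i) z.
Let Q := qrow X z i.
Let G := gdiag X z i.
Let Z := zrow z X i.
Let W := qf (row i X) (sqres (rowz X i) z).
Let cb := rc N%:R^-1 * \sum_j sqres (rowz X i) z j j.
Let Y := crow X i.
Let t := tval X.
Let S := Sval X.
Let r := Num.sqrt (Ne^-1 * S).
Let v := vval X i.
Let F := Fval X i.

Let Ne0 : 0 < Ne. Proof. exact: lt_le_trans Ne1. Qed.
Let iNe0 : 0 <= Ne^-1. Proof. by rewrite invr_ge0 ltW. Qed.
Let iNe1 : Ne^-1 <= 1. Proof. by rewrite invf_le1. Qed.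
Let N0 : (0 < N)%N. Proof. exact: N_gt0 i. Qed.
Let b0 := bsc_gt0 z0.
Let t0 : 0 <= t. Proof. exact: sqrtr_ge0. Qed.
Let t2 : t ^+ 2 = cabs (epsm z m). Proof. by rewrite sqr_sqrtr// cabs_ge0. Qed.
Let im0 : 0 <= ip m. Proof. exact: ip_mtr_ge0. Qed.
Let im10 : 0 <= ip m1. Proof. exact: ip_mtr_ge0. Qed.
Let imQ0 : 0 <= ip Q. Proof. exact: ip_qf_ge0. Qed.
Let SE : S = bsc z + 3 * t + Ne^-1. Proof. by []. Qed.
Let S0 : 0 <= S. Proof. by rewrite SE; have := b0; have := t0; have := iNe0; lra. Qed.
Let r0 : 0 <= r. Proof. exact: sqrtr_ge0. Qed.
Let r2 : r ^+ 2 = Ne^-1 * S. Proof. by rewrite sqr_sqrtr// mulr_ge0. Qed.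
Let ir : Ne^-1 <= r.
Proof.
rewrite -[leLHS]ger0_norm// -sqrtr_sqr ler_wsqrtr// expr2 ler_wpM2l// SE.
by have := b0; have := t0; lra.
Qed.
Let vE : v = cabs Y + cabs Z + r. Proof. by []. Qed.
Let Y0 := cabs_ge0 Y.
Let Z0 := cabs_ge0 Z.
Let G0 := cabs_ge0 G.
Let v0 : 0 <= v. Proof. by rewrite vE; have := Y0; have := Z0; have := r0; lra. Qed.

Let lam : cabs (m - msc z) <= 2 * t.
Proof.
rewrite -(@ler_pXn2r _ 2) ?nnegrE ?cabs_ge0 ?mulr_ge0// exprMn t2.
have -> : (2 : R) ^+ 2 = 4 by rewrite expr2; lra.
exact: lam_sq_eps.
Qed.

Let dl : cabs (m - m1) <= Ne^-1. Proof. exact: mtr_diff. Qed.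

Let ipm1 : ip m1 <= S.
Proof.
have h := ip_le_bsc z0 m.
have h1 := ip_le_cabs (m1 - m); rewrite ipB cabsBC in h1.
exact: (im_minor_aux h h1 lam dl t0).
Qed.

Let QE : Q = m1 + Z. Proof. by rewrite /Z /zrow addrC subrK. Qed.
Let ipQ : ip Q <= ip m1 + cabs Z.
Proof. by rewrite QE ipD lerD2l; exact: ip_le_cabs. Qed.

Lemma W_le : cabs W <= ip Q. Proof. exact: qf_sqres. Qed.

Lemma cb_le : cabs cb <= ip m1.
Proof.
rewrite /cb cabs_rcM; last by rewrite invr_ge0.
rewrite ip_mtr; apply: ler_wpM2l; first by rewrite invr_ge0.
apply: le_trans (cabs_sum _ _ _) _; apply: ler_sum => j _.
by apply: le_trans (cabs_sqres _ _ _ z0) _; set x := ip _; lra.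
Qed.

Lemma crow_le : cabs Y <= 2 * ip m1 + cabs Z.
Proof.
have := cabsB W cb; have := W_le; have := cb_le; have := ipQ.
by rewrite -/Y; set x := ip m1; set y := cabs W; set y' := cabs cb; lra.
Qed.

Let tle : t <= 2 + 3 * cabs m + cabs m ^+ 2.
Proof.
have h : t <= 1 + t ^+ 2 by have := sqr_ge0 (t - 2^-1); nra.
apply: le_trans h _; rewrite t2 /epsm.
have zz : cabs z <= 3.
  have := cabs_sqr z; have := cabs_ge0 z; move: re0 re2 z1 z0.
  by set x := cabs z; set a := rp z; set c := ip z => *; nra.
have m0 := cabs_ge0 m.
have h1 : cabs (1 + z * m + m ^+ 2) <= 1 + cabs z * cabs m + cabs m ^+ 2.
  apply: le_trans (cabsD _ _) _; rewrite cabsX lerD2r.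
  by apply: le_trans (cabsD _ _) _; rewrite cabs1 cabsM.
have : cabs z * cabs m <= 3 * cabs m by rewrite ler_wpM2r.
lra.
Qed.

Let vF : v <= F.
Proof.
have bb : bsc z <= 3.
  have := ip_le_cabs (msc z); have := cabs_msc z0; rewrite /bsc; move: z1.
  by set x := ip z; set y := ip (msc z); set c := cabs _; lra.
have rl : r <= 5 + 3 * t.
  have h : r <= 1 + r ^+ 2 by have := sqr_ge0 (r - 2^-1); nra.
  have : Ne^-1 * S <= 1 * S by rewrite ler_wpM2r.
  by move: h; rewrite r2 SE; move: iNe1 bb t0; lra.
have := crow_le; move: tle rl; rewrite vE /F /Fval -/m -/m1 -/Z.
by set x := ip m1; set y := cabs m; set y2 := _ ^+ 2; set c := cabs Y; set c' := cabs Z; lra.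
Qed.

Let deltaE : m - m1 = rc Ne^-1 * (G * W).
Proof.
rewrite /m /m1 mtr_rank1// qf_res2// -/G -/W /Ne invfM rmorphM /= natrC fmorphV.
by rewrite [in RHS]fmorphV /=; ring.
Qed.

Let GE : G = msc z + G * msc z * (Q - msc z).
Proof. by rewrite /G /gdiag; apply: resolvent_expand => //; exact: den_rank1. Qed.

Let QmE : Q - msc z = Z + (m1 - msc z). Proof. by rewrite QE; ring. Qed.

Let lam1 : cabs (m1 - msc z) <= 2 * t + Ne^-1.
Proof.
have -> : m1 - msc z = (m - msc z) - (m - m1) by ring.
by apply: le_trans (cabsB _ _) _; apply: lerD.
Qed.

Let Qmsc : cabs (Q - msc z) <= cabs Z + 2 * t + r.
Proof.
rewrite QmE; apply: le_trans (cabsD _ _) _; rewrite -addrA lerD2l.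
by apply: le_trans lam1 _; rewrite lerD2l.
Qed.

(** Expansion of the effect of removing the row: G is replaced by msc and the quadratic form of the
    squared resolvent by its conditional mean. The errors carry Q - msc or [crow], so a factor v + 2
    t is gained. *)
Let dd0 : cabs ((m - m1) - delta0 X i) <= Ne^-1 * (v + 2 * t).
Proof.
have -> : (m - m1) - delta0 X i = rc Ne^-1 * ((G * (msc z * (Q - msc z))) * W + msc z * Y).
  rewrite deltaE /delta0 -/cb -mulrBr; congr (_ * _).
  have -> : Y = W - cb by [].
  by rewrite {1}GE; ring.
rewrite cabs_rcM// ler_wpM2l//.
apply: le_trans (cabsD _ _) _; rewrite 4!cabsM.
have c1 := cabs_msc z0; have cp := cabs_ge0 (msc z).
have h1 : cabs G * (cabs (msc z) * cabs (Q - msc z)) * cabs W <= cabs Z + 2 * t + r.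
  have e : cabs G * (cabs (msc z) * cabs (Q - msc z)) * cabs W = (cabs (msc z) * (cabs G * cabs W)) * cabs (Q - msc z) by ring.
  rewrite e; apply: le_trans Qmsc; rewrite ler_piMl ?cabs_ge0//.
  rewrite -[1]mulr1; apply: ler_pM => //; first by apply: mulr_ge0 => //; exact: cabs_ge0.
  apply: le_trans (gdiag_ip X i z0); rewrite ler_wpM2l//; exact: W_le.
have h2 : cabs (msc z) * cabs Y <= cabs Y by rewrite ler_piMl.
by rewrite vE; lra.
Qed.

(** The difference of two defects is a product whose second factor is close to 2 m + z, hence small
    near the edge. Its majorant S and the factor 1/Ne of [dd0] combine into r^2. *)
Let fac : cabs (z + m + (m1 + delta0 X i)) <= 2 * (1 + ip m1) * S.
Proof.
have -> : z + m + (m1 + delta0 X i) = (m + msc z + z) + (m - msc z) - (m - m1) + delta0 X i by ring.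
have h0 : cabs (delta0 X i) <= Ne^-1 * ip m1.
  rewrite /delta0 -/cb cabs_rcM; last exact: iNe0.
  apply: ler_wpM2l; first exact: iNe0.
  rewrite cabsM; apply: le_trans cb_le; apply: ler_piMl; first exact: cabs_ge0.
  exact: cabs_msc.
have h1 := factor_le z0 re0 re2 m.
apply: le_trans (cabsD _ _) _; apply: le_trans (lerD (cabsB _ _) h0) _.
apply: (@le_trans _ _ (cabs (m + msc z + z) + cabs (m - msc z) + cabs (m - m1) + Ne^-1 * ip m1)).
  by rewrite 2!lerD2r cabsD.
have h2 : 0 <= ip m1 * (bsc z + 3 * t) by apply: mulr_ge0 => //; have := b0; have := t0; lra.
have h3 : 0 <= ip m1 * Ne^-1 by exact: mulr_ge0.
have h4 := b0; have h5 := t0.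
have -> : 2 * (1 + ip m1) * S = 2 * (bsc z + 3 * t + Ne^-1) + 2 * (ip m1 * (bsc z + 3 * t)) + 2 * (ip m1 * Ne^-1).
  by rewrite SE; ring.
rewrite [Ne^-1 * ip m1]mulrC.
move: h1 lam dl h2 h3 h4 h5 iNe0; move: (cabs (m + _ + _)) (cabs (m - msc z)) (cabs (m - m1)) (ip m1 * (bsc z + 3 * t)) (ip m1 * Ne^-1).
by move: (bsc z) (t) (Ne^-1) => x1 x2 x3 x4 x5 x6 x7 x8; lra.
Qed.

Let Dl := cabs (epsm z m - eps0 X i).
Let DlE : Dl <= 4 * (1 + ip m1) * r ^+ 2 * (v + t).
Proof.
have -> : Dl = cabs ((m - m1) - delta0 X i) * cabs (z + m + (m1 + delta0 X i)).
  by rewrite -cabsM /Dl /eps0 /epsm -/m1; congr cabs; ring.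
apply: (@le_trans _ _ ((Ne^-1 * (v + 2 * t)) * (2 * (1 + ip m1) * S))).
  by apply: ler_pM => //; exact: cabs_ge0.
rewrite r2.
have -> : Ne^-1 * (v + 2 * t) * (2 * (1 + ip m1) * S) = (2 * (1 + ip m1) * (Ne^-1 * S)) * (v + 2 * t) by ring.
have -> : 4 * (1 + ip m1) * (Ne^-1 * S) * (v + t) = (2 * (1 + ip m1) * (Ne^-1 * S)) * (2 * (v + t)) by ring.
apply: ler_wpM2l; last by have := v0; lra.
by apply: mulr_ge0; [have := im10; lra|exact: mulr_ge0].
Qed.

(** The only error of first order is -msc Z. It is left aside, multiplied by [phi] of a defect
    independent of row i, so that its expectation vanishes; every other term carries two small
    factors among v and t, or the increment of [phi]. *)
Lemma pointwise_bound q :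
  rp (G * (m - Q) * phi q (epsm z m)) <=
  (2 * q).+2%:R * (uval X i * (uval X i + t) ^+ (4 * q).+3) - rp (msc z * Z * phi q (eps0 X i)).
Proof.
have I1 : 1 <= 1 + ip m1 by have := im10; lra.
have e : G * (m - Q) = (G * (m - m1) - msc z * G * Z ^+ 2 - msc z * G * Z * (m1 - msc z)) - msc z * Z.
  have -> : m - Q = (m - m1) - Z by rewrite QE opprD addrA.
  rewrite mulrBr {2}GE QmE; ring.
set H := G * (m - m1) - msc z * G * Z ^+ 2 - msc z * G * Z * (m1 - msc z) in e.
have -> : G * (m - Q) * phi q (epsm z m) = H * phi q (epsm z m)
  - msc z * Z * (phi q (epsm z m) - phi q (eps0 X i)) - msc z * Z * phi q (eps0 X i).
  by rewrite e; ring.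
rewrite rpB lerD2r rpB.
have g0 := G0; have c1 := cabs_msc z0; have c0 := cabs_ge0 (msc z).
have Zv : 0 <= cabs Z <= v by rewrite Z0 vE; have := Y0; have := r0; lra.
have rv' : 0 <= r <= v by rewrite r0 vE; have := Y0; have := Z0; lra.
have hH : cabs H <= cabs G ^+ 2 * v ^+ 2 + cabs G * v ^+ 2 + cabs G * v * (2 * t + v).
  rewrite /H; apply: le_trans (cabsB _ _) _; apply: lerD; first apply: le_trans (cabsB _ _) _.
    apply: lerD.
      rewrite cabsM expr2 -mulrA ler_wpM2l//.
      apply: le_trans (mtr_diff_le X i z0) _; rewrite -/G -/Q -/Ne -mulrA ler_wpM2l//.
      rewrite ler_pdivrMr//.
      have h1 : ip Q <= S + cabs Z by apply: le_trans ipQ _; rewrite lerD2r.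
      apply: le_trans h1 _; rewrite -ler_pdivrMr// mulrDl [S / Ne]mulrC -r2.
      case/andP: Zv => _ Zv; have Zr : cabs Z / Ne <= cabs Z * r by rewrite ler_wpM2l.
      apply: le_trans (lerD (lexx _) Zr) _.
      by have := Y0; have := Z0; have := r0; rewrite vE; set x := cabs Y; set y := cabs Z; set c := r; nra.
    rewrite 2!cabsM cabsX -mulrA; apply: le_trans (_ : 1 * (cabs G * cabs Z ^+ 2) <= _).
      by rewrite ler_wpM2r// mulr_ge0 ?sqr_ge0.
    rewrite mul1r ler_wpM2l// lerXn2r ?nnegrE//; by case/andP: Zv.
  rewrite 3!cabsM; case/andP: Zv => _ Zv; apply: ler_pM; rewrite ?cabs_ge0//.
  - by rewrite !mulr_ge0.
  - by apply: ler_pM => //; [rewrite mulr_ge0|rewrite ler_piMl].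
  - apply: le_trans lam1 _; rewrite lerD2l; apply: le_trans ir _; by case/andP: rv'.
have t4 : cabs (phi q (epsm z m)) = t ^+ (4 * q).+2.
  by rewrite cabs_phi -t2 -exprM mulnS mulnA.
have p1 : rp (H * phi q (epsm z m)) <= uval X i * (uval X i + t) ^+ (4 * q).+3.
  apply: le_trans (rp_le_cabs _) _; rewrite cabsM t4.
  apply: le_trans (step_main q g0 I1 v0 vF t0).
  by rewrite ler_wpM2r// exprn_ge0.
have p2 : - rp (msc z * Z * (phi q (epsm z m) - phi q (eps0 X i))) <=
   (2 * q).+1%:R * (uval X i * (uval X i + t) ^+ (4 * q).+3).
  rewrite -rpN; apply: le_trans (rp_le_cabs _) _; rewrite cabsN 2!cabsM.
  have D0 : 0 <= Dl by exact: cabs_ge0.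
  apply: le_trans (step_phi q g0 I1 v0 vF t0 Zv rv' D0 DlE).
  apply: ler_pM; rewrite ?mulr_ge0 ?cabs_ge0//; first by rewrite ler_piMl.
  rewrite cabsBC; apply: le_trans (phi_diff _ _ _) _.
  by rewrite cabsBC -/Dl t2.
apply: le_trans (lerD p1 p2) _.
by rewrite -[(2 * q).+2]addn1 natrD mulrDl mul1r addrC.
Qed.

End Pointwise.

Lemma exists_ge_avg (R : realType) N (x : 'I_N -> R) (y : R) : (0 < N)%N ->
  y <= N%:R^-1 * \sum_i x i -> exists i, y <= x i.
Proof.
move=> N0 h; apply: contrapT => hn.
have hx i : x i < y by rewrite ltNge; apply/negP => hi; apply: hn; exists i.
have Np : 0 < N%:R :> R by rewrite ltr0n.
suff : \sum_i x i < \sum_(i < N) y.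
  rewrite sumr_const card_ord -mulr_natl => h2.
  by move: h; rewrite leNgt mulrC ltr_pdivrMr// mulrC h2.
apply: ltr_sum; last by move=> i _; exact: hx.
by apply/hasP; exists (Ordinal N0) => //; rewrite mem_index_enum.
Qed.

(** * Expectation of the pointwise estimate *)

Section Sharp.
Context d (T : measurableType d) (R : realType) (P : probability T R).
Variable N : nat.
Local Notation E := ('I_N * 'I_N)%type.
Local Notation fullE := ([set: E]%SET).
Variables (ms : {set E} -> (T -> R) -> Prop) (A : T -> 'M[complex R]_N) (Cm : R).
Hypothesis M : rmodel P ms A Cm.
Let msy := rm_sys M.
Local Notation mom := (mom P).
Local Notation rv := (rv ms).
Local Notation crv := (crv ms).

Section IndepZero.
Variables (z : complex R) (i : 'I_N) (Y : T -> complex R).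
Hypotheses (z0 : 0 < ip z) (cY : crv (off_row i) Y).
Let B w := res (rowz (A w) i) z.

Lemma quad_indep0 j k : Ex P (fun w => rp ((A w i j * B w j k * (A w i k)^*%C
    - (if j == k then rc N%:R^-1 * B w j j else 0)) * Y w)) = 0.
Proof.
have cB a b : crv (off_row i) (fun w => B w a b) by exact: (crv_minor M z0).
have cAf a : crv fullE (fun w => A w i a) by exact: (crv_full M).
have [jk|jk] := eqVneq j k; last first.
  rewrite -[RHS](@entry_indep0 _ _ _ _ _ _ _ _ M i j (fun w => B w j k * (A w i k)^*%C * Y w)).
    by apply: Ex_ext => w; congr rp; rewrite subr0; ring.
  apply: (crvM msy); last exact: (crv_sub msy (off_row_sub i j) cY).
  apply: (crvM msy); first exact: (crv_sub msy (off_row_sub i j) (cB _ _)).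
  by apply: (crvJ msy); apply: (rm_entry M); rewrite inE; apply: contra jk => /eqP[->].
rewrite -jk; pose V w := rp (B w j j * Y w).
have rV : rv (off_entry i j) V.
  apply: rv_rp; apply: (crv_sub msy (off_row_sub i j)); exact: (crvM msy).
have rA : rv [set (i, j)]%SET (fun w => cabs (A w i j) ^+ 2).
  by apply: (rvX msy); apply: (rv_cabs msy); apply: (rm_entry M); rewrite inE.
have e : Ex P (fun w => cabs (A w i j) ^+ 2 * V w) = N%:R^-1 * Ex P V.
  by rewrite (entry_indep M rA rV) (rm_var M).
have rAV : rv fullE (fun w => cabs (A w i j) ^+ 2 * V w).
  by apply: (rvM msy); [exact: (rvT msy rA)|exact: (rvT msy rV)].
transitivity (Ex P (fun w => cabs (A w i j) ^+ 2 * V w + - N%:R^-1 * V w)).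
  apply: Ex_ext => w; rewrite /V.
  have -> : A w i j * B w j j * (A w i j)^*%C = rc (cabs (A w i j) ^+ 2) * B w j j.
    by rewrite mulrAC mulJc.
  by rewrite mulrBl rpB -2!mulrA 2!rpcM mulNr.
rewrite (@ExDr _ _ _ _ _ _ msy fullE) //; last first.
  by apply: (rvM msy); [exact: (rv_cst msy)|exact: (rvT msy rV)].
by rewrite e (@ExZr _ _ _ _ _ _ msy fullE); [rewrite mulNr subrr|exact: (rvT msy rV)].
Qed.

Lemma zrow_indep0 : Ex P (fun w => rp (zrow z (A w) i * Y w)) = 0.
Proof.
have cB a b : crv fullE (fun w => B w a b) by apply: (crvT msy); exact: (crv_minor M z0).
have cYf : crv fullE Y by exact: (crvT msy cY).
have cAf a : crv fullE (fun w => A w i a) by exact: (crv_full M).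
have rt k j : rv fullE (fun w => rp ((A w i j * B w j k * (A w i k)^*%C
    - (if j == k then rc N%:R^-1 * B w j j else 0)) * Y w)).
  apply: rv_rp; apply: (crvM msy) => //; apply: (crvB msy).
    by apply: (crvM msy); [exact: (crvM msy)|exact: (crvJ msy)].
  case: eqP => _; last exact: (crv_cst msy).
  by apply: (crvM msy) => //; exact: (crv_cst msy).
transitivity (Ex P (fun w => \sum_k \sum_j rp ((A w i j * B w j k * (A w i k)^*%C
    - (if j == k then rc N%:R^-1 * B w j j else 0)) * Y w))).
  apply: Ex_ext => w.
  under eq_bigr do rewrite -rp_sum -mulr_suml.
  rewrite -rp_sum -mulr_suml; congr (rp (_ * _)).
  rewrite zrowE qfE mulr_sumr -sumrB; apply: eq_bigr => k _.
  rewrite sumrB; congr (_ - _).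
    by apply: eq_bigr => j _; rewrite [row i (A w) 0 j]mxE [row i (A w) 0 k]mxE.
  by rewrite (bigD1 k)//= eqxx big1 ?addr0// => j /negbTE ->.
rewrite (@Ex_sum _ _ _ _ _ _ msy _ _ _ _ fullE); last by move=> k _; apply: (rv_sum msy).
apply: big1 => k _; rewrite (@Ex_sum _ _ _ _ _ _ msy _ _ _ _ fullE)//.
by apply: big1 => j _; exact: quad_indep0.
Qed.
End IndepZero.

Variable z : complex R.
Hypotheses (z0 : 0 < ip z) (re0 : 0 <= rp z) (re2 : rp z <= 2) (z1 : ip z <= 1).
Hypothesis zN : 1 <= N%:R * ip z.
Local Notation Ne := (N%:R * ip z).

Lemma N0' : (0 < N)%N.
Proof. by rewrite lt0n; apply/eqP => e; move: zN; rewrite e mul0r ler10. Qed.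
Lemma Ne0' : 0 < Ne. Proof. exact: lt_le_trans zN. Qed.

Lemma rv_t : rv fullE (fun w => tval z (A w)).
Proof. by apply: (rv_sqrt msy); apply: (rv_cabs msy); exact: (crv_eps M z0). Qed.

Lemma crv_sum_sqres i : crv (off_row i) (fun w => rc N%:R^-1 * \sum_j sqres (rowz (A w) i) z j j).
Proof.
apply: (crvM msy); first exact: (crv_cst msy).
by apply: (crv_sum msy) => j _; exact: (crv_minor2 M z0).
Qed.

Lemma crv_crow i : crv fullE (fun w => crow z (A w) i).
Proof.
apply: (crvB msy); last by apply: (crvT msy); exact: crv_sum_sqres.
apply: (crv_qf msy) => a; first exact: (crv_row M).
by move=> b; apply: (crvT msy); exact: (crv_minor2 M z0).
Qed.

Lemma crv_eps0 i : crv (off_row i) (fun w => eps0 z (A w) i).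
Proof.
have h : crv (off_row i) (fun w => mtr (rowz (A w) i) z + delta0 z (A w) i).
  apply: (crvD msy); first exact: (crv_mtr_minor M z0).
  apply: (crvM msy); first exact: (crv_cst msy).
  by apply: (crvM msy); [exact: (crv_cst msy)|exact: crv_sum_sqres].
apply: (crvD msy); last exact: (crvX msy).
by apply: (crvD msy); [|apply: (crvM msy)] => //; exact: (crv_cst msy).
Qed.

Lemma rv_S : rv fullE (fun w => Sval z (A w)).
Proof.
apply: (rvD msy); last exact: (rv_cst msy).
apply: (rvD msy); first exact: (rv_cst msy).
by apply: (rvM msy); [exact: (rv_cst msy)|exact: rv_t].
Qed.

Lemma rv_zr i : rv fullE (fun w => cabs (zrow z (A w) i)).
Proof. by apply: (rv_cabs msy); exact: (crv_zrow M z0). Qed.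
Lemma rv_cr i : rv fullE (fun w => cabs (crow z (A w) i)).
Proof. by apply: (rv_cabs msy); exact: crv_crow. Qed.
Lemma rv_r : rv fullE (fun w => Num.sqrt (Ne^-1 * Sval z (A w))).
Proof. by apply: (rv_sqrt msy); apply: (rvM msy); [exact: (rv_cst msy)|exact: rv_S]. Qed.

Lemma rv_v i : rv fullE (fun w => vval z (A w) i).
Proof.
apply: (rvD msy); last exact: rv_r.
by apply: (rvD msy); [exact: rv_cr|exact: rv_zr].
Qed.

Lemma rv_m1 i : rv fullE (fun w => ip (mtr (rowz (A w) i) z)).
Proof. by apply: (rvT msy (S := off_row i)); apply: rv_ip; exact: (crv_mtr_minor M z0). Qed.
Lemma rv_m : rv fullE (fun w => cabs (mtr (A w) z)).
Proof. by apply: (rv_cabs msy); exact: (crv_mtrA M z0). Qed.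
Lemma rv_g i : rv fullE (fun w => cabs (gdiag (A w) z i)).
Proof. by apply: (rv_cabs msy); exact: (crv_gdiag M z0). Qed.

Lemma rv_F i : rv fullE (fun w => Fval z (A w) i).
Proof.
have h c (f : T -> R) : rv fullE f -> rv fullE (fun w => c * f w).
  by move=> rf; apply: (rvM msy) => //; exact: (rv_cst msy).
apply: (rvD msy); last by apply: h; apply: (rvX msy); exact: rv_m.
apply: (rvD msy); last by apply: h; exact: rv_m.
apply: (rvD msy); last exact: (rv_cst msy).
by apply: (rvD msy); apply: h; [exact: rv_m1|exact: rv_zr].
Qed.

Lemma rv_1D f : rv fullE f -> rv fullE (fun w => 1 + f w).
Proof. by move=> rf; apply: (rvD msy) => //; exact: (rv_cst msy). Qed.

Lemma rv_u i : rv fullE (fun w => uval z (A w) i).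
Proof.
apply: (rvM msy); last by apply: rv_1D; exact: rv_F.
apply: (rvM msy); last exact: rv_v.
apply: (rvM msy); last by apply: rv_1D; exact: rv_m1.
apply: (rvM msy); first exact: (rv_cst msy).
by apply: (rvX msy); apply: rv_1D; exact: rv_g.
Qed.

Lemma t_ge0 w : 0 <= tval z (A w). Proof. exact: sqrtr_ge0. Qed.
Lemma S_ge0 w : 0 <= Sval z (A w).
Proof.
have := bsc_gt0 z0; have := t_ge0 w; have := Ne0'; rewrite -invr_gt0 /Sval; lra.
Qed.
Lemma v_ge0 w i : 0 <= vval z (A w) i.
Proof. by rewrite /vval !addr_ge0 ?cabs_ge0 ?sqrtr_ge0. Qed.
Lemma m1_ge0 w i : 0 <= ip (mtr (rowz (A w) i) z). Proof. exact: ip_mtr_ge0. Qed.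
Lemma F_ge0 w i : 0 <= Fval z (A w) i.
Proof.
have h := m1_ge0 w i; have h2 := cabs_ge0 (zrow z (A w) i); have h3 := cabs_ge0 (mtr (A w) z).
by have := sqr_ge0 (cabs (mtr (A w) z)); rewrite /Fval; lra.
Qed.
Lemma u_ge0 w i : 0 <= uval z (A w) i.
Proof.
have a1 := F_ge0 w i; have a2 := m1_ge0 w i; have a3 := v_ge0 w i.
rewrite /uval /uform; apply: mulr_ge0; last lra.
apply: mulr_ge0 => //; apply: mulr_ge0; last lra.
by apply: mulr_ge0 => //; exact: sqr_ge0.
Qed.

(** The average over rows is replaced by a row where the term is at least the average. This leaves a
    single variable u, as [moment_close] requires. *)
Lemma t_recursion q : exists i, Ex P (fun w => tval z (A w) ^+ (4 * q.+1)) <=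
  (2 * q).+2%:R * Ex P (fun w => uval z (A w) i * (uval z (A w) i + tval z (A w)) ^+ (4 * q).+3).
Proof.
have ru i : rv fullE (fun w => uval z (A w) i * (uval z (A w) i + tval z (A w)) ^+ (4 * q).+3).
  by apply: (rvM msy); [exact: rv_u|apply: (rvX msy); apply: (rvD msy); [exact: rv_u|exact: rv_t]].
have cW i : crv (off_row i) (fun w => msc z * phi q (eps0 z (A w) i)).
  by apply: (crvM msy); [exact: (crv_cst msy)|apply: (crv_phi msy); exact: crv_eps0].
pose W i w := rp (zrow z (A w) i * (msc z * phi q (eps0 z (A w) i))).
have rW i : rv fullE (W i).
  by apply: rv_rp; apply: (crvM msy); [exact: (crv_zrow M z0)|exact: (crvT msy (cW i))].
have W0 i : Ex P (W i) = 0 by exact: zrow_indep0.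
apply: (exists_ge_avg N0').
have hpt w : tval z (A w) ^+ (4 * q.+1) <= N%:R^-1 * \sum_i
   ((2 * q).+2%:R * (uval z (A w) i * (uval z (A w) i + tval z (A w)) ^+ (4 * q).+3) + - 1 * W i w).
  have -> : tval z (A w) ^+ (4 * q.+1) = rp (epsm z (mtr (A w) z) * phi q (epsm z (mtr (A w) z))).
    rewrite rp_mul_phi (_ : 4 * q.+1 = 2 * (2 * q.+1))%N; last by rewrite mulnA.
    by rewrite exprM sqr_sqrtr ?cabs_ge0.
  rewrite {1}(eps_avg _ N0' z0) -mulrA mulr_suml.
  have -> : (N%:R^-1 : complex R) = rc N%:R^-1 by rewrite natrC fmorphV.
  rewrite rpcM ler_wpM2l ?invr_ge0// rp_sum; apply: ler_sum => i _.
  apply: le_trans (@pointwise_bound R N (A w) z i z0 re0 re2 z1 zN q) _.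
  rewrite mulN1r lerD2l lerN2 /W le_eqVlt; apply/orP; left; apply/eqP; congr rp; ring.
apply: le_trans (@Ex_mono _ _ _ _ _ _ msy fullE _ _ _ _ hpt) _.
- by apply: (rvX msy); exact: rv_t.
- apply: (rvM msy); first exact: (rv_cst msy).
  apply: (rv_sum msy) => i _; apply: (rvD msy); apply: (rvM msy) => //; exact: (rv_cst msy).
rewrite (@ExZr _ _ _ _ _ _ msy fullE); last first.
  by apply: (rv_sum msy) => i _; apply: (rvD msy); apply: (rvM msy) => //; exact: (rv_cst msy).
rewrite ler_wpM2l ?invr_ge0// (@Ex_sum _ _ _ _ _ _ msy _ _ _ _ fullE); last first.
  by move=> i _; apply: (rvD msy); apply: (rvM msy) => //; exact: (rv_cst msy).
apply: ler_sum => i _.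
rewrite (@ExDr _ _ _ _ _ _ msy fullE); [|by apply: (rvM msy) => //; exact: (rv_cst msy)..].
by rewrite (@ExZr _ _ _ _ _ _ msy fullE)// (@ExZr _ _ _ _ _ _ msy fullE)// W0 mulr0 addr0.
Qed.

End Sharp.

(** * Constants polynomial in the order *)

Section SharpConstants.
Variables (R : realType) (Cm : R).
Hypothesis C1 : 1 <= Cm.

(** One constant for all orders k (q + 1) with k <= 64. Its degree in q + 1 is 16 + 4 = 20, from
    [thr] and [cz]. *)
Definition sbeta (q : nat) : R := 64 * thr Cm (64 * q.+1) * cz Cm (64 * q.+1).

Lemma thr_mono a b : (a <= b)%N -> thr Cm a <= thr Cm b.
Proof.
move=> ab; have H0 : 0 <= lH Cm := le_trans ler01 (lH_ge1 C1).
have h k : 0 <= lH Cm * k%:R by apply: mulr_ge0 => //; exact: ler0n.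
rewrite /thr; apply: lerXn2r; [exact: h|exact: h|].
by apply: ler_wpM2l => //; rewrite ler_nat.
Qed.

Lemma cz_mono a b : (a <= b)%N -> cz Cm a <= cz Cm b.
Proof.
move=> ab; have e1 : 0 <= e0 R := ltW (e0_gt0 R); have C0 : 0 <= Cm := le_trans ler01 C1.
rewrite /cz; apply: ler_wpM2r; first exact: exprn_ge0.
apply: ler_wpM2l; first by apply: mulr_ge0; [exact: ler0n|exact: exprn_ge0].
by apply: lerXn2r; rewrite ?nnegrE ?ler0n// ler_nat.
Qed.

Lemma cz_ge n : (0 < n)%N -> 1 + 16 * e0 R * n%:R ^+ 2 <= cz Cm n.
Proof.
move=> n0; have e1 := e0_ge1 R; have n1 : 1 <= n%:R :> R by rewrite ler1n.
have a1 : e0 R * n%:R ^+ 2 <= e0 R ^+ 5 * n%:R ^+ 4.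
  apply: ler_pM; [lra|exact: sqr_ge0|exact: ler_eXnr|by rewrite ler_weXn2l].
have a2 : 1 <= e0 R ^+ 5 * n%:R ^+ 4 by apply: mulr_ege1; exact: exprn_ege1.
have a3 : 1 <= Cm ^+ 4 by exact: exprn_ege1.
have e : cz Cm n = 10000 * (e0 R ^+ 5 * n%:R ^+ 4) * Cm ^+ 4 by rewrite /cz; ring.
have w0 : 0 <= 10000 * (e0 R ^+ 5 * n%:R ^+ 4).
  by apply: mulr_ge0; [exact: ler0n|exact: le_trans ler01 a2].
apply: (@le_trans _ _ (10000 * (e0 R ^+ 5 * n%:R ^+ 4))).
  by move: a1 a2; rewrite -!mulrA; set x := e0 R * _; set y := _ * n%:R ^+ 4; lra.
by rewrite e; apply: ler_peMr.
Qed.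

Lemma cz1 n : (0 < n)%N -> 1 <= cz Cm n.
Proof.
move=> n0; apply: le_trans (cz_ge n0); rewrite lerDl; apply: mulr_ge0; last exact: sqr_ge0.
by apply: mulr_ge0; [exact: ler0n|exact: ltW (e0_gt0 R)].
Qed.

Lemma sbeta_cz k q : (0 < k <= 64)%N -> cz Cm (k * q.+1) <= sbeta q.
Proof.
move=> /andP[k0 k64]; have h1 := thr_ge1 C1 (_ : 0 < 64 * q.+1)%N.
have h2 : cz Cm (k * q.+1) <= cz Cm (64 * q.+1) by apply: cz_mono; rewrite leq_mul2r k64 orbT.
have h3 : 1 <= cz Cm (64 * q.+1) by exact: cz1.
apply: le_trans h2 _; rewrite /sbeta ler_peMl//; first lra.
by have := h1 isT; lra.
Qed.

Lemma sbeta_thr k q : (0 < k <= 64)%N -> 64 * thr Cm (k * q.+1) <= sbeta q.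
Proof.
move=> /andP[k0 k64].
have h2 : thr Cm (k * q.+1) <= thr Cm (64 * q.+1) by apply: thr_mono; rewrite leq_mul2r k64 orbT.
have h3 : 1 <= cz Cm (64 * q.+1) by exact: cz1.
have h4 : 1 <= thr Cm (64 * q.+1) by exact: thr_ge1.
rewrite /sbeta; apply: (@le_trans _ _ (64 * thr Cm (64 * q.+1))); first by rewrite ler_pM2l.
by rewrite ler_peMr//; lra.
Qed.

Lemma sbeta_prod k q : (0 < k <= 64)%N -> 64 * thr Cm (k * q.+1) * cz Cm (k * q.+1) <= sbeta q.
Proof.
move=> /andP[k0 k64].
have h2 : thr Cm (k * q.+1) <= thr Cm (64 * q.+1) by apply: thr_mono; rewrite leq_mul2r k64 orbT.
have h1 : cz Cm (k * q.+1) <= cz Cm (64 * q.+1) by apply: cz_mono; rewrite leq_mul2r k64 orbT.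
have kq : (0 < k * q.+1)%N by rewrite muln_gt0 k0.
have h4 : 1 <= thr Cm (k * q.+1) by exact: thr_ge1.
have h3 : 1 <= cz Cm (k * q.+1) by exact: cz1.
by rewrite /sbeta; apply: ler_pM; [lra|lra|rewrite ler_pM2l|].
Qed.

Lemma sbeta_ge64 q : 64 <= sbeta q.
Proof.
have := @sbeta_thr 1 q isT; have := thr_ge1 C1 (_ : 0 < 1 * q.+1)%N; rewrite mul1n => /(_ isT); lra.
Qed.
Lemma sq2 : (2 : R) ^+ 2 = 4.
Proof. by rewrite expr2; lra. Qed.
End SharpConstants.

Lemma close_nat (R : realType) q :
  (2 * q).+2%:R * (4 * q.+1)%:R <= 8 * ((8 * q.+1)%:R * (8 * q.+1)%:R) :> R.
Proof. by rewrite -!natrM ler_nat; nia. Qed.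

Lemma sbeta_scale (R : realType) (Cm : R) q : sbeta Cm q = sbeta Cm 0 * q.+1%:R ^+ 20.
Proof.
rewrite /sbeta /thr /cz.
have -> : (64 * q.+1)%:R = (64 * 1)%:R * q.+1%:R :> R by rewrite muln1 natrM.
move: (lH Cm) ((64 * 1)%:R : R) (10000 * e0 R ^+ 5) (Cm ^+ 4) (q.+1%:R : R) => h u k c n.
by rewrite !exprMn -[20%N]/(16 + 4)%N exprD; move: (h ^+ 16) (u ^+ 16) (u ^+ 4) (n ^+ 16) (n ^+ 4) => a b e f g; ring.
Qed.

Local Opaque sbeta thr lH lK cz.

Lemma ord48 q : ((4 * q.+1).-1.+1 <= 8 * q.+1)%N.
Proof. by rewrite -ord4P leq_mul2r orbT. Qed.

(** * Moments of all error terms in terms of those of t *)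

Section SharpMoments.
Context d (T : measurableType d) (R : realType) (P : probability T R).
Variable N : nat.
Local Notation E := ('I_N * 'I_N)%type.
Local Notation fullE := ([set: E]%SET).
Variables (ms : {set E} -> (T -> R) -> Prop) (A : T -> 'M[complex R]_N) (Cm : R).
Hypothesis M : rmodel P ms A Cm.
Let msy := rm_sys M.
Local Notation mom := (mom P).
Local Notation rv := (rv ms).
Local Notation crv := (crv ms).
Variable z : complex R.
Hypotheses (z0 : 0 < ip z) (re0 : 0 <= rp z) (re2 : rp z <= 2) (z1 : ip z <= 1).
Hypothesis zN : 1 <= N%:R * ip z.
Local Notation Ne := (N%:R * ip z).
Variable q : nat.
Local Notation be := (sbeta Cm q).
Local Notation C1 := (rm_cst M).

Lemma Ninv0 : 0 < Ne^-1. Proof. by rewrite invr_gt0; exact: Ne0'. Qed.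
Lemma Ninv1 : Ne^-1 <= 1. Proof. by rewrite invf_le1//; exact: Ne0'. Qed.
Lemma be64 : 64 <= be. Proof. exact: sbeta_ge64 C1 q. Qed.
Lemma be0 : 0 < be. Proof. by have := be64; lra. Qed.

Lemma mom_g k i : (0 < k <= 64)%N -> mom (k * q.+1) (fun w => cabs (gdiag (A w) z i)) be.
Proof.
move=> hk; have /andP[k0 _] := hk; have hb := sbeta_thr C1 q hk; have hn := N0' zN.
have kq : (0 < k * q.+1)%N by rewrite muln_gt0 k0.
have ht := thr_ge1 C1 kq; rewrite (mulP _ k0) in hb ht *.
by apply: mom_ler (gdiag_mom hn M re0 re2 zN z1 _ i); lra.
Qed.

Lemma mom_b k i j : (0 < k <= 64)%N -> mom (k * q.+1) (fun w => cabs (res (rowz (A w) i) z j j)) be.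
Proof.
move=> hk; have /andP[k0 _] := hk; have hb := sbeta_thr C1 q hk; have hn := N0' zN.
have kq : (0 < k * q.+1)%N by rewrite muln_gt0 k0.
have ht := thr_ge1 C1 kq; rewrite (mulP _ k0) in hb ht *.
by apply: mom_ler (minor_diag_mom hn M re0 re2 zN z1 _ i j); lra.
Qed.

Lemma mom_be k i j l : (0 < k <= 64)%N ->
  mom (k * q.+1) (fun w => cabs (res (rowz (A w) i) z j l)) (be * Num.sqrt (Num.sqrt (ip z)^-1)).
Proof.
move=> hk; have /andP[k0 _] := hk; have hb := sbeta_thr C1 q hk; have hn := N0' zN.
have kq : (0 < k * q.+1)%N by rewrite muln_gt0 k0.
have ht := thr_ge1 C1 kq; rewrite (mulP _ k0) in hb ht *.
have s0 := sqrtr_ge0 (Num.sqrt (ip z)^-1).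
apply: mom_ler (minor_entry_mom hn M re0 re2 zN z1 _ i j l).
  by apply: mulr_ge0 => //; lra.
by apply: ler_wpM2r => //; lra.
Qed.

Lemma mom_m k : (0 < k <= 64)%N -> mom (k * q.+1) (fun w => cabs (mtr (A w) z)) be.
Proof.
move=> hk; have /andP[k0 _] := hk.
apply: (mom_le msy (S := fullE) (g := fun w => N%:R^-1 * \sum_i cabs (gdiag (A w) z i))).
- exact: (rv_m M z0).
- by apply: (rvM msy); [exact: (rv_cst msy)|apply: (rv_sum msy) => i _; exact: (rv_g M z0)].
- by move=> w; exact: cabs_ge0.
- move=> w; rewrite mtr_gdiag// cabsM cabsV cabs_nat ler_wpM2l ?invr_ge0//; exact: cabs_sum.
have h i := mom_g i hk; rewrite (mulP _ k0) in h *.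
apply: (mom_avg msy (S := fullE)) => //.
- exact: (N0' zN).
- by move=> i; exact: (rv_g M z0).
- by move=> i w; exact: cabs_ge0.
- exact: be0.
Qed.

Lemma mom_im1 k i : (0 < k <= 64)%N -> mom (k * q.+1) (fun w => ip (mtr (rowz (A w) i) z)) be.
Proof.
move=> hk; have /andP[k0 _] := hk; have h j := mom_b i j hk; rewrite (mulP _ k0) in h *.
apply: (mom_ip_mtr M z0 be0); exact: (mom_ip M z0 h).
Qed.

Lemma mom_z32 i : mom (32 * q.+1) (fun w => cabs (zrow z (A w) i)) be.
Proof.
have e1 : (32 * q.+1 = 4 * ((8 * q.+1).-1).+1)%N by rewrite -mulP// mulnA.
have e2 : (2 * ((8 * q.+1).-1).+1 = 16 * q.+1)%N by rewrite -mulP// mulnA.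
set K := 16 * thr Cm (16 * q.+1).
have kq : (0 < 16 * q.+1)%N by [].
have t1 := thr_ge1 C1 kq.
have K1 : 1 <= K by rewrite /K; lra.
have hB j : mom (2 * ((8 * q.+1).-1).+1) (fun w => cabs (res (rowz (A w) i) z j j)) K.
  by rewrite e2 /K mulP//; exact: (minor_diag_mom (N0' zN) M re0 re2 zN z1 _ i j).
have := zrow_mom M z0 z1 K1 zN hB; rewrite -e1; apply: mom_ler.
  by apply: mulr_ge0; [apply: le_trans (cz_ge1 M _)|exact: sqrtr_ge0].
have h1 := @sbeta_prod _ _ C1 32 q isT.
have h2 : thr Cm (16 * q.+1) <= thr Cm (32 * q.+1) by apply: (thr_mono C1); rewrite leq_mul2r orbT.
have hc : 1 <= cz Cm (32 * q.+1) by exact: (cz_ge1 M).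
apply: le_trans h1; rewrite mulrC; apply: ler_pM; [exact: sqrtr_ge0|exact: le_trans ler01 hc| |exact: lexx].
apply: (@le_trans _ _ K); last by rewrite /K; lra.
rewrite -[leRHS]ger0_norm; last lra.
rewrite -sqrtr_sqr; apply: ler_wsqrtr; rewrite expr2 ler_wpM2l//; first lra.
by apply: le_trans K1; exact: Ninv1.
Qed.

Variable y : R.
Hypothesis y0 : 0 < y.
Hypothesis hy : mom (4 * q.+1) (fun w => tval z (A w)) y.
(** Deterministic counterpart of [Sval], given a bound [y] for the moments of t; likewise [sth] is
    that of the square root in [vval]. *)
Definition Sb : R := bsc z + 3 * y + Ne^-1.
Definition sth : R := Num.sqrt (Ne^-1 * Sb).

Lemma Sb_gt : Ne^-1 < Sb.
Proof. by have := bsc_gt0 z0; rewrite /Sb; have := y0; lra. Qed.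
Lemma Sb0 : 0 < Sb. Proof. by have := Sb_gt; have := Ninv0; lra. Qed.
Lemma sth0 : 0 < sth. Proof. by rewrite sqrtr_gt0 mulr_gt0 ?Ninv0 ?Sb0. Qed.
Lemma bsth k : 0 < be ^+ k * sth.
Proof. by apply: mulr_gt0; [apply: exprn_gt0; exact: be0|exact: sth0]. Qed.
Lemma bbsth k : 0 < be * (be ^+ k * sth).
Proof. by apply: mulr_gt0; [exact: be0|exact: bsth]. Qed.
Lemma bbsth1 : 0 < be * (be * sth). Proof. exact: (bbsth 1). Qed.
Lemma sth2 : sth ^+ 2 = Ne^-1 * Sb.
Proof. by rewrite sqr_sqrtr// mulr_ge0 ?ltW ?Ninv0 ?Sb0. Qed.
Lemma Ne_sth2 : Ne * sth ^+ 2 = Sb.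
Proof. by rewrite sth2 mulrA mulfV ?mul1r// gt_eqF//; exact: Ne0'. Qed.

Lemma sth_Sb : sth <= Sb.
Proof.
have h := Sb_gt; have h0 := Sb0; rewrite -[leRHS]ger0_norm ?(ltW h0)// -sqrtr_sqr; apply: ler_wsqrtr; rewrite expr2.
by apply: ler_wpM2r; exact: ltW.
Qed.

Lemma Ne_sth1 : 1 <= Ne * sth.
Proof.
have h0 := sth0; have hN := Ne0' zN; have hS := Sb_gt.
have : 1 <= (Ne * sth) ^+ 2.
  rewrite exprMn expr2 -mulrA Ne_sth2; apply: (@le_trans _ _ (Ne * Ne^-1)).
    by rewrite mulfV ?lt0r_neq0.
  by apply: ler_wpM2l; exact: ltW.
have : 0 <= Ne * sth by apply: mulr_ge0; exact: ltW.
by set x := Ne * sth => *; nra.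
Qed.

Lemma Np' : 0 < N%:R :> R. Proof. by rewrite ltr0n; exact: (N0' zN). Qed.

(** As N Im z >= 1 and [bsc z] is at least sqrt(Im z), the jump terms of order N^(-1/2) stay below
    the variance terms even at the edge. *)
Lemma b_nu2 : nu R N ^+ 2 <= bsc z.
Proof.
have b0 := bsc_gt0 z0; rewrite nu2 -[leRHS]ger0_norm ?(ltW b0)// -sqrtr_sqr; apply: ler_wsqrtr.
apply: le_trans (bsc_sq z0 re0 re2); rewrite -div1r ler_pdivrMr ?Np'// mulrC; exact: zN.
Qed.

Lemma b_sqrt : ip z * Num.sqrt (ip z)^-1 <= bsc z.
Proof.
have b0 := bsc_gt0 z0; have h := bsc_sq z0 re0 re2.
have s0 : 0 <= Num.sqrt (ip z)^-1 by exact: sqrtr_ge0.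
rewrite -[leRHS]ger0_norm ?(ltW b0)// -sqrtr_sqr -[leLHS]ger0_norm; last by apply: mulr_ge0 => //; exact: ltW.
rewrite -sqrtr_sqr; apply: le_trans (ler_wsqrtr h).
by rewrite exprMn sqr_sqrtr ?invr_ge0 ?(ltW z0)// expr2 -mulrA mulfV ?mulr1 ?gt_eqF.
Qed.

(** Concentration with theta = c sth, stated once for the resolvent of the minor and for its square.
    The number [c] records by how much the controlling variable [G0] exceeds [Sb]. *)
Lemma conc_gen i (C : T -> 'M[complex R]_N) G0 (c : R) :
  (forall a b, crv (off_row i) (fun w => C w a b)) ->
  (forall w, dominated (ip z) (C w) (res (rowz (A w) i) z)) -> rv fullE G0 ->
  (forall w, ip (qrow (A w) z i) <= G0 w + cabs (qf (row i (A w)) (C w) - rc N%:R^-1 * \sum_j C w j j)) ->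
  (forall w, ip (mtr (rowz (A w) i) z) <= G0 w) ->
  (forall j l, mom (8 * q.+1) (fun w => cabs (C w j l)) (be * Num.sqrt (Num.sqrt (ip z)^-1))) ->
  be <= c -> mom (4 * q.+1) G0 (c ^+ 2 * Sb) ->
  mom (8 * q.+1) (fun w => cabs (qf (row i (A w)) (C w) - rc N%:R^-1 * \sum_j C w j j)) (be * (c * sth)).
Proof.
move=> cC dom rG0 QG0 mG0 mC bc mG.
have b64 := be64; have c1 : 1 <= c by lra.
have c0 : 0 < c by lra.
have sb := Sb0; have th0 := sth0; have hN := Ne0' zN.
have e1 := ord84S q; have e2 := ord24S q.
have hc := @sbeta_cz _ _ C1 8 q isT.
have hb j : mom (4 * q.+1) (fun w => ip (res (rowz (A w) i) z j j)) be.
  have h j' := @mom_b 4 i j' isT; rewrite ord4P in h *; exact: (mom_ip M z0 h).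
have ns : Ne * (c * sth) ^+ 2 = c ^+ 2 * Sb.
  by rewrite exprMn mulrCA Ne_sth2.
have bS : bsc z <= Sb by rewrite /Sb; have := y0; have := Ninv0; lra.
have cc : c <= c ^+ 2 by apply: ler_eXnr.
have nub : nu R N ^+ 2 * be <= c ^+ 2 * Sb.
  rewrite mulrC; apply: ler_pM; [exact: ltW be0|exact: sqr_ge0|by lra|].
  exact: le_trans b_nu2 bS.
have sq0 : 0 < Num.sqrt (Num.sqrt (ip z)^-1) by rewrite !sqrtr_gt0 invr_gt0.
have nuk : nu R N ^+ 2 * (be * Num.sqrt (Num.sqrt (ip z)^-1)) <= c * sth.
  rewrite -(@ler_pXn2r _ 2) ?nnegrE//; last first.
    by apply: mulr_ge0; exact: ltW.
    by apply: mulr_ge0; [exact: sqr_ge0|apply: mulr_ge0; [exact: ltW be0|exact: ltW]].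
  rewrite exprMn -exprM nu4 [(be * _) ^+ 2]exprMn [Num.sqrt (Num.sqrt _) ^+ 2]sqr_sqrtr ?sqrtr_ge0//.
  rewrite [(c * sth) ^+ 2]exprMn sth2.
  have -> : N%:R^-1 * (be ^+ 2 * Num.sqrt (ip z)^-1) = be ^+ 2 * (Ne^-1 * (ip z * Num.sqrt (ip z)^-1)).
    rewrite invfM; have zn : ip z != 0 by rewrite gt_eqF.
    have nn : (N%:R : R) != 0 by rewrite gt_eqF// Np'.
    by field; rewrite nn zn.
  apply: ler_pM.
  - exact: sqr_ge0.
  - by apply: mulr_ge0; [exact: ltW Ninv0|apply: mulr_ge0; [exact: ltW|exact: sqrtr_ge0]].
  - by rewrite lerXn2r ?nnegrE//; lra.
  - by rewrite ler_wpM2l ?(ltW Ninv0)//; apply: le_trans b_sqrt bS.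
have := @quadratic_concentration _ _ _ _ _ _ _ _ M i C (fun w => res (rowz (A w) i) z) (ip z) (2 * q).+1
  cC (fun a => crv_minor M z0 i a a) z0 dom G0 (c ^+ 2 * Sb) be (be * Num.sqrt (Num.sqrt (ip z)^-1)) (c * sth) rG0 QG0.
rewrite -e1 e2 => h.
have mG0' w : N%:R^-1 * \sum_j ip (res (rowz (A w) i) z j j) <= G0 w by rewrite -ip_mtr.
have hh : mom (8 * q.+1) (fun w => cabs (qf (row i (A w)) (C w) - rc N%:R^-1 * \sum_j C w j j)) (cz Cm (8 * q.+1) * (c * sth)).
  apply: h => //.
  - by apply: mulr_gt0 => //; exact: exprn_gt0.
  - exact: be0.
  - by apply: mulr_gt0 => //; exact: be0.
  - exact: mulr_gt0.
  - by rewrite ns.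
  - rewrite mulrCA; apply: mulr_ege1 => //; exact: Ne_sth1.
  - by rewrite ns.
have cs0 : 0 <= c * sth by apply: mulr_ge0; exact: ltW.
apply: mom_ler hh; first by apply: mulr_ge0 => //; apply: le_trans (cz_ge1 M _).
by rewrite ler_wpM2r.
Qed.

Lemma mom_S : mom (4 * q.+1) (fun w => Sval z (A w)) Sb.
Proof.
have b0 := bsc_gt0 z0; have iN := Ninv0.
have r1 := rv_t M z0.
have r3 : rv fullE (fun w => 3 * tval z (A w)) by apply: (rvM msy) => //; exact: (rv_cst msy).
have -> : (fun w => Sval z (A w)) = (fun w => (bsc z + Ne^-1) + 3 * tval z (A w)).
  by apply/funext => w; rewrite /Sval addrAC.
have -> : Sb = (bsc z + Ne^-1) + 3 * y by rewrite /Sb addrAC.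
have h3 : mom (4 * q.+1) (fun w => 3 * tval z (A w)) (3 * y) by apply: (momZ msy _ r1).
have hc := mom_cst P (4 * q.+1) (bsc z + Ne^-1).
have t0 w : 0 <= 3 * tval z (A w) by apply: mulr_ge0 => //; exact: t_ge0.
have c0 : 0 < bsc z + Ne^-1 by exact: addr_gt0.
have y3 : 0 < 3 * y by exact: mulr_gt0.
rewrite ord4P in h3 hc *.
exact: (mom_add msy (S := fullE) (rv_cst msy _ _) r3 (fun=> ltW c0) t0 c0 y3 hc h3).
Qed.

Lemma mtr_minor_S w i : ip (mtr (rowz (A w) i) z) <= Sval z (A w).
Proof.
have im0 : 0 <= ip (mtr (A w) z) by exact: ip_mtr_ge0.
have h := ip_le_bsc z0 (mtr (A w) z).
have h1 := ip_le_cabs (mtr (rowz (A w) i) z - mtr (A w) z); rewrite ipB cabsBC in h1.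
have lam : cabs (mtr (A w) z - msc z) <= 2 * tval z (A w).
  have t2 : tval z (A w) ^+ 2 = cabs (epsm z (mtr (A w) z)) by rewrite sqr_sqrtr// cabs_ge0.
  rewrite -(@ler_pXn2r _ 2) ?nnegrE ?cabs_ge0 ?mulr_ge0 ?t_ge0// exprMn t2.
  rewrite sq2; exact: (lam_sq_eps z0 re0 re2 im0).
exact: (im_minor_aux h h1 lam (mtr_diff _ _ z0) (t_ge0 A z w)).
Qed.

Lemma mom_im1S i : mom (4 * q.+1) (fun w => ip (mtr (rowz (A w) i) z)) Sb.
Proof.
apply: (mom_le msy (S := fullE)) mom_S.
- exact: (rv_m1 M z0).
- exact: (rv_S M z0).
- by move=> w; exact: m1_ge0.
- by move=> w; exact: mtr_minor_S.
Qed.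

Lemma qrow_ip w i : ip (qrow (A w) z i) <= ip (mtr (rowz (A w) i) z) + cabs (zrow z (A w) i).
Proof.
have -> : qrow (A w) z i = mtr (rowz (A w) i) z + zrow z (A w) i by rewrite /zrow addrC subrK.
by rewrite ipD lerD2l; exact: ip_le_cabs.
Qed.

Lemma mom_zS i : mom (8 * q.+1) (fun w => cabs (zrow z (A w) i)) (be * (be * sth)).
Proof.
have b64 := be64; have sb := Sb0.
have -> : (fun w => cabs (zrow z (A w) i)) = (fun w => cabs (qf (row i (A w)) (res (rowz (A w) i) z) -
    rc N%:R^-1 * \sum_j res (rowz (A w) i) z j j)) by apply/funext => w; rewrite zrowE.
apply: (@conc_gen i (fun w => res (rowz (A w) i) z) (fun w => ip (mtr (rowz (A w) i) z))).
- by move=> a b; exact: (crv_minor M z0).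
- by move=> w; exact: dominated_res.
- exact: (rv_m1 M z0).
- by move=> w; rewrite -zrowE; exact: qrow_ip.
- by [].
- by move=> j l; exact: mom_be.
- by [].
- apply: mom_ler (mom_im1S i); first exact: ltW.
  by rewrite ler_peMl ?(ltW sb)//; apply: exprn_ege1; lra.
Qed.

Lemma mom_csq i j l : mom (8 * q.+1) (fun w => cabs (sqres (rowz (A w) i) z j l)) (be * Num.sqrt (Num.sqrt (ip z)^-1)).
Proof.
have b64 := be64; have b0 := be0.
have hx x : mom (8 * q.+1) (fun w => cabs (res (rowz (A w) i) z x x)) be by exact: mom_b.
have rx x : rv (off_row i) (fun w => cabs (res (rowz (A w) i) z x x)).
  by apply: (rv_cabs msy); exact: (crv_minor M z0 i x x).
have rs : rv (off_row i) (fun w => cabs (sqres (rowz (A w) i) z j l)).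
  by apply: (rv_cabs msy); exact: (crv_minor2 M z0 i j l).
have r2 : rv (off_row i) (fun w => cabs (res (rowz (A w) i) z j j) + cabs (res (rowz (A w) i) z l l)).
  exact: (rvD msy).
have r3 : rv (off_row i) (fun w => 2^-1 * (cabs (res (rowz (A w) i) z j j) + cabs (res (rowz (A w) i) z l l))).
  by apply: (rvM msy) => //; exact: (rv_cst msy).
have hpt w : cabs (sqres (rowz (A w) i) z j l) <= 2^-1 * (cabs (res (rowz (A w) i) z j j) + cabs (res (rowz (A w) i) z l l)).
  apply: le_trans (cabs_sqres _ _ _ z0) _; rewrite mulrC ler_pM2l//; apply: lerD; exact: ip_le_cabs.
apply: (mom_le msy rs r3 (fun w => cabs_ge0 _) hpt).
apply: (mom_ler (a := 2^-1 * (be + be))).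
- by apply: mulr_ge0 => //; lra.
- have -> : 2^-1 * (be + be) = be by lra.
  apply: ler_peMr; first exact: ltW.
  rewrite -[1]sqrtr1; apply: ler_wsqrtr; rewrite -[1]sqrtr1; apply: ler_wsqrtr.
  by rewrite -invr1 lef_pV2 ?posrE.
apply: (momZ msy _ r2) => //.
have h1 := hx j; have h2 := hx l; rewrite ord8P in h1 h2 *.
exact: (mom_add msy (rx j) (rx l) (fun w => cabs_ge0 _) (fun w => cabs_ge0 _) b0 b0 h1 h2).
Qed.

(** The controlling variable contains |Z| here: the imaginary part of the form of [res] is bounded
    by means of the fluctuation of that form, not of the form of [sqres]. *)
Lemma mom_cS i : mom (8 * q.+1) (fun w => cabs (crow z (A w) i)) (be * (be ^+ 2 * sth)).
Proof.
have b64 := be64; have sb := Sb0; have th := sth0; have b0 := be0.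
have rz := rv_zr M z0 i; have r1 := rv_m1 M z0 i.
apply: (@conc_gen i (fun w => sqres (rowz (A w) i) z) (fun w => ip (mtr (rowz (A w) i) z) + cabs (zrow z (A w) i))).
- by move=> a b; exact: (crv_minor2 M z0).
- by move=> w; exact: dominated_sqres.
- exact: (rvD msy).
- by move=> w; apply: le_trans (qrow_ip w i) _; rewrite lerDl cabs_ge0.
- by move=> w; rewrite lerDl cabs_ge0.
- by move=> j l; exact: mom_csq.
- by apply: ler_eXnr => //; lra.
- have mz : mom (4 * q.+1) (fun w => cabs (zrow z (A w) i)) (2 * (be * (be * sth))).
    have p := bbsth1.
    by rewrite ord4P; exact: (mom_order msy (ord48 q) rz (fun w => cabs_ge0 _) p (mom_zS i)).
  have m1 := mom_im1S i; rewrite ord4P in mz m1 *.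
  have p1 : 0 < 2 * (be * (be * sth)) := mulr_gt0 (ltr0Sn _ 1) bbsth1.
  apply: mom_ler (mom_add msy (S := fullE) r1 rz (fun w => m1_ge0 A z0 w i) (fun w => cabs_ge0 _) sb p1 m1 mz).
    by apply: addr_ge0; exact: ltW.
  have h1 := sth_Sb.
  have h2 : be * (be * sth) <= be * (be * Sb) by rewrite ler_pM2l// ler_pM2l.
  have -> : be ^+ 2 ^+ 2 * Sb = be ^+ 2 * (be * (be * Sb)) by ring.
  have h3 : 3 * (be * (be * Sb)) <= be ^+ 2 * (be * (be * Sb)).
    apply: ler_wpM2r.
      by apply/ltW; apply: mulr_gt0 => //; exact: mulr_gt0.
    by move: b64; set x := be; nra.
  have h4 : Sb <= be * (be * Sb) by rewrite mulrA ler_peMl ?(ltW sb)//; apply: mulr_ege1; lra.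
  lra.
Qed.

Lemma mom_r : mom (8 * q.+1) (fun w => Num.sqrt (Ne^-1 * Sval z (A w))) sth.
Proof.
have iN := Ninv0; rewrite ord28; apply: mom_sqrt.
- by move=> w; apply: mulr_ge0; [exact: ltW|exact: S_ge0].
- by apply: mulr_ge0; [exact: ltW|exact: ltW Sb0].
by apply: (momZ msy _ (rv_S M z0)); [exact: ltW|exact: mom_S].
Qed.

Lemma mom_v i : mom (8 * q.+1) (fun w => vval z (A w) i) (be ^+ 4 * sth).
Proof.
have b64 := be64; have b0 := be0; have th := sth0.
have h1 := mom_cS i; have h2 := mom_zS i; have h3 := mom_r; rewrite ord8P in h1 h2 h3 *.
have p1 := bbsth 2.
have p2 := bbsth1.
have h12 := mom_add msy (S := fullE) (rv_cr M z0 i) (rv_zr M z0 i) (fun w => cabs_ge0 _) (fun w => cabs_ge0 _) p1 p2 h1 h2.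
have r12 : rv fullE (fun w => cabs (crow z (A w) i) + cabs (zrow z (A w) i)).
  by apply: (rvD msy); [exact: (rv_cr M z0)|exact: (rv_zr M z0)].
have p12 := addr_gt0 p1 p2.
apply: mom_ler (mom_add msy (S := fullE) r12 (rv_r M z0) (fun w => addr_ge0 (cabs_ge0 _) (cabs_ge0 _)) (fun w => sqrtr_ge0 _) p12 th h12 h3).
  by apply: addr_ge0; exact: ltW.
have -> : be * (be ^+ 2 * sth) + be * (be * sth) + sth = (be ^+ 3 + be ^+ 2 + 1) * sth by ring.
rewrite ler_wpM2r ?(ltW th)//.
have a1 : 1 <= be ^+ 2 by apply: exprn_ege1; lra.
have a2 : be ^+ 2 <= be ^+ 3 by rewrite ler_weXn2l//; lra.
have a3 : 3 * be ^+ 3 <= be ^+ 4.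
  by rewrite [be ^+ 4]exprS ler_wpM2r//; [apply: exprn_ge0; lra|lra].
lra.
Qed.

Lemma mom_1D k f a : (0 < k)%N -> rv fullE f -> (forall w, 0 <= f w) -> 0 < a ->
  mom (k * q.+1) f a -> mom (k * q.+1) (fun w => 1 + f w) (1 + a).
Proof.
move=> k0 rf f0 a0 mf; have c1 := mom_cst P (k * q.+1) 1; rewrite mulP// in mf c1 *.
exact: (mom_add msy (S := fullE) (rv_cst msy _ _) rf (fun=> ler01) f0 ltr01 a0 c1 mf).
Qed.

Lemma mom_F i : mom (32 * q.+1) (fun w => 1 + Fval z (A w) i) (be ^+ 3).
Proof.
have b64 := be64; have b0 := be0.
have m1 := @mom_im1 32 i isT; have m2 := mom_z32 i; have m3 := @mom_m 32 isT.
have m4 : mom (32 * q.+1) (fun w => cabs (mtr (A w) z) ^+ 2) (be ^+ 2).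
  apply: mom_pow; have := @mom_m 64 isT.
  by rewrite (_ : 64 * q.+1 = 2 * (32 * q.+1))%N // mulnA.
have r1 := rv_m1 M z0 i; have r2 := rv_zr M z0 i; have r3 := rv_m M z0.
have r4 : rv fullE (fun w => cabs (mtr (A w) z) ^+ 2) by exact: (rvX msy).
have hz c (f : T -> R) a : 0 <= c -> rv fullE f -> mom (32 * q.+1) f a -> mom (32 * q.+1) (fun w => c * f w) (c * a).
  by move=> c0 rf mf; apply: (momZ msy _ rf).
have rz c (f : T -> R) : rv fullE f -> rv fullE (fun w => c * f w).
  by move=> rf; apply: (rvM msy) => //; exact: (rv_cst msy).
have ha f g a b : rv fullE f -> rv fullE g -> (forall w, 0 <= f w) -> (forall w, 0 <= g w) -> 0 < a -> 0 < b ->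
   mom (32 * q.+1) f a -> mom (32 * q.+1) g b -> mom (32 * q.+1) (fun w => f w + g w) (a + b).
  by move=> rf rg f0 g0 a0 b0' mf mg; rewrite mulP// in mf mg *; exact: (mom_add msy (S := fullE)).
have n1 w : 0 <= 2 * ip (mtr (rowz (A w) i) z) by apply: mulr_ge0 => //; exact: m1_ge0.
have n2 w : 0 <= 2 * cabs (zrow z (A w) i) by apply: mulr_ge0 => //; exact: cabs_ge0.
have n3 w : 0 <= 9 * cabs (mtr (A w) z) by apply: mulr_ge0 => //; exact: cabs_ge0.
have n4 w : 0 <= 3 * cabs (mtr (A w) z) ^+ 2 by apply: mulr_ge0 => //; exact: sqr_ge0.
have b2 : 0 < be ^+ 2 by exact: exprn_gt0.
have rc11 := rv_cst msy fullE 11.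
have s1 := ha _ _ _ _ (rz 2 _ r1) (rz 2 _ r2) n1 n2 (mulr_gt0 (ltr0Sn _ _) b0) (mulr_gt0 (ltr0Sn _ _) b0) (hz 2 _ _ (ler0n _ _) r1 m1) (hz 2 _ _ (ler0n _ _) r2 m2).
have s2 := ha _ _ _ _ (rvD msy (rz 2 _ r1) (rz 2 _ r2)) rc11 (fun w => addr_ge0 (n1 w) (n2 w)) (fun=> ler0n _ _) (addr_gt0 (mulr_gt0 (ltr0Sn _ _) b0) (mulr_gt0 (ltr0Sn _ _) b0)) (ltr0Sn _ _) s1 (mom_cst P _ 11).
have p2 : 0 < 2 * be + 2 * be + 11 by lra.
have n12 w : 0 <= 2 * ip (mtr (rowz (A w) i) z) + 2 * cabs (zrow z (A w) i) + 11.
  by apply: addr_ge0 => //; exact: addr_ge0.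
have r12 := rvD msy (rvD msy (rz 2 _ r1) (rz 2 _ r2)) rc11.
have s3 := ha _ _ _ _ r12 (rz 9 _ r3) n12 n3 p2 (mulr_gt0 (ltr0Sn _ _) b0) s2 (hz 9 _ _ (ler0n _ _) r3 m3).
have p3 : 0 < 2 * be + 2 * be + 11 + 9 * be by lra.
have r123 := rvD msy r12 (rz 9 _ r3).
have s4 := ha _ _ _ _ r123 (rz 3 _ r4) (fun w => addr_ge0 (n12 w) (n3 w)) n4 p3 (mulr_gt0 (ltr0Sn _ _) b2) s3 (hz 3 _ _ (ler0n _ _) r4 m4).
have p4 : 0 < 2 * be + 2 * be + 11 + 9 * be + 3 * be ^+ 2 by apply: addr_gt0 => //; exact: mulr_gt0.
apply: mom_ler (mom_1D _ (rv_F M z0 i) (fun w => F_ge0 A z0 w i) p4 s4) => //.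
  by apply: addr_ge0 => //; exact: ltW.
have e3 : be ^+ 3 = be * (be * be) by ring.
have b2' : 64 * be <= be * be by rewrite ler_pM2r.
have b3 : 64 * (be * be) <= be * (be * be) by rewrite ler_pM2r//; exact: mulr_gt0.
by rewrite e3 expr2; lra.
Qed.

(** Each product halves the available order. The multiples 4, 8, 16, 32 of q + 1 occur in turn, and
    the squared trace inside [Fval] asks for 64, hence the range of [sbeta]. *)
Lemma mom_u i : mom (4 * q.+1) (fun w => uval z (A w) i) (be ^+ 11 * sth).
Proof.
have b64 := be64; have b0 := be0; have th := sth0.
have b1p : 0 < 1 + be by lra.
pose g1 w := 1 + cabs (gdiag (A w) z i).
pose I1 w := 1 + ip (mtr (rowz (A w) i) z).
pose F1 w := 1 + Fval z (A w) i.
have rg1 : rv fullE g1 by apply: (rv_1D M); exact: (rv_g M z0).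
have rI1 : rv fullE I1 by apply: (rv_1D M); exact: (rv_m1 M z0).
have rF1 : rv fullE F1 by apply: (rv_1D M); exact: (rv_F M z0).
have mg : mom (16 * q.+1) (fun w => 2 * g1 w ^+ 2) (2 * (1 + be) ^+ 2).
  apply: (momZ msy (S := fullE)) => //; first exact: (rvX msy).
  apply: mom_pow; rewrite mulnA; apply: mom_1D => //; first exact: (rv_g M z0).
  by move=> w; exact: cabs_ge0.
  exact: mom_g.
have mIF : mom (16 * q.+1) (fun w => I1 w * F1 w) ((1 + be) * be ^+ 3).
  have e : (16 * q.+1 * 2 = 32 * q.+1)%N by rewrite mulnAC.
  have h1 : mom (16 * q.+1 * 2) I1 (1 + be).
    rewrite e; apply: (mom_1D _ (rv_m1 M z0 i) _ b0) => //; first by move=> w; exact: m1_ge0.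
    exact: mom_im1.
  have h2 : mom (16 * q.+1 * 2) F1 (be ^+ 3) by rewrite e; exact: mom_F.
  exact: (mom_mul msy rI1 rF1 b1p (exprn_gt0 3 b0) h1 h2).
have rG2 : rv fullE (fun w => 2 * g1 w ^+ 2) by apply: (rvM msy); [exact: (rv_cst msy)|exact: (rvX msy)].
have rIF : rv fullE (fun w => I1 w * F1 w) by exact: (rvM msy).
have pG : 0 < 2 * (1 + be) ^+ 2 by apply: mulr_gt0 => //; exact: exprn_gt0.
have pIF : 0 < (1 + be) * be ^+ 3 by apply: mulr_gt0 => //; exact: exprn_gt0.
have mP : mom (8 * q.+1) (fun w => (2 * g1 w ^+ 2) * (I1 w * F1 w)) ((2 * (1 + be) ^+ 2) * ((1 + be) * be ^+ 3)).
  have e : (8 * q.+1 * 2 = 16 * q.+1)%N by rewrite mulnAC.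
  by apply: (mom_mul msy rG2 rIF pG pIF); rewrite e.
have hv := mom_v i.
have e : (4 * q.+1 * 2 = 8 * q.+1)%N by rewrite mulnAC.
have hu : mom (4 * q.+1) (fun w => vval z (A w) i * ((2 * g1 w ^+ 2) * (I1 w * F1 w)))
    (be ^+ 4 * sth * ((2 * (1 + be) ^+ 2) * ((1 + be) * be ^+ 3))).
  have rP : rv fullE (fun w => (2 * g1 w ^+ 2) * (I1 w * F1 w)) by exact: (rvM msy).
  by apply: (mom_mul msy (rv_v M z0 i) rP (bsth 4) (mulr_gt0 pG pIF)); rewrite e.
have -> : (fun w => uval z (A w) i) = (fun w => vval z (A w) i * ((2 * g1 w ^+ 2) * (I1 w * F1 w))).
  by apply/funext => w; rewrite /uval /uform /g1 /I1 /F1; ring.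
apply: mom_ler hu.
  apply: mulr_ge0; first by apply: mulr_ge0; [exact: exprn_ge0 (ltW b0)|exact: ltW].
  apply: mulr_ge0; first by apply: mulr_ge0 => //; exact: sqr_ge0.
  by apply: mulr_ge0; [lra|exact: exprn_ge0 (ltW b0)].
have -> : be ^+ 4 * sth * (2 * (1 + be) ^+ 2 * ((1 + be) * be ^+ 3)) = (2 * (1 + be) ^+ 3) * (be ^+ 7 * sth) by ring.
have -> : be ^+ 11 * sth = be ^+ 4 * (be ^+ 7 * sth) by ring.
apply: ler_wpM2r; first by apply: mulr_ge0; [exact: exprn_ge0 (ltW b0)|exact: ltW].
have h1 : (1 + be) ^+ 3 <= (2 * be) ^+ 3 by rewrite lerXn2r ?nnegrE//; lra.
have h2 : (2 * be) ^+ 3 = 8 * be ^+ 3 by ring.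
have h3 : 64 * be ^+ 3 <= be ^+ 4 by rewrite [be ^+ 4]exprS ler_wpM2r// exprn_ge0 ?ltW.
by have : 0 <= be ^+ 3 by [exact: exprn_ge0 (ltW b0)]; lra.
Qed.

Lemma t_close : mom (4 * q.+1) (fun w => tval z (A w)) (be ^+ 12 * sth).
Proof.
have b64 := be64; have b0 := be0; have th := sth0.
have [i hi] := t_recursion M z0 re0 re2 z1 zN q.
have e43 : (4 * q.+1 = (4 * q).+3.+1)%N by rewrite mulnS.
have hu := mom_u i; rewrite e43 in hi hu *.
have A1 : 1 <= (2 * q).+2%:R :> R by rewrite ler1n.
have a0 : 0 <= be ^+ 11 * sth by apply: mulr_ge0; [exact: exprn_ge0 (ltW b0)|exact: ltW].
(* All error terms are inside [uval], so [moment_close] is applied with J = 0. *)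
have hi' : Ex P (fun w => tval z (A w) ^+ (4 * q).+3.+1) <=
  (2 * q).+2%:R * Ex P (fun w => uval z (A w) i * (uval z (A w) i + tval z (A w)) ^+ (4 * q).+3) + 0 ^+ (4 * q).+3.+1.
  by rewrite expr0n /= addr0.
have := moment_close msy (rv_t M z0) (rv_u M z0 i) (t_ge0 A z) (fun w => u_ge0 A z0 w i) A1 a0 (lexx 0) hi' hu.
rewrite -e43 mulr0 addr0; apply: mom_ler.
  apply: mulr_ge0 => //; apply: addr_ge0 => //; apply: mulr_ge0 => //; apply: mulr_ge0 => //.
  by apply: mulr_ge0 => //; have := e0_gt0 R; lra.
rewrite [be ^+ 12]exprS -[be * be ^+ 11 * sth]mulrA ler_wpM2r//.
have hc := @sbeta_cz _ _ C1 8 q isT; apply: le_trans hc.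
apply: le_trans (cz_ge C1 _) => //.
rewrite lerD2l -!mulrA (_ : 16 * (e0 R * (8 * q.+1)%:R ^+ 2) = 2 * (e0 R * (8 * (8 * q.+1)%:R ^+ 2))); last by ring.
apply: ler_wpM2l; first exact: ler0n.
by apply: ler_wpM2l; [exact: ltW (e0_gt0 R)|rewrite expr2; exact: close_nat].
Qed.

End SharpMoments.

Lemma nth_root (R : realType) (x : R) n : 0 <= x -> exists2 y, 0 <= y & y ^+ n.+1 = x.
Proof.
move=> x0; exists (x `^ n.+1%:R^-1); first exact: powR_ge0.
by rewrite -powR_mulrn ?powR_ge0// -powRrM mulVf ?pnatr_eq0// powRr1.
Qed.

(** * The trace is within 1/(N y) of the semicircle transform *)

Section Lambda.
Context d (T : measurableType d) (R : realType) (P : probability T R).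
Variable N : nat.
Local Notation E := ('I_N * 'I_N)%type.
Local Notation fullE := ([set: E]%SET).
Variables (ms : {set E} -> (T -> R) -> Prop) (A : T -> 'M[complex R]_N) (Cm : R).
Hypothesis M : rmodel P ms A Cm.
Let msy := rm_sys M.
Local Notation mom := (mom P).
Local Notation rv := (rv ms).
Variable z : complex R.
Hypotheses (z0 : 0 < ip z) (re0 : 0 <= rp z) (re2 : rp z <= 2) (z1 : ip z <= 1).
Hypothesis zN : 1 <= N%:R * ip z.
Local Notation Ne := (N%:R * ip z).
Variable q : nat.
Local Notation be := (sbeta Cm q).
Local Opaque sbeta.
Let W : R := Num.sqrt (Ne^-1 * (bsc z + Ne^-1)).

Lemma W_gt0 : 0 < W.
Proof. by rewrite sqrtr_gt0; apply: mulr_gt0; [|apply: addr_gt0]; rewrite ?Ninv0 ?bsc_gt0. Qed.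

Lemma W_sq : W ^+ 2 = Ne^-1 * (bsc z + Ne^-1).
Proof.
rewrite sqr_sqrtr//; apply: mulr_ge0; first exact: ltW (Ninv0 zN).
by apply: addr_ge0; apply: ltW; [exact: bsc_gt0|exact: Ninv0].
Qed.

Lemma W_ge : Ne^-1 <= W.
Proof.
have h := Ninv0 zN; have b0 := bsc_gt0 z0.
rewrite -[leLHS]ger0_norm ?(ltW h)// -sqrtr_sqr; apply: ler_wsqrtr; rewrite expr2.
by apply: ler_wpM2l; [exact: ltW|rewrite lerDr ltW].
Qed.

(* A recursive bound: the right-hand side [sth] of [t_close] contains the moment
   of [t] itself, with the small factor 1/(N eta). *)
Lemma t_mom : mom (4 * q.+1) (fun w => tval z (A w)) (8 * be ^+ 24 * W).
Proof.
have b64 : 64 <= be by exact: (sbeta_ge64 (rm_cst M)).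
have b24 : 1 <= be ^+ 24 by apply: exprn_ege1; lra.
have W0 := W_gt0; have W2 := W_sq; have Wi := W_ge; have iN := Ninv0 zN.
(* If the norm y of t exceeded the claim, [t_close] with this very y would give y^2 <= be^24 (W^2 +
   3 y/Ne), which is impossible since 1/Ne <= W and y > 8 be^24 W. *)
rewrite /mom leNgt; apply/negP => hlt.
set X := Ex P _ in hlt.
have X0 : 0 <= X by apply: Ex_ge0 => w; apply: exprn_ge0; exact: t_ge0.
have [y y0 yX] := @nth_root _ X (4 * q.+1).-1 X0; rewrite -ord4P in yX.
have Y0 : 0 <= 8 * be ^+ 24 * W by apply: mulr_ge0; [apply: mulr_ge0; lra|exact: ltW].
have yY : 8 * be ^+ 24 * W < y.
  rewrite ltNge; apply/negP => h; move: hlt; rewrite -yX ltNge => /negP; apply.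
  by apply: lerXn2r; rewrite ?nnegrE.
have yp : 0 < y by exact: le_lt_trans yY.
have my : mom (4 * q.+1) (fun w => tval z (A w)) y by rewrite /mom yX.
have hc := t_close M z0 re0 re2 z1 zN yp my; rewrite /mom -/X -yX in hc.
have s0 : 0 <= be ^+ 12 * sth N z y.
  by apply: mulr_ge0; [apply: exprn_ge0; lra|exact: sqrtr_ge0].
have hy : y <= be ^+ 12 * sth N z y.
  by move: hc; rewrite ord4P ler_pXn2r ?nnegrE.
have h2 : y ^+ 2 <= (be ^+ 12 * sth N z y) ^+ 2 by rewrite lerXn2r ?nnegrE.
rewrite exprMn (sth2 z0 zN yp) /Sb -exprM in h2.
have e : be ^+ (12 * 2) * (Ne^-1 * (bsc z + 3 * y + Ne^-1)) = be ^+ 24 * W ^+ 2 + 3 * be ^+ 24 * (Ne^-1 * y).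
  by rewrite W2; ring.
rewrite e in h2.
have h3 : Ne^-1 * y <= W * y by rewrite ler_wpM2r.
have h4 : be ^+ 24 * (Ne^-1 * y) <= be ^+ 24 * (W * y) by apply: ler_wpM2l => //; lra.
have h5 : 8 * (be ^+ 24 * W) * y <= y * y by apply: ler_wpM2r => //; lra.
have h6 : be ^+ 24 * W ^+ 2 <= (be ^+ 24 * W) * (be ^+ 24 * W).
  have -> : be ^+ 24 * W * (be ^+ 24 * W) = be ^+ 24 * (be ^+ 24 * W ^+ 2) by ring.
  by apply: ler_peMl => //; apply: mulr_ge0; [lra|exact: sqr_ge0].
have h7 : 8 * (be ^+ 24 * W) < y by lra.
move: h2 h3 h4 h5 h6 h7 yp W0; rewrite expr2 (mulrA (be ^+ 24) W y).
set u := be ^+ 24 * W; rewrite -(mulrA 3); set v := be ^+ 24 * (_ * y) => h2 h3 h4 h5 h6 h7 yp W0.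
have u0 : 0 < u by apply: mulr_gt0 => //; lra.
have : u * (8 * u) <= u * y by apply: ler_wpM2l; lra.
have : 0 < y * y by exact: mulr_gt0.
lra.
Qed.

(** Two regimes. If bsc >= 1/Ne, the bound for t^2 is divided by bsc; otherwise W is at most 2/Ne
    and the square-root estimate suffices. *)
Lemma lambda_mom : mom (2 * q.+1) (fun w => cabs (mtr (A w) z - msc z)) (256 * be ^+ 48 * Ne^-1).
Proof.
have b64 : 64 <= be by exact: (sbeta_ge64 (rm_cst M)).
have b24 : 1 <= be ^+ 24 by apply: exprn_ege1; lra.
have W0 := W_gt0; have W2 := W_sq; have Wi := W_ge; have iN := Ninv0 zN; have b0 := bsc_gt0 z0.
have e48 : be ^+ 48 = be ^+ 24 * be ^+ 24 by rewrite -exprD.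
have ht := t_mom; have rt := rv_t M z0.
have rL : rv fullE (fun w => cabs (mtr (A w) z - msc z)).
  by apply: (rv_cabs msy); apply: (crvB msy); [exact: (crv_mtrA M z0)|exact: (crv_cst msy)].
have im0 w : 0 <= ip (mtr (A w) z) by exact: ip_mtr_ge0.
have t2 w : tval z (A w) ^+ 2 = cabs (epsm z (mtr (A w) z)) by rewrite sqr_sqrtr// cabs_ge0.
have u0 : 0 < 8 * be ^+ 24 * W by apply: mulr_gt0 => //; lra.
have [hb|hb] := leP Ne^-1 (bsc z).
  have c0 : 0 <= 2 / bsc z by rewrite divr_ge0// ltW.
  have rt2 : rv fullE (fun w => tval z (A w) ^+ 2) by exact: (rvX msy).
  apply: (mom_le msy (S := fullE) (g := fun w => 2 / bsc z * tval z (A w) ^+ 2)) => //.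
  - by apply: (rvM msy) => //; exact: (rv_cst msy).
  - by move=> w; exact: cabs_ge0.
  - by move=> w; rewrite t2 mulrAC; apply: lam_eps.
  apply: (mom_ler (a := 2 / bsc z * (8 * be ^+ 24 * W) ^+ 2)).
  - by apply: mulr_ge0 => //; exact: sqr_ge0.
  - rewrite [(_ * W) ^+ 2]exprMn W2 e48.
    have -> : 2 / bsc z * ((8 * be ^+ 24) ^+ 2 * (Ne^-1 * (bsc z + Ne^-1))) =
      (128 * (be ^+ 24 * be ^+ 24) * Ne^-1) * ((bsc z + Ne^-1) / bsc z) by ring.
    have -> : 256 * (be ^+ 24 * be ^+ 24) * Ne^-1 = (128 * (be ^+ 24 * be ^+ 24) * Ne^-1) * 2 by ring.
    apply: ler_wpM2l.
      by apply: mulr_ge0; [apply: mulr_ge0 => //; apply: mulr_ge0; lra|exact: ltW].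
    by rewrite ler_pdivrMr//; lra.
  apply: (momZ msy _ rt2) => //; apply: mom_pow.
  by rewrite (_ : 2 * (2 * q.+1) = 4 * q.+1)%N // mulnA.
have r2 : rv fullE (fun w => 2 * tval z (A w)) by apply: (rvM msy) => //; exact: (rv_cst msy).
have t20 w : 0 <= 2 * tval z (A w) by apply: mulr_ge0 => //; exact: t_ge0.
apply: (mom_le msy (S := fullE) (g := fun w => 2 * tval z (A w))) => //.
- by move=> w; exact: cabs_ge0.
- move=> w; rewrite -(@ler_pXn2r _ 2) ?nnegrE ?cabs_ge0// exprMn t2 sq2.
  exact: (lam_sq_eps z0 re0 re2 (im0 w)).
have m2 : mom (4 * q.+1) (fun w => 2 * tval z (A w)) (2 * (8 * be ^+ 24 * W)) by apply: (momZ msy _ rt).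
have p2 : 0 < 2 * (8 * be ^+ 24 * W) by exact: mulr_gt0.
have le2 : ((2 * q).+2 <= 4 * q.+1)%N by rewrite -ord2P leq_mul2r.
apply: (mom_ler (a := 2 * (2 * (8 * be ^+ 24 * W)))).
- by apply: mulr_ge0 => //; exact: ltW.
- have hW : W <= 2 * Ne^-1.
    rewrite -(@ler_pXn2r _ 2) ?nnegrE ?(ltW W0) ?mulr_ge0 ?(ltW iN)// W2 exprMn expr2 [Ne^-1 ^+ 2]expr2.
    have : Ne^-1 * (bsc z + Ne^-1) <= Ne^-1 * (2 * Ne^-1) by rewrite ler_pM2l//; lra.
    have : 0 <= Ne^-1 * Ne^-1 by apply: mulr_ge0; exact: ltW.
    by set x := Ne^-1 * Ne^-1; rewrite (mulrCA _ 2) -/x; lra.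
  have h1 : be ^+ 24 * W <= be ^+ 24 * (2 * Ne^-1) by apply: ler_wpM2l => //; lra.
  have h2 : be ^+ 24 * Ne^-1 <= be ^+ 48 * Ne^-1.
    by apply: ler_wpM2r; [exact: ltW|rewrite e48; apply: ler_peMl; lra].
  have g1 : 2 * (2 * (8 * be ^+ 24 * W)) = 32 * (be ^+ 24 * W) by ring.
  have g2 : 256 * be ^+ 48 * Ne^-1 = 256 * (be ^+ 48 * Ne^-1) by rewrite mulrA.
  have g3 : be ^+ 24 * (2 * Ne^-1) = 2 * (be ^+ 24 * Ne^-1) by rewrite mulrCA.
  have x20 : 0 <= be ^+ 24 * Ne^-1 by apply: mulr_ge0; [exact: le_trans ler01 b24|exact: ltW].
  rewrite g1 g2; rewrite g3 in h1; move: (be ^+ 24 * W) (be ^+ 24 * Ne^-1) (be ^+ 48 * Ne^-1) h1 h2 x20.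
  by move=> x1 x2 x3 *; lra.
by rewrite ord2P; exact: (mom_order msy le2 r2 t20 p2 m2).
Qed.

End Lambda.

(** * Potentials and counting *)

Section Calculus.
Variable R : realType.
Implicit Types (f p r : R -> R) (z m : complex R).

(** A derivative read off from a quadratic remainder, the form in which algebraic expansions such as
    [msc_step] supply it. *)
Lemma quad_is_derive f (x c K dl : R) : 0 < dl -> 0 <= K ->
  (forall h, `|h| < dl -> `|f (x + h) - f x - h * c| <= K * h ^+ 2) -> is_derive x 1 f c.
Proof.
move=> d0 K0 hf.
have cv : h^-1 *: ((f \o shift x) (h *: 1) - f x) @[h --> 0^'] --> c.
  apply/cvgrPdist_le => e e0; near=> h.
  have h0 : h != 0 by near: h; exact: nbhs_dnbhs_neq.
  have hd : `|h| < dl.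
    by near: h; apply: dnbhs0_lt.
  have he : `|h| < e / (K + 1).
    by near: h; apply: dnbhs0_lt; rewrite divr_gt0//; lra.
  have hh := hf _ hd.
  have -> : c - h^-1 *: ((f \o shift x) (h *: 1) - f x) = - (h^-1 * (f (x + h) - f x - h * c)).
    rewrite /= [h *: 1]mulr1 [h + x]addrC /GRing.scale /=; field; exact: h0.
  rewrite normrN normrM normfV ler_pdivrMl ?normr_gt0//.
  apply: le_trans hh _; rewrite -real_normK ?num_real// expr2 mulrCA ler_wpM2l//.
  move: he; rewrite ltr_pdivlMr; last lra.
  by move: (normr_ge0 h); set a := `|h| => *; nra.
apply: DeriveDef; first by apply/cvg_ex; exists c.
exact: cvg_lim.
Unshelve. all: by end_near. Qed.

Lemma is_derive_atan_div p r (x a b : R) : is_derive x 1 p a -> is_derive x 1 r b -> 0 < r x ->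
  is_derive x 1 (fun t => atan (p t / r t)) ((a * r x - p x * b) / (p x ^+ 2 + r x ^+ 2)).
Proof.
move=> dp dr r0; have rn : r x != 0 by rewrite gt_eqF.
have dV : is_derive x 1 (fun t => (r t)^-1) (- (r x) ^- 2 *: b) by exact: is_deriveV.
have dd : is_derive x 1 (fun t => p t / r t) (p x *: (- (r x) ^- 2 *: b) + (r x)^-1 *: a) by exact: is_deriveM.
have da : is_derive x 1 (atan \o (fun t => p t / r t))
  ((1 + (p x / r x) ^+ 2)^-1 * (p x *: (- (r x) ^- 2 *: b) + (r x)^-1 *: a)) by exact: is_derive1_comp.
apply: is_derive_eq da _; rewrite /GRing.scale /=.
have h : p x ^+ 2 + r x ^+ 2 != 0 by rewrite gt_eqF// ltr_wpDl ?sqr_ge0// exprn_gt0.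
have h' : 1 + (p x / r x) ^+ 2 != 0 by rewrite gt_eqF// ltr_pwDl ?sqr_ge0.
by field; rewrite h rn.
Qed.

(* Along a path zeta with derivative dzeta, atan(Re/Im) decreases at speed Im(dzeta/zeta). *)
Lemma is_derive_angle (zt : R -> complex R) (x : R) (dz : complex R) : 
  is_derive x 1 (fun t => rp (zt t)) (rp dz) -> is_derive x 1 (fun t => ip (zt t)) (ip dz) ->
  0 < ip (zt x) -> is_derive x 1 (fun t => atan (rp (zt t) / ip (zt t))) (- ip (dz / zt x)).
Proof.
move=> dp dr r0; apply: is_derive_eq (is_derive_atan_div dp dr r0) _.
rewrite ipM ipV rpV cabs_sqr.
have h : rp (zt x) ^+ 2 + ip (zt x) ^+ 2 != 0 by rewrite gt_eqF// ltr_wpDl ?sqr_ge0// exprn_gt0.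
by field.
Qed.

Lemma is_derive_affine (a b x : R) : is_derive x 1 (fun t => a + t * b) b.
Proof.
have h : is_derive x 1 (cst a + (fun t : R => t * b)) (0 + (x *: 0 + b *: 1)).
  by apply: is_deriveD; apply: is_deriveM.
by apply: is_derive_eq h _; rewrite /GRing.scale /=; ring.
Qed.

Definition zpath (z0 v : complex R) (t : R) : complex R := z0 + rc t * v.
Lemma rp_zpath z0 v t : rp (zpath z0 v t) = rp z0 + t * rp v. Proof. by rewrite rpD rpcM. Qed.
Lemma ip_zpath z0 v t : ip (zpath z0 v t) = ip z0 + t * ip v. Proof. by rewrite ipD ipcM. Qed.

Lemma disc_neq0 z : 0 < ip z -> 2 * msc z + z != 0.
Proof.
move=> z0; apply/eqP => /(congr1 (fun x : complex R => ip x)); rewrite ip_disc /=.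
by have := bsc_gt0 z0; lra.
Qed.

(** The expansion follows from the quadratic equation itself, so the complex square root is never
    differentiated. *)
Lemma msc_step z h : 0 < ip z -> 0 < ip (z + h) ->
  cabs (msc (z + h) - msc z + h * (msc z / (2 * msc z + z))) <=
  cabs h ^+ 2 * (cabs (msc z + z) / (ip z ^+ 3)).
Proof.
move=> z0 z1; set m := msc z; set m' := msc (z + h).
have D0 := disc_neq0 z0; rewrite -/m in D0.
have i0 := msc_ip z0; have i1 := msc_ip z1; rewrite -/m -/m' in i0 i1.
have hD : ip z <= cabs (2 * m + z).
  by apply: le_trans (ip_le_cabs _); rewrite ip_disc /bsc -/m; lra.
have hS : ip z <= cabs (m + m' + z).
  by apply: le_trans (ip_le_cabs _); rewrite !ipD; lra.
have S0 : m + m' + z != 0 by rewrite -cabs_gt0; apply: lt_le_trans hS.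
have e : (m' - m) * (m + m' + z) = - h * m'.
  have e1 := msc_eq z; have e2 := msc_eq (z + h); rewrite -/m -/m' /epsm in e1 e2.
  apply/eqP; rewrite -subr_eq0; apply/eqP.
  transitivity ((1 + (z + h) * m' + m' ^+ 2) - (1 + z * m + m ^+ 2)); first by ring.
  by rewrite e1 e2 subrr.
have dm : m' - m = - h * m' / (m + m' + z) by rewrite -e mulfK.
have lip : cabs (m' - m) <= cabs h / ip z.
  have := msc_lip z1 z0; rewrite -/m -/m' => _.
  have := msc_lip z0 z1; rewrite -/m -/m' cabsBC.
  have -> : z - (z + h) = - h by ring.
  by rewrite cabsN.
have -> : m' - m + h * (m / (2 * m + z)) = - h * (m' - m) * (m + z) / ((m + m' + z) * (2 * m + z)).
  by rewrite {1}dm; field; rewrite D0 S0.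
rewrite cabsM cabsV !cabsM cabsN.
have p3 : 0 < ip z ^+ 3 by exact: exprn_gt0.
have Sp : 0 < cabs (m + m' + z) := lt_le_trans z0 hS.
have Dp : 0 < cabs (2 * m + z) := lt_le_trans z0 hD.
apply: (@le_trans _ _ (cabs h * (cabs h / ip z) * cabs (m + z) / (ip z * ip z))).
  apply: ler_pM.
  - by rewrite !mulr_ge0 ?cabs_ge0.
  - by rewrite invr_ge0; apply: mulr_ge0; exact: cabs_ge0.
  - by apply: ler_wpM2r; [exact: cabs_ge0|apply: ler_wpM2l => //; exact: cabs_ge0].
  - by rewrite lef_pV2 ?posrE ?mulr_gt0//; apply: ler_pM => //; exact: ltW.
have zn : ip z != 0 by rewrite gt_eqF.
by rewrite le_eqVlt; apply/orP; left; apply/eqP; field.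
Qed.

Lemma is_derive_msc z0 v (x : R) : 0 < ip (zpath z0 v x) ->
  let dm := - (v * (msc (zpath z0 v x) / (2 * msc (zpath z0 v x) + zpath z0 v x))) in
  is_derive x 1 (fun t => rp (msc (zpath z0 v t))) (rp dm) /\
  is_derive x 1 (fun t => ip (msc (zpath z0 v t))) (ip dm).
Proof.
move=> zx dm; set z := zpath z0 v x in zx dm *.
set K := cabs v ^+ 2 * (cabs (msc z + z) / (ip z ^+ 3)).
have K0 : 0 <= K.
  by apply: mulr_ge0; [exact: sqr_ge0|apply: divr_ge0; [exact: cabs_ge0|exact: exprn_ge0 (ltW zx)]].
set dl := ip z / (1 + `|ip v|).
have v1 : 0 < 1 + `|ip v| by have := normr_ge0 (ip v); lra.
have d0 : 0 < dl by rewrite divr_gt0.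
have key h : `|h| < dl -> cabs (msc (zpath z0 v (x + h)) - msc z - rc h * dm) <= K * h ^+ 2.
  move=> hd; have ez : zpath z0 v (x + h) = z + rc h * v by rewrite /z /zpath rmorphD /=; ring.
  have z1 : 0 < ip (z + rc h * v).
    rewrite ipD ipcM; move: hd; rewrite ltr_pdivlMr// => hd.
    have : - (h * ip v) <= `|h| * `|ip v| by rewrite -normrM -normrN ler_norm.
    have := normr_ge0 h; have := normr_ge0 (ip v); set a := `|h| in hd *; set b := `|ip v| in hd *.
    by nra.
  rewrite ez; have := msc_step zx z1; rewrite cabsM cabsC exprMn real_normK ?num_real//.
  have -> : msc (z + rc h * v) - msc z - rc h * dm = msc (z + rc h * v) - msc z + rc h * v * (msc z / (2 * msc z + z)).
    by rewrite /dm; ring.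
  by congr (_ <= _); rewrite /K; ring.
split; apply: (quad_is_derive d0 K0) => h /key; apply: le_trans.
  by have := rp_cabs (msc (zpath z0 v (x + h)) - msc z - rc h * dm); rewrite !rpB rpcM.
by have := ip_cabs (msc (zpath z0 v (x + h)) - msc z - rc h * dm); rewrite !ipB ipcM.
Qed.

(* Real potential: d Psi = - Im (msc dz). *)
Definition psi m : R := atan (rp m / ip m) + rp m * ip m.

(** Since z = -m - 1/m, the form m dz has the primitive log m - m^2/2. Up to the constant pi/2,
    [psi] is minus its imaginary part, the argument of m being written with an arctangent. *)
Lemma is_derive_psi z0 v (x : R) : 0 < ip (zpath z0 v x) ->
  is_derive x 1 (fun t => psi (msc (zpath z0 v t))) (- ip (v * msc (zpath z0 v x))).
Proof.
move=> zx; have [dp dr] := is_derive_msc zx.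
set z := zpath z0 v x in zx dp dr *; set m := msc z in dp dr *.
set dm := - (v * _) in dp dr.
have i0 : 0 < ip m by exact: msc_ip.
have D0 := disc_neq0 zx; rewrite -/m in D0.
have mn : m != 0 by exact: msc_neq0.
have dA := is_derive_angle dp dr i0.
have dM : is_derive x 1 (fun t => rp (msc (zpath z0 v t)) * ip (msc (zpath z0 v t))) (rp m *: ip dm + ip m *: rp dm).
  exact: is_deriveM.
have dS := is_deriveD dA dM.
apply: is_derive_eq dS _; rewrite -/z -/m /GRing.scale /=.
have -> : rp m * ip dm + ip m * rp dm = ip (m * dm) by rewrite ipM; ring.
rewrite -ipN -ipD -ipN; congr ip; rewrite /dm.
have e : z = - m - m^-1.
  have := msc_inv zx; rewrite -/m => e; apply: (mulfI mn); rewrite mulrBr mulrN mulfV//.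
  have e' : m * z = m * (z + m) - m * m by ring.
  by rewrite e' e; ring.
have e2m : 2 * m + z = m - m^-1 by rewrite e; ring.
have D1 : m - m^-1 != 0.
  by rewrite -e2m.
rewrite e2m.
have h2 : m ^+ 2 - 1 != 0.
  have -> : m ^+ 2 - 1 = m * (m - m^-1) by field.
  by rewrite mulf_neq0.
by field; rewrite mn h2.
Qed.

Lemma is_derive_cauchy z0 v (s x : R) : 0 < ip (zpath z0 v x) ->
  is_derive x 1 (fun t => atan ((rp (zpath z0 v t) - s) / ip (zpath z0 v t)))
    (ip (v * (rc s - zpath z0 v x)^-1)).
Proof.
move=> zx.
have dp : is_derive x 1 (fun t => rp (zpath z0 v t - rc s)) (rp v).
  have -> : (fun t => rp (zpath z0 v t - rc s)) = (fun t => (rp z0 - s) + t * rp v).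
    by apply/funext => t; rewrite rpB rp_zpath rpC; ring.
  exact: is_derive_affine.
have dr : is_derive x 1 (fun t => ip (zpath z0 v t - rc s)) (ip v).
  have -> : (fun t => ip (zpath z0 v t - rc s)) = (fun t => ip z0 + t * ip v).
    by apply/funext => t; rewrite ipB ip_zpath ipC subr0.
  exact: is_derive_affine.
have i0 : 0 < ip (zpath z0 v x - rc s) by rewrite ipB ipC subr0.
have := is_derive_angle dp dr i0.
have -> : (fun t => atan (rp (zpath z0 v t - rc s) / ip (zpath z0 v t - rc s))) =
  (fun t => atan ((rp (zpath z0 v t) - s) / ip (zpath z0 v t))).
  by apply/funext => t; rewrite rpB ipB rpC ipC subr0.
move=> h; apply: is_derive_eq h _.
by rewrite -ipN -mulrN -invrN opprB.
Qed.

Lemma path_increment f (df : R -> R) (a b K : R) : a <= b ->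
  (forall x, a <= x <= b -> is_derive x 1 f (df x)) -> (forall x, a <= x <= b -> `|df x| <= K) ->
  `|f b - f a| <= K * (b - a).
Proof.
move=> ab hd hK; have [->|nab] := eqVneq a b; first by rewrite !subrr normr0 mulr0.
have lab : a < b by rewrite lt_neqAle nab.
have sub x : x \in `]a, b[ -> a <= x <= b by rewrite in_itv/= => /andP[/ltW -> /ltW ->].
have hc : {within `[a, b], continuous f}.
  by apply: derivable_within_continuous => x; rewrite in_itv/= => hx; case: (hd x hx).
have [c cab ->] := MVT lab (fun x hx => hd x (sub x hx)) hc.
rewrite normrM (ger0_norm (x := b - a)) ?subr_ge0//; apply: ler_wpM2r; first by rewrite subr_ge0.
exact: hK (sub c cab).
Qed.

Lemma atan_bounds (u : R) : 0 <= u -> u / (1 + u ^+ 2) <= atan u <= u.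
Proof.
rewrite le_eqVlt => /orP[/eqP <-|u0]; first by rewrite mul0r atan0 lexx.
have hc : {within `[0, u], continuous (@atan R)}.
  by apply: derivable_within_continuous => x _; exact: ex_derive.
have [c] := MVT u0 (fun x _ => is_derive1_atan x) hc.
rewrite in_itv/= atan0 !subr0 => /andP[c0 cu] ->; rewrite [_^-1 * u]mulrC.
have c2 : 0 <= c ^+ 2 by exact: sqr_ge0.
have u2 : c ^+ 2 <= u ^+ 2 by rewrite lerXn2r ?nnegrE//; exact: ltW.
apply/andP; split.
  by rewrite ler_pM2l// lef_pV2 ?posrE; lra.
by rewrite ler_piMr ?(ltW u0)// invf_le1; lra.
Qed.

Lemma atanV (u : R) : 0 < u -> atan u^-1 = pi / 2 - atan u.
Proof.
move=> u0; have a0 : 0 < atan u by rewrite -[X in X < _]atan0 lt_atan.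
have a1 := atan_ltpi2 u.
have c0 : cos (atan u) != 0 by rewrite gt_eqF// cos_atan invr_gt0 sqrtr_gt0; have := sqr_ge0 u; lra.
have tE : tan (pi / 2 - atan u) = u^-1.
  have := atanK u; rewrite /tan => tu.
  rewrite sinB cosB sin_pihalf cos_pihalf -[in RHS]tu invf_div; congr (_ / _); ring.
rewrite -tE tanK// in_itv/=; apply/andP; split; lra.
Qed.

(** The correction x/(1 + x^2) cancels the slow tail 1/x of the arctangent. What remains decays like
    the Poisson kernel, so its sum over the spectrum is bounded by y Im m. *)
Lemma atan_step (x : R) : 0 <= x -> `|pi / 2 - (atan x + x / (1 + x ^+ 2))| <= 4 / (1 + x ^+ 2).
Proof.
move=> x0; have x2 := sqr_ge0 x; have d0 : 0 < 1 + x ^+ 2 by lra.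
have [x1|x1] := leP x 1.
  have a0 : 0 <= atan x by rewrite -[X in X <= _]atan0; move: x0; rewrite le_eqVlt => /orP[/eqP <-//|h]; apply/ltW/lt_atan.
  have a1 := atan_ltpi2 x.
  have xx : 0 <= x / (1 + x ^+ 2) <= 1 / 2.
    apply/andP; split; first by rewrite divr_ge0// ltW.
    by rewrite ler_pdivrMr//; have := sqr_ge0 (x - 1); nra.
  have p4 : (pi : R) <= 4 by have := pihalf_lt2 R; lra.
  have h2 : 2 <= 4 / (1 + x ^+ 2) by rewrite ler_pdivlMr//; nra.
  apply: le_trans h2; rewrite ler_norml; move: xx; set y := x / _; lra.
have xp : 0 < x by lra.
have e : pi / 2 - (atan x + x / (1 + x ^+ 2)) = atan x^-1 - x^-1 / (1 + x^-1 ^+ 2).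
  rewrite atanV// opprD addrA; congr (_ - _); field; rewrite gt_eqF//=.
  by rewrite !gt_eqF//; lra.
have xi : 0 <= x^-1 by rewrite invr_ge0.
have /andP[h1 h2] := atan_bounds xi.
rewrite e ger0_norm; last by rewrite subr_ge0.
apply: le_trans (lerB h2 (lexx _)) _.
have -> : x^-1 - x^-1 / (1 + x^-1 ^+ 2) = x^-1 / (1 + x ^+ 2).
  by field; rewrite !gt_eqF//=; lra.
rewrite ler_wpM2r ?invr_ge0 ?(ltW d0)//.
by apply: (@le_trans _ _ 1); [rewrite invf_le1//; exact: ltW|lra].
Qed.

End Calculus.

Lemma halfC (R : realType) : (2^-1 : complex R) = rc 2^-1.
Proof. by rewrite (natrC R 2) fmorphV. Qed.

(** * The counting potential and its variation along paths *)

Section Potential.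
Variables (R : realType) (N : nat).
Implicit Types (z v : complex R) (s y : R).

Definition spectrum_of (X : 'M[complex R]_N) (sg : 'I_N -> R) :=
  [/\ forall l, 0 <= sg l,
      forall z, 0 < ip z -> mtr X z = N%:R^-1 * \sum_l fz (sg l) z &
      forall s, 0 <= s -> eigenvalue_cdf (X^t* *m X) (s ^+ 2) = #|[pred l | sg l <= s]|%:R / N%:R].

Lemma spectrum_exists (X : 'M[complex R]_N) : exists sg, spectrum_of X sg.
Proof.
have [U [sg [UU s0 gE dE]]] := gram_spectral X; exists sg; split => //.
  by move=> z z0; rewrite /mtr (res_fcalc UU gE z0) mxtrace_fcalc.
move=> s s0'; rewrite /eigenvalue_cdf -/(gram X); congr (_%:R / _); apply: eq_card => l.
by rewrite !inE dE lecR ler_pXn2r ?nnegrE.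
Qed.

Variables (X : 'M[complex R]_N) (sg : 'I_N -> R).
Hypotheses (spX : spectrum_of X sg) (N0 : (0 < N)%N).
Let sg0 l : 0 <= sg l. Proof. by case: spX. Qed.
Let mE z : 0 < ip z -> mtr X z = N%:R^-1 * \sum_l fz (sg l) z. Proof. by case: spX => _ h _; exact: h. Qed.
Let Np : 0 < N%:R :> R. Proof. by rewrite ltr0n. Qed.

(** A primitive of Im (m dz) on the upper half plane. The quotients Re/Im are smooth there, so no
    branch of the logarithm has to be chosen. *)
Definition tpot z : R := (2 * N%:R)^-1 * \sum_l
  (atan ((rp z - sg l) / ip z) + atan ((rp z - (- sg l)) / ip z)).
Definition dpot z : R := tpot z + psi (msc z).

Lemma is_derive_tpot z0 v x : 0 < ip (zpath z0 v x) ->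
  is_derive x 1 (fun t => tpot (zpath z0 v t)) (ip (v * mtr X (zpath z0 v x))).
Proof.
move=> zx; rewrite mE//.
pose F (l : 'I_N) (t : R) := atan ((rp (zpath z0 v t) - sg l) / ip (zpath z0 v t)) +
  atan ((rp (zpath z0 v t) - (- sg l)) / ip (zpath z0 v t)).
pose dF l := ip (v * (rc (sg l) - zpath z0 v x)^-1) + ip (v * (rc (- sg l) - zpath z0 v x)^-1).
have h l : is_derive x 1 (F l) (dF l) by apply: is_deriveD; exact: is_derive_cauchy.
have hs : is_derive x 1 (\sum_l F l) (\sum_l dF l) by exact: is_derive_sum.
have hz : is_derive x 1 ((2 * N%:R)^-1 *: (\sum_l F l)) ((2 * N%:R)^-1 *: (\sum_l dF l)) by exact: is_deriveZ.
have -> : (fun t => tpot (zpath z0 v t)) = (2 * N%:R)^-1 *: (\sum_l F l).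
  by apply/funext => t; rewrite /tpot /GRing.scale /= fct_sumE.
apply: is_derive_eq hz _; rewrite /GRing.scale /=.
have -> : ip (v * (N%:R^-1 * \sum_l fz (sg l) (zpath z0 v x))) = N%:R^-1 * \sum_l ip (v * fz (sg l) (zpath z0 v x)).
  by rewrite natrC -fmorphV mulrCA ipcM mulr_sumr ip_sum.
have -> : \sum_l dF l = 2 * \sum_l ip (v * fz (sg l) (zpath z0 v x)).
  rewrite mulr_sumr; apply: eq_bigr => l _; rewrite /dF -ipD -mulrDr fzE//; set u := _ + _.
  have -> : v * (u / 2) = rc 2^-1 * (v * u) by rewrite -halfC; ring.
  by rewrite ipcM mulrA mulfV ?mul1r// pnatr_eq0.
by rewrite mulrA invfM [_ * _ * 2]mulrAC mulVf ?mul1r// pnatr_eq0.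
Qed.

Lemma is_derive_dpot z0 v x : 0 < ip (zpath z0 v x) ->
  is_derive x 1 (fun t => dpot (zpath z0 v t)) (ip (v * (mtr X (zpath z0 v x) - msc (zpath z0 v x)))).
Proof.
move=> zx; have h := is_deriveD (is_derive_tpot zx) (is_derive_psi zx).
by apply: is_derive_eq h _; rewrite mulrBr ipB.
Qed.

Let Lam z := cabs (mtr X z - msc z).

Lemma mtr_lip z z' : 0 < ip z -> 0 < ip z' -> cabs (mtr X z - mtr X z') <= cabs (z - z') / (ip z * ip z').
Proof.
move=> z0 z0'; rewrite !mE// -mulrBr cabsM cabsV cabs_nat -sumrB ler_pdivrMl//.
apply: le_trans (cabs_sum _ _ _) _.
apply: (@le_trans _ _ (\sum_(l < N) cabs (z - z') / (ip z * ip z'))).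
  by apply: ler_sum => l _; exact: fz_lip.
by rewrite sumr_const card_ord -[leLHS]mulr_natl.
Qed.

Lemma lam_lip z z' : 0 < ip z -> 0 < ip z' ->
  Lam z' <= Lam z + cabs (z' - z) * ((ip z * ip z')^-1 + (ip z')^-1).
Proof.
move=> z0 z0'; rewrite /Lam.
have -> : mtr X z' - msc z' = (mtr X z - msc z) + ((mtr X z' - mtr X z) - (msc z' - msc z)).
  by move: (mtr X z) (mtr X z') (msc z) (msc z') => a b c e; ring.
apply: le_trans (cabsD _ _) _; rewrite lerD2l; apply: le_trans (cabsB _ _) _; rewrite mulrDr; apply: lerD.
  by rewrite (mulrC (ip z)); exact: mtr_lip.
exact: msc_lip.
Qed.

Lemma dpot_step z v (h K : R) : 0 <= h -> cabs v = 1 ->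
  (forall t, 0 <= t <= h -> 0 < ip (zpath z v t) /\ Lam (zpath z v t) <= K) ->
  `|dpot (zpath z v h) - dpot z| <= K * h.
Proof.
move=> h0 v1 hK.
have e0 : zpath z v 0 = z by rewrite /zpath rmorph0 mul0r addr0.
rewrite -{2}e0; have := @path_increment _ (fun t => dpot (zpath z v t))
  (fun t => ip (v * (mtr X (zpath z v t) - msc (zpath z v t)))) 0 h K h0.
rewrite subr0; apply.
  by move=> t /hK[zt _]; exact: is_derive_dpot.
move=> t /hK[_ ht]; apply: le_trans ht; apply: le_trans (ip_cabs _) _.
by rewrite cabsM v1 mul1r.
Qed.

(** The path is cut into steps on which the integrand is compared with its value at the starting
    point; only moments of m - msc at finitely many points are then needed. *)
Lemma dpot_stepx x (h : R) : 0 <= h <= 1 ->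
  `|dpot ((x + h) +i* 1)%C - dpot (x +i* 1)%C| <= (Lam (x +i* 1)%C + 2 * h) * h.
Proof.
move=> /andP[h0 h1]; pose z : complex R := (x +i* 1)%C.
have e t : zpath z 1 t = ((x + t) +i* 1)%C.
  by apply: c_eqP; rewrite ?rp_zpath ?ip_zpath /=; ring.
rewrite -e; apply: dpot_step => //; first by rewrite cabs1.
move=> t /andP[t0 th]; rewrite e; split; first exact: ltr01.
apply: le_trans (lam_lip (z := z) _ _) _; [exact: ltr01|exact: ltr01|].
rewrite -/z lerD2l.
have -> : ((x + t) +i* 1)%C - z = rc t by apply: c_eqP; rewrite ?rpB ?ipB /=; ring.
by rewrite cabsC ger0_norm//= mulr1 invr1; lra.
Qed.

Lemma dpot_stepy s u (h : R) : 0 < u -> u <= 1 -> 0 <= h ->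
  `|dpot (s +i* (u + h))%C - dpot (s +i* u)%C| <= (Lam (s +i* u)%C + 2 * h / u ^+ 2) * h.
Proof.
move=> u0 u1 h0; pose z : complex R := (s +i* u)%C.
have e t : zpath z 'i%C t = (s +i* (u + t))%C.
  by apply: c_eqP; rewrite ?rp_zpath ?ip_zpath /=; ring.
rewrite -e; apply: dpot_step => //.
  by rewrite /cabs /= expr0n /= add0r expr1n sqrtr1.
move=> t /andP[t0 th]; rewrite e; split; first by rewrite /=; lra.
have z0 : 0 < ip z by [].
have zt : 0 < ip (s +i* (u + t))%C by rewrite /=; lra.
apply: le_trans (lam_lip z0 zt) _; rewrite lerD2l.
have ci : cabs ('i%C : complex R) = 1 by rewrite /cabs /= expr0n /= add0r expr1n sqrtr1.
have -> : cabs ((s +i* (u + t))%C - z) = t.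
  have -> : (s +i* (u + t))%C - z = 'i%C * rc t by apply: c_eqP; rewrite ?rpB ?ipB ?rpM ?ipM /=; ring.
  by rewrite cabsM ci mul1r cabsC ger0_norm.
rewrite [ip z]/= [ip (_ +i* _)%C]/=.
have ut0 : 0 < u + t by lra.
have a1 : (u * (u + t))^-1 <= (u ^+ 2)^-1.
  rewrite lef_pV2; [by rewrite expr2 (ler_pM2l u0); lra| |]; rewrite posrE; [exact: mulr_gt0|exact: exprn_gt0].
have a2 : (u + t)^-1 <= (u ^+ 2)^-1.
  rewrite lef_pV2; [by rewrite expr2; nra| |]; rewrite posrE; [by []|exact: exprn_gt0].
have a3 : 0 <= (u ^+ 2)^-1 by rewrite invr_ge0 sqr_ge0.
have -> : 2 * h / u ^+ 2 = h * (2 * (u ^+ 2)^-1) by ring.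
apply: ler_pM => //; last lra.
by apply: addr_ge0; rewrite invr_ge0; [apply: mulr_ge0|]; lra.
Qed.

Lemma msc_uniq (z m : complex R) : 0 < ip z -> 0 < ip m -> epsm z m = 0 -> m = msc z.
Proof.
move=> z0 m0; rewrite epsm_factor => /eqP; rewrite mulf_eq0 => /orP[|]; first by rewrite subr_eq0 => /eqP.
move=> /eqP /(congr1 (fun x : complex R => ip x)); rewrite !ipD /= => h.
by exfalso; have := msc_ip z0; lra.
Qed.

(** The reflection sending z to minus its conjugate fixes i: the arctangents cancel in pairs and msc
    is purely imaginary there. *)
Lemma dpot_i : dpot (0 +i* 1)%C = 0.
Proof.
rewrite /dpot /tpot /=.
rewrite big1 ?mulr0 ?add0r => [|l _]; last by rewrite !divr1 !sub0r opprK atanN addNr.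
set z : complex R := (0 +i* 1)%C; have z0 : 0 < ip z by exact: ltr01.
have e : - ((msc z)^*)%C = msc z.
  apply: msc_uniq => //; first by rewrite ipN ipJ opprK; exact: msc_ip.
  have := congr1 (fun x : complex R => (x^*)%C) (msc_eq z); rewrite /epsm /= => h.
  have zc : (z^*)%C = - z by apply: c_eqP; rewrite ?rpJ ?ipJ ?rpN ?ipN /=; ring.
  have h' : 1 + (z^*)%C * ((msc z)^*)%C + ((msc z)^*)%C ^+ 2 = 0.
    by rewrite -(rmorph1 (@conjc R)) -rmorphM -rmorphXn -!rmorphD; rewrite -[RHS](rmorph0 (@conjc R)) -(msc_eq z).
  by rewrite -h' zc; ring.
have r0 : rp (msc z) = 0.
  by have := congr1 (fun x : complex R => rp x) e; rewrite rpN rpJ => h; lra.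
by rewrite /psi r0 mul0r mul0r atan0 addr0.
Qed.

(** Each singular value enters with both signs. For s > 0 the negative copy always contributes about
    pi/2, the positive one pi/2 or -pi/2 according to its side of s; together they give pi times the
    indicator. *)
Lemma count_bound s y : 0 < s -> 0 < y ->
  `|pi * eigenvalue_cdf (X^t* *m X) (s ^+ 2) - (2 * tpot (s +i* y)%C - 2 * y * rp (mtr X (s +i* y)%C))|
  <= 8 * y * ip (mtr X (s +i* y)%C).
Proof.
move=> s0 y0; set z : complex R := (s +i* y)%C; have z0 : 0 < ip z by [].
have -> : eigenvalue_cdf (X^t* *m X) (s ^+ 2) = N%:R^-1 * \sum_l (if sg l <= s then 1 else 0).
  case: spX => _ _ /(_ s (ltW s0)) ->; rewrite mulrC; congr (_ * _).
  by rewrite -sum1_card natr_sum big_mkcond /=; apply: eq_bigr => l _; rewrite inE; case: ifP.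
rewrite mE// /tpot /=.
have crp (t : R) : rp (rc t - z)^-1 = - ((s - t) / ((s - t) ^+ 2 + y ^+ 2)).
  rewrite rpV cabs_sqr !rpB !ipB rpC ipC /= sub0r sqrrN -[(t - s) ^+ 2]sqrrN opprB -mulNr.
  by congr (_ / _); ring.
have cip (t : R) : ip (rc t - z)^-1 = y / ((s - t) ^+ 2 + y ^+ 2).
  by rewrite ipV cabs_sqr !rpB !ipB rpC ipC /= sub0r opprK sqrrN -[(t - s) ^+ 2]sqrrN opprB.
pose g (t : R) := atan ((s - t) / y) + y * ((s - t) / ((s - t) ^+ 2 + y ^+ 2)).
pose k (t : R) := y ^+ 2 / ((s - t) ^+ 2 + y ^+ 2).
have hg t : `|(if t <= s then pi / 2 else - (pi / 2)) - g t| <= 4 * k t.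
  have main (x : R) : 0 <= x -> `|pi / 2 - (atan (x / y) + y * (x / (x ^+ 2 + y ^+ 2)))| <= 4 * (y ^+ 2 / (x ^+ 2 + y ^+ 2)).
    move=> x0; have xy : 0 <= x / y by rewrite divr_ge0// ltW.
    have d0 : 0 < x ^+ 2 + y ^+ 2 by rewrite ltr_wpDl ?sqr_ge0// exprn_gt0.
    have yn : y != 0 by rewrite gt_eqF.
    have e : 1 + (x / y) ^+ 2 = (x ^+ 2 + y ^+ 2) / y ^+ 2 by field.
    have := atan_step xy; rewrite e.
    have -> : x / y / ((x ^+ 2 + y ^+ 2) / y ^+ 2) = y * (x / (x ^+ 2 + y ^+ 2)).
      by field; rewrite yn (gt_eqF d0).
    by have -> : 4 / ((x ^+ 2 + y ^+ 2) / y ^+ 2) = 4 * (y ^+ 2 / (x ^+ 2 + y ^+ 2)) by rewrite invf_div.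
  rewrite /g /k; case: ifPn => [ts|]; first by apply: main; rewrite subr_ge0.
  rewrite -ltNge => st; have := main (t - s); rewrite subr_ge0 => /(_ (ltW st)).
  rewrite -[(t - s) ^+ 2]sqrrN opprB -(opprB s t) mulNr atanN mulNr mulrN -normrN.
  by set a := atan _; set b := y * _; congr (`|_| <= _); ring.
have hl l : `|pi * (if sg l <= s then 1 else 0) - ((g (sg l)) + (g (- sg l)))| <= 4 * (k (sg l) + k (- sg l)).
  have h1 := hg (sg l); have h2 := hg (- sg l); rewrite (_ : - sg l <= s = true) in h2; last first.
    by apply: (le_trans (y := 0)); [rewrite oppr_le0|exact: ltW].
  rewrite mulrDr; apply: le_trans (lerD h1 h2); apply: le_trans (ler_normD _ _).
  by rewrite le_eqVlt; apply/orP; left; apply/eqP; congr `|_|; case: ifP => _; field.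
have e1 : pi * (N%:R^-1 * \sum_l (if sg l <= s then 1 else 0)) -
  (2 * ((2 * N%:R)^-1 * \sum_l (atan ((s - sg l) / y) + atan ((s - - sg l) / y))) -
   2 * y * rp (N%:R^-1 * \sum_l fz (sg l) z)) =
  N%:R^-1 * \sum_l (pi * (if sg l <= s then 1 else 0) - ((g (sg l)) + (g (- sg l)))).
  rewrite natrC -fmorphV rpcM rp_sum.
  have -> : 2 * ((2 * N%:R)^-1 * \sum_l (atan ((s - sg l) / y) + atan ((s - - sg l) / y))) =
    N%:R^-1 * \sum_l (atan ((s - sg l) / y) + atan ((s - - sg l) / y)).
    by rewrite invfM mulrA mulrA mulfV ?pnatr_eq0// mul1r.
  rewrite [pi * (N%:R^-1 * _)]mulrCA.
  have -> : 2 * y * (N%:R^-1 * \sum_l rp (fz (sg l) z)) = N%:R^-1 * (2 * y * \sum_l rp (fz (sg l) z)) by rewrite mulrCA.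
  rewrite -!mulrBr; congr (_ * _); rewrite !mulr_sumr -!sumrB; apply: eq_bigr => l _.
  rewrite fzE//.
  have -> : rp (((rc (sg l) - z)^-1 + (rc (- sg l) - z)^-1) / 2) = 2^-1 * (rp (rc (sg l) - z)^-1 + rp (rc (- sg l) - z)^-1).
    by rewrite -rpD -rpcM -halfC mulrC.
  rewrite !crp /g; move: (pi * _) (atan _) (atan _) ((s - sg l) / (_ + _)) ((s - - sg l) / (_ + _)) => a b c e f.
  by field.
rewrite e1 normrM ger0_norm ?invr_ge0//.
rewrite natrC -fmorphV ipcM ip_sum -[X in _ <= X]mulrC -mulrA; apply: ler_wpM2l; first by rewrite invr_ge0.
apply: le_trans (ler_norm_sum _ _ _) _; rewrite mulr_suml; apply: ler_sum => l _.
apply: le_trans (hl l) _; rewrite fzE// ip_half !cip /k le_eqVlt; apply/orP; left; apply/eqP.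
by field; rewrite !gt_eqF// ltr_wpDl ?sqr_ge0// exprn_gt0.
Qed.

End Potential.

Lemma atan_lip (R : realType) (a b : R) : `|atan a - atan b| <= `|a - b|.
Proof.
wlog ab : a b / b <= a.
  by move=> h; case: (leP b a) => [|/ltW] /h //; rewrite distrC [`|b - a|]distrC.
have := @path_increment _ (@atan R) (fun x => (1 + x ^+ 2)^-1) b a 1 ab.
rewrite mul1r (ger0_norm (x := a - b)) ?subr_ge0//; apply => x _; have x2 := sqr_ge0 x; rewrite ger0_norm ?invr_ge0; last lra.
by rewrite invf_le1; lra.
Qed.

(** * Boundary value of the semicircle potential *)

Section PsiLimit.
Variable R : realType.
Variable s : R.
Hypotheses (s0 : 0 < s) (s2 : s < 2).
Let r : R := Num.sqrt (4 - s ^+ 2).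
(** The boundary value of msc at the real point [s]: the root of m^2 + s m + 1 with positive
    imaginary part. *)
Let m0 : complex R := ((- s / 2) +i* (r / 2))%C.

Lemma r_gt0 : 0 < r.
Proof. by rewrite sqrtr_gt0; move: s0 s2; nra. Qed.

Lemma m0_dist e : 0 < e -> cabs (msc (s +i* e)%C - m0) <= e / (r / 2).
Proof.
move=> e0; have r0 := r_gt0; set z : complex R := (s +i* e)%C; have z0 : 0 < ip z by [].
have c1 := cabs_msc z0; have i0 := msc_ip z0.
have h0 : m0 ^+ 2 + rc s * m0 + 1 = 0.
  have rr : r ^+ 2 = 4 - s ^+ 2 by rewrite sqr_sqrtr//; move: s0 s2; nra.
  have e4 : 1 = (s ^+ 2 + r ^+ 2) / 4 by rewrite rr; lra.
  apply: c_eqP; rewrite ?expr2 ?rpD ?ipD ?rpM ?ipM /= ?mul0r ?subr0 ?addr0; last by field.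
  have -> : - s / 2 * (- s / 2) - r / 2 * (r / 2) + s * (- s / 2) + 1 = 1 - (s ^+ 2 + r ^+ 2) / 4 by field.
  by rewrite -e4 subrr.
have e1 : (msc z - m0) * (msc z + m0 + rc s) = - ('i%C * rc e * msc z).
  have hz : z = rc s + 'i%C * rc e by apply: c_eqP; rewrite ?rpD ?ipD ?rpM ?ipM /=; ring.
  have h1 := msc_eq z; rewrite /epsm in h1; apply/eqP; rewrite -subr_eq0; apply/eqP.
  transitivity ((1 + (rc s + 'i%C * rc e) * msc z + msc z ^+ 2) - (m0 ^+ 2 + rc s * m0 + 1)); first by ring.
  by rewrite h0 -{1}hz h1 subrr.
have hb : r / 2 <= cabs (msc z + m0 + rc s).
  by apply: le_trans (ip_le_cabs _); rewrite !ipD /= addr0; lra.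
have ci : cabs ('i%C : complex R) = 1 by rewrite /cabs /= expr0n /= add0r expr1n sqrtr1.
rewrite ler_pdivlMr ?divr_gt0//.
apply: (@le_trans _ _ (cabs (msc z - m0) * cabs (msc z + m0 + rc s))).
  by rewrite ler_wpM2l// cabs_ge0.
rewrite -cabsM e1 cabsN !cabsM ci mul1r cabsC gtr0_norm// ler_piMr//; exact: ltW.
Qed.

Lemma psi_lip (m : complex R) : cabs (m - m0) <= r / 4 ->
  `|psi m - psi m0| <= (4 * (s + r) / r ^+ 2 + s + r) * cabs (m - m0).
Proof.
move=> hm; have r0 := r_gt0; set dl := cabs (m - m0) in hm *.
have d0 : 0 <= dl by exact: cabs_ge0.
have hp : `|rp m - rp m0| <= dl by rewrite -rpB; exact: rp_cabs.
have hi : `|ip m - ip m0| <= dl by rewrite -ipB; exact: ip_cabs.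
rewrite /psi; set p := rp m in hp *; set i := ip m in hi *; rewrite [rp m0]/= in hp *; rewrite [ip m0]/= in hi *.
have i4 : r / 4 <= i by move: hi; rewrite ler_norml; lra.
have ip0 : 0 < i by lra.
have h1 : `|atan (p / i) - atan (- s / 2 / (r / 2))| <= 4 * (s + r) / r ^+ 2 * dl.
  apply: le_trans (atan_lip _ _) _.
  have -> : p / i - - s / 2 / (r / 2) = ((p - - s / 2) * (r / 2) + s / 2 * (i - r / 2)) / (i * (r / 2)).
    by field; rewrite !gt_eqF.
  rewrite normrM normfV (gtr0_norm (_ : 0 < i * (r / 2))); last by rewrite mulr_gt0// divr_gt0.
  rewrite ler_pdivrMr; last by rewrite mulr_gt0// divr_gt0.
  have s2' : 0 <= s / 2 by have := s0; lra.
  have r2' : 0 <= r / 2 by lra.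
  apply: (@le_trans _ _ (dl * (r / 2) + s / 2 * dl)).
    apply: le_trans (ler_normD _ _) _; rewrite (normrM (p - _)) (normrM (s / 2)) (ger0_norm s2') (ger0_norm r2').
    by apply: lerD; [apply: ler_wpM2r|apply: ler_wpM2l].
  have hr : r ^+ 2 / 8 <= i * (r / 2) by rewrite expr2; nra.
  have sr : 0 <= (s + r) / r ^+ 2 * dl.
    by apply: mulr_ge0 => //; apply: divr_ge0; [have := s0; lra|exact: sqr_ge0].
  apply: (@le_trans _ _ (4 * (s + r) / r ^+ 2 * dl * (r ^+ 2 / 8))).
    rewrite le_eqVlt; apply/orP; left; apply/eqP; field; by rewrite gt_eqF.
  apply: ler_wpM2l => //; have -> : 4 * (s + r) / r ^+ 2 * dl = 4 * ((s + r) / r ^+ 2 * dl) by ring.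
  by lra.
have h2 : `|p * i - - s / 2 * (r / 2)| <= (s + r) * dl.
  have -> : p * i - - s / 2 * (r / 2) = (p - - s / 2) * i + - (s / 2) * (i - r / 2) by ring.
  have i2 : i <= r by move: hi; rewrite ler_norml; lra.
  have s2' : 0 <= s / 2 by have := s0; lra.
  have a1 : `|p - - s / 2| * i <= dl * r by apply: ler_pM => //; exact: ltW.
  have a2 : s / 2 * `|i - r / 2| <= s / 2 * dl by apply: ler_wpM2l.
  have a3 : 0 <= s / 2 * dl by apply: mulr_ge0.
  apply: le_trans (ler_normD _ _) _; rewrite (normrM (p - _)) (normrM (- (s / 2))) normrN (ger0_norm s2') (gtr0_norm ip0).
  by apply: le_trans (lerD a1 a2) _; lra.
have -> : atan (p / i) + p * i - (atan (- s / 2 / (r / 2)) + - s / 2 * (r / 2)) =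
  (atan (p / i) - atan (- s / 2 / (r / 2))) + (p * i - - s / 2 * (r / 2)) by ring.
apply: le_trans (ler_normD _ _) _; apply: le_trans (lerD h1 h2) _.
by rewrite -mulrDl addrA.
Qed.

(** The Lipschitz constant near [m0] degenerates as s tends to 2, so it is used only at an
    arbitrarily small height u. From u up to y, [psi] varies at speed at most |msc| <= 1, which
    makes the estimate uniform. *)
Lemma psi_edge (y : R) : 0 < y -> `|psi (msc (s +i* y)%C) - psi m0| <= y.
Proof.
move=> y0; have r0 := r_gt0.
set C := 4 * (s + r) / r ^+ 2 + s + r.
have C0 : 0 < C.
  rewrite /C -addrA; apply: addr_gt0; last by have := s0; lra.
  by rewrite divr_gt0 ?exprn_gt0// mulr_gt0//; have := s0; lra.
apply/ler_addgt0Pr => e e0.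
set u := Num.min y (Num.min (r ^+ 2 / 8) (e * r / (2 * C))).
have u0 : 0 < u by rewrite !lt_min y0 !divr_gt0 ?exprn_gt0 ?mulr_gt0.
have uy : u <= y by rewrite ge_min lexx.
have ur : u <= r ^+ 2 / 8 by rewrite !ge_min lexx orbT.
have ue : u <= e * r / (2 * C) by rewrite !ge_min lexx !orbT.
have h1 : `|psi (msc (s +i* y)%C) - psi (msc (s +i* u)%C)| <= y - u.
  pose z : complex R := (s +i* u)%C.
  have ez t : zpath z 'i%C t = (s +i* (u + t))%C by apply: c_eqP; rewrite ?rp_zpath ?ip_zpath /=; ring.
  have ey : (s +i* y)%C = zpath z 'i%C (y - u) by rewrite ez addrC subrK.
  have eu : (s +i* u)%C = zpath z 'i%C 0 by rewrite ez addr0.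
  rewrite ey eu.
  have ci : cabs ('i%C : complex R) = 1 by rewrite /cabs /= expr0n /= add0r expr1n sqrtr1.
  have := @path_increment _ (fun t => psi (msc (zpath z 'i%C t))) (fun t => - ip ('i%C * msc (zpath z 'i%C t))) 0 (y - u) 1.
  rewrite subr_ge0 mul1r subr0; apply => // t /andP[t0 _].
    by apply: is_derive_psi; rewrite ez /=; lra.
  rewrite normrN; apply: le_trans (ip_cabs _) _; rewrite cabsM ci mul1r.
  by apply: cabs_msc; rewrite ez /=; lra.
have hd := m0_dist u0.
have hd2 : u / (r / 2) <= r / 4 by rewrite ler_pdivrMr ?divr_gt0//; move: ur; rewrite expr2; lra.
have h2 := psi_lip (le_trans hd hd2).
have h3 : C * cabs (msc (s +i* u)%C - m0) <= e.
  apply: (@le_trans _ _ (C * (u / (r / 2)))); first by rewrite ler_wpM2l// ltW.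
  apply: (@le_trans _ _ (C * (e * r / (2 * C) / (r / 2)))).
    by rewrite ler_wpM2l ?(ltW C0)// ler_wpM2r// invr_ge0 divr_ge0// ltW.
  by rewrite le_eqVlt; apply/orP; left; apply/eqP; field; rewrite !gt_eqF.
have -> : psi (msc (s +i* y)%C) - psi m0 = (psi (msc (s +i* y)%C) - psi (msc (s +i* u)%C)) + (psi (msc (s +i* u)%C) - psi m0) by ring.
apply: le_trans (ler_normD _ _) _; move: h1 h2 h3; rewrite -/C; lra.
Qed.

Lemma psi_m0 : psi m0 = - (atan (s / r) + s * r / 4).
Proof.
have r0 := r_gt0; rewrite /psi /=.
have -> : - s / 2 / (r / 2) = - (s / r) by field; rewrite gt_eqF.
by rewrite atanN; field.
Qed.

End PsiLimit.

(** * The Marchenko-Pastur distribution function *)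

Section MarchenkoPastur.
Variable R : realType.
Implicit Types s x E a b t : R.
Local Notation mu := (@lebesgue_measure R).

Definition edge s : R := Num.sqrt (4 - s ^+ 2).
(** The Marchenko-Pastur distribution function at s^2 in closed form: -2/pi times the boundary value
    of [psi]. *)
Definition mp_angle s : R := 2 / pi * (atan (s / edge s) + s * edge s / 4).

Lemma edge_sq s : -2 <= s -> s <= 2 -> edge s ^+ 2 = 4 - s ^+ 2.
Proof. by move=> h1 h2; rewrite sqr_sqrtr//; nra. Qed.

Lemma edge_gt0 s : -2 < s -> s < 2 -> 0 < edge s.
Proof. by move=> h1 h2; rewrite sqrtr_gt0; nra. Qed.

Lemma is_derive_edge s : -2 < s -> s < 2 -> is_derive s 1 edge (- s / edge s).
Proof.
move=> h1 h2; have e0 := edge_gt0 h1 h2.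
have d1 : is_derive s 1 (fun s => 4 - s ^+ 2) (- (2 * s)).
  apply: (@quad_is_derive _ _ _ _ 1 1) => // h _.
  have -> : 4 - (s + h) ^+ 2 - (4 - s ^+ 2) - h * - (2 * s) = - h ^+ 2 by ring.
  by rewrite normrN ger0_norm ?sqr_ge0// mul1r.
have p0 : 0 < 4 - s ^+ 2 by nra.
have h := @is_derive1_comp _ Num.sqrt (fun s => 4 - s ^+ 2) s _ _ (is_derive1_sqrt p0) d1.
apply: is_derive_eq h _; rewrite -/(edge s); field; exact: lt0r_neq0.
Qed.

Lemma is_derive_mp_angle s : -2 < s -> s < 2 -> is_derive s 1 mp_angle (edge s / pi).
Proof.
move=> h1 h2; have e0 := edge_gt0 h1 h2; have de := is_derive_edge h1 h2.
have di : is_derive s 1 (fun t : R => t) 1 by exact: is_derive_id.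
have dA := is_derive_atan_div di de e0.
have dM : is_derive s 1 (fun t => t * edge t) (s *: (- s / edge s) + edge s *: 1) by exact: (is_deriveM di de).
have dB : is_derive s 1 (fun t => 4^-1 * (t * edge t)) (4^-1 *: (s *: (- s / edge s) + edge s *: 1)).
  exact: (is_deriveZ 4^-1 dM).
have dZ := is_deriveZ (2 / pi) (is_deriveD dA dB).
have -> : mp_angle = (2 / pi) *: ((fun t => atan (t / edge t)) + (fun t => 4^-1 * (t * edge t))).
  by apply/funext => t; rewrite /mp_angle [_ / 4]mulrC.
apply: is_derive_eq dZ _; rewrite /GRing.scale /=.
have e2 := edge_sq (ltW h1) (ltW h2).
have pn : pi != 0 :> R by rewrite gt_eqF ?pi_gt0.
have en : edge s != 0 by rewrite gt_eqF.
have -> : s ^+ 2 + edge s ^+ 2 = 4 by rewrite e2; ring.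
move: pn; move: (pi : R) => p pn; field.
by rewrite en pn.
Qed.

Lemma mp_densityE x : 0 < x <= 4 -> mp_density x = (2 * pi)^-1 * (edge (Num.sqrt x) * (Num.sqrt x)^-1).
Proof.
move=> /andP[x0 x4]; rewrite /mp_density x0 x4 /= /edge sqr_sqrtr ?ltW//; congr (_ * _).
have -> : 4 / x - 1 = (4 - x) * x^-1 by rewrite mulrBl divff// gt_eqF.
by rewrite sqrtrM ?subr_ge0// sqrtrV// ltW.
Qed.

Lemma mp_density_ge0 x : 0 <= mp_density x.
Proof.
rewrite /mp_density; case: ifP => // _; apply: mulr_ge0; last exact: sqrtr_ge0.
by rewrite invr_ge0; apply: mulr_ge0 => //; exact: ltW (pi_gt0 R).
Qed.

Lemma measurable_mp_density : measurable_fun [set: R] (@mp_density R).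
Proof.
have -> : @mp_density R = (fun x => if (0 < x) && (x <= 4) then (2 * pi)^-1 * Num.sqrt (4 * x `^ (-1) - 1) else 0).
  apply/funext => x; rewrite /mp_density; case: ifP => // /andP[x0 _].
  by rewrite powR_inv1// ltW.
apply: measurable_fun_ifT => //.
  by apply: measurable_and; [exact: measurable_fun_ltr|exact: measurable_fun_ler].
apply: measurable_funM => //.
apply: (@measurableT_comp _ _ _ _ _ _ (@Num.sqrt R)); first exact: measurable_sqrt.
apply: measurable_funB => //; apply: measurable_funM => //; exact: measurable_powR.
Qed.

Lemma integral_mp_density a b : 0 < a -> a < b -> b < 4 ->
  (\int[mu]_(x in `[a, b]) (mp_density x)%:E = (mp_angle (Num.sqrt b) - mp_angle (Num.sqrt a))%:E)%E.
Proof.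
move=> a0 ab b4.
pose g x : R := (2 * pi)^-1 * (edge (Num.sqrt x) * (Num.sqrt x)^-1).
pose F x : R := mp_angle (Num.sqrt x).
have sq x : a <= x <= b -> [/\ 0 < x, 0 < Num.sqrt x & Num.sqrt x < 2].
  move=> /andP[ax xb]; have x0 : 0 < x by lra.
  have s0 : 0 < Num.sqrt x by rewrite sqrtr_gt0.
  have s2 : Num.sqrt x ^+ 2 = x by rewrite sqr_sqrtr ?ltW.
  by split => //; rewrite -(ltr_pXn2r (n := 2))// ?nnegrE ?ltW//; rewrite s2; lra.
have dF x : a <= x <= b -> is_derive x 1 F (g x).
  move=> hx; have [x0 s0 s2] := sq x hx.
  have s2' : -2 < Num.sqrt x by lra.
  have h := @is_derive1_comp _ mp_angle Num.sqrt x _ _ (is_derive_mp_angle s2' s2) (is_derive1_sqrt x0).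
  have pn : pi != 0 :> R by rewrite gt_eqF ?pi_gt0.
  apply: is_derive_eq h _; rewrite /g; move: pn; move: (pi : R) => p pn; field.
  by rewrite (gt_eqF s0) pn.
have dg x : a <= x <= b -> derivable g x 1.
  move=> hx; have [x0 s0 s2] := sq x hx.
  have s2' : -2 < Num.sqrt x by lra.
  have [h1 _] := @is_derive1_comp _ edge Num.sqrt x _ _ (is_derive_edge s2' s2) (is_derive1_sqrt x0).
  have [h2 _] := is_derive1_sqrt x0.
  have h3 : derivable (fun y => (Num.sqrt y)^-1) x 1 by apply: derivableV => //; rewrite gt_eqF.
  have h4 := derivableM h1 h3.
  have [h0 _] : is_derive x 1 (cst (2 * pi)^-1 : R -> R) 0 by exact: is_derive_cst.
  by have := derivableM h0 h4.
have cF x : a <= x <= b -> {for x, continuous F}.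
  move=> /dF [h _]; apply: differentiable_continuous; exact/derivable1_diffP.
have hI := @continuous_FTC2 _ g F a b ab.
transitivity (\int[mu]_(x in `[a, b]) (g x)%:E)%E.
  apply: eq_integral => x; rewrite inE /= in_itv /= => /andP[h1 h2]; rewrite mp_densityE//.
  by apply/andP; split; lra.
rewrite hI ?EFinB//.
- by apply: derivable_within_continuous => x; rewrite in_itv /=; exact: dg.
- split.
  + move=> x; rewrite in_itv /= => /andP[h1 h2]; have [|h _] := dF x => //; by rewrite !ltW.
  + by apply: cvg_at_right_filter; apply: cF; rewrite lexx ltW.
  + by apply: cvg_at_left_filter; apply: cF; rewrite lexx ltW.
- move=> x; rewrite in_itv /= => /andP[h1 h2]; rewrite derive1E.
  by have [|_ h] := dF x => //; rewrite !ltW.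
Qed.

Lemma mp_angle0 : mp_angle 0 = 0.
Proof. by rewrite /mp_angle !mul0r atan0 addr0 mulr0. Qed.

Lemma integral_mp_density0 s : 0 < s -> s < 2 ->
  (\int[mu]_(x in `[0%R, (s ^+ 2)%R]) (mp_density x)%:E = (mp_angle s)%:E)%E.
Proof.
move=> s0 s2; have mf := measurable_mp_density.
have mfE (S : set R) : measurable_fun S (EFin \o @mp_density R).
  by apply/measurable_EFinP; exact: measurable_funTS.
(* The density is unbounded at 0. The integral is computed from the square of [h n], and monotone
   convergence lets [h n] tend to 0. *)
pose h (n : nat) : R := s / 2 * harmonic n.
have hp n : 0 < h n by rewrite /h mulr_gt0 ?divr_gt0// /harmonic /= invr_gt0.
have hs n : h n < s.
  have : harmonic n <= 1 :> R by rewrite /harmonic /= invf_le1 ?ler1n.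
  by rewrite /h => h1; have : s / 2 * harmonic n <= s / 2 * 1 by [apply: ler_wpM2l; lra]; lra.
pose F n : set R := `[(h n) ^+ 2, s ^+ 2]%classic.
have F_nd : {homo F : n m / (n <= m)%N >-> (n <= m)%O}.
  move=> n m nm; apply/subsetPset => x; rewrite /F /= !in_itv /= => /andP[h1 ->]; rewrite andbT.
  apply: le_trans h1; rewrite ler_pXn2r ?nnegrE ?(ltW (hp _))// /h ler_wpM2l//; first lra.
  by rewrite /harmonic /= lef_pV2 ?posrE// ler_nat.
have cv : (fun n => (\int[mu]_(x in F n) (EFin \o @mp_density R) x)%E) @ \oo --> (\int[mu]_(x in \bigcup_n F n) (EFin \o @mp_density R) x)%E.
  apply: ge0_nondecreasing_set_cvg_integral; [exact: F_nd|by move=> n; exact: measurable_itv|by move=> n; exact: mfE|].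
  by move=> n x _; rewrite lee_fin mp_density_ge0.
have FU : \bigcup_n F n = `]0, s ^+ 2]%classic.
  apply/seteqP; split => x.
    move=> [n _]; rewrite /F /= !in_itv /= => /andP[h1 ->]; rewrite andbT.
    by apply: lt_le_trans h1; exact: exprn_gt0.
  rewrite /= in_itv /= => /andP[x0 xs].
  have q0 : 0 < Num.sqrt x by rewrite sqrtr_gt0.
  have d0 : 0 < Num.sqrt x * 2 / s by rewrite divr_gt0// mulr_gt0.
  have [k hk] := ltr_add_invr d0; exists k => //; rewrite /F /= in_itv /= xs andbT.
  rewrite -[leRHS](sqr_sqrtr (ltW x0)) ler_pXn2r ?nnegrE ?(ltW (hp _)) ?(ltW q0)//.
  rewrite /h /harmonic /=; rewrite add0r in hk.
  have : s / 2 * k.+1%:R^-1 <= s / 2 * (Num.sqrt x * 2 / s) by apply: ler_wpM2l; [lra|exact: ltW].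
  have -> : s / 2 * (Num.sqrt x * 2 / s) = Num.sqrt x by field; rewrite gt_eqF.
  by [].
rewrite FU in cv.
have cu : (fun n => (\int[mu]_(x in F n) (EFin \o @mp_density R) x)%E) = (fun n => (mp_angle s - mp_angle (h n))%:E).
  apply/funext => n; rewrite /F integral_mp_density.
  - by rewrite !sqrtr_sqr !gtr0_norm.
  - exact: exprn_gt0.
  - by rewrite ltr_pXn2r ?nnegrE ?(ltW (hp _)) ?(ltW s0).
  - by nra.
rewrite cu in cv.
have ch : h n @[n --> \oo] --> s / 2 * 0 by apply: cvgM; [exact: cvg_cst|exact: cvg_harmonic].
rewrite mulr0 in ch.
have c0 : {for 0, continuous mp_angle}.
  have h1 : -2 < 0 :> R by lra. have h2 : 0 < 2 :> R by lra.
  have [hd _] := is_derive_mp_angle h1 h2.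
  by apply: differentiable_continuous; exact/derivable1_diffP.
have ca : mp_angle (h n) @[n --> \oo] --> (0 : R).
  by rewrite -mp_angle0; first [exact: (cvg_comp _ _ ch c0)|(apply: cvg_comp; [exact: ch|exact: c0])].
have cv2 : (mp_angle s - mp_angle (h n))%:E @[n --> \oo] --> (mp_angle s)%:E.
  apply: cvg_EFin; first exact: nearW.
  have hB : mp_angle s - mp_angle (h n) @[n --> \oo] --> mp_angle s - 0 by apply: cvgB => //; exact: cvg_cst.
  by rewrite subr0 in hB.
have <- := cvg_unique (@ereal_hausdorff R) cv cv2.
by rewrite -integral_itv_obnd_cbnd.
Qed.

Lemma mp_cdfE s : 0 < s -> s < 2 -> mp_cdf (s ^+ 2) = mp_angle s.
Proof. by move=> s0 s2; rewrite /mp_cdf /Rintegral integral_mp_density0. Qed.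

Lemma mp_density_le1 x : 1 <= x -> mp_density x <= 1.
Proof.
move=> x1; rewrite /mp_density; case: ifP => // _.
have p2 := pi_ge2 R.
have h1 : Num.sqrt (4 / x - 1) <= 2.
  rewrite -[leRHS](ger0_norm (x := 2))// -sqrtr_sqr; apply: ler_wsqrtr.
  have : 4 / x <= 4 by rewrite ler_pdivrMr; lra.
  by rewrite expr2; lra.
have h2 : (2 * pi)^-1 <= 4^-1 :> R by rewrite lef_pV2 ?posrE; lra.
have h3 : 0 <= (2 * pi)^-1 :> R by rewrite invr_ge0; lra.
by have := ler_pM h3 (sqrtr_ge0 _) h2 h1; lra.
Qed.

(** Beyond s^2 >= 1 the density is at most 1, and it vanishes above 4. *)
Lemma mp_cdf_tail s E : 1 <= s -> s < 2 -> 4 <= E ->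
  mp_cdf (s ^+ 2) <= mp_cdf E <= mp_cdf (s ^+ 2) + (4 - s ^+ 2).
Proof.
move=> s1 s2 E4; have s0 : 0 < s by lra.
have t4 : s ^+ 2 < 4 by nra.
have t1 : 1 <= s ^+ 2 by nra.
have mf := measurable_mp_density.
have mfE (S : set R) : measurable_fun S (EFin \o @mp_density R).
  by apply/measurable_EFinP; exact: measurable_funTS.
have f0 x : (0 <= (EFin \o @mp_density R) x)%E by rewrite lee_fin mp_density_ge0.
have e : `[0, E]%classic = `[0, s ^+ 2]%classic `|` `]s ^+ 2, E]%classic :> set R.
  apply/seteqP; split => x /=; rewrite !in_itv /=.
    by move=> /andP[-> ->]; rewrite andbT; case: leP; [left|right].
  by move=> [/andP[-> h]|/andP[h ->]]; rewrite ?andbT /=; lra.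
have dsj : [disjoint `[0, s ^+ 2]%classic & `]s ^+ 2, E]%classic : set R].
  apply/disj_setPS => x [] /=; rewrite !in_itv /= => /andP[_ h1] /andP[h2 _].
  by have := lt_le_trans h2 h1; rewrite ltxx.
have i1 : (\int[mu]_(x in `[0%R, E]) (mp_density x)%:E =
   (mp_angle s)%:E + \int[mu]_(x in `](s ^+ 2)%R, E]) (mp_density x)%:E)%E.
  rewrite e ge0_integral_setU; [by rewrite integral_mp_density0|exact: measurable_itv|exact: measurable_itv|exact: mfE|by move=> x _; exact: f0|exact: dsj].
have i2 : (\int[mu]_(x in `](s ^+ 2)%R, E]) (mp_density x)%:E <= (4 - s ^+ 2)%:E)%E.
  apply: (@le_trans _ _ (\int[mu]_(x in `](s ^+ 2)%R, E]) (\1_(`]s ^+ 2, 4]%classic) x)%:E)%E).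
    apply: ge0_le_integral => //.
    - by move=> x _; rewrite lee_fin mp_density_ge0.
    - exact: mfE.
    - by apply/measurable_EFinP; exact: measurable_indic.
    move=> x; rewrite /= in_itv /= => /andP[h1 h2]; rewrite lee_fin indicE; case: (leP x 4) => x4.
      rewrite mem_set; [by apply: mp_density_le1; lra|by rewrite /= in_itv /= h1 x4].
    by rewrite /mp_density (leNgt x 4) x4 andbF ler0n.
  rewrite integral_indic// setIidl; last first.
    by move=> x; rewrite /= !in_itv /= => /andP[-> h]; rewrite /=; lra.
  have hm : mu `](s ^+ 2)%R, 4%R]%classic = (4 - s ^+ 2)%:E by rewrite lebesgue_measure_itv /= lte_fin t4 -EFinB.
  by rewrite le_eqVlt; apply/orP; left; apply/eqP; exact: hm.
have i3 : (0 <= \int[mu]_(x in `](s ^+ 2)%R, E]) (mp_density x)%:E)%E by apply: integral_ge0 => x _; exact: f0.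
rewrite (mp_cdfE s0 s2) /mp_cdf /Rintegral i1.
move: i2 i3; case: (\int[mu]_(x in _) _)%E => [r| |] //=; rewrite !lee_fin => h1 h2; lra.
Qed.

Lemma two_over_pi : 0 <= 2 / pi :> R /\ 2 / pi <= 1 :> R.
Proof.
have p2 := pi_ge2 R; split; first by apply: divr_ge0; lra.
by rewrite ler_pdivrMr; lra.
Qed.

Lemma atan_le x : 0 <= x -> atan x <= x.
Proof. by move=> x0; have := atan_lip x 0; rewrite atan0 !subr0 (ger0_norm x0); apply: le_trans; exact: ler_norm. Qed.

Lemma atan_ge0 x : 0 <= x -> 0 <= atan x.
Proof.
move=> x0; have /andP[+ _] := atan_bounds x0; apply: le_trans.
by apply: divr_ge0 => //; have := sqr_ge0 x; lra.
Qed.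

Lemma mp_angle_small s : 0 < s -> s <= 1 -> mp_angle s <= 2 * s.
Proof.
move=> s0 s1; have [p0 p1] := two_over_pi.
have h1 : -2 <= s by lra. have h2 : s <= 2 by lra.
have e2 := edge_sq h1 h2.
have e0 : 0 <= edge s by exact: sqrtr_ge0.
have e1 : 1 <= edge s by nra.
have e4 : edge s <= 2 by nra.
have a1 : atan (s / edge s) <= s.
  have d0 : 0 <= s / edge s by apply: divr_ge0 => //; exact: ltW.
  by apply: le_trans (atan_le d0) _; rewrite ler_pdivrMr ?ler_peMr//; lra.
have a2 : s * edge s / 4 <= s / 2 by nra.
have a3 : 0 <= atan (s / edge s).
  by apply: atan_ge0; apply: divr_ge0 => //; exact: ltW.
apply: (@le_trans _ _ (1 * (atan (s / edge s) + s * edge s / 4))); last lra.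
by apply: ler_wpM2r => //; apply: addr_ge0 => //; apply: divr_ge0 => //; apply: mulr_ge0 => //; exact: ltW.
Qed.

Lemma mp_angle_edge s : 1 <= s -> s < 2 -> `|1 - mp_angle s| <= edge s.
Proof.
move=> s1 s2; have [p0 p1] := two_over_pi; have h1 : -2 < s by lra.
have e0 := edge_gt0 h1 s2; have s0 : 0 < s by lra.
have av : atan (s / edge s) = pi / 2 - atan (edge s / s).
  by rewrite -(invf_div (edge s) s) atanV// divr_gt0.
have a1 : atan (edge s / s) <= edge s.
  have d0 : 0 <= edge s / s by apply: divr_ge0; exact: ltW.
  by apply: le_trans (atan_le d0) _; rewrite ler_pdivrMr// ler_peMr// ltW.
have a0 : 0 <= atan (edge s / s) by apply: atan_ge0; apply: divr_ge0; exact: ltW.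
have pn : pi != 0 :> R by rewrite gt_eqF ?pi_gt0.
have -> : 1 - mp_angle s = 2 / pi * (atan (edge s / s) - s * edge s / 4).
  by rewrite /mp_angle av; move: pn; move: (pi : R) => p pn; field.
have b1 : s * edge s / 4 <= edge s by nra.
have b2 : 0 <= s * edge s / 4 by apply: divr_ge0 => //; apply: mulr_ge0; exact: ltW.
rewrite normrM (ger0_norm p0); apply: (@le_trans _ _ (1 * `|atan (edge s / s) - s * edge s / 4|)).
  exact: ler_wpM2r.
by rewrite mul1r ler_norml; lra.
Qed.

End MarchenkoPastur.

(** * From the local law to the counting function *)

Section PathSums.
Variables (R : realType) (N : nat) (X : 'M[complex R]_N) (sg : 'I_N -> R).
Hypotheses (spX : spectrum_of X sg) (N0 : (0 < N)%N).
Local Notation Lam z := (cabs (mtr X z - msc z)).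

Lemma path_x (h : R) n : 0 <= h <= 1 ->
  `|dpot sg (n%:R * h +i* 1)%C - dpot sg (0 +i* 1)%C| <=
  \sum_(k < n) (Lam (k%:R * h +i* 1)%C + 2 * h) * h.
Proof.
move=> h1; elim: n => [|n ih]; first by rewrite mul0r subrr normr0 big_ord0.
rewrite big_ord_recr /= -(natr1 n) mulrDl mul1r.
have st := dpot_stepx spX N0 (n%:R * h) h1.
set a := dpot sg ((n%:R * h + h) +i* 1)%C in st *; set b := dpot sg (n%:R * h +i* 1)%C in st ih *.
have -> : a - dpot sg (0 +i* 1)%C = (b - dpot sg (0 +i* 1)%C) + (a - b) by ring.
by apply: le_trans (ler_normD _ _) _; apply: lerD.
Qed.

Lemma path_y (s y h : R) n : 0 < y -> 0 <= h -> y + n%:R * h <= 1 ->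
  `|dpot sg (s +i* (y + n%:R * h))%C - dpot sg (s +i* y)%C| <=
  \sum_(k < n) (Lam (s +i* (y + k%:R * h))%C + 2 * h / y ^+ 2) * h.
Proof.
move=> y0 h0; elim: n => [|n ih]; first by rewrite mul0r addr0 subrr normr0 big_ord0.
rewrite -(natr1 n) mulrDl mul1r addrA big_ord_recr /= => hn.
have nh : 0 <= n%:R * h by apply: mulr_ge0.
have u0 : 0 < y + n%:R * h by lra.
have u1 : y + n%:R * h <= 1 by lra.
have st := dpot_stepy spX N0 s u0 u1 h0.
have inv : 2 * h / (y + n%:R * h) ^+ 2 <= 2 * h / y ^+ 2.
  apply: ler_wpM2l; first by apply: mulr_ge0.
  rewrite lef_pV2 ?posrE ?exprn_gt0//; apply: lerXn2r; [by rewrite nnegrE ltW|by rewrite nnegrE ltW|by rewrite lerDl].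
set a := dpot sg (s +i* (y + n%:R * h + h))%C in st *; set b := dpot sg (s +i* (y + n%:R * h))%C in st ih *.
have -> : a - dpot sg (s +i* y)%C = (b - dpot sg (s +i* y)%C) + (a - b) by ring.
apply: le_trans (ler_normD _ _) _; apply: lerD; first exact: ih.
apply: le_trans st _; apply: ler_wpM2r => //; rewrite lerD2l; exact: inv.
Qed.

Definition lev (l : nat) : R := 2^-1 ^+ l.

Lemma lev_gt0 l : 0 < lev l. Proof. by rewrite exprn_gt0. Qed.
Lemma levS l : lev l = 2 * lev l.+1.
Proof. by rewrite /lev exprS mulrA mulfV ?mul1r. Qed.
Lemma lev_le1 l : lev l <= 1.
Proof. by apply: exprn_ile1 => //; lra. Qed.

(** A level of height y is cut into N steps of length y/N. Each has discretisation error 2/N^2, so a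
    level costs 2/N whatever its height. *)
Lemma path_levels (s : R) L :
  `|dpot sg (s +i* 1)%C - dpot sg (s +i* lev L)%C| <=
  \sum_(l < L) (\sum_(k < N) lev l.+1 / N%:R * Lam (s +i* (lev l.+1 + k%:R * (lev l.+1 / N%:R)))%C + 2 / N%:R).
Proof.
have Np : 0 < N%:R :> R by rewrite ltr0n.
have Nn : N%:R != 0 :> R by rewrite gt_eqF.
elim: L => [|L ih]; first by rewrite /lev expr0 subrr normr0 big_ord0.
rewrite big_ord_recr /=; set y := lev L.+1; have y0 : 0 < y by exact: lev_gt0.
have yn : y != 0 by rewrite gt_eqF.
have eL : y + N%:R * (y / N%:R) = lev L by rewrite levS -/y; field.
have y1 := lev_le1 L.
have h0 : 0 <= y / N%:R by rewrite divr_ge0// ltW.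
have st := @path_y s y (y / N%:R) N y0 h0.
rewrite eL in st.
set a := dpot sg (s +i* 1)%C in ih *; set b := dpot sg (s +i* lev L)%C in st ih *.
have -> : a - dpot sg (s +i* y)%C = (a - b) + (b - dpot sg (s +i* y)%C) by ring.
apply: le_trans (ler_normD _ _) _; apply: lerD; first exact: ih.
apply: le_trans (st y1) _; rewrite le_eqVlt; apply/orP; left; apply/eqP.
have -> : 2 / N%:R = \sum_(k < N) (2 * (y / N%:R) / y ^+ 2 * (y / N%:R)).
  rewrite sumr_const card_ord -[RHS]mulr_natl; field; by rewrite yn Nn.
rewrite -big_split /=; apply: eq_bigr => k _; by rewrite mulrDl [X in _ = X + _]mulrC.
Qed.

Lemma psi_mp_cdf (s y : R) : 0 < s -> s < 2 -> 0 < y ->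
  `|pi * mp_cdf (s ^+ 2) + 2 * psi (msc (s +i* y)%C)| <= 2 * y.
Proof.
move=> s0 s2 y0; have := psi_edge s0 s2 y0; rewrite (psi_m0 s0 s2) (mp_cdfE s0 s2).
rewrite /mp_angle -/(edge s); set q := psi _; set t := atan _ + s * edge s / 4.
have pn : pi != 0 :> R by rewrite gt_eqF ?pi_gt0.
have -> : pi * (2 / pi * t) = 2 * t by move: pn; move: (pi : R) => p pn; field.
by rewrite !ler_norml; lra.
Qed.

Lemma cdf_path (s y : R) : 0 < s -> s < 2 -> 0 < y ->
  `|eigenvalue_cdf (X^t* *m X) (s ^+ 2) - mp_cdf (s ^+ 2)| <=
  2 * `|dpot sg (s +i* y)%C| + 10 * y * cabs (mtr X (s +i* y)%C) + 2 * y.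
Proof.
move=> s0 s2 y0; have h1 := count_bound spX s0 y0; have h2 := psi_mp_cdf s0 s2 y0.
set z := (s +i* y)%C in h1 h2 *; set m := mtr X z in h1 *.
have p1 : 1 <= pi :> R by have := pi_ge2 R; lra.
have h3 : tpot sg z = dpot sg z - psi (msc z) by rewrite /dpot addrK.
have r1 : `|2 * y * rp m| <= 2 * y * cabs m.
  rewrite normrM ger0_norm; last lra.
  by apply: ler_wpM2l; [lra|exact: rp_cabs].
have r2 : 8 * y * ip m <= 8 * y * cabs m by apply: ler_wpM2l; [lra|exact: ip_le_cabs].
rewrite h3 in h1; move: h1 h2; set F := eigenvalue_cdf _ _; set G := mp_cdf _ => h1 h2.
have h4 : `|pi * (F - G)| <= 2 * `|dpot sg z| + 10 * y * cabs m + 2 * y.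
  have -> : pi * (F - G) = (pi * F - (2 * (dpot sg z - psi (msc z)) - 2 * y * rp m)) + (2 * dpot sg z - 2 * y * rp m) - (pi * G + 2 * psi (msc z)) by ring.
  apply: le_trans (ler_normB _ _) _; apply: le_trans (lerD (ler_normD _ _) (lexx _)) _.
  have h5 : `|2 * dpot sg z - 2 * y * rp m| <= 2 * `|dpot sg z| + 2 * y * cabs m.
    apply: le_trans (ler_normB _ _) _; apply: lerD => //.
    by rewrite normrM ger0_norm.
  by move: h1 h2 h5; lra.
apply: le_trans h4; rewrite normrM gtr0_norm; last lra.
by rewrite ler_peMl.
Qed.

(** Each singular value at most s contributes at least 1/(2 s) to the imaginary part of the kernel
    at the point i s. *)
Lemma cdf_small (s : R) : 0 < s -> eigenvalue_cdf (X^t* *m X) (s ^+ 2) <= 2 * s * cabs (mtr X (0 +i* s)%C).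
Proof.
move=> s0; set z : complex R := (0 +i* s)%C; have z0 : 0 < ip z by [].
case: spX => sg0 mE cE; rewrite (cE s (ltW s0)).
have hl l : (if sg l <= s then 1 else 0) <= 2 * s * ip (fz (sg l) z).
  have g0 := fz_ip_ge0 (sg l) z0; case: (leP (sg l) s) => ls; last by apply: mulr_ge0 => //; lra.
  have s2 := sg0 l.
  have e : rc (sg l ^+ 2) - z ^+ 2 = rc (sg l ^+ 2 + s ^+ 2).
    by apply: c_eqP; rewrite ?expr2 ?rpB ?ipB ?rpM ?ipM /=; ring.
  have d0 : 0 < sg l ^+ 2 + s ^+ 2 by rewrite ltr_wpDl ?sqr_ge0// exprn_gt0.
  have -> : ip (fz (sg l) z) = s / (sg l ^+ 2 + s ^+ 2) by rewrite /fz e -fmorphV [z * _]mulrC ipcM mulrC.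
  rewrite mulrA ler_pdivlMr// mul1r.
  have : sg l ^+ 2 <= s ^+ 2 by apply: lerXn2r => //; rewrite nnegrE ltW.
  by rewrite !expr2; lra.
apply: (@le_trans _ _ (2 * s * ip (mtr X z))); last by apply: ler_wpM2l; [lra|exact: ip_le_cabs].
have Np : 0 < N%:R^-1 :> R by rewrite invr_gt0 ltr0n.
rewrite mE// natrC -fmorphV ipcM ip_sum mulrC mulrCA; apply: ler_wpM2l; first exact: ltW.
rewrite mulr_sumr -sum1_card natr_sum big_mkcond; apply: ler_sum => l _.
by apply: le_trans (hl l); rewrite inE; case: ifP.
Qed.
End PathSums.

Section CdfMonotone.
Variables (R : realType) (N : nat) (H : 'M[complex R]_N).

Lemma eigenvalue_cdf_mono (a b : R) : a <= b -> eigenvalue_cdf H a <= eigenvalue_cdf H b.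
Proof.
move=> ab; rewrite /eigenvalue_cdf; apply: ler_wpM2r; first by rewrite invr_ge0.
rewrite ler_nat; apply: subset_leq_card; apply/fintype.subsetP => i; rewrite !inE => h.
by apply: le_trans h _; rewrite lecR.
Qed.

Lemma eigenvalue_cdf_bounds (a : R) : 0 <= eigenvalue_cdf H a <= 1.
Proof.
rewrite /eigenvalue_cdf; apply/andP; split; first by rewrite divr_ge0.
have h : #|[pred i | spectral_diag H 0 i <= rc a]|%:R <= N%:R :> R by rewrite ler_nat -[leqRHS]card_ord max_card.
have [e|e] := eqVneq (N%:R : R) 0; first by rewrite e invr0 mulr0.
by rewrite ler_pdivrMr ?mul1r// lt0r e ler0n.
Qed.
End CdfMonotone.

(** * Moment bound for the error of the counting function *)

Section Assembly.
Context d (T : measurableType d) (R : realType) (P : probability T R).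
Variable N : nat.
Local Notation E := ('I_N * 'I_N)%type.
Local Notation fullE := ([set: E]%SET).
Variables (ms : {set E} -> (T -> R) -> Prop) (A : T -> 'M[complex R]_N).
Hypothesis msy : msystem P ms.
Variables (p : nat) (c1 be : R).
Hypotheses (c0 : 0 < c1) (be0 : 0 < be) (N2 : (1 < N)%N).
Local Notation mom := (mom P).
Local Notation rv := (rv ms).
Definition regular_point (z : complex R) :=
  [/\ 0 < ip z, 0 <= rp z, rp z <= 2, ip z <= 1 & 1 <= N%:R * ip z].
Hypothesis rm : forall z, 0 < ip z -> crv ms fullE (fun w => mtr (A w) z).
Hypothesis mL : forall z, regular_point z -> mom p.+1 (fun w => cabs (mtr (A w) z - msc z)) (c1 / (N%:R * ip z)).
Hypothesis mM : forall z, regular_point z -> mom p.+1 (fun w => cabs (mtr (A w) z)) be.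
Local Notation Lam z := (fun w => cabs (mtr (A w) z - msc z)).
Local Notation cdf w x := (eigenvalue_cdf ((A w)^t* *m A w) x).

Lemma dim_gt0 : 0 < N%:R :> R. Proof. by rewrite ltr0n ltnW. Qed.
Lemma dim_neq0 : N%:R != 0 :> R. Proof. by rewrite gt_eqF// dim_gt0. Qed.
Lemma rvL z : 0 < ip z -> rv fullE (Lam z).
Proof. by move=> z0; apply: (rv_cabs msy); apply: (crvB msy); [exact: rm|exact: (crv_cst msy)]. Qed.

Lemma sumN (a : R) : \sum_(k < N) a = N%:R * a.
Proof. by rewrite sumr_const card_ord -[LHS]mulr_natl. Qed.

Lemma mom_weighted (h : R) (z : nat -> complex R) (a : R) : 0 < h -> 0 < a ->
  (forall k, (k < N)%N -> regular_point (z k)) ->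
  (forall k, (k < N)%N -> h * (c1 / (N%:R * ip (z k))) <= a) ->
  rv fullE (fun w => \sum_(k < N) h * Lam (z k) w) /\
  mom p.+1 (fun w => \sum_(k < N) h * Lam (z k) w) (N%:R * a).
Proof.
move=> h0 a0 hz ha.
have r (k : 'I_N) : rv fullE (fun w => h * Lam (z k) w).
  by apply: (rvM msy); [exact: (rv_cst msy)|apply: rvL; case: (hz k (ltn_ord k))].
split; first by apply: (rv_sum msy) => k _; exact: r.
rewrite -sumN; apply: (mom_sum msy (S := fullE) (F := fun (k : 'I_N) w => h * Lam (z k) w) (a := fun=> a)) => //.
  by move=> k w; apply: mulr_ge0; [exact: ltW|exact: cabs_ge0].
move=> k; have hk := hz k (ltn_ord k); have [z0 _ _ _ _] := hk.
apply: mom_ler (ha k (ltn_ord k)) _.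
  apply: mulr_ge0; first exact: ltW.
  by apply: divr_ge0; [exact: ltW|apply: mulr_ge0; [exact: ltW dim_gt0|exact: ltW]].
apply: (momZ msy (S := fullE)); [exact: ltW|exact: rvL|exact: mL].
Qed.

Definition Ktot : R := 100 * (c1 + be + 1).

Lemma ln_ge_half : 2^-1 <= ln (N%:R : R).
Proof.
have h : ln (1 + - 2^-1 : R) <= - 2^-1 by apply: le_ln1Dx; lra.
have e : 1 + - 2^-1 = 2^-1 :> R by field.
rewrite e lnV ?posrE// in h.
have : ln 2 <= ln (N%:R : R) by rewrite ler_ln ?posrE ?dim_gt0// ler_nat.
lra.
Qed.

(** [trunc_log 2 N] levels put the lowest height between 1/N and 2/N. Each level costs c1/N for the
    moments plus 2/N for the discretisation, and L + 1 <= 4 ln N. *)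
Lemma bulk (s : R) : 0 < s -> s < 2 -> exists f, [/\ rv fullE f, forall w, 0 <= f w,
  forall w, `|cdf w (s ^+ 2) - mp_cdf (s ^+ 2)| <= f w &
  mom p.+1 f (80 * (c1 + be + 1) * (ln N%:R / N%:R))].
Proof.
move=> s0 s2; have Np := dim_gt0; have Nn := dim_neq0; have lh := ln_ge_half.
pose L := trunc_log 2 N.
have [L1 L2] : (2 ^ L <= N)%N /\ (N < 2 ^ L.+1)%N by split; [apply: trunc_logP => //; exact: ltnW|exact: trunc_log_ltn].
have L0 : (0 < L)%N.
  by rewrite lt0n; apply/eqP => h; move: L2; rewrite h expn1; lia.
have levE l : lev R l = ((2 ^ l)%:R)^-1 by rewrite /lev exprVn natrX.
have lev1 l : (l <= L)%N -> 1 <= N%:R * lev R l.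
  move=> lL; rewrite levE ler_pdivlMr ?mul1r ?ler_nat ?ltr0n ?expn_gt0//.
  by apply: leq_trans L1; rewrite leq_exp2l.
have lev2 : N%:R * lev R L <= 2.
  rewrite levE ler_pdivrMr ?ltr0n ?expn_gt0// -natrM ler_nat; move: L2; rewrite expnS; lia.
have Lln : L%:R + 1 <= 4 * ln (N%:R : R).
  have h1 : L%:R * ln 2 <= ln (N%:R : R).
    have -> : L%:R * ln (2 : R) = ln ((2 ^ L)%:R : R) by rewrite natrX lnXn// -[RHS]mulr_natl.
    by rewrite ler_ln ?posrE ?dim_gt0 ?ltr0n ?expn_gt0 ?ler_nat.
  have h2 : 2^-1 <= ln (2 : R).
    have h : ln (1 + - 2^-1 : R) <= - 2^-1 by apply: le_ln1Dx; lra.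
    have e : 1 + - 2^-1 = 2^-1 :> R by field.
    by rewrite e lnV ?posrE// in h; lra.
  have h3 : L%:R * 2^-1 <= L%:R * ln (2 : R) by apply: ler_wpM2l.
  lra.
have hs0 : 0 < s / N%:R by exact: divr_gt0.
have hs1 : 0 <= s / N%:R <= 1.
  have N2' : 2 <= N%:R :> R by rewrite ler_nat.
  by rewrite (ltW hs0) ler_pdivrMr//; lra.
pose zx k : complex R := (k%:R * (s / N%:R) +i* 1)%C.
have [rX mX] : rv fullE (fun w => \sum_(k < N) s / N%:R * Lam (zx k) w) /\
  mom p.+1 (fun w => \sum_(k < N) s / N%:R * Lam (zx k) w) (N%:R * (s / N%:R * (c1 / N%:R))).
  apply: mom_weighted => //.
  - by apply: mulr_gt0 => //; exact: divr_gt0.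
  - move=> k kN; have k0 : 0 <= k%:R * (s / N%:R) by apply: mulr_ge0 => //; exact: ltW.
    have k1 : k%:R * (s / N%:R) <= 2.
      have : k%:R * (s / N%:R) <= N%:R * (s / N%:R) by apply: ler_wpM2r; [exact: ltW|rewrite ler_nat ltnW].
      have -> : N%:R * (s / N%:R) = s by field.
      lra.
    by split => //=; rewrite mulr1 ler1n ltnW.
  - by move=> k _; rewrite /= mulr1.
pose zy l k : complex R := (s +i* (lev R l.+1 + k%:R * (lev R l.+1 / N%:R)))%C.
pose VY l w := \sum_(k < N) lev R l.+1 / N%:R * Lam (zy l k) w.
have hY (l : 'I_L) : rv fullE (VY l) /\ mom p.+1 (VY l) (N%:R * (c1 / N%:R ^+ 2)).
  have y0 := lev_gt0 R l.+1.
  have k0 k : 0 <= k%:R * (lev R l.+1 / N%:R) by apply: mulr_ge0 => //; apply: divr_ge0; exact: ltW.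
  have kN k : (k < N)%N -> k%:R * (lev R l.+1 / N%:R) <= lev R l.+1.
    move=> kN; have : k%:R * (lev R l.+1 / N%:R) <= N%:R * (lev R l.+1 / N%:R).
      by apply: ler_wpM2r; [apply: divr_ge0; exact: ltW|rewrite ler_nat ltnW].
    by have -> : N%:R * (lev R l.+1 / N%:R) = lev R l.+1 by field.
  have hN := lev1 l.+1 (ltn_ord l).
  apply: mom_weighted.
  - exact: divr_gt0.
  - by apply: divr_gt0 => //; exact: exprn_gt0.
  - move=> k /kN hk; have hk0 := k0 k; have l1 := lev_le1 R l; have lS := levS R l; split => /=; try lra.
    by rewrite mulrDr; have := mulr_ge0 (ltW Np) hk0; lra.
  - move=> k kk; rewrite /=; set u := _ + _.
    have u0 : lev R l.+1 <= u by rewrite lerDl.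
    have up : 0 < u by lra.
    have -> : lev R l.+1 / N%:R * (c1 / (N%:R * u)) = (c1 / N%:R ^+ 2) * (lev R l.+1 / u).
      by field; rewrite Nn gt_eqF.
    rewrite ler_piMr//; last by rewrite ler_pdivrMr ?mul1r.
    by apply: divr_ge0; [exact: ltW|apply: sqr_ge0].
have rV : rv fullE (fun w => \sum_(l < L) VY l w) by apply: (rv_sum msy) => l _; case: (hY l).
have mV : mom p.+1 (fun w => \sum_(l < L) VY l w) (\sum_(l < L) N%:R * (c1 / N%:R ^+ 2)).
  apply: (mom_sum msy (S := fullE) (F := fun (l : 'I_L) w => VY l w) (a := fun=> N%:R * (c1 / N%:R ^+ 2))).
  - by move=> l; case: (hY l).
  - move=> l w; apply: sumr_ge0 => k _; apply: mulr_ge0; last exact: cabs_ge0.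
    by apply: divr_ge0; [exact: ltW (lev_gt0 R _)|exact: ltW].
  - by move=> l; apply: mulr_gt0 => //; apply: divr_gt0 => //; exact: exprn_gt0.
  - by move=> l; case: (hY l).
rewrite sumr_const card_ord -[N%:R * _ *+ L]mulr_natl in mV.
set y := lev R L in lev2; have y0 : 0 < y by exact: lev_gt0.
pose z : complex R := (s +i* y)%C.
have hz : regular_point z by split => //=; [exact: ltW|exact: ltW|exact: lev_le1|exact: lev1].
have rZ : rv fullE (fun w => cabs (mtr (A w) z)) by apply: (rv_cabs msy); exact: rm.
have mZ := mM hz.
pose HX w := \sum_(k < N) s / N%:R * Lam (zx k) w.
pose WY w := \sum_(l < L) VY l w.
pose cc : R := 2 * (2 * s ^+ 2 / N%:R + 2 * L%:R / N%:R) + 2 * y.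
pose f w := 2 * HX w + (2 * WY w + (10 * y * cabs (mtr (A w) z) + cc)).
have X0 w : 0 <= HX w.
  by apply: sumr_ge0 => k _; apply: mulr_ge0; [exact: ltW|exact: cabs_ge0].
have Y0 w : 0 <= WY w.
  apply: sumr_ge0 => l _; apply: sumr_ge0 => k _; apply: mulr_ge0; last exact: cabs_ge0.
  by apply: divr_ge0; [exact: ltW (lev_gt0 R _)|exact: ltW].
have Li : 0 <= L%:R / N%:R :> R by apply: divr_ge0 => //; exact: ltW.
have si : 0 <= s ^+ 2 / N%:R by apply: divr_ge0; [exact: sqr_ge0|exact: ltW].
have cc0 : 0 < cc by rewrite /cc -!mulrA; lra.
have Z0 w : 0 <= 10 * y * cabs (mtr (A w) z) by apply: mulr_ge0; [lra|exact: cabs_ge0].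
have rc1 c g : rv fullE g -> rv fullE (fun w => c * g w) by move=> rg; apply: (rvM msy) => //; exact: (rv_cst msy).
have r3 : rv fullE (fun w => 10 * y * cabs (mtr (A w) z) + cc) by apply: (rvD msy); [exact: rc1|exact: (rv_cst msy)].
have r2 : rv fullE (fun w => 2 * WY w + (10 * y * cabs (mtr (A w) z) + cc)) by apply: (rvD msy) => //; exact: rc1.
exists f; split.
- by apply: (rvD msy) => //; exact: rc1.
- by move=> w; have := X0 w; have := Y0 w; have := Z0 w; rewrite /f; lra.
- move=> w; have [sg spX] := spectrum_exists (A w); have N0 : (0 < N)%N := ltnW N2.
  apply: le_trans (cdf_path spX s0 s2 y0) _.
  have p1 := path_x spX N0 N hs1; have p2 := path_levels spX N0 s L.
  have eN : N%:R * (s / N%:R) = s by field.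
  have q1 : `|dpot sg (s +i* 1)%C| <= HX w + 2 * s ^+ 2 / N%:R.
    have d0 := dpot_i sg.
    have {}p1 := p1; rewrite eN d0 in p1.
    have e0 : dpot sg (s +i* 1)%C - 0 = dpot sg (s +i* 1)%C by ring.
    rewrite e0 in p1; apply: le_trans p1 _; rewrite le_eqVlt; apply/orP; left; apply/eqP.
    have -> : 2 * s ^+ 2 / N%:R = \sum_(k < N) (2 * (s / N%:R) * (s / N%:R)) by rewrite sumN; field.
    by rewrite /HX -big_split /=; apply: eq_bigr => k _; rewrite mulrDl [X in X + _]mulrC.
  have q2 : `|dpot sg (s +i* 1)%C - dpot sg z| <= WY w + 2 * L%:R / N%:R.
    apply: le_trans p2 _; rewrite le_eqVlt; apply/orP; left; apply/eqP.
    rewrite big_split /=; congr (_ + _).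
    by rewrite sumr_const card_ord -[LHS]mulr_natl; ring.
  have q3 : `|dpot sg z| <= `|dpot sg (s +i* 1)%C| + `|dpot sg (s +i* 1)%C - dpot sg z|.
    by have := ler_normB (dpot sg (s +i* 1)%C) (dpot sg (s +i* 1)%C - dpot sg z); rewrite opprB addrC subrK.
  by rewrite /f /cc -/z; lra.
have pX : 0 < 2 * (N%:R * (s / N%:R * (c1 / N%:R))).
  by apply: mulr_gt0 => //; apply: mulr_gt0 => //; apply: mulr_gt0 => //; exact: divr_gt0.
have pY : 0 < 2 * (L%:R * (N%:R * (c1 / N%:R ^+ 2))).
  apply: mulr_gt0 => //; apply: mulr_gt0; first by rewrite ltr0n.
  by apply: mulr_gt0 => //; apply: divr_gt0 => //; exact: exprn_gt0.
have pZ : 0 < 10 * y * be by apply: mulr_gt0 => //; lra.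
have y10 : 0 <= 10 * y by lra.
have m3 := mom_add msy (S := fullE) (rc1 (10 * y) _ rZ) (rv_cst msy fullE cc) Z0 (fun=> ltW cc0) pZ cc0 (momZ msy y10 rZ mZ) (mom_cst P p.+1 cc).
have m2 := mom_add msy (S := fullE) (rc1 2 _ rV) r3 (fun w => mulr_ge0 (ler0n R 2) (Y0 w)) (fun w => addr_ge0 (Z0 w) (ltW cc0)) pY (addr_gt0 pZ cc0) (momZ msy (ler0n R 2) rV mV) m3.
have g2 w : 0 <= 2 * WY w + (10 * y * cabs (mtr (A w) z) + cc) by have := Y0 w; have := Z0 w; lra.
have m1 := mom_add msy (S := fullE) (rc1 2 _ rX) r2 (fun w => mulr_ge0 (ler0n R 2) (X0 w)) g2 pX (addr_gt0 pY (addr_gt0 pZ cc0)) (momZ msy (ler0n R 2) rX mX) m2.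
apply: mom_ler m1; first by have := pX; have := pY; have := pZ; lra.
have yN : y <= 2 / N%:R by rewrite ler_pdivlMr// mulrC.
have -> : N%:R * (s / N%:R * (c1 / N%:R)) = s * (c1 / N%:R) by field.
have -> : L%:R * (N%:R * (c1 / N%:R ^+ 2)) = L%:R / N%:R * c1 by field.
pose i : R := N%:R^-1; have i0 : 0 < i by rewrite invr_gt0.
have yN' : y <= 2 * i := yN.
have t1 : s * (c1 * i) <= 2 * (c1 * i) by apply: ler_wpM2r; [apply: mulr_ge0; exact: ltW|exact: ltW].
have t2 : y * be <= 2 * i * be by apply: ler_wpM2r; [exact: ltW|].
have t3 : s ^+ 2 * i <= 4 * i by apply: ler_wpM2r; [exact: ltW|nra].
have t4 : (L%:R + 1) * i <= 4 * ln N%:R * i by apply: ler_wpM2r; [exact: ltW|].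
have t5 : 0 <= L%:R * i by apply: mulr_ge0 => //; exact: ltW.
have t6 : (L%:R + 1) * i * c1 <= 4 * ln N%:R * i * c1 by apply: ler_wpM2r; [exact: ltW|].
have t7 : (L%:R + 1) * i * be <= 4 * ln N%:R * i * be by apply: ler_wpM2r; [exact: ltW|].
have t8 : 0 <= L%:R * i * c1 by apply: mulr_ge0 => //; exact: ltW.
have t9 : 0 <= L%:R * i * be by apply: mulr_ge0 => //; exact: ltW.
have t10 : 0 <= i * c1 by apply: mulr_ge0; exact: ltW.
have t11 : 0 <= i * be by apply: mulr_ge0; exact: ltW.
rewrite /cc -/i; clear yN; move: yN' t1 t2 t3 t4 t5 t6 t7 t8 t9 t10 t11; clearbody i.
lra.
Qed.

Lemma small_scale (s : R) : 0 < s -> s <= 1 -> 1 <= N%:R * s -> exists f, [/\ rv fullE f, forall w, 0 <= f w,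
  forall w, `|cdf w (s ^+ 2) - mp_cdf (s ^+ 2)| <= f w & mom p.+1 f (2 * (be + 1) * s)].
Proof.
move=> s0 s1 sN; pose z : complex R := (0 +i* s)%C.
have hz : regular_point z by split => //=; lra.
have rZ : rv fullE (fun w => cabs (mtr (A w) z)) by apply: (rv_cabs msy); exact: rm.
have r1 : rv fullE (fun w => 2 * s * cabs (mtr (A w) z)) by apply: (rvM msy) => //; exact: (rv_cst msy).
have z1 w : 0 <= 2 * s * cabs (mtr (A w) z) by apply: mulr_ge0; [lra|exact: cabs_ge0].
have s20 : 0 < 2 * s by lra.
exists (fun w => 2 * s * cabs (mtr (A w) z) + 2 * s); split.
- by apply: (rvD msy) => //; exact: (rv_cst msy).
- by move=> w; have := z1 w; lra.
- move=> w; have [sg spX] := spectrum_exists (A w).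
  have h1 := cdf_small spX (ltnW N2) s0; have /andP[h2 _] := eigenvalue_cdf_bounds ((A w)^t* *m A w) (s ^+ 2).
  have s2 : s < 2 by lra.
  have h3 : mp_cdf (s ^+ 2) <= 2 * s by rewrite (mp_cdfE s0 s2); exact: mp_angle_small.
  have h4 : 0 <= mp_cdf (s ^+ 2) by apply: Rintegral_ge0 => x _; exact: mp_density_ge0.
  by rewrite ler_norml; have := z1 w; lra.
have pZ : 0 < 2 * s * be by exact: mulr_gt0.
have m1 := mom_add msy (S := fullE) r1 (rv_cst msy fullE (2 * s)) z1 (fun=> ltW s20) pZ s20 (momZ msy (ltW s20) rZ (mM hz)) (mom_cst P p.+1 (2 * s)).
by have -> : 2 * (be + 1) * s = 2 * s * be + 2 * s by ring.
Qed.

(** Both distribution functions are monotone and compared with their values at s = 2 - N^(-2). With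
    this choice [edge s], which bounds the missing mass, is of order 1/N. *)
Lemma edge_scale (x : R) : 4 <= x -> exists f, [/\ rv fullE f, forall w, 0 <= f w,
  forall w, `|cdf w x - mp_cdf x| <= f w & mom p.+1 f (Ktot * (ln N%:R / N%:R))].
Proof.
move=> x4; have Np := dim_gt0; have Nn := dim_neq0; have lh := ln_ge_half.
have N2' : 2 <= N%:R :> R by rewrite ler_nat.
pose i : R := N%:R^-1; have i0 : 0 < i by rewrite invr_gt0.
have i1 : i <= 2^-1 by rewrite lef_pV2 ?posrE//.
pose s := 2 - i ^+ 2.
have ii : i ^+ 2 <= i / 2 by rewrite expr2 ler_wpM2l// ltW.
have i2 : 0 < i ^+ 2 by exact: exprn_gt0.
have s2 : s < 2 by rewrite /s; lra.
have s1 : 1 <= s by rewrite /s; lra.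
have s0 : 0 < s by lra.
have [f [rf f0 fh fm]] := bulk s0 s2.
have c6 : 0 < 6 * i by lra.
exists (fun w => f w + 6 * i); split.
- by apply: (rvD msy) => //; exact: (rv_cst msy).
- by move=> w; have := f0 w; lra.
- move=> w; have h1 := fh w; have h2 := mp_angle_edge s1 s2; rewrite -(mp_cdfE s0 s2) in h2.
  have /andP[h3 h4] := mp_cdf_tail s1 s2 x4.
  have sx : s ^+ 2 <= x by nra.
  have h5 := eigenvalue_cdf_mono ((A w)^t* *m A w) sx.
  have /andP[_ h6] := eigenvalue_cdf_bounds ((A w)^t* *m A w) x.
  have e2 : edge s <= 2 * i.
    have e0 : 0 <= edge s by exact: sqrtr_ge0.
    have sm : -2 <= s by lra.
    have := edge_sq sm (ltW s2) => e.
    rewrite -(ler_pXn2r (n := 2))// ?nnegrE; last lra.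
    rewrite e exprMn /s; move: (i ^+ 2) i2 => j j0; nra.
  have s4 : 4 - s ^+ 2 <= 4 * i by rewrite /s; move: i2 ii; set j := i ^+ 2; nra.
  move: h1 h2; rewrite !ler_norml; lra.
have bp : 0 < 80 * (c1 + be + 1) * (ln N%:R / N%:R).
  by apply: mulr_gt0; [have := c0; have := be0; lra|apply: divr_gt0 => //; lra].
have m1 := mom_add msy (S := fullE) rf (rv_cst msy fullE (6 * i)) f0 (fun=> ltW c6) bp c6 fm (mom_cst P p.+1 (6 * i)).
apply: mom_ler m1; first lra.
have l1 : 2^-1 * i <= ln N%:R * i by apply: ler_wpM2r => //; exact: ltW.
have l2 : 0 <= (c1 + be) * (ln N%:R * i) by apply: mulr_ge0; [have := c0; have := be0; lra|apply: mulr_ge0; [lra|exact: ltW]].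
by rewrite /Ktot -/i; lra.
Qed.

Lemma cdf_moment (x : R) : (N%:R ^+ 2)^-1 <= x -> exists f, [/\ rv fullE f, forall w, 0 <= f w,
  forall w, `|cdf w x - mp_cdf x| <= f w &
  mom p.+1 f (Ktot * Num.min (Num.sqrt x) (ln N%:R / N%:R))].
Proof.
move=> hx; have Np := dim_gt0; have lh := ln_ge_half.
have lN : ln N%:R <= N%:R :> R by exact: ltW (ln_sublinear Np).
have lq0 : 0 < ln N%:R / N%:R :> R by apply: divr_gt0 => //; lra.
have lq1 : ln N%:R / N%:R <= 1 :> R by rewrite ler_pdivrMr// mul1r.
have x0 : 0 < x by apply: lt_le_trans hx; rewrite invr_gt0 exprn_gt0.
set s := Num.sqrt x; have s0 : 0 < s by rewrite sqrtr_gt0.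
have xs : x = s ^+ 2 by rewrite sqr_sqrtr// ltW.
have sN : 1 <= N%:R * s.
  rewrite -(ler_pXn2r (n := 2))// ?nnegrE//; last by apply: mulr_ge0; exact: ltW.
  by rewrite expr1n exprMn -xs -ler_pdivrMl ?exprn_gt0// mulr1.
have [x4|x4] := leP 4 x.
  have -> : Num.min s (ln N%:R / N%:R) = ln N%:R / N%:R.
    by apply: min_r; apply: le_trans lq1 _; nra.
  exact: edge_scale.
have s2 : s < 2 by nra.
have [sl|sl] := leP s (ln N%:R / N%:R).
  have s1 : s <= 1 by lra.
  have [f [rf f0 fh fm]] := small_scale s0 s1 sN.
  exists f; rewrite xs; split => //; apply: mom_ler fm.
    by apply: mulr_ge0; [have := be0; lra|exact: ltW].
  by apply: ler_wpM2r; [exact: ltW|rewrite /Ktot; have := c0; have := be0; lra].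
have [f [rf f0 fh fm]] := bulk s0 s2.
exists f; rewrite xs; split => //; apply: mom_ler fm.
  by apply: mulr_ge0; [have := c0; have := be0; lra|exact: ltW].
by apply: ler_wpM2r; [exact: ltW|rewrite /Ktot; have := c0; have := be0; lra].
Qed.

End Assembly.

(** * Measurability and truncation *)

Section CountMeasurable.
Context d (T : measurableType d) (R : realType) (P : probability T R).
Variables (N : nat) (E : finType) (ms : {set E} -> (T -> R) -> Prop).
Hypothesis msy : msystem P ms.

Definition mpow (H : 'M[complex R]_N) k := iter k (mulmx H) 1%:M.

Lemma fcalc_pow (U : 'M[complex R]_N) f k : U \is unitarymx ->
  mpow (fcalc U f) k = fcalc U (fun l => f l ^+ k).
Proof.
move=> UU; elim: k => [|k ih]; rewrite /mpow /=.
  by rewrite -(fcalc_cst _ UU); congr fcalc; apply/funext => l; rewrite expr0.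
transitivity (fcalc U f *m mpow (fcalc U f) k); first by [].
rewrite ih (fcalcM _ _ UU); congr (fcalc U _); apply/funext => l; exact: esym (exprS _ _).
Qed.

Lemma mms_pow S (M : T -> 'M[complex R]_N) k : mms ms S M -> mms ms S (fun w => mpow (M w) k).
Proof.
move=> mM; elim: k => [|k ih] /=; first by move=> i j; exact: (cms_cst msy).
exact: (mms_mul msy).
Qed.

Lemma harmonic_cvg (u : nat -> R) a C : (forall n, `|u n - a| <= C * harmonic n) -> u n @[n --> \oo] --> a.
Proof.
move=> h; have hC : C * harmonic n @[n --> \oo] --> C * 0 by apply: cvgM; [exact: cvg_cst|exact: cvg_harmonic].
rewrite mulr0 in hC.
have h1 : a - C * harmonic n @[n --> \oo] --> a - 0 by apply: cvgB => //; exact: cvg_cst.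
have h2 : a + C * harmonic n @[n --> \oo] --> a + 0 by apply: cvgD => //; exact: cvg_cst.
rewrite subr0 in h1; rewrite addr0 in h2; apply: (squeeze_cvgr _ h1 h2).
by apply: nearW => n; have := h n; rewrite ler_distl.
Qed.

Lemma cvg_big_sum (I : Type) (r : seq I) (u : I -> nat -> R) (a : I -> R) :
  (forall i, u i n @[n --> \oo] --> a i) ->
  \sum_(i <- r) u i n @[n --> \oo] --> \sum_(i <- r) a i.
Proof.
move=> h; elim: r => [|i r ih].
  have -> : (fun n => \sum_(i <- [::]) u i n) = (fun=> 0) by apply/funext => n; rewrite big_nil.
  by rewrite big_nil; exact: cvg_cst.
have -> : (fun n => \sum_(j <- i :: r) u j n) = (fun n => u i n + \sum_(j <- r) u j n).
  by apply/funext => n; rewrite big_cons.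
by rewrite big_cons; exact: cvgD.
Qed.

Lemma bernoulli (x : R) n : 0 <= x -> 1 + n%:R * x <= (1 + x) ^+ n.
Proof.
move=> x0; elim: n => [|n ih]; first by rewrite mul0r addr0 expr0.
rewrite exprS; have h : (1 + x) * (1 + n%:R * x) <= (1 + x) * (1 + x) ^+ n by rewrite ler_wpM2l//; lra.
apply: le_trans h; rewrite -natr1; have n0 : 0 <= n%:R :> R by rewrite ler0n.
by nra.
Qed.

(* A rational approximation of the indicator of [t <= 1], so that the counting
   function is a limit of traces of inverses and hence measurable. *)
Lemma threshold_cvg (t : R) : 0 <= t ->
  (1 + n.+1%:R^-1 * t ^+ (n.+1 * n.+1))^-1 @[n --> \oo] --> (if t <= 1 then 1 else 0 : R).
Proof.
move=> t0; case: (leP t 1) => t1.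
  apply: (@harmonic_cvg _ _ 1) => n; rewrite mul1r /harmonic /=.
  have i0 : 0 <= n.+1%:R^-1 :> R by rewrite invr_ge0.
  have p1 : t ^+ (n.+1 * n.+1) <= 1 by exact: exprn_ile1.
  have p0 : 0 <= t ^+ (n.+1 * n.+1) by exact: exprn_ge0.
  set x := n.+1%:R^-1 * _; have x0 : 0 <= x by exact: mulr_ge0.
  have xi : x <= n.+1%:R^-1 by rewrite -[leRHS]mulr1 ler_wpM2l.
  have y0 : 0 < 1 + x by lra.
  have -> : (1 + x)^-1 - 1 = - (x / (1 + x)) by field; rewrite gt_eqF.
  rewrite normrN ger0_norm; last by apply: divr_ge0 => //; exact: ltW.
  by apply: le_trans xi; rewrite ler_pdivrMr// ler_peMr//; lra.
set dl := t - 1; have d0 : 0 < dl by rewrite subr_gt0.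
apply: (@harmonic_cvg _ _ dl^-1) => n; rewrite subr0 /harmonic /=.
have k0 : 0 < n.+1%:R :> R by [].
have te : t = 1 + dl by rewrite /dl; ring.
have h1 := @bernoulli dl n.+1 (ltW d0).
have h2 : n.+1%:R * dl <= t ^+ n.+1 by rewrite te; lra.
have h3 : 1 <= t ^+ n.+1 by apply: exprn_ege1; exact: ltW.
have hb := @bernoulli dl (n.+1 * n.+1) (ltW d0).
have h4 : n.+1%:R * dl <= n.+1%:R^-1 * t ^+ (n.+1 * n.+1).
  rewrite ler_pdivlMl// te; apply: le_trans hb; rewrite natrM mulrA.
  by lra.
have q0 : 0 < n.+1%:R * dl by exact: mulr_gt0.
have y0 : 0 < 1 + n.+1%:R^-1 * t ^+ (n.+1 * n.+1) by apply: addr_gt0 => //; exact: lt_le_trans q0 h4.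
rewrite ger0_norm; last by rewrite invr_ge0; exact: ltW.
rewrite -invfM [dl * _]mulrC lef_pV2 ?posrE//; apply: le_trans h4 _.
by rewrite lerDr.
Qed.

Lemma measurable_eigenvalue_cdf (M : T -> 'M[complex R]_N) (x : R) S : 0 < x -> mms ms S M ->
  measurable_fun [set: T] (fun w => eigenvalue_cdf ((M w)^t* *m M w) x).
Proof.
move=> x0 mM.
pose c n : R := n.+1%:R^-1 * (x^-1) ^+ (n.+1 * n.+1).
(* The inverse of [Q n w] has the eigenvalues of [threshold_cvg] at t = sg^2 / x. The double sign
   matches the form of [fcalcB]. *)
pose Q n w : 'M[complex R]_N := 1%:M - rc (- c n) *: mpow (gram (M w)) (n.+1 * n.+1).
have c0 n : 0 <= c n by apply: mulr_ge0; rewrite ?invr_ge0// exprn_ge0// invr_ge0 ltW.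
have hQ w : exists U sg, [/\ U \is unitarymx, forall n, Q n w = fcalc U (fun l => rc (1 + c n * (sg l ^+ 2) ^+ (n.+1 * n.+1))) &
     forall l, spectral_diag (gram (M w)) 0 l = rc (sg l ^+ 2)].
  have [U [sg [UU s0 gE dE]]] := gram_spectral (M w); exists U, sg; split; [exact: UU|move=> n|exact: dE].
  rewrite /Q gE (fcalc_pow _ _ UU) fcalcZ -(fcalc_cst _ UU) fcalcB; congr (fcalc U _); apply/funext => l.
  by rewrite -rmorphXn -rmorphM /= -(rmorph1 (real_complex R)) -rmorphB mulNr opprK.
have pos n (s : R) : 0 < 1 + c n * (s ^+ 2) ^+ (n.+1 * n.+1).
  by apply: ltr_wpDr => //; apply: mulr_ge0 => //; apply: exprn_ge0; exact: sqr_ge0.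
have nz n (s : R) : rc (1 + c n * (s ^+ 2) ^+ (n.+1 * n.+1)) != 0.
  by rewrite fmorph_eq0 gt_eqF.
have uQ n w : Q n w \in unitmx.
  have [U [sg [UU qE _]]] := hQ w.
  have e : Q n w *m fcalc U (fun l => (rc (1 + c n * (sg l ^+ 2) ^+ (n.+1 * n.+1)))^-1) = 1%:M.
    rewrite qE fcalcM// -(fcalc_cst 1 UU); congr fcalc; apply/funext => l; exact: mulfV.
  by case: (mulmx1_unit e).
pose h n w : R := N%:R^-1 * rp (\tr (invmx (Q n w))).
have mh n : measurable_fun [set: T] (h n).
  have mg : mms ms S (fun w => gram (M w)) by apply: (mms_mul msy) => //; exact: (mms_adj msy).
  have mp := mms_pow (n.+1 * n.+1) mg.
  have mQ : mms ms S (Q n).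
    move=> i j; have -> : (fun w => Q n w i j) = (fun w => (1%:M : 'M[complex R]_N) i j + (- rc (- c n)) * mpow (gram (M w)) (n.+1 * n.+1) i j).
      by apply/funext => w; rewrite /Q mxE [in X in _ + X]mxE [in X in _ + X]mxE mulNr.
    apply: (cmsD msy); first exact: (cms_cst msy).
    by apply: (cmsM msy); [exact: (cms_cst msy)|exact: mp].
  have mi := mms_inv msy mQ (uQ n).
  have mt : cms ms S (fun w => \tr (invmx (Q n w))) by apply: (cms_sum msy) => i _; exact: mi.
  apply: measurable_funM => //; exact: (ms_meas msy mt.1).
apply: (measurable_fun_cvg mh) => w _.
have [U [sg [UU qE dE]]] := hQ w.
have hE : h ^~ w = (fun n => N%:R^-1 * \sum_l (1 + n.+1%:R^-1 * (sg l ^+ 2 / x) ^+ (n.+1 * n.+1))^-1).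
  apply/funext => n; rewrite /h; congr (_ * _).
  rewrite qE fcalc_inv// mxtrace_fcalc// rp_sum; apply: eq_bigr => l _.
  rewrite -fmorphV rpC /c; congr ((1 + _)^-1).
  by rewrite [(sg l ^+ 2 / x) ^+ _]exprMn -mulrA; congr (_ * _); exact: mulrC.
rewrite hE; have -> : eigenvalue_cdf ((M w)^t* *m M w) x = N%:R^-1 * \sum_l (if sg l ^+ 2 / x <= 1 then 1 else 0).
  rewrite /eigenvalue_cdf -/(gram (M w)) mulrC; congr (_ * _).
  rewrite -sum1_card natr_sum big_mkcond /=; apply: eq_bigr => l _.
  by rewrite inE dE lecR ler_pdivrMr// mul1r; case: ifP.
apply: cvgM; first exact: cvg_cst.
apply: cvg_big_sum => l; apply: threshold_cvg; apply: divr_ge0; [exact: sqr_ge0|exact: ltW].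
Qed.
End CountMeasurable.

Lemma Ex_EFin d (T : measurableType d) (R : realType) (P : probability T R) (f : T -> R) : bm f -> (\int[P]_w (f w)%:E)%E = (Ex P f)%:E.
Proof.
move=> bf; rewrite /Ex /Rintegral fineK//.
by apply: integrable_fin_num => //; exact: (bm_integrable P bf).
Qed.

(** * Independence structure of the entries *)

Section EntrySystem.
Context d (T : measurableType d) (R : realType) (P : probability T R).
Variables (N : nat) (Y : 'I_N * 'I_N * bool -> T -> R).
Hypothesis mY : forall i, measurable_fun [set: T] (Y i).
Hypothesis indY : mutually_independent P Y.
Local Notation E := ('I_N * 'I_N)%type.

Definition parts (S : {set E}) : {set E * bool} := [set k | k.1 \in S]%SET.
Definition ms_entry (S : {set E}) (f : T -> R) :=
  measurable_fun [set: sigma_of Y (parts S)] (f : sigma_of Y (parts S) -> R).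

Lemma entry_msystem : msystem P ms_entry.
Proof.
split.
- by move=> S f mf; exact: (sigma_of_measurable mY mf).
- by move=> S c; exact: measurable_cst.
- by move=> S f g mf mg; exact: measurable_funD.
- by move=> S f g mf mg; exact: measurable_funM.
- by move=> S f phi mphi mf; exact: (measurableT_comp mphi mf).
- move=> S S' f SS' mf; apply: sigma_of_sub mf.
  by apply/fintype.subsetP => k; rewrite !inE; exact: (fintype.subsetP SS').
- move=> S S' f g dS mf mg [a fa] [b gb].
  have dP : [disjoint parts S & parts S']%B.
    rewrite -setI_eq0; apply/eqP/setP => k; rewrite !inE.
    by apply/negP => /andP[k1 k2]; move: (disjointFr dS k1); rewrite k2.
  have bf : bm f by split; [exact: (sigma_of_measurable mY mf)|exists a].
  have bg : bm g by split; [exact: (sigma_of_measurable mY mg)|exists b].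
  have mf1 : measurable_fun [set: T] f := bf.1.
  have mg1 : measurable_fun [set: T] g := bg.1.
  (* Factorisation is available for nonnegative functions; adding the bounds makes both variables
     nonnegative, and the extra terms cancel by linearity. *)
  pose f1 w := f w + a; pose g1 w := g w + b.
  have f0 w : 0 <= f1 w by have := fa w; rewrite ler_norml /f1; lra.
  have g0 w : 0 <= g1 w by have := gb w; rewrite ler_norml /g1; lra.
  have ca (c : R) : bm (fun _ : T => c) by split; [exact: measurable_cst|exact: bfct_cst].
  have bD (u v : T -> R) : bm u -> bm v -> bm (fun w => u w + v w).
    by move=> [u1 u2] [v1 v2]; split; [exact: measurable_funD|exact: bounded_fctD].
  have bM (u v : T -> R) : bm u -> bm v -> bm (fun w => u w * v w).
    by move=> [u1 u2] [v1 v2]; split; [exact: measurable_funM|exact: bounded_fctM].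
  have h := @ge0_indep_integral _ _ _ P _ Y mY indY _ _ f1 g1 dP
    (measurable_funD mf (measurable_cst a)) (measurable_funD mg (measurable_cst b)) f0 g0.
  have bf1 : bm f1 by exact: bD. have bg1 : bm g1 by exact: bD.
  rewrite (Ex_EFin P (bM _ _ bf1 bg1)) (Ex_EFin P bf1) (Ex_EFin P bg1) -EFinM in h.
  case: h => h.
  have e1 : Ex P f1 = Ex P f + a by rewrite (ExD P bf (ca a)) Ex_cst.
  have e2 : Ex P g1 = Ex P g + b by rewrite (ExD P bg (ca b)) Ex_cst.
  have e3 : Ex P (fun w => f1 w * g1 w) = Ex P (fun w => f w * g w) + (b * Ex P f + (a * Ex P g + a * b)).
    have b1 := bM _ _ (ca b) bf; have b2 := bM _ _ (ca a) bg; have b3 := ca (a * b).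
    transitivity (Ex P (fun w => f w * g w + (b * f w + (a * g w + a * b)))).
      by congr Ex; apply/funext => w; rewrite /f1 /g1; ring.
    by rewrite (ExD P (bM _ _ bf bg) (bD _ _ b1 (bD _ _ b2 b3))) (ExD P b1 (bD _ _ b2 b3)) (ExD P b2 b3) (ExZ P b bf) (ExZ P a bg) Ex_cst.
  move: h; rewrite e1 e2 e3 => h.
  by apply: (addIr (b * Ex P f + (a * Ex P g + a * b))); rewrite h; ring.
Qed.
End EntrySystem.

Section ModelConstant.
Variables (R : realType) (mu4 D : R).

(** The maxima with 1 allow the powers of [D] and [mu4] to be raised to the full order; the 4
    absorbs the powers of 2 from splitting into real and imaginary parts. *)
Definition model_cst : R := 4 * Num.max D 1 * Num.max mu4 1.

Lemma model_cst_ge1 : 1 <= model_cst.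
Proof.
have D2 : 1 <= Num.max D 1 by rewrite le_max lexx orbT.
have M2 : 1 <= Num.max mu4 1 by rewrite le_max lexx orbT.
by rewrite /model_cst; nra.
Qed.

End ModelConstant.

Lemma leq_double_quad q : ((2 * q.+1).+1 <= 4 * q.+1)%N.
Proof. lia. Qed.

Lemma add_expn_le (R : realType) (a b : R) n : 0 <= a -> 0 <= b -> (a + b) ^+ n <= 2 ^+ n * (a ^+ n + b ^+ n).
Proof.
wlog ab : a b / a <= b.
  by move=> h a0 b0; case: (leP a b) => [|/ltW] hab; [|rewrite addrC [a ^+ n + _]addrC]; exact: h.
move=> a0 b0; apply: (@le_trans _ _ ((2 * b) ^+ n)).
  by apply: lerXn2r; rewrite ?nnegrE; lra.
by rewrite exprMn ler_wpM2l ?exprn_ge0// lerDr exprn_ge0.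
Qed.

(** * The truncated matrix and its relation to the original one *)

Section Model.
Context d (T : measurableType d) (R : realType) (P : probability T R).

Lemma markov_power (f : T -> R) (c : R) n : measurable_fun [set: T] f -> (forall w, 0 <= f w) -> 0 <= c ->
  ((c ^+ n)%:E * P [set w | (c <= f w)%R] <= \int[P]_w (f w ^+ n)%:E)%E /\ measurable [set w | (c <= f w)%R].
Proof.
move=> mf f0 c0.
have mS : measurable [set w | c <= f w].
  have -> : [set w | c <= f w] = [set: T] `&` f @^-1` `[c, +oo[%classic.
    by apply/seteqP; split => w /=; rewrite in_itv /= andbT // => -[].
  by apply: mf.
split => //; rewrite -(integral_cst P mS).
have mfn : measurable_fun [set: T] (fun w => (f w ^+ n)%:E) by apply/measurable_EFinP; exact: measurable_funX.
apply: (@le_trans _ _ (\int[P]_(w in [set w | (c <= f w)%R]) (f w ^+ n)%:E)%E).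
  apply: ge0_le_integral => //.
  - by move=> w _; rewrite lee_fin exprn_ge0.
  - exact: measurable_funTS.
  - by move=> w /= cf; rewrite lee_fin; apply: lerXn2r; rewrite ?nnegrE.
by apply: ge0_subset_integral => // w _; rewrite lee_fin exprn_ge0.
Qed.

Variables (mu4 D : R) (N : nat) (X : T -> 'M[complex R]_N).
Hypotheses (D0 : 0 < D) (N0 : (0 < N)%N) (H : random_matrix_hyp P mu4 D X).
Local Notation Y := (entry_part X).
Let mY := entry_part_measurable H.
Let o : 'I_N := Ordinal N0.

Lemma identical_integral (g : R -> R) k j : measurable_fun [set: R] g -> (forall x, 0 <= g x) ->
  (\int[P]_w (g (Y k w))%:E = \int[P]_w (g (Y j w))%:E)%E.
Proof.
move=> mg g0.
pose iY i : {mfun T >-> R} := HB.pack (Y i) (isMeasurableFun.Build _ _ _ _ _ (mY i)).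
have e i : (\int[P]_w (g (Y i w))%:E = \int[distribution P (iY i)]_y (g y)%:E)%E.
  by rewrite (ge0_integral_pushforward (mY i))//=; [exact/measurable_EFinP|move=> x _; rewrite /= lee_fin].
rewrite (e k) (e j); apply: eq_measure_integral => B mB _.
exact: (entry_part_identical H).
Qed.

Lemma measurable_absr : measurable_fun [set: R] (fun x : R => `|x|).
Proof. by apply: continuous_measurable_fun; exact: norm_continuous. Qed.

Lemma measurable_normrX n : measurable_fun [set: R] (fun x : R => `|x| ^+ n).
Proof. by apply: measurable_funX; exact: measurable_absr. Qed.

(** Moments are assumed for the entry x_11 only. Equality in law carries them to every real and
    imaginary part. *)
Lemma entry_part_moment k q : (0 < q)%N ->
  (\int[P]_w (`|Y k w| ^+ (4 * q))%:E <= (D ^+ (4 * (q - 1)) * N%:R ^+ (q - 1) * mu4)%:E)%E.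
Proof.
move=> q0; rewrite (@identical_integral (fun x => `|x| ^+ (4 * q)) k (o, o, false)); last 2 first.
- exact: measurable_normrX.
- by move=> x; exact: exprn_ge0.
have := entry_moments H (erefl : nat_of_ord o = 0%N) q0; rewrite expectation.unlock; apply: le_trans.
apply: ge0_le_integral => //.
- by apply/measurable_EFinP; exact: (measurableT_comp (measurable_normrX _) (mY _)).
- have -> : (fun w => (cabs (X w o o) ^+ (4 * q))%:E) = EFin \o (fun w => (Y (o, o, false) w ^+ 2 + Y (o, o, true) w ^+ 2) ^+ (2 * q)).
    by apply/funext => w /=; rewrite -[(2 * 2 * q)%N]/(4 * q)%N -(mulnA 2 2 q) exprM cabs_sqr.
  by apply/measurable_EFinP; apply: measurable_funX; apply: measurable_funD; exact: measurable_funX.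
- by move=> w _; rewrite lee_fin; apply: lerXn2r; rewrite ?nnegrE ?cabs_ge0//; exact: rp_cabs.
Qed.

Definition cutoff : R := 2 * D * Num.sqrt (Num.sqrt N%:R).

Lemma cutoff_ge0 : 0 <= cutoff.
Proof. by apply: mulr_ge0; [have := D0; lra|exact: sqrtr_ge0]. Qed.

Lemma cutoff_pow q : cutoff ^+ (4 * q) = 16 ^+ q * D ^+ (4 * q) * N%:R ^+ q.
Proof.
rewrite /cutoff !exprMn; congr (_ * _ * _).
  by rewrite exprM; congr (_ ^+ q); ring.
by rewrite exprM; congr (_ ^+ q); rewrite -[4%N]/(2 * 2)%N exprM !sqr_sqrtr ?sqrtr_ge0.
Qed.

(* [E|Y|^(4q) <= D^(4(q-1)) N^(q-1) mu4] for all [q] forces [|Y| < 2 D N^(1/4)] almost surely. *)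
Lemma entry_part_bounded k : measurable [set w | cutoff <= `|Y k w|] /\ P [set w | cutoff <= `|Y k w|] = 0%E.
Proof.
have mA : measurable_fun [set: T] (fun w => `|Y k w|) by exact: (measurableT_comp measurable_absr (mY k)).
have mk n := @markov_power (fun w => `|Y k w|) cutoff n mA (fun w => normr_ge0 _) cutoff_ge0.
have [_ mS] := mk 0%N; split => //.
set S := [set w | _] in mk mS *.
have fin : P S \is a fin_num by exact: fin_num_measure.
have p0 : 0 <= fine (P S) by rewrite fine_ge0.
rewrite -(fineK fin); congr EFin; apply/eqP; rewrite eq_le p0 andbT leNgt; apply/negP => p1.
have Np : 0 < N%:R :> R by rewrite ltr0n.
pose c := D ^+ 4 * N%:R * fine (P S); have c0 : 0 < c by apply: mulr_gt0 => //; apply: mulr_gt0 => //; exact: exprn_gt0.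
have key n : 16 ^+ n.+1 * c <= mu4.
  have [h _] := mk (4 * n.+1)%N; have := le_trans h (entry_part_moment k (ltn0Sn n)).
  rewrite -(fineK fin) -EFinM lee_fin cutoff_pow subn1 /= => h2.
  have q0 : 0 < D ^+ (4 * n) * N%:R ^+ n by apply: mulr_gt0; exact: exprn_gt0.
  rewrite -(ler_pM2l q0); apply: le_trans h2; rewrite le_eqVlt; apply/orP; left; apply/eqP.
  by rewrite /c mulnS exprD [N%:R ^+ n.+1]exprSr; ring.
have m0 : 0 <= mu4 / c.
  apply: divr_ge0; last exact: ltW; apply: le_trans (key 0%N); apply: mulr_ge0; last exact: ltW.
  by rewrite expr1.
have h1 := archi_boundP m0; set n := Num.bound _ in h1.
have h2 := key n; have h3 : n%:R <= 16 ^+ n.+1 :> R.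
  by rewrite -[16]/(16%:R) -natrX ler_nat; apply: ltnW; apply: leq_trans (ltn_expl n (isT : (1 < 16)%N)) _; rewrite leq_exp2l.
have h4 : n%:R * c <= 16 ^+ n.+1 * c by apply: ler_wpM2r => //; exact: ltW.
rewrite ltr_pdivrMr// in h1.
by have := lt_le_trans h1 (le_trans h4 h2); rewrite ltxx.
Qed.

(** The cut is almost surely without effect, so mean, variance and moments are unchanged; its
    purpose is boundedness at every sample point. *)
Definition trunc_at (x : R) : R := if `|x| < cutoff then x else 0.

Lemma measurable_trunc : measurable_fun [set: R] trunc_at.
Proof.
apply: measurable_fun_ifT => //; apply: measurable_fun_ltr => //; exact: measurable_absr.
Qed.

Lemma trunc_bound x : `|trunc_at x| <= cutoff.
Proof. by rewrite /trunc_at; case: ifP => [/ltW //|_]; rewrite normr0 cutoff_ge0. Qed.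

Lemma Ex_trunc (g : R -> R) k : measurable_fun [set: R] g ->
  Ex P (fun w => g (trunc_at (Y k w))) = fine (\int[P]_w (g (Y k w))%:E)%E.
Proof.
move=> mg; rewrite /Ex /Rintegral; congr fine; apply: ae_eq_integral => //.
- apply/measurable_EFinP; apply: (measurableT_comp mg).
  exact: (measurableT_comp measurable_trunc (mY k)).
- by apply/measurable_EFinP; exact: (measurableT_comp mg (mY k)).
have [mS S0] := entry_part_bounded k; exists [set w | cutoff <= `|Y k w|]; split => // w /= h.
by rewrite leNgt; apply/negP => hb; apply: h => _; rewrite /trunc_at hb.
Qed.

Definition sN : R := (Num.sqrt N%:R)^-1.
Lemma sN_sq : sN ^+ 2 = N%:R^-1.
Proof. by rewrite exprVn sqr_sqrtr. Qed.
Lemma sN_ge0 : 0 <= sN. Proof. by rewrite invr_ge0 sqrtr_ge0. Qed.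

Definition truncated (w : T) : 'M[complex R]_N :=
  \matrix_(i, j) ((sN * trunc_at (Y (i, j, false) w)) +i* (sN * trunc_at (Y (i, j, true) w)))%C.

Lemma truncated_rp i j w : rp (truncated w i j) = sN * trunc_at (Y (i, j, false) w).
Proof. by rewrite mxE. Qed.
Lemma truncated_ip i j w : ip (truncated w i j) = sN * trunc_at (Y (i, j, true) w).
Proof. by rewrite mxE. Qed.

Local Notation ms := (ms_entry Y).
Let msy : msystem P ms := entry_msystem mY (entry_part_independent H).

Lemma ms_part (S : {set 'I_N * 'I_N}) i j b : (i, j) \in S -> ms S (Y (i, j, b)).
Proof. by move=> ij; rewrite /ms_entry; apply: sigma_of_coord; rewrite inE. Qed.

Lemma rv_trunc (S : {set 'I_N * 'I_N}) i j b : (i, j) \in S -> rv ms S (fun w => trunc_at (Y (i, j, b) w)).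
Proof.
move=> ij; split; last by exists cutoff => w; exact: trunc_bound.
by apply: (ms_comp msy measurable_trunc); exact: ms_part.
Qed.

Lemma rv_truncZ (S : {set 'I_N * 'I_N}) i j b : (i, j) \in S -> rv ms S (fun w => sN * trunc_at (Y (i, j, b) w)).
Proof. by move=> ij; apply: (rvM msy); [exact: (rv_cst msy)|exact: rv_trunc]. Qed.

Lemma Ex_trunc1 k : Ex P (fun w => trunc_at (Y k w)) = 0.
Proof.
rewrite (@Ex_trunc id k)//.
by have := entry_part_mean H k; rewrite expectation.unlock => ->.
Qed.

Lemma Ex_trunc2 k : Ex P (fun w => trunc_at (Y k w) ^+ 2) = 2^-1.
Proof.
rewrite (@Ex_trunc (fun x => x ^+ 2) k); last exact: measurable_funX.
have := entry_part_variance H k; rewrite /variance covariance.unlock (entry_part_mean H k) expectation.unlock.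
have -> : (\int[P]_w ((((Y k) \- cst (fine 0%E)) * ((Y k) \- cst (fine 0%E)))%R w)%:E = \int[P]_w (Y k w ^+ 2)%:E)%E.
  by apply: eq_integral => w _; congr EFin; rewrite /= expr2 /GRing.mul /= !subr0.
by move=> ->.
Qed.

Lemma Ex_trunc_moment k q : Ex P (fun w => trunc_at (Y k w) ^+ (4 * q.+1)) <= D ^+ (4 * q) * N%:R ^+ q * mu4.
Proof.
have -> : (fun w => trunc_at (Y k w) ^+ (4 * q.+1)) = (fun w => `|trunc_at (Y k w)| ^+ (4 * q.+1)).
  by apply/funext => w; rewrite -normrX ger0_norm// -[4%N]/(2 * 2)%N -mulnA exprM exprn_ge0// sqr_ge0.
rewrite (@Ex_trunc (fun x => `|x| ^+ (4 * q.+1)) k); last exact: measurable_normrX.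
have := entry_part_moment k (ltn0Sn q); rewrite subn1 /=.
have : (0 <= \int[P]_w (`|Y k w| ^+ (4 * q.+1))%:E)%E by apply: integral_ge0 => w _; rewrite lee_fin exprn_ge0.
by case: (\int[P]_w _)%E => [r| |] //=; rewrite !lee_fin.
Qed.

Lemma truncated_rmodel : rmodel P ms truncated (model_cst mu4 D).
Proof.
have D1 : D <= Num.max D 1 by rewrite le_max lexx.
have D2 : 1 <= Num.max D 1 by rewrite le_max lexx orbT.
have M1 : mu4 <= Num.max mu4 1 by rewrite le_max lexx.
have M2 : 1 <= Num.max mu4 1 by rewrite le_max lexx orbT.
have inT k : k \in [set: 'I_N * 'I_N]%SET by rewrite inE.
have rT k b : rv ms [set: 'I_N * 'I_N]%SET (fun w => trunc_at (Y (k, b) w)) by case: k => i j; exact: rv_trunc.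
split => //.
- move=> S i j ij; split.
    by apply: (rv_ext (f := fun w => sN * trunc_at (Y (i, j, false) w))); [move=> w; rewrite truncated_rp|exact: rv_truncZ].
  by apply: (rv_ext (f := fun w => sN * trunc_at (Y (i, j, true) w))); [move=> w; rewrite truncated_ip|exact: rv_truncZ].
- move=> i j; transitivity (Ex P (fun w => sN * trunc_at (Y (i, j, false) w))).
    by apply: Ex_ext => w; rewrite truncated_rp.
  by rewrite (ExZr msy _ (rT (i, j) false)) Ex_trunc1 mulr0.
- move=> i j; transitivity (Ex P (fun w => sN * trunc_at (Y (i, j, true) w))).
    by apply: Ex_ext => w; rewrite truncated_ip.
  by rewrite (ExZr msy _ (rT (i, j) true)) Ex_trunc1 mulr0.
- move=> i j; transitivity (Ex P (fun w => sN ^+ 2 * (trunc_at (Y (i, j, false) w) ^+ 2 + trunc_at (Y (i, j, true) w) ^+ 2))).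
    by apply: Ex_ext => w; rewrite cabs_sqr truncated_rp truncated_ip; ring.
  have r1 := rvX msy 2 (rT (i, j) false); have r2 := rvX msy 2 (rT (i, j) true).
  rewrite (ExZr msy _ (rvD msy r1 r2)) (ExDr msy r1 r2) !Ex_trunc2 sN_sq; field.
  by rewrite pnatr_eq0 -lt0n.
- exact: model_cst_ge1.
move=> i j q; set m := (4 * q.+1)%N.
have r1 := rvX msy m (rT (i, j) false); have r2 := rvX msy m (rT (i, j) true).
have sm : sN ^+ m = N%:R^-1 ^+ (2 * q.+1) by rewrite /m -[4%N]/(2 * 2)%N -mulnA exprM sN_sq.
have s0 : 0 <= sN ^+ m by apply: exprn_ge0; exact: sN_ge0.
apply: (@le_trans _ _ (Ex P (fun w => (sN ^+ m * 2 ^+ (2 * q.+1)) * (trunc_at (Y (i, j, false) w) ^+ m + trunc_at (Y (i, j, true) w) ^+ m)))).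
  have rA : crv ms [set: 'I_N * 'I_N]%SET (fun w => truncated w i j).
    split.
      by apply: (rv_ext (f := fun w => sN * trunc_at (Y (i, j, false) w))); [move=> w; rewrite truncated_rp|exact: rv_truncZ].
    by apply: (rv_ext (f := fun w => sN * trunc_at (Y (i, j, true) w))); [move=> w; rewrite truncated_ip|exact: rv_truncZ].
  apply: (Ex_mono msy (S := [set: 'I_N * 'I_N]%SET)).
  - by apply: (rvX msy); exact: (rv_cabs msy).
  - by apply: (rvM msy); [exact: (rv_cst msy)|exact: (rvD msy)].
  move=> w; have -> : cabs (truncated w i j) ^+ m = sN ^+ m * (trunc_at (Y (i, j, false) w) ^+ 2 + trunc_at (Y (i, j, true) w) ^+ 2) ^+ (2 * q.+1).
    have -> : cabs (truncated w i j) ^+ m = (cabs (truncated w i j) ^+ 2) ^+ (2 * q.+1) by rewrite -exprM mulnA.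
    have -> : sN ^+ m = (sN ^+ 2) ^+ (2 * q.+1) by rewrite -exprM mulnA.
    rewrite -exprMn; congr (_ ^+ _).
    by rewrite cabs_sqr truncated_rp truncated_ip; ring.
  rewrite -mulrA; apply: ler_wpM2l => //.
  by apply: le_trans (add_expn_le _ (sqr_ge0 _) (sqr_ge0 _)) _; rewrite -!exprM mulnA.
rewrite (ExZr msy _ (rvD msy r1 r2)) (ExDr msy r1 r2).
have e1 := Ex_trunc_moment (i, j, false) q; have e2 := Ex_trunc_moment (i, j, true) q.
have c0 : 0 <= sN ^+ m * 2 ^+ (2 * q.+1) by apply: mulr_ge0 => //; exact: exprn_ge0.
apply: le_trans (ler_wpM2l c0 (lerD e1 e2)) _.
have Nn : N%:R != 0 :> R by rewrite pnatr_eq0 -lt0n.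
have -> : sN ^+ m * 2 ^+ (2 * q.+1) * (D ^+ (4 * q) * N%:R ^+ q * mu4 + D ^+ (4 * q) * N%:R ^+ q * mu4) =
  (2 ^+ (2 * q.+1).+1 * (D ^+ (4 * q) * mu4)) * N%:R^-1 ^+ q.+2.
  (* The power 2 (q + 1) of 1/N is split into q + 2, which the model demands, and q, which cancels
     the growth N^q of the assumed moments. *)
  have -> : sN ^+ m = N%:R^-1 ^+ q.+2 * N%:R^-1 ^+ q by rewrite sm -exprD; congr (_ ^+ _); lia.
  have eN : N%:R^-1 ^+ q * N%:R ^+ q = 1 :> R by rewrite -exprMn mulVf// expr1n.
  rewrite [2 ^+ _.+1]exprS; transitivity (2 * 2 ^+ (2 * q.+1) * (D ^+ (4 * q) * mu4) * N%:R^-1 ^+ q.+2 * (N%:R^-1 ^+ q * N%:R ^+ q)); first by ring.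
  by rewrite eN mulr1.
apply: ler_wpM2r; first by apply: exprn_ge0; rewrite invr_ge0.
have d1 : 0 <= D ^+ (4 * q) by apply: exprn_ge0; exact: ltW.
have d2 : D ^+ (4 * q) <= Num.max D 1 ^+ m.
  apply: (@le_trans _ _ (Num.max D 1 ^+ (4 * q))); first by apply: lerXn2r; [rewrite nnegrE; exact: ltW|rewrite nnegrE; lra|exact: D1].
  by apply: ler_weXn2l => //; rewrite /m leq_mul2l leqnSn.
have d3 : Num.max mu4 1 <= Num.max mu4 1 ^+ m by apply: ler_eXnr.
have d4 : 2 ^+ (2 * q.+1).+1 <= 4 ^+ m :> R.
  apply: (@le_trans _ _ (2 ^+ m)); first by apply: ler_weXn2l; [rewrite ler1n|exact: leq_double_quad].
  by apply: lerXn2r; rewrite ?nnegrE; lra.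
rewrite /model_cst !exprMn -mulrA.
have d5 : D ^+ (4 * q) * mu4 <= Num.max D 1 ^+ m * Num.max mu4 1 ^+ m.
  apply: (@le_trans _ _ (D ^+ (4 * q) * Num.max mu4 1)); first exact: ler_wpM2l.
  by apply: ler_pM => //; lra.
apply: (@le_trans _ _ (2 ^+ (2 * q.+1).+1 * (Num.max D 1 ^+ m * Num.max mu4 1 ^+ m))).
  by apply: ler_wpM2l => //; exact: exprn_ge0.
by apply: ler_wpM2r => //; apply: mulr_ge0; apply: exprn_ge0; lra.
Qed.

Lemma rescaled_mms : mms ms [set: 'I_N * 'I_N]%SET (fun w => rescaled (X w)).
Proof.
move=> i j; have h b : ms [set: 'I_N * 'I_N]%SET (fun w => sN * Y (i, j, b) w).
  by apply: (ms_mul msy); [exact: (ms_cst msy)|apply: ms_part; rewrite inE].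
split.
  by have -> : (fun w => rp (rescaled (X w) i j)) = (fun w => sN * Y (i, j, false) w); [apply/funext => w; rewrite mxE rpcM|exact: h].
by have -> : (fun w => ip (rescaled (X w) i j)) = (fun w => sN * Y (i, j, true) w); [apply/funext => w; rewrite mxE ipcM|exact: h].
Qed.

Lemma bad_event : exists B : set T, [/\ measurable B, P B = 0%E & forall w, ~ B w -> truncated w = rescaled (X w)].
Proof.
have h (r : seq ('I_N * 'I_N * bool)) : exists B : set T, [/\ measurable B, P B = 0%E &
    forall w k, k \in r -> cutoff <= `|Y k w| -> B w].
  elim: r => [|k r [B [mB B0 hB]]]; first by exists set0; split => //; exact: measure0.
  have [mS S0] := entry_part_bounded k.
  exists ([set w | cutoff <= `|Y k w|] `|` B); split; first exact: measurableU.
  - by rewrite measureU0.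
  move=> w k'; rewrite inE => /orP[/eqP -> hk|kr hk]; [by left|right; exact: hB hk].
have [B [mB B0 hB]] := h (enum ({: 'I_N * 'I_N * bool})); exists B; split => // w nB.
have tE k : trunc_at (Y k w) = Y k w.
  rewrite /trunc_at; case: ltP => // hk; exfalso; apply: nB; apply: hB hk; exact: mem_enum.
apply/matrixP => i j; apply: c_eqP.
  by rewrite truncated_rp tE mxE rpcM.
by rewrite truncated_ip tE mxE ipcM.
Qed.

(** Up to a null set the event for the original matrix is contained in the event that [f] is at
    least [c], to which Markov's inequality applies. Measurability of the counting function makes
    the comparison of probabilities legitimate. *)
Lemma deviation_prob (f : T -> R) (x v c : R) n : 0 < x -> 0 < c ->
  rv ms [set: 'I_N * 'I_N]%SET f -> (forall w, 0 <= f w) ->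
  (forall w, `|eigenvalue_cdf ((truncated w)^t* *m truncated w) x - v| <= f w) ->
  (P [set w | (c <= `|eigenvalue_cdf ((rescaled (X w))^t* *m rescaled (X w)) x - v|)%R]
    <= (Ex P (fun w => f w ^+ n) / c ^+ n)%:E)%E.
Proof.
move=> x0 c0 rf f0 hf; have [B [mB B0 hB]] := bad_event.
have mf : measurable_fun [set: T] f := ms_meas msy rf.1.
have [mk mS] := markov_power n mf f0 (ltW c0).
have mE : measurable_fun [set: T] (fun w => `|eigenvalue_cdf ((rescaled (X w))^t* *m rescaled (X w)) x - v|).
  apply: (measurableT_comp measurable_absr); apply: measurable_funB => //.
  exact: (measurable_eigenvalue_cdf msy x0 rescaled_mms).
have [_ mE1] := markov_power 0 mE (fun w => normr_ge0 _) (ltW c0).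
apply: (@le_trans _ _ (P ([set w | (c <= f w)%R] `|` B))).
  apply: le_measure; rewrite ?inE//; first exact: measurableU.
  move=> w /= hw; have [Bw|nB] := pselect (B w); [by right|left].
  by rewrite -(hB w nB) in hw; exact: le_trans hw (hf w).
rewrite measureU0// EFinM muleC lee_pdivlMl ?exprn_gt0//.
apply: le_trans mk _.
have bfn : bm (fun w => f w ^+ n) by exact: (rv_bm msy (rvX msy n rf)).
by rewrite (Ex_EFin P bfn).
Qed.

End Model.

(** * Conclusion by Markov's inequality *)

Lemma leq_half_order k : (k.+1 <= (2 * k).+2)%N.
Proof. lia. Qed.

Theorem theorem4p2p2 (R : realType) (mu4 D : R) (hD : 0 < D) :
  exists (M0 : R) (N0 : nat) (C c : R),
    [/\ 0 < M0, (0 < N0)%N, 0 < C & 0 < c] /\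
    forall N : nat, (N0 < N)%N ->
    forall (d : measure_display) (T : measurableType d) (P : probability T R)
      (X : T -> 'M[complex R]_N), random_matrix_hyp P mu4 D X ->
    forall K E : R, 0 < K -> M0 / N%:R ^+ 2 <= E -> forall q : nat,
      (P [set w | (K * Num.min (Num.sqrt E) (ln N%:R / N%:R) <=
                   `| eigenvalue_cdf ((rescaled (X w))^t* *m rescaled (X w)) E
                      - mp_cdf E |)%R]
       <= ((C * q%:R) `^ (c * q%:R ^+ 2) / K ^+ q)%:E)%E.
Proof.
pose Cm := model_cst mu4 D.
have [b0 b0E] : exists b0, b0 = sbeta Cm 0 by exists (sbeta Cm 0).
have Cm1 : 1 <= Cm by exact: model_cst_ge1.
have b64 q : 64 <= sbeta Cm q by exact: sbeta_ge64.
have b1 : 1 <= b0 ^+ 48 by apply: exprn_ege1; have := b64 0%N; rewrite -b0E; lra.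
(* The 2 comes from [mom_order] and the 100 from [Ktot]; 258 = 256 + 1 + 1 collects the terms of c1
   + be + 1, each bounded by a multiple of [be ^+ 48]. *)
have [C [C1 CE]] : exists C, 1 <= C /\ C = 2 * (100 * 258) * b0 ^+ 48.
  by exists (2 * (100 * 258) * b0 ^+ 48); split => //; move: (b0 ^+ 48) b1 => u u1; lra.
(* [M0 = 1] expresses N sqrt E >= 1, and N > 1 makes ln N positive. The exponent is 960 = 48 * 20,
   because [be] grows like the 20th power of q. *)
exists 1, 1%N, C, 960%:R; split.
  by split; [exact: ltr01| |exact: lt_le_trans ltr01 C1|rewrite ltr0n].
move=> N N2 d T P X H K E K0 hE q.
have N0 : (0 < N)%N by exact: ltnW.
have M := truncated_rmodel hD N0 H.
set ms := ms_entry _ in M; set A := truncated _ _ in M.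
have msy := rm_sys M.
(* Moments are bounded at the positive orders q' + 1; the order q = 0 is treated separately
   below. *)
pose q' := q.-1; have [be beE0] : exists be, be = sbeta Cm q' by exists (sbeta Cm q').
have [c1 c1E] : exists c1, c1 = 256 * be ^+ 48 by exists (256 * be ^+ 48).
have be64 : 64 <= be by rewrite beE0; exact: b64.
have be0 : 0 < be by lra.
have c0 : 0 < c1 by rewrite c1E; apply: mulr_gt0; [exact: ltr0n|exact: exprn_gt0].
have e2 : (2 * q'.+1 = (2 * q').+2)%N by rewrite mulnS.
have mL z : regular_point N z -> mom P (2 * q').+2 (fun w => cabs (mtr (A w) z - msc z)) (c1 / (N%:R * ip z)).
  by move=> [z0 re0 re2 z1 zN]; rewrite -e2 c1E beE0; exact: (lambda_mom M z0 re0 re2 z1 zN).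
have mM z : regular_point N z -> mom P (2 * q').+2 (fun w => cabs (mtr (A w) z)) be.
  by move=> [z0 re0 re2 z1 zN]; rewrite -e2 beE0; exact: (mom_m M z0 re0 re2 z1 zN q' (k := 2) isT).
have rm z : 0 < ip z -> crv ms [set: 'I_N * 'I_N]%SET (fun w => mtr (A w) z) by move=> z0; exact: (crv_mtrA M z0).
have hE' : (N%:R ^+ 2)^-1 <= E by rewrite -[leLHS]mul1r.
have [f [rf f0 fh fm]] := cdf_moment msy c0 be0 N2 rm mL mM hE'.
set mn := Num.min _ _ in fm *.
have Np : 0 < N%:R :> R by rewrite ltr0n.
have E0 : 0 < E by apply: lt_le_trans hE'; rewrite invr_gt0 exprn_gt0.
have mn0 : 0 < mn.
  rewrite /mn lt_min sqrtr_gt0 E0 divr_gt0//; apply: ln_gt0.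
  by rewrite ltr1n.
have Kt0 : 0 < Ktot c1 be by rewrite /Ktot; lra.
have key : Ex P (fun w => f w ^+ q) <= (2 * (Ktot c1 be * mn)) ^+ q.
  rewrite /q' in fm *; move: fm; case: (q) => [|k] /= fm.
    rewrite expr0 -[leRHS](Ex_cst P) le_eqVlt; apply/orP; left; apply/eqP.
    by congr Ex; apply/funext => w; rewrite expr0.
  apply: (mom_order msy (S := [set: 'I_N * 'I_N]%SET) _ rf f0 (mulr_gt0 Kt0 mn0) fm).
  exact: leq_half_order.
apply: le_trans (deviation_prob hD N0 H q E0 (mulr_gt0 K0 mn0) rf f0 fh) _.
rewrite lee_fin; apply: (@le_trans _ _ ((2 * Ktot c1 be) ^+ q / K ^+ q)).
  have -> : (2 * Ktot c1 be) ^+ q / K ^+ q = (2 * (Ktot c1 be * mn)) ^+ q / (K * mn) ^+ q.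
    rewrite !exprMn; field; by rewrite !expf_neq0// gt_eqF.
  by apply: ler_wpM2r => //; rewrite invr_ge0; apply: exprn_ge0; apply: mulr_ge0; exact: ltW.
apply: ler_wpM2r; first by rewrite invr_ge0 exprn_ge0// ltW.
(* For q = 0 the base on the right is 0, and a real power with exponent 0 equals 1, as does the
   left-hand factor. *)
case: (posnP q) => [->|q0]; first by rewrite expr0 mulr0 expr0n /= mulr0 powRr0.
have qE : q'.+1 = q by rewrite prednK.
have q1 : 1 <= q%:R :> R by rewrite ler1n.
have Cq1 : 1 <= C * q%:R by apply: mulr_ege1.
have -> : 960%:R * q%:R ^+ 2 = (960 * q ^ 2)%:R :> R by rewrite natrM natrX.
rewrite powR_mulrn; last lra.
have step : 2 * Ktot c1 be <= (C * q%:R) ^+ 960.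
  have beE : be ^+ 48 = b0 ^+ 48 * q%:R ^+ 960.
    by rewrite beE0 sbeta_scale qE -b0E exprMn -exprM.
  have be1 : 1 <= be ^+ 48 by apply: exprn_ege1; lra.
  have beb : be <= be ^+ 48 by apply: ler_eXnr => //; lra.
  apply: (@le_trans _ _ (C * q%:R ^+ 960)).
    rewrite CE -[leRHS]mulrA -beE /Ktot c1E; move: (be ^+ 48) be1 beb => u u1 u2; lra.
  rewrite exprMn; apply: ler_wpM2r; first by apply: exprn_ge0; lra.
  by apply: ler_eXnr.
rewrite exprM; apply: (@le_trans _ _ (((C * q%:R) ^+ 960) ^+ q)).
  by apply: lerXn2r => //; rewrite nnegrE; [lra|apply: exprn_ge0; lra].
(* The moments give the exponent 960 q, which is relaxed to 960 q^2. *)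
apply: ler_weXn2l; first exact: exprn_ege1.
by rewrite -mulnn leq_pmulr.
Qed.
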